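(* Let $\Omega\subset\mathbb R^N$ be an arbitrary domain and let $\mu\in S(\partial\Omega)$ be a smooth measure on $\partial\Omega$. Then the semigroup $\mathcal P_t^\mu$ on $L^2(\Omega)$, $\mathcal P_t^\mu f(x)=E_x[f(X_t)e^{-A_t^\mu}]$, is sandwiched between the semigroup of the Dirichlet Laplacian and the semigroup of the Neumann Laplacian, that is, $$0\le e^{-t\Delta_D}\le\mathcal P_t^\mu\le e^{-t\Delta_N}\qquad\text{for all }t\ge0,$$ in the sense of positive operators.
   Context: Let $X=\overline\Omega$ and $m(A)=\lambda(A\cap\Omega)$ for Borel $A\subset\overline\Omega$, with $\lambda$ Lebesgue measure, so $L^2(\Omega)=L^2(\overline\Omega,m)$. Let $\widetilde H^1(\Omega)$ be the closure of $H^1(\Omega)\cap C_c(\overline\Omega)$ in $H^1(\Omega)$, and let $\mathcal E(u,v)=\int_\Omega\nabla u\cdot\nabla v\,dx$ with domain $\mathcal F=\widetilde H^1(\Omega)$; $(\mathcal E,\mathcal F)$ is a regular local Dirichlet form on $L^2(\overline\Omega,m)$. Put $\mathcal E_1(u,v)=\mathcal E(u,v)+\int_\Omega uv\,dx$. Relative capacity: for $A\subset\overline\Omega$ relatively open, $\mathrm{Cap}_{\overline\Omega}(A)=\inf\{\mathcal E_1(u,u):u\in\widetilde H^1(\Omega),\ u\ge1\text{ a.e. on }A\}$; for arbitrary $A\subset\overline\Omega$, $\mathrm{Cap}_{\overline\Omega}(A)=\inf\{\mathrm{Cap}_{\overline\Omega}(B):B\text{ relatively open},\ A\subset B\subset\overline\Omega\}$.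 ''Relatively quasi-everywhere'' (r.q.e.) means outside a set of zero relative capacity. Smooth measures: $S(\partial\Omega)$ is the set of positive Borel measures $\mu$ on $\partial\Omega$ that charge no set of zero relative capacity and for which there is an increasing sequence $(F_n)$ of closed subsets of $\partial\Omega$ with $\mu(F_n)<\infty$ for all $n$ and $\lim_{n\to\infty}\mathrm{Cap}_{\overline\Omega}(K\setminus F_n)=0$ for every compact $K\subset\partial\Omega$. $(X_t,P_x)$ is the general reflecting Brownian motion: the $m$-symmetric diffusion process on $\overline\Omega$, with lifetime $\xi$ and filtration $(\mathcal F_t)$, associated with $(\mathcal E,\mathcal F)$; functions are extended by $0$ at the cemetery. Additive functional: a function $A_t(\omega)\in[-\infty,\infty]$, with $A_t$ $\mathcal F_t$-measurable, such that there are a defining set $\Lambda\in\mathcal F_\infty$ and an exceptional set $\mathcal N$ with $\mathrm{Cap}_{\overline\Omega}(\mathcal N)=0$ satisfying $P_x(\Lambda)=1$ for all $x\in\overline\Omega\setminus\mathcal N$, $\theta_t\Lambda\subset\Lambda$ for $t>0$ ($\theta_t$ the shift), and for $\omega\in\Lambda$: $A_0(\omega)=0$, $|A_t(\omega)|<\infty$ for $t<\xi$, $A_\cdot(\omega)$ is right continuous with left limits, and $A_{t+s}(\omega)=A_t(\omega)+A_s(\theta_t\omega)$. It is a positive continuous additive functional (PCAF) if moreover $A_t(\omega)$ is nonnegative and continuous in $t$ for $\omega\in\Lambda$. For $\mu\in S(\partial\Omega)$, $A^\mu$ denotes the PCAF (unique up to equivalence) with Revuz measure $\mu$: for every $\gamma$-excessive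 $h$ and every nonnegative Borel $f$ on $\overline\Omega$, $\lim_{t\searrow0}\frac1tE_{h\cdot m}\big[\int_0^tf(X_s)\,dA^\mu_s\big]=\int_{\partial\Omega}hf\,d\mu$. $\Delta_N$ and $\Delta_D$ denote the nonnegative self-adjoint operators on $L^2(\Omega)$ associated with the form $\int_\Omega\nabla u\cdot\nabla v\,dx$ with domain $\widetilde H^1(\Omega)$ and $H^1_0(\Omega)$ respectively; $e^{-t\Delta_N}f(x)=E_x[f(X_t)]$. For operators $S,T$ on $L^2(\Omega)$, $S\le T$ in the sense of positive operators means $Sf\le Tf$ a.e. for all $f\in L^2(\Omega)$ with $f\ge0$. *)

(* Defs.v *)
From HB Require Import structures.
From mathcomp Require Import all_boot all_order all_algebra.
From mathcomp Require Import all_classical all_reals all_analysis.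
From mathcomp Require Import measurable_realfun.
Set Implicit Arguments.
Unset Strict Implicit.
Unset Printing Implicit Defensive.
Import Order.TTheory GRing.Theory Num.Theory.
Import numFieldNormedType.Exports.
Local Open Scope classical_set_scope.
Local Open Scope ring_scope.

Section borel.
Variables (R : realType) (m n : nat).

Definition mx_open : set (set 'M[R]_(m, n)) := @open 'M[R]_(m, n).

Let mx0 : <<s mx_open >> set0. Proof. exact: sigma_algebra0. Qed.

Let mxC A : <<s mx_open >> A -> <<s mx_open >> (~` A).
Proof. exact: sigma_algebraC. Qed.

Let mxU (F : (set 'M[R]_(m, n))^nat) : (forall i, <<s mx_open >> (F i)) ->
  <<s mx_open >> (\bigcup_i F i).
Proof. exact: sigma_algebra_bigcup. Qed.

HB.instance Definition _ := @isMeasurable.Build (sigma_display mx_open)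
  'M[R]_(m, n) <<s mx_open >> mx0 mxC mxU.

End borel.

Section lebesgue_rV.
Variable R : realType.

Lemma rV_open_measurable n (U : set 'rV[R]_n) : open U -> measurable U.
Proof. by move=> oU; exact: sub_sigma_algebra. Qed.

Lemma measurable_coord n (i : 'I_n) :
  measurable_fun [set: 'rV[R]_n] (fun v : 'rV[R]_n => v 0 i).
Proof.
apply: (measurability _ (measurable_realfun.RGenOInfty.measurableE R)).
move=> _ [_ [a ->] <-]; rewrite setTI; apply: rV_open_measurable.
apply: open_comp; last exact: interval_open.
by move=> x _; exact: coord_continuous.
Qed.

Lemma measurable_fun_rV d (T : measurableType d) n (f : T -> 'rV[R]_n) :
  (forall i, measurable_fun [set: T] (fun t => f t 0 i)) ->
  measurable_fun [set: T] f.
Proof.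
move=> mf; apply: (measurability (@mx_open R 1 n)); first by [].
move=> _ [U oU <-]; rewrite setTI.
pose c (p : 'rV[rat]_n * nat) : 'rV[R]_n := map_mx (@ratr R) p.1.
pose r (p : 'rV[rat]_n * nat) : R := p.2.+1%:R^-1.
pose P := [set p | ball (c p) (r p) `<=` U].
have UE : U = \bigcup_(p in P) ball (c p) (r p).
  apply/seteqP; split => [x Ux|x [p Pp]]; last exact: Pp.
  have /nbhs_ballP[e /= e0 eU] : nbhs x U by exact: open_nbhs_nbhs.
  have [k ke] : exists k : nat, k.+1%:R^-1 < e / 2.
    have e20 : 0 < e / 2 by rewrite divr_gt0.
    have [k _ /(_ k (leqnn k)) /=] := near_infty_natSinv_lt (PosNum e20).
    by exists k.
  have k0 : 0 < k.+1%:R^-1 :> R by rewrite invr_gt0.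
  have qE (i : 'I_n) : exists q : rat, `|ratr q - x 0 i| < k.+1%:R^-1.
    have Bx : ball (x 0 i) k.+1%:R^-1 !=set0 by exists (x 0 i); exact: ballxx.
    have oB : open (ball (x 0 i) (k.+1%:R^-1 : R)) by exact: (@ball_open R R^o).
    have [y [By [q _ qy]]] := @dense_rat R _ Bx oB.
    by exists q; move: By; rewrite -qy /ball/= distrC.
  pose q : 'rV[rat]_n := \row_i sval (cid (qE i)).
  have qx : ball (c (q, k)) (r (q, k)) x.
    split => [|i j]; first exact: k0.
    rewrite ord1 /c /= !mxE /ball/=.
    exact: (svalP (cid (qE j))).
  exists (q, k) => //= y qy; apply: eU.
  rewrite (splitr e); apply: (@ball_triangle _ _ (c (q, k))).
    by apply: ball_sym; apply: le_ball qx; exact: ltW.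
  by apply: le_ball qy; exact: ltW.
rewrite UE preimage_bigcup.
pose G p := if pselect (P p) then f @^-1` ball (c p) (r p) else set0.
rewrite (_ : \bigcup_(p in P) _ = \bigcup_p G p); last first.
  apply/seteqP; split => [t [p Pp pt]|t [p _]]; last first.
    by rewrite /G; case: pselect => // Pp pt; exists p.
  by exists p => //; rewrite /G; case: pselect.
apply: countable_bigcupT_measurable => [|p]; first exact: countableP.
rewrite /G; case: (pselect (P p)) => [Pp|Pp]; last exact: measurable0.
rewrite (_ : _ @^-1` _ = \bigcap_(i in [set: 'I_n])
    ((fun t => f t 0 i) @^-1` ball (c p 0 i) (r p))); last first.
  apply/seteqP; split => [t [_ pt] i _|t pt]; first exact: pt.
  split=> [|i j]; first by rewrite invr_gt0.
  by rewrite ord1; exact: pt.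
apply: fin_bigcap_measurable => // i _.
rewrite -[X in measurable X]setTI; apply: mf => //.
by apply: measurable_realfun.open_measurable; exact: (@ball_open R R^o).
Qed.

Definition consrV n (p : measurableTypeR R * 'rV[R]_n) : 'rV[R]_n.+1 :=
  \row_i oapp (p.2 0) p.1 (unlift ord0 i).

Lemma measurable_consrV n : measurable_fun [set: _] (@consrV n).
Proof.
apply: measurable_fun_rV => i.
under eq_fun do rewrite mxE.
case: (unliftP ord0 i) => [j _|_] /=; last exact: measurable_fst.
apply: (@measurableT_comp _ _ _ _ _ _ (fun v : 'rV[R]_n => v 0 j)).
  exact: measurable_coord.
exact: measurable_snd.
Qed.

Let unconsrV n (v : 'rV[R]_n.+1) : measurableTypeR R * 'rV[R]_n :=
  (v 0 ord0, \row_j v 0 (lift ord0 j)).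

Let measurable_unconsrV n : measurable_fun [set: _] (@unconsrV n).
Proof.
apply/measurable_fun_pairP; split; first exact: measurable_coord.
apply: measurable_fun_rV => i /=.
by under eq_fun do rewrite mxE; exact: measurable_coord.
Qed.

Let consrVK n : cancel (@consrV n) (@unconsrV n).
Proof.
move=> [x v]; congr pair; first by rewrite mxE unlift_none.
by apply/rowP => j; rewrite !mxE liftK.
Qed.

Section step.
Variables (n : nat) (mu : {sigma_finite_measure set 'rV[R]_n -> \bar R}).

Definition lebesgue_step : set 'rV[R]_n.+1 -> \bar R :=
  pushforward (@lebesgue_measure R \x mu)%E (@consrV n).

Let step0 : lebesgue_step set0 = 0%E.
Proof. by rewrite /lebesgue_step /pushforward preimage_set0 measure0. Qed.

Let step_ge0 A : (0 <= lebesgue_step A)%E.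
Proof. by rewrite /lebesgue_step /pushforward; exact: measure_ge0. Qed.

Let step_sigma_additive : semi_sigma_additive lebesgue_step.
Proof.
have mc A : measurable A -> measurable (@consrV n @^-1` A).
  by move=> mA; rewrite -[X in measurable X]setTI; exact: measurable_consrV.
move=> F mF tF mUF; rewrite /lebesgue_step /pushforward preimage_bigcup.
apply: measure_semi_sigma_additive.
- by move=> k; exact: mc.
- apply/trivIsetP => /= i j _ _ ij; rewrite -preimage_setI.
  by move/trivIsetP : tF => /(_ _ _ _ _ ij) ->//; rewrite preimage_set0.
- by rewrite -preimage_bigcup; exact: mc.
Qed.

HB.instance Definition _ := isMeasure.Build _ _ _ lebesgue_step
  step0 step_ge0 step_sigma_additive.

Let step_sigma_finite : sigma_finite setT lebesgue_step.
Proof.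
have [F FT Foo] : sigma_finite setT (@lebesgue_measure R \x mu)%E.
  have /sigma_finiteP[F [TF ndF Foo]] := sigma_finiteT (@lebesgue_measure R).
  have /sigma_finiteP[G [TG ndG Goo]] := sigma_finiteT mu.
  exists (fun k => F k `*` G k).
    rewrite -setXTT TF TG predeqE => -[x y]; split; last first.
      by move=> [k _ []/= ? ?]; split; exists k.
    move=> [/= [k _ Fkx] [l _ Gly]]; exists (maxn k l) => //; split.
      by move: x Fkx; exact/subsetPset/ndF/leq_maxl.
    by move: y Gly; exact/subsetPset/ndG/leq_maxr.
  move=> k; have [? ?] := Foo k; have [? ?] := Goo k.
  split; first exact: measurableX.
  by rewrite product_measure1E// lte_mul_pinfty// ge0_fin_numE.
exists (fun k => @unconsrV n @^-1` F k).
  by rewrite -preimage_bigcup -FT preimage_setT.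
move=> k; have [mF Fk] := Foo k; split.
  by rewrite -[X in measurable X]setTI; exact: measurable_unconsrV.
rewrite /lebesgue_step /pushforward -comp_preimage.
by rewrite (_ : _ \o _ = id) ?preimage_id//; apply/funext => p; exact: consrVK.
Qed.

HB.instance Definition _ := Measure_isSigmaFinite.Build _ _ _ lebesgue_step
  step_sigma_finite.

End step.

(** Lebesgue measure on R^n, as the n-fold product of [lebesgue_measure] *)
Fixpoint lebesgue_rV n : {sigma_finite_measure set 'rV[R]_n -> \bar R} :=
  if n is n'.+1 then lebesgue_step (lebesgue_rV n') else \d_(0 : 'rV[R]_0).

End lebesgue_rV.

Record domain (R : realType) (N : nat) := Domain {
  domain_set :> set 'rV[R]_N ;
  domain_open : open domain_set ;
  domain_connected : connected domain_set ;
  domain_nonempty : domain_set !=set0 }.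

Section sobolev.
Context {R : realType} {N : nat} (Omega : domain R N).
Local Notation E := 'rV[R]_N.
Implicit Types (u v f g : E -> R) (K : set E).

Lemma measurable_domain : measurable (Omega : set E).
Proof. by apply: rV_open_measurable; exact: domain_open. Qed.

Definition bdry : set E := closure Omega `\` Omega°.

(** [m A] is the Lebesgue measure of [A `&` Omega]. Functions on Omega or on its
    closure are represented by functions on R^N; m does not see their values
    outside of Omega. *)
Definition m : {measure set E -> \bar R} :=
  mrestr (lebesgue_rV R N) measurable_domain.

Definition L2 : set (E -> R) := [set f | f \in Lfun m 2%:E].

Definition L2norm f : \bar R := Lnorm m 2%:E (EFin \o f).

Definition ip f g : R := \int[m]_x (f x * g x).

Definition partial (i : 'I_N) f : E -> R := fun x => 'D_(delta_mx 0 i) f x.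

Definition smooth f := forall s : seq 'I_N,
  continuous (foldr partial f s) /\
  forall i x, derivable (foldr partial f s) x (delta_mx 0 i).

Definition test_function : set (E -> R) := [set phi | smooth phi /\
  exists K, [/\ compact K, K `<=` Omega & forall x, ~ K x -> phi x = 0]].

Definition weak_grad u (G : 'I_N -> E -> R) := forall i, L2 (G i) /\
  forall phi, test_function phi -> ip u (partial i phi) = - ip (G i) phi.

Definition H1 : set (E -> R) := [set u | L2 u /\ exists G, weak_grad u G].

(** weak gradients are unique up to m-null sets; [grad] selects one *)
Definition grad u : 'I_N -> E -> R := xget (fun=> cst 0) (weak_grad u).

Definition dform u v : R := \sum_(i < N) ip (grad u i) (grad v i).

Definition dform1 u v : R := dform u v + ip u v.

Definition H1_closure (C : set (E -> R)) : set (E -> R) :=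
  [set u | H1 u /\ forall e : R, 0 < e -> exists v,
    [/\ H1 v, C v & dform1 (v \- u) (v \- u) < e]].

Definition Cc_closure : set (E -> R) :=
  [set u | {within closure Omega, continuous u} /\ exists K,
    [/\ compact K, K `<=` closure Omega &
        forall x, closure Omega x -> ~ K x -> u x = 0]].

Definition tildeH1 := H1_closure Cc_closure.

Definition H10 := H1_closure test_function.

Definition rel_open (A : set E) :=
  exists2 U : set E, open U & A = U `&` closure Omega.

Definition cap_open (A : set E) : \bar R :=
  ereal_inf [set (dform1 u u)%:E | u in
    [set u | tildeH1 u /\ {ae m, forall x, A x -> 1 <= u x}]].

Definition cap (A : set E) : \bar R :=
  ereal_inf [set cap_open B | B in [set B | rel_open B /\ A `<=` B]].

(** A Borel measure on the boundary is a Borel measure on R^N carried by it. *)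
Definition smooth_measure (mu : {measure set E -> \bar R}) :=
  [/\ mu (~` bdry) = 0%E,
      forall A, measurable A -> A `<=` bdry -> cap A = 0%E -> mu A = 0%E &
      exists F : (set E)^nat,
        [/\ forall n, closed (F n) /\ F n `<=` bdry,
            forall n, F n `<=` F n.+1,
            forall n, (mu (F n) < +oo)%E &
            forall K, compact K -> K `<=` bdry ->
              cap (K `\` F n) @[n --> \oo] --> 0%E]].

(** [form_operator D u f] : u is in the domain of the operator associated with
    the form [dform] with domain D, and f is the image of u. *)
Definition form_operator (D : set (E -> R)) u f :=
  [/\ D u, L2 f & forall v, D v -> dform u v = ip f v].

(** [semigroup_of D T] : T is the strongly continuous contraction semigroup on
    L^2 whose generator is the opposite of [form_operator D]. *)
Record semigroup_of (D : set (E -> R)) (T : R -> (E -> R) -> (E -> R)) : Prop :=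
  SemigroupOf {
  semigroup_L2 : forall t f, 0 <= t -> L2 f -> L2 (T t f) ;
  semigroup_linear : forall t a f g, 0 <= t -> L2 f -> L2 g ->
    {ae m, forall x, T t (fun y => a * f y + g y) x = a * T t f x + T t g x} ;
  semigroup_contraction : forall t f, 0 <= t -> L2 f ->
    (L2norm (T t f) <= L2norm f)%E ;
  semigroup_0 : forall f, L2 f -> {ae m, forall x, T 0 f x = f x} ;
  semigroup_D : forall s t f, 0 <= s -> 0 <= t -> L2 f ->
    {ae m, forall x, T (s + t) f x = T s (T t f) x} ;
  semigroup_continuous : forall f, L2 f ->
    L2norm (T t f \- f) @[t --> 0^'+] --> 0%E ;
  semigroup_generator : forall u f, L2 u -> L2 f ->
    L2norm (fun x => t^-1 * (u x - T t u x) - f x) @[t --> 0^'+] --> 0%E <->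
    form_operator D u f }.

(** Values in [\bar R], because expectations are extended-real-valued *)
Definition op_le (S T : (E -> R) -> E -> \bar R) :=
  forall f, L2 f -> {ae m, forall x, 0 <= f x} ->
    {ae m, forall x, (S f x <= T f x)%E}.

End sobolev.

(** Processes on the closure of Omega, with the cemetery [None] adjoined as point
    at infinity: the closure of Omega being closed in R^N, its one-point
    compactification is a subspace of that of R^N. If it is compact, then the
    cemetery is isolated in [state Omega]. *)

Record process (R : realType) (N : nat) d (W : measurableType d) := Process {
  traj : R -> W -> one_point_compactification 'rV[R]_N ;
  timeshift : R -> W -> W ;
  law : option 'rV[R]_N -> probability W R }.

Section process.
Context {R : realType} {N : nat} (Omega : domain R N).
Context d (W : measurableType d) (X : process R N W).
Local Notation E := 'rV[R]_N.
Local Open Scope ereal_scope.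
Implicit Types (s t : R) (w : W) (A B : set E) (L : set W).

Definition state : set (one_point_compactification E) :=
  [set o | if o is Some x then closure Omega x else True].

Definition lifetime w : \bar R :=
  ereal_inf [set t%:E | t in [set t | (0 <= t)%R /\ traj X t w = None]].

(** E_x[f(X_t)], functions being extended by 0 at the cemetery *)
Definition pt t (f : E -> \bar R) (x : E) : \bar R :=
  \int[law X (Some x)]_w oapp f 0 (traj X t w).

(** sigma-algebra generated by the X_t, t in I *)
Definition natural (I : set R) : set (set W) :=
  <<s [set L | exists t B, [/\ I t, measurable B &
                               L = traj X t @^-1` (Some @` B)]] >>.

(** P_kappa for the initial distribution kappa = nu + delta_None *)
Definition law_from (nu : {finite_measure set E -> \bar R}) L : \bar R :=
  \int[nu]_(x in closure Omega) law X (Some x) L + law X None L.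

(** Completion of a sub-sigma-algebra by the P_kappa-null sets, intersected over
    all initial distributions kappa. As every finite kappa is dominated by one of
    the form nu + delta_None, it suffices to consider those. *)
Definition completed (S : set (set W)) : set (set W) :=
  [set L | forall nu : {finite_measure set E -> \bar R},
    exists L0 G, [/\ S L0, measurable G, law_from nu G = 0 &
                     (L `\` L0) `|` (L0 `\` L) `<=` G]].

Definition filt t : set (set W) := completed (natural `[0%R, t]%classic).

Definition filt_oo : set (set W) := completed (natural `[0%R, +oo[%classic).

Definition stopping_time (sigma : W -> \bar R) :=
  (forall w, 0 <= sigma w) /\
  forall t, (0 <= t)%R -> filt t [set w | sigma w <= t%:E].

Definition filt_at (sigma : W -> \bar R) : set (set W) :=
  [set L | filt_oo L /\ forall t, (0 <= t)%R ->
    filt t (L `&` [set w | sigma w <= t%:E])].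

Definition traj_at (s : \bar R) w : one_point_compactification E :=
  if s is t%:E then traj X t w else None.

(** Events of the completed sigma-algebras need not be measurable in W; integrals
    of nonnegative functions being lower integrals, they agree with the integrals
    for the completions of the laws, and [{ae law X x, _}] does so as well. *)
Record hunt_process : Prop := HuntProcess {
  hunt_sample : (measurable : set (set W)) = natural `[0%R, +oo[%classic ;
  hunt_law : forall L, measurable L ->
    measurable_fun (closure Omega) ((fun x => law X (Some x) L) : E -> \bar R) ;
  hunt_state : forall t w, (0 <= t)%R -> state (traj X t w) ;
  hunt_normal : forall x, state x -> {ae law X x, forall w, traj X 0 w = x} ;
  hunt_shift : forall s t w, (0 <= s)%R -> (0 <= t)%R ->
    traj X s (timeshift X t w) = traj X (s + t) w ;
  hunt_cemetery : forall s t w, (0 <= s <= t)%R ->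
    traj X s w = None -> traj X t w = None ;
  hunt_right : forall t w, (0 <= t)%R ->
    traj X s w @[s --> t^'+] --> traj X t w ;
  hunt_left : forall t w, (0 < t)%R ->
    exists2 l, state l & traj X s w @[s --> t^'-] --> l ;
  hunt_filt_right : forall t L, (0 <= t)%R ->
    (forall s, (t < s)%R -> filt s L) -> filt t L ;
  hunt_strong_markov : forall sigma L t B x, stopping_time sigma ->
    filt_at sigma L -> (0 <= t)%R -> measurable B -> state x ->
    \int[law X x]_w
      (\1_(L `&` [set w' | (Some @` B) (traj_at (sigma w' + t%:E) w')]) w)%:E =
    \int[law X x]_w ((\1_L w)%:E *
      law X (traj_at (sigma w) w) (traj X t @^-1` (Some @` B))) ;
  hunt_quasi_left : forall (sigma : (W -> \bar R)^nat) x,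
    (forall n, stopping_time (sigma n)) ->
    (forall n w, sigma n w <= sigma n.+1 w) -> state x ->
    let sup w := ereal_sup (range (sigma ^~ w)) in
    {ae law X x, forall w, sup w < +oo ->
      traj_at (sigma n w) w @[n --> \oo] --> traj_at (sup w) w} }.

Definition diffusion := hunt_process /\
  forall x, closure Omega x ->
    {ae law X (Some x), forall w t, (0 < t)%R -> t%:E < lifetime w ->
      traj X s w @[s --> t] --> traj X t w}.

Definition nonneg_borel (f : E -> \bar R) :=
  measurable_fun (closure Omega) f /\ forall x, closure Omega x -> 0 <= f x.

Definition symmetric := forall t (f g : E -> \bar R), (0 <= t)%R ->
  nonneg_borel f -> nonneg_borel g ->
  \int[m Omega]_x (pt t f x * g x) = \int[m Omega]_x (f x * pt t g x).

Definition reflecting_brownian_motion := [/\ diffusion, symmetric &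
  forall T, semigroup_of Omega (tildeH1 Omega) T ->
    forall t (f : E -> R), (0 <= t)%R -> L2 Omega f ->
      {ae m Omega, forall x, pt t (EFin \o f) x = (T t f x)%:E}].

(** [a] is an additive functional with defining set [L] and exceptional set
    [A] *)
Record additive_functional (a : R -> W -> \bar R) L A : Prop :=
  AdditiveFunctional {
  af_adapted : forall t, (0 <= t)%R -> forall B : set (\bar R), measurable B ->
    filt t (a t @^-1` B) ;
  af_defining : filt_oo L ;
  af_exceptional : A `<=` closure Omega /\ cap Omega A = 0 ;
  af_full : forall x, closure Omega x -> ~ A x ->
    {ae law X (Some x), forall w, L w} ;
  af_shift : forall t, (0 < t)%R -> timeshift X t @` L `<=` L ;
  af_0 : forall w, L w -> a 0%R w = 0 ;
  af_finite : forall w t, L w -> (0 <= t)%R -> t%:E < lifetime w ->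
    a t w \is a fin_num ;
  af_right : forall w t, L w -> (0 <= t)%R ->
    a s w @[s --> t^'+] --> a t w ;
  af_left : forall w t, L w -> (0 < t)%R ->
    exists l : \bar R, a s w @[s --> t^'-] --> l ;
  af_additive : forall w s t, L w -> (0 <= s)%R -> (0 <= t)%R ->
    a (t + s)%R w = a t w + a s (timeshift X t w) }.

Definition pcaf (a : R -> W -> \bar R) := exists L A,
  [/\ additive_functional a L A,
      forall w t, L w -> (0 <= t)%R -> 0 <= a t w &
      forall w, L w -> {within [set t | (0 <= t)%R], continuous (a ^~ w)}].

(** [nu] is the measure [da] on [[0, lifetime w)[]; [a] may be infinite from the
    lifetime on, where functions of the process vanish *)
Definition stieltjes (a : R -> W -> \bar R) w
    (nu : {measure set (measurableTypeR R) -> \bar R}) :=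
  nu (~` [set t | (0 <= t)%R /\ t%:E < lifetime w]) = 0 /\
  forall t, (0 <= t)%R -> t%:E < lifetime w -> nu `[0%R, t]%classic = a t w.

(** the integral of f(X_s) da_s over [[0, t]]; [nu] is unique when it exists *)
Definition af_integral (a : R -> W -> \bar R) t (f : E -> R) w : \bar R :=
  xget 0 [set I | exists2 nu, stieltjes a w nu &
    I = \int[nu]_(s in `[0%R, t]%classic) (oapp f 0%R (traj X s w))%:E].

Definition universally_measurable (h : E -> \bar R) :=
  forall nu : {finite_measure set E -> \bar R}, exists g1 g2 : E -> \bar R,
    [/\ measurable_fun setT g1, measurable_fun setT g2,
        forall x, closure Omega x -> g1 x <= h x <= g2 x &
        {ae nu, forall x, closure Omega x -> g1 x = g2 x}].

Definition excessive (gamma : R) (h : E -> \bar R) :=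
  [/\ universally_measurable h,
      forall x, closure Omega x -> 0 <= h x,
      forall t x, (0 < t)%R -> closure Omega x ->
        (expR (- gamma * t))%:E * pt t h x <= h x &
      forall x, closure Omega x ->
        (expR (- gamma * t))%:E * pt t h x @[t --> (0%R : R)^'+] --> h x].

Definition revuz_measure (a : R -> W -> \bar R)
    (mu : {measure set E -> \bar R}) :=
  forall gamma (h : E -> \bar R) (f : E -> R), (0 <= gamma)%R ->
    excessive gamma h ->
    measurable_fun (closure Omega) f ->
    (forall x, closure Omega x -> (0 <= f x)%R) ->
    (t^-1)%:E * \int[m Omega]_x
        (h x * \int[law X (Some x)]_w af_integral a t f w)
      @[t --> (0%R : R)^'+] --> \int[mu]_(x in bdry Omega) (h x * (f x)%:E).

Definition Pmu (a : R -> W -> \bar R) t (f : E -> R) (x : E) : \bar R :=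
  \int[law X (Some x)]_w ((oapp f 0%R (traj X t w))%:E * expeR (- a t w)).

End process.

(* Main.v *)
From HB Require Import structures.
Require Import Defs.
From mathcomp Require Import all_boot all_order all_algebra.
From mathcomp Require Import all_classical all_reals all_analysis.
From mathcomp Require Import measurable_realfun ring lra.

(** The upper bound holds because the functional is nonnegative: [Pmu X Amu t f x] is the
    expectation of f (X_t) weighted by exp (- A_t) <= 1, and the expectation of f (X_t) is
    [TN t f x].

    For the lower bound, the functional does not increase while the path stays in a compact
    subset K of the domain ([pcaf_vanish]). Let e (t) be the integral over m of the expected
    increase of the functional during the time interval from 0 to t, on the event that the
    path stays in K during this time. The Revuz formula for h = 1 and the indicator of K says
    e (t) = o (t), because mu is only integrated over the boundary; and additivity, the Markov
    property and the symmetry of the process give e (2 t) <= 2 e (t). Hence e = 0. So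
    [Pmu X Amu t f x] is at least the expectation of f (X_t) on the event that the path stays
    in K up to time t, for every K, and it remains to bound [TD t f] by such expectations.

    This is done without identifying the process killed at the boundary. Let 0 <= g <= u with
    u in [H10] and excessive. For a test function psi with support K close to u, the element w of
    least energy among those that are at least u outside of K is excessive and of small norm
    ([dirichlet_obstacle]). Killing the semigroup TD outside of K at the multiples of t / n
    costs at most [expR (l * t) * w], because what is lost is at most a multiple of u, hence of w
    ([dirichlet_leak]). The killed products are dominated by the expectations of g (X_t) on the
    event that the path is in K at these times, since TD <= TN and the transition
    probabilities of the process are TN ([killed_le_survive]). Refining the times and then
    letting w tend to 0 proves the bound for g ([dirichlet_le_Pmu_dominated]), and such g
    approximate every nonnegative f from below.

    The facts on forms and semigroups used on the way are proved from the definitions. The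
    transition probabilities make TN positive, hence its resolvents positive, and this makes the
    form domain stable under positive parts ([dform_pospart]); [H10] is an order ideal in it
    ([H10_pospart_sub]) because functions of [tildeH1] with compact support in the domain
    belong to [H10] ([H10_of_compact_support], by mollification). Positivity of TD, TD <= TN and
    excessivity all come from one principle: the norm of the positive part of a curve in L^2
    does not increase if the derivative pairs nonpositively with that positive part
    ([pospart_dissipative]). Finally, the events of the completed filtrations need not be
    measurable, so integrals over the path space are compared as lower integrals
    ([ge0_ae_le_lower_integral]), and the functional is replaced by measurable versions at fixed
    times ([completed_version]). *)

Set Implicit Arguments.
Unset Strict Implicit.
Unset Printing Implicit Defensive.
Import Order.TTheory GRing.Theory Num.Theory.
Import numFieldNormedType.Exports.
Local Open Scope classical_set_scope.
Local Open Scope ring_scope.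

(** * Minimization over convex sets in complete quadratic spaces *)

(** Young's inequality, with the Cauchy-Schwarz bound [s ^+ 2 <= p * q] as
    hypothesis: it replaces square roots throughout. *)
Lemma young_of_sqr_le {R : realType} (s p q a : R) :
  0 <= p -> 0 <= q -> 0 < a -> s ^+ 2 <= p * q -> 2 * s <= a * p + q / a.
Proof.
move=> p0 q0 a0 spq.
have w0 : 0 <= q / a by rewrite divr_ge0// ltW.
have : q = a * (q / a) by field; rewrite gt_eqF.
move: (q / a) w0 => w w0 qE; rewrite qE in spq.
rewrite leNgt; apply/negP => ltw.
have : (a * p + w) ^+ 2 < (2 * s) ^+ 2.
  have h0 : 0 <= a * p + w by rewrite addr_ge0// mulr_ge0// ltW.
  by rewrite ltr_pXn2r// nnegrE// (le_trans h0)// ltW.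
have := sqr_ge0 (a * p - w).
nra.
Qed.

Section quadratic_space.
Context {R : realType} {V : lmodType R}.
Implicit Types (D C : set V) (B : V -> V -> R) (u : V^nat) (x y z : V).

(** Functions that agree almost everywhere are not identified, so the forms below are
    only semidefinite; and being additive or symmetric only on a domain, as integrals
    are, they are not bilinear forms on the whole of V. *)
Record semi_inner D B : Prop := SemiInner {
  si0 : D 0 ;
  siD : forall x y, D x -> D y -> D (x + y) ;
  siZ : forall (a : R) x, D x -> D (a *: x) ;
  siC : forall x y, D x -> D y -> B x y = B y x ;
  siDl : forall x y z, D x -> D y -> D z -> B (x + y) z = B x z + B y z ;
  siZl : forall (a : R) x z, D x -> D z -> B (a *: x) z = a * B x z ;
  si_ge0 : forall x, D x -> 0 <= B x x }.

Definition qcvg B u x := forall e : R, 0 < e ->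
  exists n0, forall n, (n0 <= n)%N -> B (u n - x) (u n - x) < e.

Definition qcauchy B u := forall e : R, 0 < e ->
  exists n0, forall i j, (n0 <= i)%N -> (n0 <= j)%N ->
    B (u i - u j) (u i - u j) < e.

Definition qcomplete D B := forall u, (forall n, D (u n)) -> qcauchy B u ->
  exists2 x, D x & qcvg B u x.

Definition qclosed D B C := forall x, D x ->
  (forall e : R, 0 < e -> exists2 y, C y & B (y - x) (y - x) < e) -> C x.

Definition qconvex C := forall (t : R) x y, 0 <= t -> t <= 1 -> C x -> C y ->
  C (x + t *: (y - x)).

Section theory.
Variables (D : set V) (B : V -> V -> R).
Hypothesis DB : semi_inner D B.

Lemma siN x : D x -> D (- x).
Proof. by move=> Dx; rewrite -scaleN1r; exact: (siZ DB). Qed.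

Lemma siB x y : D x -> D y -> D (x - y).
Proof. by move=> Dx /siN; exact: (siD DB). Qed.

Lemma siNl x z : D x -> D z -> B (- x) z = - B x z.
Proof. by move=> Dx Dz; rewrite -scaleN1r (siZl DB)// mulN1r. Qed.

Lemma siBl x y z : D x -> D y -> D z -> B (x - y) z = B x z - B y z.
Proof. by move=> Dx Dy Dz; rewrite (siDl DB) ?siNl//; exact: siN. Qed.

Lemma siDr x y z : D x -> D y -> D z -> B z (x + y) = B z x + B z y.
Proof.
move=> Dx Dy Dz; rewrite ![B z _](siC DB)//; last exact: (siD DB).
exact: (siDl DB).
Qed.

Lemma siZr (a : R) x z : D x -> D z -> B z (a *: x) = a * B z x.
Proof.
move=> Dx Dz; rewrite ![B z _](siC DB)//; last exact: (siZ DB).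
exact: (siZl DB).
Qed.

Lemma siNr x z : D x -> D z -> B z (- x) = - B z x.
Proof. by move=> Dx Dz; rewrite -scaleN1r siZr// mulN1r. Qed.

Lemma siBr x y z : D x -> D y -> D z -> B z (x - y) = B z x - B z y.
Proof. by move=> Dx Dy Dz; rewrite siDr ?siNr//; exact: siN. Qed.

Lemma si0l z : D z -> B 0 z = 0.
Proof. by move=> Dz; rewrite -(scale0r (0 : V)) (siZl DB) ?mul0r//; exact: si0 DB. Qed.

Lemma siDD x y : D x -> D y ->
  B (x + y) (x + y) = B x x + 2 * B x y + B y y.
Proof.
move=> Dx Dy; have Dxy := siD DB Dx Dy.
rewrite (siDl DB)// !siDr// (siC DB Dy Dx); ring.
Qed.

Lemma siBB x y : D x -> D y ->
  B (x - y) (x - y) = B x x - 2 * B x y + B y y.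
Proof.
move=> Dx Dy; rewrite siDD//; last exact: siN.
rewrite siNr// siNr ?siNl//; last exact: siN.
ring.
Qed.

Lemma siZZ (a : R) x : D x -> B (a *: x) (a *: x) = a ^+ 2 * B x x.
Proof.
by move=> Dx; rewrite (siZl DB)// ?siZr// ?mulrA//; exact: (siZ DB).
Qed.

Lemma si_subC x y : D x -> D y -> B (x - y) (x - y) = B (y - x) (y - x).
Proof. by move=> Dx Dy; rewrite !siBB// (siC DB Dx Dy); ring. Qed.

(** The polynomial [B (x + a *: y) (x + a *: y)] in a is nonnegative: at its minimum
    if [B y y > 0], far away if [B y y = 0]. *)
Lemma si_cauchy_schwarz x y : D x -> D y -> B x y ^+ 2 <= B x x * B y y.
Proof.
move=> Dx Dy.
have P (a : R) : 0 <= B x x + 2 * a * B x y + a ^+ 2 * B y y.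
  have := si_ge0 DB (siD DB Dx (siZ DB a Dy)).
  by rewrite siDD ?siZZ ?siZr// ?mulrA//; exact: (siZ DB).
have By := si_ge0 DB Dy; have Bx := si_ge0 DB Dx.
have [y0|y0] := eqVneq (B y y) 0.
  rewrite y0 mulr0.
  have [->|xy0] := eqVneq (B x y) 0; first by rewrite expr0n.
  have := P (- (B x x + 1) / (2 * B x y)); rewrite y0 mulr0 addr0.
  rewrite (_ : 2 * _ * _ = - (B x x + 1)); first by lra.
  by field.
have {}By : 0 < B y y by rewrite lt_neqAle eq_sym y0.
have := P (- B x y / B y y).
rewrite (_ : _ + _ + _ = B x x - B x y ^+ 2 / B y y); last by field.
by rewrite subr_ge0 ler_pdivrMr.
Qed.

Lemma si_sqrD x y : D x -> D y -> B (x + y) (x + y) <= 2 * B x x + 2 * B y y.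
Proof.
move=> Dx Dy; have := si_ge0 DB (siB Dx Dy).
by rewrite siBB// siDD//; lra.
Qed.

Lemma si_sqrB x y : D x -> D y -> B (x - y) (x - y) <= 2 * B x x + 2 * B y y.
Proof.
move=> Dx Dy; have := si_ge0 DB (siD DB Dx Dy).
by rewrite siBB// siDD//; lra.
Qed.

(** A minimizing sequence of [B x x - 2 * l x] over a convex set is Cauchy by the
    parallelogram identity; the first variation at the limit is the conclusion. *)
Lemma si_minimizer C (l : V -> R) (c : R) : qcomplete D B ->
  C `<=` D -> C !=set0 -> qconvex C -> qclosed D B C ->
  (forall x y, D x -> D y -> l (x + y) = l x + l y) ->
  (forall a x, D x -> l (a *: x) = a * l x) ->
  0 <= c -> (forall x, D x -> l x ^+ 2 <= B x x * c) ->
  exists2 x, C x & forall y, C y -> l (y - x) <= B x (y - x).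
Proof.
move=> cD CD [z0 Cz0] Cc Ccl lD lZ c0 lc.
have lN x : D x -> l (- x) = - l x.
  by move=> Dx; rewrite -scaleN1r lZ// mulN1r.
have lB x y : D x -> D y -> l (x - y) = l x - l y.
  by move=> Dx Dy; rewrite lD ?lN//; exact: siN.
have B0 := si_ge0 DB.
pose J x := B x x - 2 * l x.
have Jc x : D x -> - c <= J x.
  move=> Dx; have := young_of_sqr_le (B0 _ Dx) c0 ltr01 (lc _ Dx).
  by rewrite /J mul1r divr1; lra.
pose S := [set J x | x in C].
have S0 : S !=set0 by exists (J z0); exists z0.
have lbS : has_lbound S.
  by exists (- c) => _ [x Cx <-]; exact/Jc/CD.
have hS : has_inf S by [].
pose I := inf S.
have IJ x : C x -> I <= J x by move=> Cx; apply: ge_inf => //; exists x.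
have xn n : exists2 x, C x & J x < I + n.+1%:R^-1.
  have n0 : 0 < n.+1%:R^-1 :> R by rewrite invr_gt0.
  by have [_ [x Cx <-] xI] := inf_adherent n0 hS; exists x.
pose x_ n := sval (cid2 (xn n)).
have Cx n : C (x_ n) by rewrite /x_; case: cid2.
have Jx n : J (x_ n) < I + n.+1%:R^-1 by rewrite /x_; case: cid2.
have small (e : R) : 0 < e -> exists n0, forall n, (n0 <= n)%N -> n.+1%:R^-1 < e.
  by move=> e0; have [k _ ke] := near_infty_natSinv_lt (PosNum e0); exists k.
(* parallelogram identity: both [J (x_ i)] and [J (x_ j)] are close to I, and J of
   the midpoint is at least I *)
have cau : qcauchy B x_.
  move=> e e0; have [|n0 hn0] := small (e / 4); first by rewrite divr_gt0.
  exists n0 => i j /hn0 hi /hn0 hj.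
  have Di := CD _ (Cx i); have Dj := CD _ (Cx j).
  have half0 : 0 <= 2^-1 :> R by lra.
  have half1 : 2^-1 <= 1 :> R by lra.
  have := IJ _ (Cc 2^-1 _ _ half0 half1 (Cx i) (Cx j)).
  have Dji := siB Dj Di; have DZ := siZ DB 2^-1 Dji.
  rewrite /J siDD// siZZ// siZr// lD// lZ// lB//.
  rewrite siBB// (si_subC Di Dj) [X in _ < X]/= siBB//.
  rewrite siBr// (siC DB Di Dj).
  rewrite (_ : 2^-1 ^+ 2 = 4^-1 :> R); last by rewrite expr2 -invfM -natrM.
  move: (Jx i) (Jx j) hi hj; rewrite /J.
  move: (i.+1%:R^-1) (j.+1%:R^-1) => a b.
  move: (B (x_ i) (x_ i)) (B (x_ j) (x_ j)) (B (x_ j) (x_ i)) (l (x_ i)) (l (x_ j)).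
  move=> b1 b2 b3 l1 l2 h1 h2 h3 h4 h5.
  clear -h1 h2 h3 h4 h5.
  lra.
have [x Dx xx] := cD _ (fun n => CD _ (Cx n)) cau.
have Cxx : C x.
  apply: Ccl => // e /xx[n0 hn0]; exists (x_ n0) => //; exact: hn0.
(* J is continuous for the seminorm of B; K collects what multiplies e when the two
   cross terms are estimated by Young's inequality with weight e *)
have JxI : J x <= I.
  rewrite leNgt; apply/negP => IJx.
  pose K := 3 + B x x + c.
  have K0 : 0 < K by rewrite /K; have := B0 _ Dx; lra.
  pose e := (J x - I) / K.
  have e0 : 0 < e by rewrite divr_gt0// subr_gt0.
  have e20 : 0 < e ^+ 2 by rewrite exprn_gt0.
  have [n1 hn1] := small _ e0; have [n2 hn2] := xx _ e20.
  pose n := maxn n1 n2; have Dn := CD _ (Cx n).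
  have {hn1}h1 := hn1 n (leq_maxl _ _); have {hn2}h2 := hn2 n (leq_maxr _ _).
  have Dz := siB Dn Dx; set z := x_ n - x in h2 Dz.
  have ez0 : 0 < e^-1 by rewrite invr_gt0.
  have ez : e^-1 * B z z <= e.
    by rewrite ler_pdivrMl// -expr2 ltW.
  have hB : - (2 * B z x) <= e + e * B x x.
    have := young_of_sqr_le (B0 _ Dz) (B0 _ Dx) ez0 _ (s := - B z x).
    rewrite sqrrN => /(_ (si_cauchy_schwarz Dz Dx)); rewrite invrK mulrC in ez *.
    by rewrite [B x x * _]mulrC; lra.
  have hl : 2 * l z <= e + e * c.
    have := young_of_sqr_le (B0 _ Dz) c0 ez0 (lc _ Dz).
    by rewrite invrK [c * _]mulrC; lra.
  have xE : x_ n = z + x by rewrite subrK.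
  have := Jx n; rewrite /J xE siDD// lD// => Jn.
  have Bz := B0 _ Dz.
  have eK : e * K = J x - I by rewrite /e divfK// gt_eqF.
  move: eK Jn hB hl Bz h1 IJx; rewrite /K /J !mulrDr.
  move: (n.+1%:R^-1) (B z z) (B z x) (B x x) (l z) (l x) => a b1 b2 b3 l1 l2.
  move: (e * b3) (e * c) => fb fc; clearbody e; clear; lra.
exists x => // y Cy; have Dy := CD _ Cy; have Dd := siB Dy Dx.
set d := y - x in Dd *.
(* first variation: moving from x towards y by a small t would decrease J *)
rewrite leNgt; apply/negP => hlt.
pose k := l d - B x d; have k0 : 0 < k by rewrite subr_gt0.
have Bd := B0 _ Dd.
pose t := k / (B d d + 1 + k).
have s0 : 0 < B d d + 1 + k by lra.
have t0 : 0 < t by rewrite divr_gt0.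
have t1 : t <= 1 by rewrite ler_pdivrMr// mul1r; lra.
have := IJ _ (Cc t _ _ (ltW t0) t1 Cxx Cy); rewrite -/d.
have Dt := siZ DB t Dd.
rewrite /J siDD// siZZ// siZr// lD// lZ// => hh.
have : 0 <= t * (t * B d d - 2 * k).
  by move: JxI hh; rewrite /J /k; lra.
rewrite pmulr_rge0// subr_ge0 => h2.
have : t * B d d < k * 1.
  rewrite /t mulrAC -mulrA ltr_pM2l// ltr_pdivrMr// mul1r; lra.
by lra.
Qed.

Lemma si_riesz (l : V -> R) (c : R) : qcomplete D B ->
  (forall x y, D x -> D y -> l (x + y) = l x + l y) ->
  (forall a x, D x -> l (a *: x) = a * l x) ->
  0 <= c -> (forall x, D x -> l x ^+ 2 <= B x x * c) ->
  exists2 x, D x & forall y, D y -> B x y = l y.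
Proof.
move=> cD lD lZ c0 lc.
have [||||x Dx xP] := @si_minimizer D l c cD _ _ _ _ lD lZ c0 lc => //.
- by exists 0; exact: si0 DB.
- move=> t x y _ _ Dx Dy; apply: (siD DB) => //; apply: (siZ DB); exact: siB.
exists x => // y Dy.
have h z : D z -> l z <= B x z.
  by move=> Dz; have := xP _ (siD DB Dx Dz); rewrite addrAC subrr add0r.
apply/eqP; rewrite eq_le h// andbT.
have := h _ (siN Dy).
by rewrite siNr// -scaleN1r lZ// mulN1r lerN2.
Qed.

Lemma qclosed_complete C : qcomplete D B -> C `<=` D -> qclosed D B C ->
  qcomplete C B.
Proof.
move=> cD CD Ccl u Cu /(cD _ (fun n => CD _ (Cu n)))[x Dx ux].
exists x => //; apply: Ccl => // e /ux[n0 h]; exists (u n0) => //; exact: h.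
Qed.

Lemma qcvg_cvg u x y : (forall n, D (u n)) -> D x -> D y -> qcvg B u x ->
  B (u n) y @[n --> \oo] --> B x y.
Proof.
move=> Du Dx Dy ux; apply/cvgrPdist_lt => e e0.
have By : 0 < B y y + 1 by rewrite ltr_wpDl// (si_ge0 DB).
have d0 : 0 < e ^+ 2 / (B y y + 1) by rewrite divr_gt0// exprn_gt0.
have [n0 h] := ux _ d0; exists n0 => // n /= n0n.
rewrite distrC -siBl// -(@ltr_pXn2r _ 2)// ?nnegrE ?ltW// -normrX ger0_norm ?sqr_ge0//.
have Dd := siB (Du n) Dx.
apply: le_lt_trans (si_cauchy_schwarz Dd Dy) _.
have := h n n0n; rewrite ltr_pdivlMr// mulrDr mulr1; apply: le_lt_trans.
by rewrite lerDl (si_ge0 DB).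
Qed.

End theory.
End quadratic_space.

(** * The space L^2 *)

Section lebesgue_L2.
Context {R : realType} {N : nat} (Omega : domain R N).
Local Notation E := 'rV[R]_N.
Local Notation L2 := (L2 Omega).
Local Notation ip := (ip Omega).
Local Notation m := (m Omega).
Local Notation L2norm := (L2norm Omega).
Implicit Types (u v f g h : E -> R).

Lemma L2_measurable f : L2 f -> measurable_fun setT f.
Proof. by rewrite /Defs.L2/= inE => /andP[]; rewrite inE. Qed.

Lemma L2_integrable_mul f g : L2 f -> L2 g ->
  m.-integrable setT (EFin \o (fun x => f x * g x)).
Proof. by move=> Lf Lg; apply/Lfun1_integrable; exact: Lfun2_mul_Lfun1. Qed.

Lemma L2_integrable_sqr f : L2 f ->
  m.-integrable setT (EFin \o (fun x => f x * f x)).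
Proof. by move=> Lf; exact: L2_integrable_mul. Qed.

Lemma L2P f : measurable_fun setT f ->
  m.-integrable setT (EFin \o (fun x => f x * f x)) -> L2 f.
Proof.
move=> mf /integrableP[_ foo]; rewrite /Defs.L2/= inE; apply/andP; split.
  by rewrite inE.
rewrite inE/= /finite_norm unlock; apply: poweR_lty.
apply: le_lt_trans foo; rewrite le_eqVlt; apply/orP; left; apply/eqP.
apply: eq_integral => x _ /=; congr EFin.
by rewrite powR_mulrn// expr2 -normrM.
Qed.

Lemma L2_0 : L2 0.
Proof. by have [] := Lfun_addr_closed m (lee1n 2). Qed.

Lemma L2D f g : L2 f -> L2 g -> L2 (f + g).
Proof. by have [_] := Lfun_addr_closed m (lee1n 2); apply. Qed.

Lemma L2Z a f : L2 f -> L2 (a *: f).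
Proof.
move=> Lf; have := @Lfun_scale _ _ _ m f a 2 (ler1n _ 2) Lf.
by rewrite (_ : a \o* f = a *: f)//; apply/funext => x; rewrite /= mulrC.
Qed.

Lemma L2N f : L2 f -> L2 (- f).
Proof. by rewrite -scaleN1r; exact: L2Z. Qed.

Lemma L2B f g : L2 f -> L2 g -> L2 (f - g).
Proof. by move=> Lf /L2N; exact: L2D. Qed.

Lemma L2_dominated f g : measurable_fun setT f -> L2 g ->
  {ae m, forall x, `|f x| <= `|g x|} -> L2 f.
Proof.
move=> mf Lg fg; apply: L2P => //; apply/integrableP; split.
  by apply/measurable_EFinP; exact: measurable_funM.
have /integrableP[mg] := L2_integrable_sqr Lg.
apply: le_lt_trans; apply: ae_ge0_le_integral => //.
- apply: measurableT_comp => //; apply/measurable_EFinP.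
  exact: measurable_funM.
- exact: measurableT_comp.
- apply: filterS fg => x fgx _ /=; rewrite lee_fin !normrM.
  exact: ler_pM.
Qed.

Lemma L2_ae f g : measurable_fun setT f -> L2 g ->
  {ae m, forall x, f x = g x} -> L2 f.
Proof.
by move=> mf Lg fg; apply: (L2_dominated mf Lg); apply: filterS fg => x ->.
Qed.

Lemma ipC f g : ip f g = ip g f.
Proof. by apply: eq_Rintegral => x _; rewrite mulrC. Qed.

Lemma ipDl f g h : L2 f -> L2 g -> L2 h -> ip (f + g) h = ip f h + ip g h.
Proof.
move=> Lf Lg Lh; rewrite /Defs.ip -RintegralD//.
- by apply: eq_Rintegral => x _; rewrite -mulrDl.
- exact: L2_integrable_mul.
- exact: L2_integrable_mul.
Qed.

Lemma ipZl a f h : L2 f -> L2 h -> ip (a *: f) h = a * ip f h.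
Proof.
move=> Lf Lh; rewrite /Defs.ip -RintegralZl//; last exact: L2_integrable_mul.
by apply: eq_Rintegral => x _; rewrite mulrA.
Qed.

Lemma ip0l h : ip 0 h = 0.
Proof.
rewrite /Defs.ip (_ : (fun x => _) = cst 0); last by apply/funext => x; rewrite mul0r.
by rewrite /Rintegral integral0.
Qed.

Lemma ipNl f h : L2 f -> L2 h -> ip (- f) h = - ip f h.
Proof. by move=> Lf Lh; rewrite -scaleN1r ipZl// mulN1r. Qed.

Lemma ipBl f g h : L2 f -> L2 g -> L2 h -> ip (f - g) h = ip f h - ip g h.
Proof. by move=> Lf Lg Lh; rewrite ipDl ?ipNl//; exact: L2N. Qed.

Lemma ipDr f g h : L2 f -> L2 g -> L2 h -> ip h (f + g) = ip h f + ip h g.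
Proof. by move=> Lf Lg Lh; rewrite ![ip h _]ipC; exact: ipDl. Qed.

Lemma ipZr a f h : L2 f -> L2 h -> ip h (a *: f) = a * ip h f.
Proof. by move=> Lf Lh; rewrite ![ip h _]ipC; exact: ipZl. Qed.

Lemma ipNr f h : L2 f -> L2 h -> ip h (- f) = - ip h f.
Proof. by move=> Lf Lh; rewrite ![ip h _]ipC; exact: ipNl. Qed.

Lemma ipBr f g h : L2 f -> L2 g -> L2 h -> ip h (f - g) = ip h f - ip h g.
Proof. by move=> Lf Lg Lh; rewrite ![ip h _]ipC; exact: ipBl. Qed.

Lemma ip_ge0 f : 0 <= ip f f.
Proof. by apply: Rintegral_ge0 => x _; rewrite -expr2 sqr_ge0. Qed.

Lemma ip_nneg f g : L2 f -> L2 g -> {ae m, forall x, 0 <= f x} ->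
  {ae m, forall x, 0 <= g x} -> 0 <= ip f g.
Proof.
move=> Lf Lg f0 g0; apply: fine_ge0.
have /measurable_int mfg := L2_integrable_mul Lf Lg.
rewrite (ae_eq_integral (fun x => `|f x * g x|%:E))//.
- by apply: integral_ge0 => x _; rewrite lee_fin.
- apply/measurable_EFinP; apply: measurableT_comp => //.
  exact/measurable_EFinP.
- apply: filterS2 f0 g0 => x f0 g0 _ /=.
  by rewrite ger0_norm// mulr_ge0.
Qed.

Lemma ip_aeql f f' g : L2 f -> L2 f' -> L2 g ->
  {ae m, forall x, f x = f' x} -> ip f g = ip f' g.
Proof.
move=> Lf Lf' Lg ff'; congr fine; apply: ae_eq_integral => //.
- exact: measurable_int (L2_integrable_mul Lf Lg).
- exact: measurable_int (L2_integrable_mul Lf' Lg).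
- by apply: filterS ff' => x /= -> _.
Qed.

Lemma ip_aeqr f f' g : L2 f -> L2 f' -> L2 g ->
  {ae m, forall x, f x = f' x} -> ip g f = ip g f'.
Proof. by move=> *; rewrite ![ip g _]ipC; exact: ip_aeql. Qed.

Lemma ip_eq0 f : L2 f -> ip f f = 0 -> {ae m, forall x, f x = 0}.
Proof.
move=> Lf f0.
have If := L2_integrable_sqr Lf.
have : (\int[m]_x `|(f x * f x)%:E| = 0)%E.
  rewrite -[LHS](_ : \int[m]_x (f x * f x)%:E = _)%E; last first.
    by apply: eq_integral => x _; rewrite gee0_abs// lee_fin -expr2 sqr_ge0.
  rewrite -[LHS]fineK; last exact: integrable_fin_num.
  by congr EFin.
move/(ae_eq_integral_abs m measurableT (measurable_int m If)).
apply: filterS => x /(_ I)/= /eqP; rewrite eqe -expr2 sqrf_eq0.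
by move/eqP.
Qed.

Lemma ip_ae0 f : L2 f -> {ae m, forall x, f x = 0} -> ip f f = 0.
Proof. by move=> Lf f0; rewrite (ip_aeql Lf L2_0)// ip0l. Qed.

Lemma L2norm_ip f : L2 f -> L2norm f = (Num.sqrt (ip f f))%:E.
Proof.
move=> Lf; rewrite /Defs.L2norm unlock.
rewrite (_ : (\int[m]_x _)%E = (ip f f)%:E).
  by rewrite poweR_EFin powR12_sqrt// ip_ge0.
rewrite /Defs.ip /Rintegral fineK; last first.
  exact: (integrable_fin_num measurableT (L2_integrable_sqr Lf)).
apply: eq_integral => x _ /=; congr EFin.
by rewrite powR_mulrn// expr2 -normrM ger0_norm// -expr2 sqr_ge0.
Qed.

Lemma L2_norm f : L2 f -> L2 (fun x => `|f x|).
Proof.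
move=> Lf; apply: (L2_dominated _ Lf).
  by apply: measurableT_comp => //; exact: L2_measurable.
by apply: aeW => x; rewrite normr_id.
Qed.

Lemma L2_max f g : L2 f -> L2 g -> L2 (fun x => Num.max (f x) (g x)).
Proof.
move=> Lf Lg; apply: (@L2_dominated _ (fun x => `|f x| + `|g x|)).
- by apply: measurable_maxr; exact: L2_measurable.
- by apply: L2D; exact: L2_norm.
- apply: aeW => x; rewrite [leRHS]ger0_norm ?addr_ge0//.
  by case: (leP (f x) (g x)) => _; rewrite ?lerDl ?lerDr.
Qed.

Lemma L2_min f g : L2 f -> L2 g -> L2 (fun x => Num.min (f x) (g x)).
Proof.
move=> Lf Lg; apply: (@L2_dominated _ (fun x => `|f x| + `|g x|)).
- by apply: measurable_minr; exact: L2_measurable.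
- by apply: L2D; exact: L2_norm.
- apply: aeW => x; rewrite [leRHS]ger0_norm ?addr_ge0//.
  by case: (leP (f x) (g x)) => _; rewrite ?lerDl ?lerDr.
Qed.

Lemma L2_patch (A : set E) f : measurable A -> L2 f -> L2 (f \_ A).
Proof.
move=> mA Lf; apply: (L2_dominated _ Lf).
  apply/(measurable_restrictT f mA).
  by apply: measurable_funTS; exact: L2_measurable.
by apply: aeW => x; rewrite patchE; case: ifPn => // _; rewrite normr0.
Qed.

Lemma L2_semi_inner : semi_inner L2 ip.
Proof.
split; [exact: L2_0|exact: L2D|exact: L2Z|by move=> *; exact: ipC| | |].
- by move=> *; exact: ipDl.
- by move=> *; exact: ipZl.
- by move=> *; exact: ip_ge0.
Qed.

Lemma ip_EFin f : L2 f -> (\int[m]_x (f x * f x)%:E = (ip f f)%:E)%E.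
Proof.
move=> Lf; rewrite /Defs.ip /Rintegral fineK//.
exact: (integrable_fin_num measurableT (L2_integrable_sqr Lf)).
Qed.

(** Fatou's lemma for squares; completeness below uses it for the limit of the
    differences. *)
Lemma L2_fatou (v : (E -> R)^nat) f (c : R) : (forall n, L2 (v n)) ->
  measurable_fun setT f -> (forall n, ip (v n) (v n) <= c) ->
  {ae m, forall x, v n x @[n --> \oo] --> f x} -> L2 f /\ ip f f <= c.
Proof.
move=> Lv mf vc vf.
have sq0 (g : E -> R) x : (0 <= (g x * g x)%:E)%E.
  by rewrite lee_fin -expr2 sqr_ge0.
have msq (g : E -> R) : measurable_fun setT g ->
    measurable_fun setT (fun x => (g x * g x)%:E).
  by move=> mg; apply/measurable_EFinP; exact: measurable_funM.
have mv n := msq _ (L2_measurable (Lv n)).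
have ffc : (\int[m]_x (f x * f x)%:E <= c%:E)%E.
  apply: (@le_trans _ _ (limn_einf (fun n => \int[m]_x (v n x * v n x)%:E)%E)).
    apply: le_trans (fatou _ _ mv (fun n x _ => sq0 (v n) x)) => //.
    apply: ae_ge0_le_integral => //.
    - exact: msq.
    - move=> x _; rewrite limn_einf_lim; apply: lime_ge.
        exact: is_cvg_einfs.
      by apply: nearW => n; apply: le_ereal_inf_tmp => _ [k _ <-]; exact: sq0.
    - rewrite /limn_einf; apply: measurableT_comp => //.
      apply: measurable_fun_limn_esup => n.
      by apply: measurableT_comp => //; exact: mv.
    - apply: filterS vf => x vx _.
      have h : (v n x * v n x)%:E @[n --> \oo] --> (f x * f x)%:E.
        by apply: cvg_EFin; [exact: nearW|exact: cvgM].
      by rewrite (cvg_limn_einf_sup h).1.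
  rewrite limn_einf_lim; apply: lime_le; first exact: is_cvg_einfs.
  apply: nearW => n; apply: le_trans (_ : (\int[m]_x (v n x * v n x)%:E <= _)%E).
    by apply: ereal_inf_lbound; exists n => //=.
  by rewrite ip_EFin// lee_fin.
have Lf : L2 f.
  apply: L2P => //; apply/integrableP; split; first exact: msq.
  apply: le_lt_trans (ltry c); apply: le_trans ffc; rewrite le_eqVlt.
  by apply/orP; left; apply/eqP; apply: eq_integral => x _; rewrite gee0_abs//; exact: sq0.
by split => //; rewrite -lee_fin -ip_EFin.
Qed.

(** Riesz-Fischer. Along a subsequence with [ip d_j d_j < 8 ^- j] for the
    successive differences d_j, the sum of the [4 ^ j * d_j ^ 2] has a finite
    integral, hence is finite almost everywhere, and it makes the differences
    summable at every point where it is finite. *)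
Lemma L2_complete : qcomplete L2 ip.
Proof.
move=> u Lu cu.
have mu n := L2_measurable (Lu n).
have k0 (j : nat) : exists n0, forall i l, (n0 <= i)%N -> (n0 <= l)%N ->
    ip (u i - u l) (u i - u l) < 8 ^- j.
  by apply: cu; rewrite invr_gt0 exprn_gt0.
pose k1 j := sval (cid (k0 j)).
have k1P j : forall i l, (k1 j <= i)%N -> (k1 j <= l)%N ->
    ip (u i - u l) (u i - u l) < 8 ^- j by rewrite /k1; case: cid.
(* the sum dominates all earlier ranks, and the term j makes the subsequence cofinal *)
pose k j := (\sum_(i < j.+1) k1 i + j)%N.
have k1k i j : (i <= j)%N -> (k1 i <= k j)%N.
  by move=> ij; rewrite /k (bigD1 (Ordinal (ij : (i < j.+1)%N)))//= -addnA leq_addr.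
pose v j := u (k j); pose d j : E -> R := v j.+1 - v j.
have Lv j : L2 (v j) by exact: Lu.
have Ld j : L2 (d j) by exact: L2B.
have vP i j l : (i <= j)%N -> (i <= l)%N -> ip (v j - v l) (v j - v l) < 8 ^- i.
  by move=> ij il; apply: k1P; exact: k1k.
pose s j x := (4 ^+ j * (d j x * d j x))%:E.
have s0 j x : (0 <= s j x)%E by rewrite lee_fin mulr_ge0 ?exprn_ge0// -expr2 sqr_ge0.
have ms j : measurable_fun setT (s j).
  apply/measurable_EFinP; apply: measurable_funM => //.
  by apply: measurable_funM; exact: L2_measurable.
pose S x := (\sum_(0 <= j <oo) s j x)%E.
have S0 x : (0 <= S x)%E by apply: nneseries_ge0 => j _ _; exact: s0.
have mS : measurable_fun setT S.
  by apply: ge0_emeasurable_sum => // j x _ _; exact: s0.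
have iS : (\int[m]_x S x < +oo)%E.
  rewrite integral_nneseries//.
  apply: (@le_lt_trans _ _ (\sum_(0 <= j <oo) (2^-1 ^+ j)%:E)%E).
    apply: lee_nneseries => [j _ _|j _].
      by apply: integral_ge0 => x _; exact: s0.
    rewrite /s; under eq_integral do rewrite EFinM.
    rewrite ge0_integralZl_EFin//; last 2 first.
    - by move=> x _; rewrite lee_fin -expr2 sqr_ge0.
    - by apply/measurable_EFinP; apply: measurable_funM; exact: L2_measurable.
    rewrite ip_EFin// -EFinM lee_fin.
    have := ltW (vP j j.+1 j (leqnSn _) (leqnn _)); rewrite -/(d j) => dj.
    rewrite -(@ler_pM2l _ (4 ^+ j)) in dj; last by rewrite exprn_gt0.
    by apply: (le_trans dj); rewrite -expr_div_n (_ : 4 / 8 = 2^-1 :> R)//; field.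
  apply: (@le_lt_trans _ _ 2%:E); last exact: ltry.
  apply: lime_le.
    by apply: is_cvg_nneseries => n _ _; rewrite lee_fin exprn_ge0.
  apply: nearW => n; rewrite sumEFin lee_fin.
  have := @geometric_le_lim R n 1 2^-1.
  rewrite ger0_norm// => /(_ ler01); rewrite /series/=.
  under eq_bigr do rewrite mul1r.
  move=> h; apply: le_trans (h _ _) _; rewrite ?invr_gt0//.
    by rewrite invf_lt1// ltr1n.
  by rewrite ler_pdivrMr; lra.
have aeS : {ae m, forall x, (S x < +oo)%E}.
  have IS : m.-integrable setT S.
    apply/integrableP; split => //.
    by under eq_integral do rewrite gee0_abs//.
  apply: filterS (integrable_ae measurableT IS) => x /(_ Logic.I).
  by rewrite ge0_fin_numE.
pose A := [set x | (S x < +oo)%E].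
have mA : measurable A.
  rewrite (_ : A = setT `&` [set x | (S x < +oo)%E]); last by rewrite setTI.
  exact: emeasurable_fun_infty_o.
(* [4 ^ j * d_j ^ 2 <= S] gives [|d_j| <= sqrt S / 2 ^ j], a geometric bound *)
have vA x : A x -> cvgn (fun j => v j x).
  move=> Ax; pose C := fine (S x).
  have SC : S x = C%:E by rewrite /C fineK// ge0_fin_numE.
  have C0 : 0 <= C by rewrite -lee_fin -SC.
  have dC j : `|d j x| <= geometric (Num.sqrt C) 2^-1 j.
    have : (s j x <= C%:E)%E.
      rewrite -SC; apply: le_trans (nneseries_lim_ge j.+1 _) => //.
      by rewrite big_mkord big_ord_recr/= leeDr// sume_ge0.
    rewrite /s lee_fin -expr2 => h.
    have -> : `|d j x| = Num.sqrt ((4 ^+ j * d j x ^+ 2) * (2^-1 ^+ j) ^+ 2).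
      rewrite -exprM mulnC exprM mulrAC -exprMn_comm; last exact: mulrC.
      rewrite (_ : 4 * _ = 1 :> R); last by rewrite expr2; field.
      by rewrite expr1n mul1r sqrtr_sqr.
    rewrite sqrtrM; last by rewrite mulr_ge0 ?sqr_ge0// exprn_ge0.
    rewrite sqrtr_sqr [X in _ * X]ger0_norm ?exprn_ge0//=.
    by rewrite ler_wpM2r ?exprn_ge0// ler_wsqrtr.
  have : cvgn (series (fun j => d j x)).
    apply: normed_cvg; apply: (series_le_cvg _ _ dC) => //.
      by move=> n; rewrite /= mulr_ge0 ?exprn_ge0// sqrtr_ge0.
    by apply: is_cvg_geometric_series; rewrite ger0_norm//; lra.
  have -> : (fun j => v j x) = (fun j => v 0%N x + series (fun j => d j x) j).
    apply/funext => j; elim: j => [|j ih].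
      by rewrite /series/= big_geq// addr0.
    by rewrite seriesSr addrA -ih (_ : d j x = v j.+1 x - v j x)// addrC subrK.
  by move=> h; apply: is_cvgD => //; exact: is_cvg_cst.
pose f x := limn (fun j => (v j \_ A) x).
have fE x : (v j \_ A) x @[j --> \oo] --> f x.
  have [Ax|nAx] := pselect (A x); last first.
    rewrite /f; apply/cvg_ex; exists 0.
    by under eq_fun do rewrite patchE memNset//; exact: cvg_cst.
  rewrite /f; apply/cvg_ex.
  have /cvg_ex[l hl] := vA _ Ax; exists l.
  by under eq_fun do rewrite patchE mem_set//.
have mf : measurable_fun setT f.
  apply: (@measurable_fun_cvg _ _ _ setT (fun j => v j \_ A)).
  - move=> j; apply/(measurable_restrictT _ mA).
    by apply: measurable_funTS; exact: L2_measurable.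
  - by move=> x _; exact: fE.
have vf i : L2 (v i - f) /\ ip (v i - f) (v i - f) <= 8 ^- i.
  apply: (@L2_fatou (fun n => v i - v (i + n)%N)).
  - by move=> n; exact: L2B.
  - by apply: measurable_funB => //; exact: L2_measurable.
  - by move=> n; apply: ltW; apply: vP => //; exact: leq_addr.
  - apply: filterS aeS => x Ax; apply: (@cvgB _ _ _ _ _ (cst (v i x))).
      exact: cvg_cst.
    have := fE x; under eq_fun do rewrite patchE mem_set//.
    by rewrite -(@cvg_shiftn i); under eq_fun do rewrite addnC.
have Lf : L2 f by have := L2B (Lv 0%N) (vf 0%N).1; rewrite opprB addrC subrK.
exists f => // e e0.
have e4 : 0 < e / 4 by rewrite divr_gt0.
have [n0 hn0] := cu _ e4.
have [i hi] : exists i, 8 ^- i < e / 4 /\ (n0 <= k i)%N.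
  have [l _ hl] := near_infty_natSinv_lt (PosNum e4).
  exists (maxn n0 l); split; last first.
    by rewrite /k (leq_trans (leq_maxl n0 l))// leq_addl.
  apply: le_lt_trans (hl _ (leq_maxr n0 l)).
  by rewrite lef_pV2 ?posrE ?exprn_gt0// -natrX ler_nat ltn_expl.
exists n0 => n n0n.
have -> : u n - f = (u n - v i) + (v i - f) by rewrite addrA subrK.
apply: le_lt_trans (si_sqrD L2_semi_inner (L2B (Lu n) (Lv i)) (vf i).1) _.
have := hn0 n (k i) n0n hi.2; have := (vf i).2; rewrite -/(v i); case: hi.
move: (ip _ _) (ip _ _) (8 ^- i) => a b c; clear; lra.
Qed.

End lebesgue_L2.

(** * Smooth functions with compact support *)

Section flat.
Context {R : realType}.
Implicit Types (p : {poly R}) (s : R).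

(** The functions [p (1 / s) * exp (- 1 / s)] for s > 0, extended by 0: a class
    that is stable under derivation and contains the usual C^infinity step. *)
Definition flat p s : R := if 0 < s then p.[s^-1] * expR (- s^-1) else 0.

(** [exp y >= y ^ (i + 2) / (i + 2)!] beats each monomial of p with two powers to
    spare. *)
Lemma flat_bound p : exists2 M, 0 <= M & forall s, 0 < s ->
  `|p.[s^-1] * expR (- s^-1)| <= M * s ^+ 2.
Proof.
exists (\sum_(i < size p) `|p`_i| * (i.+2)`!%:R).
  by apply: sumr_ge0 => i _; rewrite mulr_ge0.
move=> s s0; have y0 : 0 < s^-1 by rewrite invr_gt0.
set y := s^-1 in y0 *.
rewrite normrM [X in _ * X]ger0_norm ?expR_ge0// horner_coef.
rewrite -ler_pdivrMr ?exprn_gt0// -exprVn -/y.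
apply: (@le_trans _ _ ((\sum_(i < size p) `|p`_i| * y ^+ i) * expR (- y) * y ^+ 2)).
  rewrite !ler_wpM2r ?exprn_ge0 ?expR_ge0 ?(ltW y0)//.
  apply: le_trans (ler_norm_sum _ _ _) _; apply: ler_sum => i _.
  by rewrite normrM [X in _ * X]ger0_norm// exprn_ge0// ltW.
rewrite -mulrA mulr_suml; apply: ler_sum => i _.
rewrite -mulrA ler_wpM2l//.
rewrite [expR _ * _]mulrC mulrA -exprD addn2 expRN ler_pdivrMr ?expR_gt0//.
have := expR_ge1Dxn i.+1 (ltW y0).
rewrite -(@ler_pM2l _ (i.+2)`!%:R) ?ltr0n ?fact_gt0// mulrDr mulrCA divff; last first.
  by rewrite pnatr_eq0 -lt0n fact_gt0.
by rewrite !mulr1; apply: le_trans; rewrite lerDr.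
Qed.

(** Away from 0 this is the chain rule; at 0 the difference quotient is bounded by
    [M * |s|]. *)
Lemma is_derive_flat p s : is_derive s 1 (flat p) (flat ('X^2 * (p - p^`())) s).
Proof.
have [s0|s0|s0] := ltgtP s 0.
- rewrite {2}/flat ltNge (ltW s0)/=.
  apply: (@near_eq_is_derive _ _ _ (cst 0)).
    near=> t; rewrite /flat ltNge (_ : t <= 0)//.
    by apply: ltW; near: t; exact: lt_nbhsl.
- rewrite {2}/flat s0.
  apply: (@near_eq_is_derive _ _ _ (fun s => p.[s^-1] * expR (- s^-1))).
    near=> t; rewrite /flat (_ : 0 < t)//.
    by near: t; exact: lt_nbhsr.
  have sn0 : s != 0 by rewrite gt_eqF.
  have dV : is_derive s 1 (fun s : R => s^-1) (- s ^- 2).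
    by apply: is_derive_eq (is_deriveV _ (is_derive_id _ _)) _; rewrite // [_ *: _]mulr1.
  have dp : is_derive s 1 (fun s => p.[s^-1]) (p^`().[s^-1] * - s ^- 2).
    exact: (@is_derive1_comp _ (horner p) (fun s => s^-1)).
  have de : is_derive s 1 (fun s => expR (- s^-1)) (expR (- s^-1) * s ^- 2).
    apply: (@is_derive1_comp _ (@expR R) (fun s => - s^-1)).
    by apply: is_derive_eq (is_deriveN dV) _; rewrite opprK.
  apply: is_derive_eq; rewrite !hornerE /GRing.scale/= exprVn; ring.
- rewrite s0 {2}/flat ltxx.
  have [M M0 hM] := flat_bound p.
  have h0 : h^-1 *: (flat p (h *: 1 + 0) - flat p 0) @[h --> 0^'] --> (0 : R).
    apply/cvgr0Pnorm_lt => e e0.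
    have d0 : 0 < e / (M + 1) by rewrite divr_gt0// ltr_wpDl.
    near=> h.
    rewrite addr0 [_ *: 1]mulr1 {2}/flat ltxx subr0 /flat.
    case: ifPn => [h0|_]; last by rewrite scaler0 normr0.
    have hb := hM _ h0.
    rewrite -[X in `|X| < _]/(h^-1 * (p.[h^-1] * expR (- h^-1))).
    rewrite normrM normfV (gtr0_norm h0).
    rewrite ltr_pdivrMl//; apply: le_lt_trans hb _.
    rewrite expr2 mulrA mulrC ltr_pM2l//.
    have : h < e / (M + 1).
      rewrite -(gtr0_norm h0); near: h; apply: dnbhs0_lt; exact: d0.
    rewrite ltr_pdivlMr ?ltr_wpDl// mulrDr mulr1 mulrC; lra.
  by apply: DeriveDef; [apply/cvg_ex; exists 0|exact/cvg_lim].
Unshelve. all: by end_near. Qed.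

Lemma flat1_ge0 s : 0 <= flat 1 s.
Proof. by rewrite /flat; case: ifP => // _; rewrite hornerC mul1r expR_ge0. Qed.

Lemma flat1_le1 s : flat 1 s <= 1.
Proof.
rewrite /flat; case: ifP => // s0; rewrite hornerC mul1r -expR0 ler_expR.
by rewrite oppr_le0 invr_ge0 ltW.
Qed.

Lemma flat1_gt0 s : 0 < s -> 0 < flat 1 s.
Proof. by rewrite /flat => ->; rewrite hornerC mul1r expR_gt0. Qed.

Lemma flat1_eq0 s : s <= 0 -> flat 1 s = 0.
Proof. by rewrite /flat leNgt => /negbTE ->. Qed.

Lemma flat1_cvg s : flat 1 (n%:R * s) @[n --> \oo] --> ((0 < s)%R%:R : R).
Proof.
have [s0|s0] := ltP 0 s; last first.
  rewrite (_ : (fun n => _) = cst 0); first exact: cvg_cst.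
  by apply/funext => n; rewrite flat1_eq0// mulr_ge0_le0.
apply: (@cvg_trans _ (expR (- (n%:R * s)^-1) @[n --> \oo])).
  apply: near_eq_cvg; near=> n.
  rewrite /flat pmulr_rgt0; last by rewrite ltr0n; near: n; exact: nbhs_infty_gt.
  by rewrite s0 hornerC mul1r.
have -> : (true%:R : R) = expR 0 by rewrite expR0.
 apply: continuous_cvg; first exact: continuous_expR.
rewrite -oppr0; apply: cvgN.
apply/gtr0_cvgV0; first by near=> n; rewrite mulr_gt0// ltr0n; near: n; exact: nbhs_infty_gt.
apply/cvgryPge => A; near=> n; rewrite -ler_pdivrMr//.
by near: n; exact: nbhs_infty_ger.
Unshelve. all: by end_near. Qed.

End flat.

Section smooth_algebra.
Context {R : realType} {N : nat}.
Local Notation E := 'rV[R]_N.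
Implicit Types (S : set (E -> R)) (f g : E -> R).

(** Smoothness is proved by exhibiting a class of functions that is stable under partial
    derivatives; by the Leibniz rule it suffices to check the generators of an algebra. *)
Inductive fun_alg S : (E -> R) -> Prop :=
| fun_alg_gen f : S f -> fun_alg S f
| fun_alg_cst c : fun_alg S (cst c)
| fun_algD f g : fun_alg S f -> fun_alg S g -> fun_alg S (f + g)
| fun_algM f g : fun_alg S f -> fun_alg S g -> fun_alg S (f * g).

Definition diff_stable (S S' : set (E -> R)) := forall f, S f ->
  continuous f /\ forall i : 'I_N,
    (forall x, derivable f x (delta_mx 0 i)) /\ S' (partial i f).

Lemma diff_stable_smooth S f : diff_stable S S -> S f -> smooth f.
Proof.
move=> SS Sf s.
have : S (foldr (@partial R N) f s) by elim: s => //= i s /SS[_ /(_ i)[]].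
by move=> /SS[? h]; split => // i; exact: (h i).1.
Qed.

Lemma smooth_diff_stable : diff_stable (@smooth R N) (@smooth R N).
Proof.
move=> f sf; split; first exact: (sf [::]).1.
move=> i; split; first exact: (sf [::]).2.
by move=> s; have := sf (rcons s i); rewrite foldr_rcons.
Qed.

(** By induction, with the Leibniz rule. *)
Lemma diff_stable_alg S : diff_stable S (fun_alg S) ->
  diff_stable (fun_alg S) (fun_alg S).
Proof.
move=> SS f; elim=> {f} [f /SS//|c|f g Af [cf df] Ag [cg dg]|f g Af [cf df] Ag [cg dg]].
- split; first exact: cst_continuous.
  move=> i; split; first by move=> x; exact: derivable_cst.
  rewrite (_ : partial i _ = cst 0); first exact: fun_alg_cst.
  by apply/funext => x; rewrite /partial derive_cst.
- split; first by move=> x; exact: (cvgD (cf x) (cg x)).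
  move=> i; have [dfi Af'] := df i; have [dgi Ag'] := dg i; split.
    by move=> x; exact: derivableD.
  rewrite (_ : partial i _ = partial i f + partial i g); first exact: fun_algD.
  by apply/funext => x; rewrite /partial deriveD.
- split; first by move=> x; exact: (cvgM (cf x) (cg x)).
  move=> i; have [dfi Af'] := df i; have [dgi Ag'] := dg i; split.
    by move=> x; exact: derivableM.
  rewrite (_ : partial i _ = f * partial i g + g * partial i f).
    by apply: fun_algD; exact: fun_algM.
  by apply/funext => x; rewrite /partial deriveM.
Qed.

Lemma smooth_alg S f : diff_stable S (fun_alg S) -> fun_alg S f -> smooth f.
Proof. by move=> SS; apply: diff_stable_smooth; exact: diff_stable_alg. Qed.

Lemma smooth_fun_alg f : fun_alg (@smooth R N) f -> smooth f.
Proof.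
apply: smooth_alg => g /smooth_diff_stable[? h]; split => // i.
by have [? ?] := h i; split => //; exact: fun_alg_gen.
Qed.

Lemma smoothD f g : smooth f -> smooth g -> smooth (f + g).
Proof.
by move=> sf sg; apply: smooth_fun_alg; apply: fun_algD; exact: fun_alg_gen.
Qed.

Lemma smoothZ (a : R) f : smooth f -> smooth (a *: f).
Proof.
move=> sf; apply: smooth_fun_alg.
rewrite (_ : a *: f = cst a * f)//.
by apply: fun_algM; [exact: fun_alg_cst|exact: fun_alg_gen].
Qed.

Lemma derive_line f x (v : E) : 'D_v f x = 'D_1 (fun h : R => f (h *: v + x)) 0.
Proof.
rewrite /derive; set g1 := fun h => h^-1 *: _; set g2 := fun h => h^-1 *: _.
suff -> : g1 = g2 by [].
by rewrite funeqE /g1 /g2 => h /=; rewrite addr0 scale0r add0r [_%:A]mulr1.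
Qed.

Definition flat_coord : set (E -> R) :=
  [set f | exists p i a b, f = fun x : E => flat p (a * x 0 i + b)].

Lemma flat_coord_diff_stable : diff_stable flat_coord (fun_alg flat_coord).
Proof.
move=> _ [p [i [a [b ->]]]].
have cflat q : continuous (@flat R q).
  by move=> s; apply/differentiable_continuous/derivable1_diffP; exact: (@ex_derive _ _ _ _ _ _ _ (is_derive_flat q s)).
split.
  move=> x; apply: (@continuous_comp _ _ _ (fun x : E => a * x 0 i + b)); last exact: cflat.
  have cx : (fun y : E => y 0 i) @ x --> x 0 i by exact: coord_continuous.
  exact: (cvgD (cvgM (cvg_cst a) cx) (cvg_cst b)).
move=> j.
have d x : is_derive x (delta_mx 0 j) (fun x : E => flat p (a * x 0 i + b))
    (flat ('X^2 * (p - p^`())) (a * x 0 i + b) * (a * (i == j)%:R)).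
  have h : is_derive (0 : R) 1 (fun h : R => flat p (a * (h *: (delta_mx 0 j : E) + x) 0 i + b))
      (flat ('X^2 * (p - p^`())) (a * x 0 i + b) * (a * (i == j)%:R)).
    rewrite (_ : (fun h => _) = flat p \o (fun h : R => h * (a * (i == j)%:R) + (a * x 0 i + b))).
      apply: is_derive1_comp.
        by rewrite /= mul0r add0r; exact: is_derive_flat.
      by apply: is_derive_eq; rewrite addr0 scaler0 add0r [_ *: _]mulr1.
    by apply/funext => h /=; rewrite !mxE eqxx/=; congr flat; ring.
  split; first by apply/derivable1P; exact: (@ex_derive _ _ _ _ _ _ _ h).
  by rewrite derive_line; exact: (@derive_val _ _ _ _ _ _ _ h).
split; first by move=> x; exact: (@ex_derive _ _ _ _ _ _ _ (d x)).
rewrite (_ : partial j _ = (fun x : E => flat ('X^2 * (p - p^`())) (a * x 0 i + b)) * cst (a * (i == j)%:R)).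
  apply: fun_algM; last exact: fun_alg_cst.
  by apply: fun_alg_gen; exists ('X^2 * (p - p^`())), i, a, b.
by apply/funext => x; rewrite /partial; exact: (@derive_val _ _ _ _ _ _ _ (d x)).
Qed.

(** For n > 0 these functions are positive exactly on the box of the x with
    [lo i < x i < hi i], and they tend to its indicator when n tends to infinity. *)
Definition box_bump (n : nat) (lo hi : 'I_N -> R) : E -> R :=
  fun x => \prod_(i < N)
    (flat 1 (n%:R * (x 0 i - lo i)) * flat 1 (n%:R * (hi i - x 0 i))).

Lemma smooth_box_bump n lo hi : smooth (box_bump n lo hi).
Proof.
apply: (@smooth_alg flat_coord); first exact: flat_coord_diff_stable.
rewrite (_ : box_bump n lo hi = \prod_(i < N)
    ((fun x : E => flat 1 (n%:R * x 0 i + - (n%:R * lo i))) *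
     (fun x : E => flat 1 (- n%:R * x 0 i + n%:R * hi i)))).
  apply: (big_ind (fun_alg flat_coord)).
  - exact: fun_alg_cst.
  - exact: fun_algM.
  - move=> i _; apply: fun_algM; apply: fun_alg_gen.
    + by exists 1, i, n%:R, (- (n%:R * lo i)).
    + by exists 1, i, (- n%:R), (n%:R * hi i).
apply/funext => x; rewrite /box_bump.
elim/big_rec2: _ => // i f y _ ->.
rewrite -[RHS]/(flat 1 (n%:R * x 0 i + - (n%:R * lo i)) *
  flat 1 (- n%:R * x 0 i + n%:R * hi i) * f x).
by congr (flat _ _ * flat _ _ * _); ring.
Qed.

Definition open_box (lo hi : 'I_N -> R) : set E :=
  [set x | forall i, lo i < x 0 i < hi i].

Definition closed_box (lo hi : 'I_N -> R) : set E :=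
  [set x | forall i, lo i <= x 0 i <= hi i].

Lemma box_bump_ge0 n lo hi x : 0 <= box_bump n lo hi x.
Proof. by apply: prodr_ge0 => i _; rewrite mulr_ge0// flat1_ge0. Qed.

Lemma box_bump_le1 n lo hi x : box_bump n lo hi x <= 1.
Proof.
apply: prodr_ile1 => i _.
by rewrite mulr_ge0 ?flat1_ge0//= mulr_ile1 ?flat1_ge0 ?flat1_le1.
Qed.

Lemma box_bump_eq0 n lo hi x : ~ closed_box lo hi x -> box_bump n lo hi x = 0.
Proof.
move=> /existsNP[i /negP]; rewrite negb_and -!ltNge => xi.
rewrite /box_bump (bigD1 i)//=; case/orP: xi => xi.
  by rewrite flat1_eq0 ?mul0r// mulr_ge0_le0// subr_le0 ltW.
by rewrite [X in _ * X * _]flat1_eq0 ?mulr0 ?mul0r// mulr_ge0_le0// subr_le0 ltW.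
Qed.

Lemma box_bump_cvg lo hi x :
  box_bump n lo hi x @[n --> \oo] --> (\1_(open_box lo hi) x : R).
Proof.
have h : box_bump n lo hi x @[n --> \oo] -->
    \prod_(i < N) (((0 < x 0 i - lo i)%R%:R : R) * ((0 < hi i - x 0 i)%R%:R : R)).
  apply: (@cvg_big R _ *%R 1 predT (@mul_continuous R) _ \oo (index_enum 'I_N) (fun i n => flat 1 (n%:R * (x 0 i - lo i)) * flat 1 (n%:R * (hi i - x 0 i)))).
  by move=> i _; apply: cvgM; exact: flat1_cvg.
suff -> : (\1_(open_box lo hi) x : R) =
    \prod_(i < N) (((0 < x 0 i - lo i)%R%:R : R) * ((0 < hi i - x 0 i)%R%:R : R)) by [].
rewrite indicE; have [bx|nbx] := pselect (open_box lo hi x).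
  rewrite mem_set// big1// => i _; rewrite !subr_gt0.
  by case/andP: (bx i) => -> ->; rewrite mulr1.
rewrite memNset//; move/existsNP: nbx => [i /negP]; rewrite negb_and => xi.
rewrite (bigD1 i)//= !subr_gt0; case/orP: xi => /negbTE ->.
  by rewrite !mul0r.
by rewrite mulr0 mul0r.
Qed.

Lemma box_bump_gt0 n lo hi x : (0 < n)%N -> open_box lo hi x ->
  0 < box_bump n lo hi x.
Proof.
move=> n0 bx; apply: prodr_gt0 => i _; have /andP[lx xh] := bx i.
by rewrite mulr_gt0// flat1_gt0// mulr_gt0 ?ltr0n// subr_gt0.
Qed.

Lemma open_open_box lo hi : open (open_box lo hi).
Proof.
rewrite openE => x bx.
have := @filter_forall _ 'I_N (fun i (y : E) => lo i < y 0 i < hi i)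
  (nbhs (x : E)) (nbhs_filter _).
apply => i.
have : open ((fun x : E => x 0 i) @^-1` `]lo i, hi i[%classic).
  apply: open_comp; last exact: interval_open.
  by move=> y _; exact: coord_continuous.
rewrite openE => /(_ x); rewrite /= in_itv/= => /(_ (bx i)).
by apply: filterS => y /=; rewrite in_itv.
Qed.

Lemma closed_closed_box lo hi : closed (closed_box lo hi).
Proof.
rewrite (_ : closed_box lo hi = \bigcap_(i in [set: 'I_N])
    ((fun x : E => x 0 i) @^-1` `[lo i, hi i]%classic)).
  apply: closed_bigI => i _; apply: closed_comp; last exact: interval_closed.
  by move=> x _; exact: coord_continuous.
apply/seteqP; split => [x bx i _|x bx i]; first by rewrite /= in_itv/=.
by have := bx i Logic.I; rewrite /= in_itv/=.
Qed.

Lemma compact_closed_box lo hi : compact (closed_box lo hi).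
Proof.
apply: (subclosed_compact (@closed_closed_box lo hi)
  (@rV_compact R N (fun i => `[lo i, hi i]%classic) _)).
  by move=> i; exact: segment_compact.
by move=> x bx i; rewrite /= in_itv/=; exact: bx.
Qed.

Lemma sub_open_closed_box lo hi : open_box lo hi `<=` closed_box lo hi.
Proof. by move=> x bx i; have /andP[/ltW -> /ltW ->] := bx i. Qed.

End smooth_algebra.

(** * The fundamental lemma of the calculus of variations *)

Lemma dynkin_induction (T : Type) (G H : set (set T)) :
  setI_closed G -> dynkin H -> G `<=` H -> <<s G >> `<=` H.
Proof.
move=> GI dH GH A; rewrite -setI_closed_g_dynkin_g_sigma_algebra//.
exact: (smallest_sub dH GH).
Qed.

Section boxes.
Context {R : realType}.

Definition boxes n : set (set 'rV[R]_n) :=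
  [set B | exists lo hi, B = open_box lo hi].

Lemma open_boxI n (lo hi lo' hi' : 'I_n -> R) :
  open_box lo hi `&` open_box lo' hi' =
  open_box (fun i => Num.max (lo i) (lo' i)) (fun i => Num.min (hi i) (hi' i)).
Proof.
apply/seteqP; split => [x [xB xB'] i|x xB].
  by rewrite gt_max lt_min; have /andP[-> ->] := xB i; have /andP[-> ->] := xB' i.
split=> i; have := xB i; rewrite gt_max lt_min;
  by move=> /andP[/andP[? ?] /andP[? ?]]; apply/andP.
Qed.

Lemma boxes_setI n : setI_closed (@boxes n).
Proof.
by move=> _ _ [lo [hi ->]] [lo' [hi' ->]]; rewrite open_boxI; do 2 eexists.
Qed.

(** Half spaces are countable unions of boxes. *)
Lemma boxes_generate n (A : set 'rV[R]_n) : measurable A -> <<s @boxes n >> A.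
Proof.
have : measurable_fun [set: g_sigma_algebraType (@boxes n)]
    (id : g_sigma_algebraType (@boxes n) -> 'rV[R]_n).
  apply: measurable_fun_rV => i.
  apply: (measurability _ (measurable_realfun.RGenOInfty.measurableE R)).
  move=> _ [_ [a ->] <-]; rewrite setTI.
  rewrite (_ : _ @^-1` _ = \bigcup_k
      open_box (fun j => if j == i then a else - k%:R) (fun=> k%:R)).
    by apply: bigcupT_measurable => k; apply: sub_sigma_algebra; exists
      (fun j => if j == i then a else - k%:R), (fun=> k%:R).
  apply/seteqP; split => [x|x [k _ /(_ i)]]; rewrite /= in_itv/= andbT; last first.
    by rewrite eqxx => /andP[].
  move=> ax; pose k := (\max_(j < n) (Num.truncn `|x ord0 j|).+1)%N.
  exists k => // j.
  have /ltr_normlP[xk kx] : `|x 0 j| < k%:R.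
    apply: lt_le_trans (truncnS_gt _) _; rewrite ler_nat.
    exact: (leq_bigmax (F := fun j => (Num.truncn `|x 0 j|).+1)).
  by rewrite kx andbT; case: eqP => [->//|_]; rewrite ltrNl.
by move=> mid mA; have := mid measurableT _ mA; rewrite setTI.
Qed.

Lemma open_box_measurable n (lo hi : 'I_n -> R) : measurable (open_box lo hi).
Proof. by apply: rV_open_measurable; exact: open_open_box. Qed.

Lemma closed_rV_measurable n (K : set 'rV[R]_n) : closed K -> measurable K.
Proof.
move=> cK; rewrite -(setCK K); apply: measurableC.
by apply: rV_open_measurable; exact: closed_openC.
Qed.

Lemma compact_rV_measurable n (K : set 'rV[R]_n) : compact K -> measurable K.
Proof.
move=> cK; apply: closed_rV_measurable; exact: compact_closed.
Qed.

(** A product of intervals, through the recursive definition of the measure. *)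
Lemma lebesgue_closed_box n (lo hi : 'I_n -> R) :
  (lebesgue_rV R n (closed_box lo hi) < +oo)%E.
Proof.
elim: n => [|n ih] in lo hi *.
  by rewrite /= (le_lt_trans (probability_le1 _ _)) ?ltry//; apply: closed_rV_measurable; exact: closed_closed_box.
rewrite /= /lebesgue_step /pushforward.
rewrite (_ : _ @^-1` _ = `[lo ord0, hi ord0]%classic `*`
    closed_box (fun i => lo (lift ord0 i)) (fun i => hi (lift ord0 i))).
  rewrite product_measure1E//; last by apply: closed_rV_measurable; exact: closed_closed_box.
  have := @lebesgue_measure_itv R `[lo ord0, hi ord0]; rewrite /= => ->.
  case: ifP => [lh|_]; last by rewrite mul0e.
  rewrite -EFinB; apply: lte_mul_pinfty; [|by []|exact: ih].
  by rewrite lee_fin subr_ge0 ltW// -lte_fin.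
apply/seteqP; split => [[x v] /= xv|[x v] /= [xl vl] i].
  split; first by have := xv ord0; rewrite mxE unlift_none in_itv.
  by move=> i; have := xv (lift ord0 i); rewrite mxE liftK.
rewrite mxE; case: unliftP => [j ->|->] /=; first exact: vl.
by move: xl; rewrite in_itv.
Qed.

Lemma lebesgue_compact n (K : set 'rV[R]_n) : compact K ->
  (lebesgue_rV R n K < +oo)%E.
Proof.
move=> cK; have [M [_ HM]] := compact_bounded cK.
pose b := M + 1.
have Kb : K `<=` closed_box (fun=> - b) (fun=> b).
  move=> x Kx i; rewrite -ler_norml; apply: le_trans (HM b _ x Kx).
    by rewrite /Num.norm/= mx_normrE; apply: (le_bigmax _ (fun ij => `|x ij.1 ij.2|) (0, i)).
  by rewrite /b ltrDl.
apply: le_lt_trans (lebesgue_closed_box _ _); apply: le_measure Kb.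
- by rewrite inE; exact: compact_rV_measurable.
- by rewrite inE; apply: closed_rV_measurable; exact: closed_closed_box.
Qed.

End boxes.

Section fundamental_lemma.
Context {R : realType} {N : nat} (Omega : domain R N).
Local Notation E := 'rV[R]_N.
Local Notation L2 := (L2 Omega).
Local Notation ip := (ip Omega).
Local Notation m := (m Omega).

Lemma m_compact (K : set E) : compact K -> (m K < +oo)%E.
Proof.
move=> cK; apply: le_lt_trans (lebesgue_compact cK).
rewrite /= /mrestr; apply: le_measure; rewrite ?inE.
- by apply: measurableI; [exact: compact_rV_measurable|exact: measurable_domain].
- exact: compact_rV_measurable.
- by move=> x [].
Qed.

Lemma m_setC_domain : m (~` Omega) = 0%E.
Proof. by rewrite /= /mrestr setICl measure0. Qed.

Lemma ae_domain : {ae m, forall x, (Omega : set E) x}.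
Proof.
exists (~` Omega); split => //; last exact: m_setC_domain.
by apply: measurableC; exact: measurable_domain.
Qed.

Lemma L2_bounded_compact (K : set E) (c : R) (f : E -> R) : compact K ->
  measurable_fun setT f -> (forall x, `|f x| <= c) ->
  (forall x, ~ K x -> f x = 0) -> L2 f.
Proof.
move=> cK mf fc fK; apply: L2P => //; apply/integrableP; split.
  by apply/measurable_EFinP; exact: measurable_funM.
have mK := compact_rV_measurable cK.
apply: (@le_lt_trans _ _ (\int[m]_x ((c ^+ 2)%:E * (\1_K x)%:E))%E).
  apply: ge0_le_integral => //.
  - apply: measurableT_comp => //; apply/measurable_EFinP.
    exact: measurable_funM.
  - apply/measurable_EFinP; apply: measurable_funM => //.
  - move=> x _; rewrite /= -EFinM lee_fin indicE.
    have [Kx|nKx] := pselect (K x).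
      by rewrite mem_set// mulr1 normrM -expr2 lerXn2r// nnegrE (le_trans _ (fc x)).
    by rewrite memNset// mulr0 fK// mulr0 normr0.
rewrite ge0_integralZl_EFin//; last 2 first.
- by apply/measurable_EFinP.
- exact: sqr_ge0.
rewrite integral_indic// setIT lte_mul_pinfty//; last exact: m_compact.
by rewrite lee_fin sqr_ge0.
Qed.

Lemma continuous_rV_measurable (f : E -> R) : continuous f ->
  measurable_fun setT f.
Proof.
move=> cf; apply: (measurability _ (measurable_realfun.RGenOInfty.measurableE R)).
move=> _ [_ [a ->] <-]; rewrite setTI; apply: rV_open_measurable.
by apply: open_comp; [move=> x _; exact: cf|exact: interval_open].
Qed.

Lemma bounded_compact_support (K : set E) (f : E -> R) : compact K ->
  continuous f -> (forall x, ~ K x -> f x = 0) ->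
  exists2 c, 0 <= c & forall x, `|f x| <= c.
Proof.
move=> cK cf fK.
have cfK : compact (f @` K).
  by apply: continuous_compact => //; exact: continuous_subspaceT.
have [M [_ HM]] := compact_bounded cfK.
exists (Num.max 0 (M + 1)); first by rewrite le_max lexx.
move=> x; have [Kx|nKx] := pselect (K x).
  rewrite le_max; apply/orP; right; apply: HM; last by exists x.
  by rewrite ltrDl.
by rewrite fK// normr0 le_max lexx.
Qed.

Lemma L2_continuous_compact (K : set E) (f : E -> R) : compact K ->
  continuous f -> (forall x, ~ K x -> f x = 0) -> L2 f.
Proof.
move=> cK cf fK; have [c _ fc] := bounded_compact_support cK cf fK.
by apply: (L2_bounded_compact cK _ fc fK); exact: continuous_rV_measurable.
Qed.

Lemma test_L2 phi : test_function Omega phi -> L2 phi.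
Proof.
move=> [sphi [K [cK _ phiK]]]; apply: (L2_continuous_compact cK) => //.
exact: (sphi [::]).1.
Qed.

Lemma testD phi psi : test_function Omega phi -> test_function Omega psi ->
  test_function Omega (phi + psi).
Proof.
move=> [sphi [K [cK KO phiK]]] [spsi [K' [cK' KO' psiK']]].
split; first exact: smoothD.
exists (K `|` K'); split; first exact: compactU.
  by move=> x [/KO|/KO'].
move=> x /not_orP[nKx nKx'].
by rewrite -[LHS]/(phi x + psi x) phiK// psiK'// addr0.
Qed.

Lemma testZ (a : R) phi : test_function Omega phi ->
  test_function Omega (a *: phi).
Proof.
move=> [sphi [K [cK KO phiK]]]; split; first exact: smoothZ.
exists K; split => // x nKx.
by rewrite -[LHS]/(a * phi x) phiK// mulr0.
Qed.

Lemma test_0 : test_function Omega 0.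
Proof.
split; last by exists set0; split => //; exact: compact0.
rewrite (_ : 0 = (0 : R) *: box_bump 0 (fun=> 0) (fun=> 0)); last by rewrite scale0r.
by apply: smoothZ; exact: smooth_box_bump.
Qed.

Lemma test_partial i phi : test_function Omega phi ->
  test_function Omega (partial i phi).
Proof.
move=> [sphi [K [cK KO phiK]]]; split.
  by have [_ /(_ i)[]] := smooth_diff_stable sphi.
exists K; split => // x nKx.
have nb : nbhs x (~` K).
  by apply: open_nbhs_nbhs; split => //; apply: closed_openC; exact: compact_closed.
rewrite /partial (@near_eq_derive _ _ _ _ (cst 0)) ?derive_cst//.
by apply: filterS nb => y; exact: phiK.
Qed.

Lemma test_box_bump n lo hi : closed_box lo hi `<=` (Omega : set E) ->
  test_function Omega (box_bump n lo hi).
Proof.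
move=> bO; split; first exact: smooth_box_bump.
exists (closed_box lo hi); split => //; first exact: compact_closed_box.
by move=> x; exact: box_bump_eq0.
Qed.

Lemma m_fin_compact_integrable (K : set E) (f : E -> R) : compact K -> L2 f ->
  m.-integrable K (EFin \o f).
Proof.
move=> cK Lf; have mK := compact_rV_measurable cK.
apply/integrable_mkcond => //.
have L1 : L2 (\1_K : E -> R).
  apply: (L2_bounded_compact (c := 1) cK) => //.
  - by move=> x; rewrite indicE; case: (_ \in _); rewrite ?normr1// normr0.
  - by move=> x nKx; rewrite indicE memNset.
have := L2_integrable_mul Lf L1; apply: eq_integrable => // x _.
rewrite /= patchE indicE; case: ifPn => [/set_mem Kx|nKx].
  by rewrite mulr1.
by rewrite mulr0.
Qed.

(** Box bumps are test functions that tend to the indicator of the box. *)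
Lemma integral_box_eq0 (G : E -> R) lo hi : L2 G ->
  (forall phi, test_function Omega phi -> ip G phi = 0) ->
  closed_box lo hi `<=` (Omega : set E) ->
  (\int[m]_(x in open_box lo hi) (G x)%:E = 0)%E.
Proof.
move=> LG Gt bO.
have cK := @compact_closed_box R N lo hi.
have mK := compact_rV_measurable cK.
have Tt n := test_L2 (test_box_bump n bO).
have [] := @dominated_convergence _ _ _ m setT measurableT
  (fun n x => (G x * box_bump n lo hi x)%:E)
  (fun x => (G x * \1_(open_box lo hi) x)%:E)
  (fun x => (`|G x| * \1_(closed_box lo hi) x)%:E).
- by move=> n; exact: measurable_int (L2_integrable_mul LG (Tt n)).
- apply/measurable_EFinP; apply: measurable_funM; first exact: (L2_measurable LG).
  by apply: measurable_indic; exact: open_box_measurable.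
- apply: aeW => x _; apply: cvg_EFin; first exact: nearW.
  by apply: cvgM; [exact: cvg_cst|exact: box_bump_cvg].
- apply: L2_integrable_mul; first exact: L2_norm.
  apply: (L2_bounded_compact (c := 1) cK) => //.
  + by move=> x; rewrite indicE; case: (_ \in _); rewrite ?normr1// normr0.
  + by move=> x nKx; rewrite indicE memNset.
- apply: aeW => x n _; rewrite lee_fin normrM ler_wpM2l//.
  rewrite ger0_norm ?box_bump_ge0// indicE.
  have [Kx|nKx] := pselect (closed_box lo hi x).
    by rewrite mem_set// box_bump_le1.
  by rewrite memNset// box_bump_eq0.
move=> _ _; rewrite (_ : (fun n => _) = cst 0%E); last first.
  apply/funext => n.
  have := Gt _ (test_box_bump n bO); rewrite /Defs.ip /Rintegral => h.
  have If := integrable_fin_num measurableT (L2_integrable_mul LG (Tt n)).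
  by rewrite /= -(fineK If) h.
move=> /(cvg_unique _ (@cvg_cst _ _ _ _ _)) => /(_ (@ereal_hausdorff R)) h.
rewrite integral_mkcond [RHS]h; apply: eq_integral => x _.
by rewrite patchE indicE; case: ifPn => _; rewrite ?mulr1 ?mulr0.
Qed.

(** The sets over which G has integral 0 inside the given box form a Dynkin system
    that contains the boxes, hence all Borel sets. *)
Lemma box_ae_eq0 (G : E -> R) lo hi : L2 G ->
  (forall phi, test_function Omega phi -> ip G phi = 0) ->
  closed_box lo hi `<=` (Omega : set E) ->
  {ae m, forall x, open_box lo hi x -> G x = 0}.
Proof.
move=> LG Gt bO; pose B := open_box lo hi.
have mB : measurable B by exact: open_box_measurable.
have IG : m.-integrable B (EFin \o G).
  apply: integrableS (m_fin_compact_integrable (@compact_closed_box R N lo hi) LG) => //.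
    by apply: compact_rV_measurable; exact: compact_closed_box.
  exact: sub_open_closed_box.
have IGA A : measurable A -> m.-integrable (A `&` B) (EFin \o G).
  by move=> mA; apply: integrableS IG => //; exact: measurableI.
pose H : set (set E) := [set A | measurable A /\
  (\int[m]_(x in A `&` B) (G x)%:E = 0)%E].
have dH : dynkin H.
  split.
  - by split => //; rewrite setTI; exact: integral_box_eq0.
  - move=> A [mA A0]; split; first exact: measurableC.
    have := integral_box_eq0 LG Gt bO; rewrite -/B.
    rewrite -[in X in X -> _](setTI B) -(setUv A) setIUl.
    have mAB : measurable (A `&` B) by exact: measurableI.
    have mCB : measurable (~` A `&` B) by apply: measurableI => //; exact: measurableC.
    rewrite integral_setU// ?A0 ?add0e//.
      rewrite -setIUl setUv setTI; exact: measurable_int IG.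
    by apply/disj_setPS => x [[? _] [? _]].
  - move=> F tF FH; split; first by apply: bigcupT_measurable => n; exact: (FH n).1.
    rewrite setI_bigcupl (@integral_bigcup _ _ _ m (fun n => F n `&` B) (EFin \o G)).
    + by rewrite eseries0// => n _ _; exact: (FH n).2.
    + exact: trivIset_setIr.
    + by move=> n; apply: measurableI => //; exact: (FH n).1.
    + rewrite -setI_bigcupl; apply: IGA.
      by apply: bigcupT_measurable => n; exact: (FH n).1.
have bH : @boxes R N `<=` H.
  move=> _ [lo' [hi' ->]]; split; first exact: open_box_measurable.
  rewrite /B open_boxI; apply: integral_box_eq0 => // x xb; apply: bO => i.
  have := xb i; rewrite ge_max le_min => /andP[/andP[_ ->]] /andP[_ ->]//.
have HA A : measurable A -> H A.
  move=> mA; apply: (dynkin_induction (@boxes_setI R N) dH bH).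
  exact: boxes_generate.
have := @integral_ae_eq _ _ _ m B mB (cst 0%E) (EFin \o G) IG (measurable_cst _).
move=> h; have {}h : ae_eq m B (EFin \o G) (cst 0%E).
  apply: h => A AB mA; rewrite integral0.
  by have [_] := HA _ mA; rewrite setIidl.
by apply: filterS h => x h /h [].
Qed.

(** Boxes with rational centre and with size the inverse of an integer. *)
Lemma box_cover (U : set E) : open U -> U !=set0 ->
  exists lo hi : nat -> 'I_N -> R,
  (forall k, closed_box (lo k) (hi k) `<=` U) /\
  U `<=` \bigcup_k open_box (lo k) (hi k).
Proof.
move=> oU [x0 Ux0].
pose T := ('rV[rat]_N * nat)%type.
pose c (p : T) : 'I_N -> R := fun i => ratr (p.1 0 i).
pose l (p : T) i := c p i - p.2.+1%:R^-1.
pose h (p : T) i := c p i + p.2.+1%:R^-1.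
pose good (p : T) := `[< closed_box (l p) (h p) `<=` U >].
have goodP x : U x -> exists2 p, good p & open_box (l p) (h p) x.
  move=> Ux.
  have /nbhs_ballP[e /= e0 eU] : nbhs x U by exact: open_nbhs_nbhs.
  have e20 : 0 < e / 2 by rewrite divr_gt0.
  have [k _ /(_ k (leqnn k)) /= ke] := near_infty_natSinv_lt (PosNum e20).
  have k0 : 0 < k.+1%:R^-1 :> R by rewrite invr_gt0.
  have qE (i : 'I_N) : exists q : rat, `|ratr q - x 0 i| < k.+1%:R^-1.
    have Bx : ball (x 0 i) k.+1%:R^-1 !=set0 by exists (x 0 i); exact: ballxx.
    have oB : open (ball (x 0 i) (k.+1%:R^-1 : R)) by exact: (@ball_open R R^o).
    have [y [By [q _ qy]]] := @dense_rat R _ Bx oB.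
    by exists q; move: By; rewrite -qy /ball/= distrC.
  pose q : 'rV[rat]_N := \row_i sval (cid (qE i)).
  have qx i : `|c (q, k) i - x 0 i| < k.+1%:R^-1.
    by rewrite /c /= mxE; exact: (svalP (cid (qE i))).
  exists (q, k).
    apply/asboolP => y yb; apply: eU; split; first exact: e0.
    move=> i j; rewrite (ord1 i); have /andP[] := yb j; have := qx j.
    rewrite /ball/= /l /h /= => /ltr_normlP[h1 h2] h3 h4.
    move: ke h1 h2 h3 h4 => /=.
    move: (k.+1%:R^-1) (c _ _) (x 0 j) (y 0 j) => a b u v *.
    by apply/ltr_normlP; split; lra.
  move=> i; have /ltr_normlP[] := qx i; rewrite /l /h /=.
  by move: (k.+1%:R^-1) (c _ _) => a b *; apply/andP; split; lra.
have [p0 gp0 _] := goodP _ Ux0.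
pose g k := if unpickle k is Some p then if good p then p else p0 else p0.
have gg k : good (g k) by rewrite /g; case: unpickle => // p; case: ifP.
exists (fun k => l (g k)), (fun k => h (g k)); split.
  by move=> k; exact/asboolP/gg.
move=> x /goodP[p gp xp]; exists (pickle p) => //.
by rewrite /g pickleK gp.
Qed.

(** Cover Omega by countably many boxes on which G vanishes. *)
Lemma fundamental_lemma (G : E -> R) : L2 G ->
  (forall phi, test_function Omega phi -> ip G phi = 0) ->
  {ae m, forall x, G x = 0}.
Proof.
move=> LG Gt; have [lo [hi [bO Ob]]] := box_cover (@domain_open _ _ Omega) (@domain_nonempty _ _ Omega).
have h k := box_ae_eq0 LG Gt (bO k).
apply: filterS2 (ae_foralln h) ae_domain => x hx /Ob[k _ xk].
exact: hx xk.
Qed.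

End fundamental_lemma.

(** * Weak gradients and the Sobolev space *)

Section sobolev.
Context {R : realType} {N : nat} (Omega : domain R N).
Local Notation E := 'rV[R]_N.
Local Notation L2 := (L2 Omega).
Local Notation ip := (ip Omega).
Local Notation m := (m Omega).
Local Notation H1 := (H1 Omega).
Local Notation dform := (dform Omega).
Local Notation dform1 := (dform1 Omega).
Local Notation weak_grad := (weak_grad Omega).
Local Notation grad := (grad Omega).
Local Notation test := (test_function Omega).
Implicit Types (u v w f g : E -> R) (G : 'I_N -> E -> R).

Lemma H1_L2 u : H1 u -> L2 u. Proof. by case. Qed.

Lemma weak_grad_grad u : H1 u -> weak_grad u (grad u).
Proof. by move=> [_ [G uG]]; rewrite /Defs.grad; case: xgetP => [? ->//|/(_ G)]. Qed.

Lemma grad_L2 u i : H1 u -> L2 (grad u i).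
Proof. by move=> /weak_grad_grad/(_ i)[]. Qed.

Lemma test_partial_L2 i phi : test phi -> L2 (partial i phi).
Proof. by move=> tp; apply: test_L2; exact: test_partial. Qed.

(** The difference of two weak gradients is orthogonal to all test functions. *)
Lemma weak_grad_unique u G G' : weak_grad u G -> weak_grad u G' ->
  forall i, {ae m, forall x, G i x = G' i x}.
Proof.
move=> uG uG' i; have [LG h] := uG i; have [LG' h'] := uG' i.
have : {ae m, forall x, (G i - G' i) x = 0}.
  apply: fundamental_lemma => [|phi tphi]; first exact: L2B.
  rewrite ipBl//; last exact: test_L2.
  by apply/eqP; rewrite subr_eq0 -eqr_opp -h// -h'.
by apply: filterS => x /eqP; rewrite subr_eq0 => /eqP.
Qed.

Lemma weak_gradD u v G G' : L2 u -> L2 v -> weak_grad u G -> weak_grad v G' ->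
  weak_grad (u + v) (fun i => G i + G' i).
Proof.
move=> Lu Lv uG vG' i; have [LG h] := uG i; have [LG' h'] := vG' i.
split=> [|phi tphi]; first exact: L2D.
have Lp := test_L2 tphi; have Ldp := test_partial_L2 i tphi.
by rewrite !ipDl// h// h'// opprD.
Qed.

Lemma weak_gradZ (a : R) u G : L2 u -> weak_grad u G ->
  weak_grad (a *: u) (fun i => a *: G i).
Proof.
move=> Lu uG i; have [LG h] := uG i; split=> [|phi tphi]; first exact: L2Z.
have Lp := test_L2 tphi; have Ldp := test_partial_L2 i tphi.
by rewrite !ipZl// h// mulrN.
Qed.

Lemma weak_grad_ae u u' G : L2 u -> L2 u' -> {ae m, forall x, u x = u' x} ->
  weak_grad u G -> weak_grad u' G.
Proof.
move=> Lu Lu' uu' uG i; have [LG h] := uG i; split=> // phi tphi.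
by rewrite -h//; apply: ip_aeql => //; [exact: test_partial_L2|by apply: filterS uu' => x ->].
Qed.

Lemma H1D u v : H1 u -> H1 v -> H1 (u + v).
Proof.
move=> [Lu [G uG]] [Lv [G' vG']]; split; first exact: L2D.
by eexists; exact: (weak_gradD Lu Lv uG vG').
Qed.

Lemma H1Z (a : R) u : H1 u -> H1 (a *: u).
Proof.
move=> [Lu [G uG]]; split; first exact: L2Z.
by eexists; exact: (weak_gradZ a Lu uG).
Qed.

Lemma H1_0 : H1 0.
Proof.
split; first exact: L2_0.
exists (fun=> 0) => i; split=> [|phi tphi]; first exact: L2_0.
by rewrite !ip0l oppr0.
Qed.

Lemma H1_ae u u' : H1 u -> L2 u' -> {ae m, forall x, u x = u' x} -> H1 u'.
Proof.
move=> [Lu [G uG]] Lu' uu'; split => //; exists G.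
exact: (weak_grad_ae Lu Lu' uu' uG).
Qed.

(** [grad] is obtained by choice; up to null sets it may be replaced by any weak
    gradient, which is how sums and multiples are computed. *)
Lemma dformE u v G G' : H1 u -> H1 v -> weak_grad u G -> weak_grad v G' ->
  dform u v = \sum_(i < N) ip (G i) (G' i).
Proof.
move=> Hu Hv uG vG'; apply: eq_bigr => i _.
have gu := weak_grad_unique (weak_grad_grad Hu) uG i.
have gv := weak_grad_unique (weak_grad_grad Hv) vG' i.
have [LG _] := uG i; have [LG' _] := vG' i.
rewrite (ip_aeql _ LG _ gu); [|exact: grad_L2..].
by rewrite (ip_aeqr _ LG' _ gv)//; exact: grad_L2.
Qed.

Lemma dformC u v : dform u v = dform v u.
Proof. by apply: eq_bigr => i _; exact: ipC. Qed.

Lemma dformDl u v w : H1 u -> H1 v -> H1 w -> dform (u + v) w = dform u w + dform v w.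
Proof.
move=> Hu Hv Hw.
rewrite (dformE (H1D Hu Hv) Hw (weak_gradD (H1_L2 Hu) (H1_L2 Hv)
  (weak_grad_grad Hu) (weak_grad_grad Hv)) (weak_grad_grad Hw)).
by rewrite -big_split; apply: eq_bigr => i _; apply: ipDl; exact: grad_L2.
Qed.

Lemma dformZl (a : R) u w : H1 u -> H1 w -> dform (a *: u) w = a * dform u w.
Proof.
move=> Hu Hw.
rewrite (dformE (H1Z a Hu) Hw (weak_gradZ a (H1_L2 Hu) (weak_grad_grad Hu)) (weak_grad_grad Hw)).
by rewrite mulr_sumr; apply: eq_bigr => i _; apply: ipZl; exact: grad_L2.
Qed.

Lemma dform_ge0 u : 0 <= dform u u.
Proof. by apply: sumr_ge0 => i _; exact: ip_ge0. Qed.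

Lemma dform_aeq u u' v : H1 u -> L2 u' -> {ae m, forall x, u x = u' x} -> H1 v ->
  dform u v = dform u' v.
Proof.
move=> Hu Lu' uu' Hv; have Hu' := H1_ae Hu Lu' uu'.
rewrite (dformE Hu' Hv _ (weak_grad_grad Hv) (G := grad u))//.
exact: (weak_grad_ae (H1_L2 Hu) Lu' uu' (weak_grad_grad Hu)).
Qed.

(** The form [E_b] of the theory of Dirichlet forms; for b > 0 it makes the form
    domains complete. *)
Definition dformb (b : R) u v := dform u v + b * ip u v.

Lemma dformb1 u v : dformb 1 u v = dform1 u v.
Proof. by rewrite /dformb mul1r. Qed.

Lemma H1_semi_inner (b : R) : 0 <= b -> semi_inner H1 (dformb b).
Proof.
move=> b0; split; [exact: H1_0|exact: H1D|exact: H1Z| | | |].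
- by move=> u v _ _; rewrite /dformb dformC ipC.
- move=> u v w Hu Hv Hw.
  have h1 := dformDl Hu Hv Hw.
  have h2 := ipDl (H1_L2 Hu) (H1_L2 Hv) (H1_L2 Hw).
  by rewrite /dformb h1 h2 mulrDr addrACA.
- move=> a u w Hu Hw.
  have h1 := dformZl a Hu Hw; have h2 := ipZl a (H1_L2 Hu) (H1_L2 Hw).
  by rewrite /dformb h1 h2 mulrDr mulrCA.
- by move=> u _; rewrite /dformb addr_ge0 ?dform_ge0// mulr_ge0// ip_ge0.
Qed.

Lemma dform_semi_inner : semi_inner H1 dform.
Proof.
split; [exact: H1_0|exact: H1D|exact: H1Z| | | |].
- by move=> u v _ _; exact: dformC.
- exact: dformDl.
- by move=> *; exact: dformZl.
- by move=> u _; exact: dform_ge0.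
Qed.

Lemma gradB u v i : H1 u -> H1 v ->
  {ae m, forall x, grad (u - v) i x = (grad u i - grad v i) x}.
Proof.
move=> Hu Hv.
have HNv : H1 (- v) by rewrite -scaleN1r; exact: H1Z.
have wN : weak_grad (- v) (fun i => - grad v i).
  rewrite (_ : (fun i => _) = fun i => -1 *: grad v i).
    by rewrite -scaleN1r; apply: weak_gradZ (weak_grad_grad Hv); exact: H1_L2.
  by apply/funext => j; rewrite scaleN1r.
have w := weak_gradD (H1_L2 Hu) (H1_L2 HNv) (weak_grad_grad Hu) wN.
exact: (weak_grad_unique (weak_grad_grad (H1D Hu HNv)) w i).
Qed.

Lemma ip_gradB_le u v i : H1 u -> H1 v ->
  ip (grad u i - grad v i) (grad u i - grad v i) <= dform (u - v) (u - v).
Proof.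
move=> Hu Hv; have HB : H1 (u - v).
  by apply: H1D => //; rewrite -scaleN1r; exact: H1Z.
have Lg := L2B (grad_L2 i Hu) (grad_L2 i Hv).
have gE := gradB i Hu Hv; have Lg' := grad_L2 i HB.
rewrite -(ip_aeql Lg' Lg Lg gE) -(ip_aeqr Lg' Lg Lg' gE).
rewrite /Defs.dform (bigD1 i)//= lerDl sumr_ge0// => j _; exact: ip_ge0.
Qed.

(** Riesz-Fischer for the functions and for each partial derivative; the identity
    defining weak gradients passes to the limit. *)
Lemma H1_complete (b : R) : 0 < b -> qcomplete H1 (dformb b).
Proof.
move=> b0 u Hu cu.
have DB := H1_semi_inner (ltW b0).
have HB i j : H1 (u i - u j) by exact: (siB DB).
have [f Lf uf] : exists2 f, L2 f & qcvg ip u f.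
  apply: L2_complete => [n|e e0]; first exact: H1_L2.
  have [n0 h] := cu _ (mulr_gt0 b0 e0).
  exists n0 => i j hi hj; have := h i j hi hj; rewrite /dformb => hij.
  by rewrite -(ltr_pM2l b0); apply: le_lt_trans hij; rewrite lerDr dform_ge0.
have gc (i : 'I_N) : exists2 g, L2 g & qcvg ip (fun n => grad (u n) i) g.
  apply: L2_complete => [n|e e0]; first exact: grad_L2.
  have [n0 h] := cu _ e0; exists n0 => j k hj hk.
  apply: le_lt_trans (ip_gradB_le i (Hu j) (Hu k)) _.
  apply: le_lt_trans (h j k hj hk); rewrite /dformb lerDl.
  by rewrite mulr_ge0 ?ip_ge0// ltW.
pose G i := sval (cid2 (gc i)).
have LG i : L2 (G i) by rewrite /G; case: cid2.
have uG i : qcvg ip (fun n => grad (u n) i) (G i) by rewrite /G; case: cid2.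
have wG : weak_grad f G.
  move=> i; split => // phi tphi.
  have Lp := test_L2 tphi; have Ldp := test_partial_L2 i tphi.
  have c1 := qcvg_cvg (L2_semi_inner Omega) (fun n => H1_L2 (Hu n)) Lf Ldp uf.
  have c2 := qcvg_cvg (L2_semi_inner Omega) (fun n => grad_L2 i (Hu n)) (LG i) Lp (uG i).
  move: c1; rewrite (_ : (fun n => _) = fun n => - ip (grad (u n) i) phi).
    move=> c1; apply: (cvg_unique _ c1); [exact: norm_hausdorff|exact: cvgN].
  by apply/funext => n; have [_ ->] := weak_grad_grad (Hu n) i.
have Hf : H1 f by split => //; exists G.
exists f => // e e0.
pose d := e / (N.+1%:R * (1 + b)).
have K0 : 0 < N.+1%:R * (1 + b) by rewrite mulr_gt0// ltr_wpDl.
have d0 : 0 < d by rewrite divr_gt0.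
have [n0 hn0] := uf _ d0.
have nn i : exists n0, forall n, (n0 <= n)%N ->
    ip (grad (u n) i - G i) (grad (u n) i - G i) < d by exact: uG.
pose n1 := (\max_(i < N) sval (cid (nn i)))%N.
exists (maxn n0 n1) => n; rewrite geq_max => /andP[/hn0 h0 hn1].
have hG i : ip (grad (u n) i - G i) (grad (u n) i - G i) < d.
  apply: (svalP (cid (nn i))); apply: leq_trans hn1.
  exact: (leq_bigmax (F := fun i => sval (cid (nn i)))).
have HNf : H1 (- f) by rewrite -scaleN1r; exact: H1Z.
have wN : weak_grad (- f) (fun i => - G i).
  rewrite (_ : (fun i => _) = fun i => -1 *: G i).
    by rewrite -scaleN1r; exact: weak_gradZ.
  by apply/funext => j; rewrite scaleN1r.
have w := weak_gradD (H1_L2 (Hu n)) (H1_L2 HNf) (weak_grad_grad (Hu n)) wN.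
have Hd := H1D (Hu n) HNf.
rewrite /dformb (dformE Hd Hd w w).
apply: (@le_lt_trans _ _ (N%:R * d + b * d)).
  apply: lerD; last by rewrite ler_pM2l// ltW.
  apply: (@le_trans _ _ (\sum_(i < N) d)).
    by apply: ler_sum => i _; exact/ltW/hG.
  by rewrite sumr_const card_ord mulr_natl.
rewrite -mulrDl /d mulrA ltr_pdivrMr// mulrC ltr_pM2l// -natr1.
have : 0 <= N%:R * b by rewrite mulr_ge0// ltW.
rewrite mulrDl mul1r mulrDr mulr1; lra.
Qed.

Section closure.
Variable C : set (E -> R).
Hypotheses (C0 : C 0) (CD : forall u v, C u -> C v -> C (u + v))
  (CZ : forall (a : R) u, C u -> C (a *: u)).
Local Notation D := (H1_closure Omega C).

Lemma H1_closure_H1 : D `<=` H1. Proof. by move=> u []. Qed.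

Lemma H1_closure_L2 u : D u -> L2 u.
Proof. by move=> /H1_closure_H1/H1_L2. Qed.

Lemma sub_H1_closure u : H1 u -> C u -> D u.
Proof.
move=> Hu Cu; split => // e e0; exists u; split => //.
have D1 := H1_semi_inner ler01.
rewrite (_ : u \- u = 0); last by apply/funext => x /=; rewrite subrr.
by rewrite -dformb1 (si0l D1)//; exact: H1_0.
Qed.

Lemma H1_closureD u v : D u -> D v -> D (u + v).
Proof.
move=> [Hu hu] [Hv hv]; split; first exact: H1D.
move=> e e0; have e4 : 0 < e / 4 by rewrite divr_gt0.
have [u' [Hu' Cu' hu']] := hu _ e4; have [v' [Hv' Cv' hv']] := hv _ e4.
exists (u' + v'); split; [exact: H1D|exact: CD|].
have D1 := H1_semi_inner ler01.
rewrite (_ : (u' + v') \- (u + v) = (u' - u) + (v' - v)).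
  rewrite -dformb1; apply: le_lt_trans (si_sqrD D1 (siB D1 Hu' Hu) (siB D1 Hv' Hv)) _.
  move: hu' hv'; rewrite -!dformb1.
  rewrite -[u' \- u]/(u' - u) -[v' \- v]/(v' - v).
  by move: (dformb _ _ _) (dformb _ _ _) => a b; lra.
by apply/funext => x /=; rewrite opprD addrACA.
Qed.

Lemma H1_closureZ (a : R) u : D u -> D (a *: u).
Proof.
move=> [Hu hu]; split; first exact: H1Z.
move=> e e0; have a0 : 0 < a ^+ 2 + 1 by rewrite ltr_wpDl// sqr_ge0.
have [u' [Hu' Cu' hu']] := hu _ (divr_gt0 e0 a0).
exists (a *: u'); split; [exact: H1Z|exact: CZ|].
have D1 := H1_semi_inner ler01.
rewrite (_ : _ \- _ = a *: (u' - u)); last first.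
  by apply/funext => x /=; rewrite -[RHS]/(a * (u' x - u x)) mulrBr.
have Hd := siB D1 Hu' Hu.
rewrite -dformb1 (siZZ D1)//; move: hu'; rewrite -dformb1 ltr_pdivlMr//.
rewrite -[u' \- u]/(u' - u); have := si_ge0 D1 Hd.
by rewrite mulrC mulrDl mul1r; move: (dformb _ _ _) => x; move: (a ^+ 2 * x) => y; lra.
Qed.

Lemma H1_closure_semi_inner (b : R) : 0 <= b -> semi_inner D (dformb b).
Proof.
move=> b0; have [_ _ _ h1 h2 h3 h4] := H1_semi_inner b0.
split.
- by apply: sub_H1_closure => //; exact: H1_0.
- exact: H1_closureD.
- exact: H1_closureZ.
- by move=> u v /H1_closure_H1 Hu /H1_closure_H1 Hv; exact: h1.
- by move=> u v w /H1_closure_H1 Hu /H1_closure_H1 Hv /H1_closure_H1 Hw; exact: h2.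
- by move=> a u v /H1_closure_H1 Hu /H1_closure_H1 Hv; exact: h3.
- by move=> u /H1_closure_H1 Hu; exact: h4.
Qed.

(** The norms for different b > 0 are equivalent, the constant being [1 + b^-1]. *)
Lemma H1_closure_closed (b : R) : 0 < b -> qclosed H1 (dformb b) D.
Proof.
move=> b0 x Hx hx; split => // e e0.
have D1 := H1_semi_inner ler01.
pose K := 4 * (1 + b^-1); have bV : 0 < b^-1 by rewrite invr_gt0.
have K0 : 0 < K by rewrite /K; lra.
have [y [Hy hy] yx] := hx _ (divr_gt0 e0 K0).
have e4 : 0 < e / 4 by rewrite divr_gt0.
have [v [Hv Cv vy]] := hy _ e4.
exists v; split => //.
rewrite -dformb1 (_ : v \- x = (v - y) + (y - x)); last first.
  by apply/funext => z /=; rewrite -[RHS]/((v z - y z) + (y z - x z)); ring.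
apply: le_lt_trans (si_sqrD D1 (siB D1 Hv Hy) (siB D1 Hy Hx)) _.
have h : dformb 1 (y - x) (y - x) <= (1 + b^-1) * dformb b (y - x) (y - x).
  rewrite /dformb mul1r mulrDl mul1r [b^-1 * _]mulrDr mulrA mulVf ?gt_eqF// mul1r.
  have := dform_ge0 (y - x); have := ip_ge0 Omega (y - x).
  move=> i0 d0; have := mulr_ge0 (ltW bV) d0; have := mulr_ge0 (ltW b0) i0.
  by move: (b * _) (b^-1 * _) => p q; lra.
move: yx; rewrite /K ltr_pdivlMr// => yx.
move: vy; rewrite -dformb1 -[v \- y]/(v - y).
move: h yx; rewrite mulrCA [X in _ <= X]mulrC.
by move: (dformb 1 _ _) (dformb 1 _ _) (dformb b _ _ * _) => p q r; lra.
Qed.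

Lemma H1_closure_complete (b : R) : 0 < b -> qcomplete D (dformb b).
Proof.
move=> b0; apply: (qclosed_complete (H1_complete b0) H1_closure_H1).
exact: H1_closure_closed.
Qed.

Lemma H1_closure_ae u u' : D u -> L2 u' -> {ae m, forall x, u x = u' x} -> D u'.
Proof.
move=> [Hu hu] Lu' uu'; have Hu' := H1_ae Hu Lu' uu'; split => // e e0.
have [v [Hv Cv vu]] := hu _ e0; exists v; split => //.
have D1 := H1_semi_inner ler01.
have Hd := siB D1 Hv Hu; have Hd' := siB D1 Hv Hu'.
have h : {ae m, forall x, (v - u) x = (v - u') x}.
  by apply: filterS uu' => x ux; rewrite -[LHS]/(v x - u x) ux.
move: vu; rewrite -[v \- u]/(v - u) -[v \- u']/(v - u') /Defs.dform1.
rewrite (dform_aeq Hd (H1_L2 Hd') h Hd) dformC (dform_aeq Hd (H1_L2 Hd') h Hd').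
by rewrite (ip_aeql (H1_L2 Hd) (H1_L2 Hd') (H1_L2 Hd) h)
  (ip_aeqr (H1_L2 Hd) (H1_L2 Hd') (H1_L2 Hd') h).
Qed.

(** Bounded energy and convergence in L^2 suffice to stay in the form domain: the
    elements of least norm in shrinking L^2-balls around the limit form a Cauchy
    sequence for the form norm. *)
Lemma H1_closure_of_bounded w (M : R) : L2 w ->
  (forall e : R, 0 < e -> exists2 x, D x & dform x x <= M /\
     ip (x - w) (x - w) < e) ->
  D w /\ dform w w <= M.
Proof.
move=> Lw hw.
have DB := H1_closure_semi_inner ler01.
have cD := H1_closure_complete ltr01.
have LB := L2_semi_inner Omega.
have LD x : D x -> L2 x by exact: H1_closure_L2.
pose r n : R := n.+1%:R^-1.
have r0 n : 0 < r n by rewrite invr_gt0.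
pose Cn n : set (E -> R) := [set x | D x /\ ip (x - w) (x - w) <= r n].
have CnS n k : (n <= k)%N -> Cn k `<=` Cn n.
  move=> nk x [Dx h]; split => //; apply: le_trans h _.
  by rewrite /r lef_pV2 ?posrE// ler_nat.
have y_ n : exists2 y, Cn n y & dform y y <= M.
  by have [y Dy [yM yr]] := hw _ (r0 n); exists y => //; split => //; exact: ltW.
(* convexity and closedness of the L^2-ball of square radius r n inside D *)
have min n : exists2 x, Cn n x & forall y, Cn n y -> 0 <= dformb 1 x (y - x).
  apply: (@si_minimizer _ _ D (dformb 1) DB (Cn n) (fun=> 0) 0) => //.
  - by move=> x [].
  - by have [y Cy _] := y_ n; exists y.
  - move=> t x y t0 t1 [Dx hx] [Dy hy]; split.
      by apply: (siD DB) => //; apply: (siZ DB); exact: (siB DB).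
    have Lx := LD _ Dx; have Ly := LD _ Dy.
    have Lxw := L2B Lx Lw; have Lyw := L2B Ly Lw.
    rewrite (_ : x + t *: (y - x) - w = (1 - t) *: (x - w) + t *: (y - w)).
      rewrite (siDD LB); [|exact: L2Z..].
      rewrite !(siZZ LB)// (siZl LB) ?(siZr LB)//; [|exact: L2Z].
      have := si_sqrB LB Lxw Lyw; have := si_ge0 LB (siB LB Lxw Lyw).
      rewrite (siBB LB)// => h1 _.
      have t1' : 0 <= 1 - t by rewrite subr_ge0.
      have h2 := mulr_ge0 (mulr_ge0 t0 t1') h1.
      have h3 := ler_wpM2l t0 hy; have h4 := ler_wpM2l t1' hx.
      move: h2 h3 h4; move: (ip (x - w) (x - w)) (ip (x - w) (y - w)) (ip (y - w) (y - w)) (r n) => a b c d.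
      rewrite (_ : t * (1 - t) * (a - 2 * b + c) =
        (1 - t) * a + t * c - ((1 - t) ^+ 2 * a + 2 * ((1 - t) * (t * b)) + t ^+ 2 * c)); last by ring.
      by move: ((1 - t) ^+ 2 * a + _ + _) => s; move: (t * c) ((1 - t) * a) => p q *; lra.
    apply/funext => z.
    rewrite -[LHS]/(x z + t * (y z - x z) - w z).
    by rewrite -[RHS]/((1 - t) * (x z - w z) + t * (y z - w z)); ring.
  - move=> x Dx hx; split => //.
    rewrite leNgt; apply/negP => rx.
    pose e := ip (x - w) (x - w) - r n.
    have Lx := LD _ Dx; have Lxw := L2B Lx Lw.
    have a0 : 0 < ip (x - w) (x - w) by exact: lt_trans rx.
    pose k := e / (2 * ip (x - w) (x - w)).
    have e0 : 0 < e by rewrite subr_gt0.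
    have k0 : 0 < k by rewrite divr_gt0// mulr_gt0.
    have d0 : 0 < k * e / 4 by rewrite divr_gt0// mulr_gt0.
    have [y [Dy hy] yx] := hx _ d0.
    have Ly := LD _ Dy; have Lyx := L2B Ly Lx.
    have iyx : ip (y - x) (y - x) < k * e / 4.
      by apply: le_lt_trans yx; rewrite /dformb mul1r lerDr dform_ge0.
    have E1 : ip (y - w) (y - w) = ip (y - x) (y - x) + 2 * ip (y - x) (x - w) + ip (x - w) (x - w).
      by rewrite -(siDD LB)// addrA subrK.
    have k0' : 0 < k^-1 by rewrite invr_gt0.
    have := young_of_sqr_le (ip_ge0 Omega (y - x)) (ltW a0) k0'
      (s := - ip (y - x) (x - w)).
    rewrite sqrrN => /(_ (si_cauchy_schwarz LB Lyx Lxw)); rewrite invrK => h.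
    have h1 : k^-1 * ip (y - x) (y - x) < e / 4.
      by rewrite ltr_pdivrMl// mulrA.
    have h2 : ip (x - w) (x - w) * k = e / 2.
      by rewrite /k; field; rewrite gt_eqF.
    rewrite h2 in h.
    have h3 := ip_ge0 Omega (y - x).
    move: h h1 hy E1 h3 e0; rewrite /e.
    move: (ip (y - x) (y - x)) (ip (y - x) (x - w)) (ip (x - w) (x - w)) (ip (y - w) (y - w)) (r n) (k^-1 * _).
    by clear => *; lra.
  - by move=> *; rewrite addr0.
  - by move=> *; rewrite mulr0.
  - by move=> *; rewrite expr0n mulr0.
pose x_ n := sval (cid2 (min n)).
have Cx n : Cn n (x_ n) by rewrite /x_; case: cid2.
have xmin n y : Cn n y -> 0 <= dformb 1 (x_ n) (y - x_ n).
  by rewrite /x_; case: cid2 => ? ? /=; apply.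
have Dx n : D (x_ n) by have [] := Cx n.
pose b n := dformb 1 (x_ n) (x_ n).
(* the variational inequality says that x_ n is the projection of 0 to [Cn n] *)
have bmin n y : Cn n y -> b n + dformb 1 (y - x_ n) (y - x_ n) <= dformb 1 y y.
  move=> Cy; have [Dy _] := Cy; have := xmin _ _ Cy.
  rewrite (siBr DB)// subr_ge0 => h.
  by rewrite (siBB DB)// (siC DB Dy (Dx n)) -/(b n); move: h; rewrite -/(b n); lra.
have K0 := ip_ge0 Omega w; set K := ip w w in K0.
(* comparison with an element of energy at most M; the weight a of Young's
   inequality is sent to 0 at the end to get the sharp bound *)
have bub n (a : R) : 0 < a -> b n <= M + K + r n + a^-1 * r n + a * K.
  move=> a0; have [y [Dy hy] yM] := y_ n; have Ly := LD _ Dy; have Lyw := L2B Ly Lw.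
  have a0' : 0 < a^-1 by rewrite invr_gt0.
  have := bmin n y (conj Dy hy); rewrite [X in _ <= X]/dformb mul1r.
  have := si_ge0 DB (siB DB Dy (Dx n)).
  have -> : ip y y = ip (y - w) (y - w) + 2 * ip (y - w) w + K.
    by rewrite -(siDD LB)// subrK.
  have := young_of_sqr_le (ip_ge0 Omega (y - w)) K0 a0' (si_cauchy_schwarz LB Lyw Lw).
  rewrite invrK [K * a]mulrC; have := ler_wpM2l (ltW a0') hy; move: hy yM.
  by move: (dformb _ _ _) (ip (y - w) (y - w)) (ip (y - w) w) (a^-1 * _) (a^-1 * _) (a * K) (dform _ _) => *; lra.
(* the [Cn n] decrease, so the least norms b n increase; being bounded, they are
   Cauchy *)
have bnd n k : (n <= k)%N -> dformb 1 (x_ k - x_ n) (x_ k - x_ n) <= b k - b n.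
  by move=> nk; have := bmin n _ (CnS _ _ nk _ (Cx k)); rewrite -/(b k); lra.
have hS : has_sup (range b).
  split; first by exists (b 0%N); exists 0%N.
  exists (M + K + 1 + 1 + K) => _ [n _ <-]; apply: le_trans (bub n 1 ltr01) _.
  rewrite invr1 !mul1r; have : r n <= 1 by rewrite invf_le1// ler1n.
  by move: (r n) => q; lra.
have bS n : b n <= sup (range b) by apply: sup_upper_bound => //; exists n.
have cx : qcauchy (dformb 1) x_.
  move=> e e0; have e4 : 0 < e / 4 by rewrite divr_gt0.
  have [_ [n0 _ <-] bn0] := sup_adherent e4 hS.
  exists n0 => i j hi hj.
  rewrite (_ : x_ i - x_ j = (x_ i - x_ n0) - (x_ j - x_ n0)); last first.
    by rewrite opprB addrA subrK.
  apply: le_lt_trans (si_sqrB DB (siB DB (Dx i) (Dx n0)) (siB DB (Dx j) (Dx n0))) _.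
  have := bnd _ _ hi; have := bnd _ _ hj; have := bS i; have := bS j; move: bn0.
  by move: (dformb 1 (x_ i - x_ n0) _) (dformb 1 (x_ j - x_ n0) _) (sup _) (b i) (b j) (b n0) => *; lra.
have [x DxL xx] := cD _ Dx cx.
have Lx := LD _ DxL; have Lxw := L2B Lx Lw.
have rsmall (e : R) : 0 < e -> exists n0, forall n, (n0 <= n)%N -> r n < e.
  by move=> e0; have [k _ ke] := near_infty_natSinv_lt (PosNum e0); exists k.
have xw0 : ip (x - w) (x - w) = 0.
  apply/eqP; rewrite eq_le ip_ge0 andbT; apply/ler_addgt0Pr => e e0.
  have e4 : 0 < e / 4 by rewrite divr_gt0.
  have [n0 h0] := xx _ e4; have [n1 h1] := rsmall _ e4.
  pose n := maxn n0 n1; have {h0}h0 := h0 n (leq_maxl _ _).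
  have {h1}h1 := h1 n (leq_maxr _ _).
  have [_ hn] := Cx n; have Ln := LD _ (Dx n).
  rewrite (_ : x - w = (x_ n - w) - (x_ n - x)); last first.
    apply/funext => z; rewrite -[RHS]/((x_ n z - w z) - (x_ n z - x z)).
    by rewrite -[LHS]/(x z - w z); ring.
  apply: le_trans (si_sqrB LB (L2B Ln Lw) (L2B Ln Lx)) _.
  have : ip (x_ n - x) (x_ n - x) <= dformb 1 (x_ n - x) (x_ n - x).
    by rewrite /dformb mul1r lerDr dform_ge0.
  move: h0 h1 hn; move: (dformb _ _ _) (ip _ _) (ip _ _) (r n) => *; lra.
have xw : {ae m, forall z, x z = w z}.
  have := ip_eq0 Lxw xw0; apply: filterS => z h.
  by apply/eqP; rewrite -subr_eq0; apply/eqP.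
have Dw : D w by exact: H1_closure_ae xw.
split => //.
have Hx := H1_closure_H1 DxL; have Hw := H1_closure_H1 Dw.
have dE : dformb 1 x x = dform w w + K.
  rewrite /dformb mul1r (dform_aeq Hx Lw xw Hx) dformC (dform_aeq Hx Lw xw Hw).
  by rewrite (ip_aeql Lx Lw Lx xw) (ip_aeqr Lx Lw Lw xw).
suff : dform w w + K <= M + K by rewrite lerD2r.
rewrite -dE; apply/ler_addgt0Pr => e e0.
have K4 : 0 < K + 4 by rewrite ltr_wpDl.
pose a := Num.min 1 (e / (K + 4)).
have a0 : 0 < a by rewrite lt_min ltr01 divr_gt0.
have a1 : a <= 1 by rewrite ge_min lexx.
have aK : a * (K + 4) <= e.
  by rewrite -ler_pdivlMr// ge_min lexx orbT.
have [n1 h1] := rsmall _ (exprn_gt0 2 a0).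
have c := qcvg_cvg DB Dx DxL DxL xx.
have [n0 _ h0] := (cvgrPdist_lt _ _).1 c a a0.
pose n := maxn n0 n1; have {h0}/ltr_normlP[_ h0] := h0 n (leq_maxl _ _).
have {h1}h1 := h1 n (leq_maxr _ _).
have h2 := bub n a a0.
have h3 : a^-1 * r n <= a by rewrite ler_pdivrMl// -expr2 ltW.
have h4 : r n <= a.
  by apply: le_trans (ltW h1) _; rewrite expr2 ger_pMr.
have h5 := si_ge0 DB (siB DB (Dx n) DxL).
rewrite (siBB DB)// -/(b n) in h5.
have {}aK : a * K + a * 4 <= e by rewrite -mulrDr.
move: h0 h2 h3 h4 h5 aK a0 => /=.
by move: (dformb 1 x x) (dformb 1 (x_ n) x) (b n) (a^-1 * r n) (r n) (a * K) => *; lra.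
Qed.

End closure.

End sobolev.

(** * Regularization by convolution *)

Section lebesgue_translation.
Context {R : realType}.

Lemma lebesgue_open_box n (lo hi : 'I_n -> R) :
  lebesgue_rV R n (open_box lo hi) = (\prod_(i < n) Num.max 0 (hi i - lo i))%:E.
Proof.
elim: n => [|n ih] in lo hi *.
  rewrite big_ord0 /= diracE mem_set//; by case.
rewrite /= /lebesgue_step /pushforward.
rewrite (_ : _ @^-1` _ = `]lo ord0, hi ord0[%classic `*`
    open_box (fun i => lo (lift ord0 i)) (fun i => hi (lift ord0 i))).
  rewrite product_measure1E//; last exact: open_box_measurable.
  rewrite big_ord_recl EFinM -ih; congr (_ * _)%E.
  have := @lebesgue_measure_itv R `]lo ord0, hi ord0[; rewrite /= => ->.
  rewrite lte_fin; case: ifPn => lh.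
    by rewrite -EFinB max_r// subr_ge0 ltW.
  by rewrite max_l// subr_le0 leNgt.
apply/seteqP; split => [[x v] /= xv|[x v] /= [xl vl] i].
  split; first by have := xv ord0; rewrite mxE unlift_none in_itv.
  by move=> i; have := xv (lift ord0 i); rewrite mxE liftK.
rewrite mxE; case: unliftP => [j ->|->] /=; first exact: vl.
by move: xl; rewrite in_itv.
Qed.

Lemma measurable_shift_rV n (x : 'rV[R]_n) :
  measurable_fun setT (fun y : 'rV[R]_n => y + x).
Proof.
apply: measurable_fun_rV => i.
under eq_fun do rewrite mxE.
by apply: measurable_funD => //; exact: measurable_coord.
Qed.

Definition shift_rV n (x y : 'rV[R]_n) : 'rV[R]_n := y + x.

HB.instance Definition _ n (x : 'rV[R]_n) :=
  isMeasurableFun.Build _ _ _ _ (shift_rV x) (measurable_shift_rV x).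

(** Both measures give boxes the product of their side lengths. *)
Lemma lebesgue_shift n (x : 'rV[R]_n) (A : set 'rV[R]_n) : measurable A ->
  pushforward (lebesgue_rV R n) (shift_rV x) A = lebesgue_rV R n A.
Proof.
move=> mA; pose g k : set 'rV[R]_n := open_box (fun=> - k%:R) (fun=> k%:R).
apply/esym; apply: (@measure_unique _ R _ (@boxes R n) g _ _ _ _
  (lebesgue_rV R n) (pushforward (lebesgue_rV R n) (shift_rV x))) => //.
- apply/seteqP; split => [B mB|B]; first exact: boxes_generate.
  apply: smallest_sub; first exact: sigma_algebra_measurable.
  by move=> _ [lo [hi ->]]; exact: open_box_measurable.
- exact: boxes_setI.
- by move=> k; exists (fun=> - k%:R), (fun=> k%:R).
- apply/seteqP; split => // y _.
  pose k := (\max_(j < n) (Num.truncn `|y ord0 j|).+1)%N.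
  exists k => // j; rewrite -ltr_norml.
  apply: lt_le_trans (truncnS_gt _) _; rewrite ler_nat.
  exact: (leq_bigmax (F := fun j => (Num.truncn `|y ord0 j|).+1)).
- move=> _ [lo [hi ->]]; rewrite /= /pushforward.
  rewrite (_ : _ @^-1` _ = open_box (fun i => lo i - x 0 i) (fun i => hi i - x 0 i)).
    rewrite !lebesgue_open_box; congr EFin; apply: eq_bigr => i _.
    by congr (Num.max 0 _); ring.
  apply/seteqP; split => y yb i; have := yb i; rewrite /shift_rV mxE.
    by rewrite ltrBlDr ltrBrDr.
  by rewrite ltrBlDr ltrBrDr.
- by move=> k; apply: le_lt_trans (lebesgue_closed_box (fun=> - k%:R) (fun=> k%:R));
    apply: le_measure; rewrite ?inE; [exact: open_box_measurable|apply: closed_rV_measurable; exact: closed_closed_box|exact: sub_open_closed_box].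
Qed.

Lemma ge0_integral_shift n (x : 'rV[R]_n) (f : 'rV[R]_n -> \bar R) :
  measurable_fun setT f -> (forall y, 0 <= f y)%E ->
  (\int[lebesgue_rV R n]_y f (y + x)%R = \int[lebesgue_rV R n]_y f y)%E.
Proof.
move=> mf f0.
have := @ge0_integral_pushforward _ _ _ _ R (shift_rV x) (measurable_shift_rV x)
  (lebesgue_rV R n) setT f measurableT mf (fun y _ => f0 y).
rewrite preimage_setT => <-.
apply: eq_measure_integral => A mA _; exact: lebesgue_shift.
Qed.

End lebesgue_translation.

Section mollifier.
Context {R : realType} {N : nat} (Omega : domain R N).
Local Notation E := 'rV[R]_N.
Local Notation L2 := (L2 Omega).
Local Notation ip := (ip Omega).
Local Notation m := (m Omega).
Local Notation leb := (lebesgue_rV R N).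
Local Notation Om := (Omega : set E).
Implicit Types (f g k : E -> R) (x y : E) (e : R).

Lemma ge0_integral_m (f : E -> \bar R) : measurable_fun setT f ->
  (forall x, 0 <= f x)%E ->
  (\int[m]_x f x = \int[leb]_x ((f \_ Om) x))%E.
Proof.
move=> mf f0; have mO := measurable_domain Omega.
have mC : measurable (~` Om) by exact: measurableC.
rewrite (ge0_negligible_integral mC measurableT mf (fun x _ => f0 x) (m_setC_domain Omega)).
rewrite setTD setCK -integral_mkcond; apply: eq_measure_integral => A mA AO.
by rewrite /= /mrestr setIidl.
Qed.

Lemma ge0_integral_m_le (f : E -> \bar R) : measurable_fun setT f ->
  (forall x, 0 <= f x)%E -> (\int[m]_x f x <= \int[leb]_x f x)%E.
Proof.
move=> mf f0; apply: ge0_le_measure_integral => // A mA.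
rewrite /= /mrestr; apply: le_measure; rewrite ?inE//.
by apply: measurableI => //; exact: measurable_domain.
Qed.

Definition kernel e : E -> R := box_bump 1 (fun=> - e) (fun=> e).

Lemma kernelC e x : kernel e (- x) = kernel e x.
Proof.
apply: eq_bigr => i _; rewrite !mxE mulrC.
by congr (flat _ _ * flat _ _); ring.
Qed.

Lemma kernel_sub e x : (fun y => kernel e (x - y)) =
  box_bump 1 (fun i => x 0 i - e) (fun i => x 0 i + e).
Proof.
apply/funext => y; rewrite -kernelC opprB; apply: eq_bigr => i _; rewrite !mxE.
by congr (flat _ _ * flat _ _); ring.
Qed.

Lemma smooth_kernel e : smooth (kernel e).
Proof. exact: smooth_box_bump. Qed.

Lemma kernel_ge0 e x : 0 <= kernel e x. Proof. exact: box_bump_ge0. Qed.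

Lemma kernel_le1 e x : kernel e x <= 1. Proof. exact: box_bump_le1. Qed.

Lemma kernel_eq0 e x : ~ (forall i, `|x 0 i| <= e) -> kernel e x = 0.
Proof.
move=> nx; apply: box_bump_eq0 => xb; apply: nx => i.
by rewrite ler_norml; exact: xb.
Qed.

Lemma measurable_kernel e : measurable_fun setT (kernel e).
Proof. by apply: continuous_rV_measurable; exact: (smooth_kernel e [::]).1. Qed.

Definition kernel_mass e : R := \int[leb]_x kernel e x.

(** The mass of the kernel is finite: it is at most the volume of a box. *)
Lemma kernel_massE e : (\int[leb]_x (kernel e x)%:E = (kernel_mass e)%:E)%E.
Proof.
rewrite /kernel_mass /Rintegral fineK// ge0_fin_numE; last first.
  by apply: integral_ge0 => x _; rewrite lee_fin kernel_ge0.
have mK : measurable (closed_box (fun=> - e) (fun=> e) : set E).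
  by apply: closed_rV_measurable; exact: closed_closed_box.
apply: (@le_lt_trans _ _ (\int[leb]_x (\1_(closed_box (fun=> - e) (fun=> e) : set E) x)%:E)%E).
  apply: ge0_le_integral => //.
  - by move=> x _; rewrite lee_fin kernel_ge0.
  - by apply/measurable_EFinP; exact: measurable_kernel.
  - by apply/measurable_EFinP.
  - move=> x _; rewrite lee_fin indicE.
    have [xK|xK] := pselect (closed_box (fun=> - e) (fun=> e) x).
      by rewrite mem_set// kernel_le1.
    by rewrite memNset// /kernel box_bump_eq0.
by rewrite integral_indic// setIT; exact: lebesgue_closed_box.
Qed.

Lemma kernel_mass_gt0 e : 0 < e -> 0 < kernel_mass e.
Proof.
move=> e0; rewrite lt_neqAle eq_sym; apply/andP; split; last first.
  by apply: Rintegral_ge0 => x _; exact: kernel_ge0.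
apply/eqP => m0.
have := kernel_massE e; rewrite m0.
rewrite -[LHS](_ : \int[leb]_x `|(kernel e x)%:E| = _)%E; last first.
  by apply: eq_integral => x _; rewrite gee0_abs// lee_fin kernel_ge0.
have mk : measurable_fun setT (fun x => (kernel e x)%:E).
  by apply/measurable_EFinP; exact: measurable_kernel.
move/(ae_eq_integral_abs leb measurableT mk) => [A [mA A0 hA]].
have : (leb (open_box (fun=> (- e)%R) (fun=> e)) <= leb A)%E.
  apply: le_measure; rewrite ?inE//; first exact: open_box_measurable.
  move=> x xb; apply: hA => /= /(_ Logic.I)[] h.
  by have := @box_bump_gt0 R N 1 _ _ x (leqnn _) xb; rewrite -/(kernel e) h ltxx.
rewrite A0 lebesgue_open_box lee_fin leNgt => /negP; apply.
by apply: prodr_gt0 => i _; rewrite lt_max opprK addr_gt0// orbT.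
Qed.

Lemma integral_kernel e x : (\int[leb]_y (kernel e (x - y)%R)%:E = (kernel_mass e)%:E)%E.
Proof.
rewrite -kernel_massE -[RHS](@ge0_integral_shift R N (- x)).
- by apply: eq_integral => y _; rewrite -kernelC opprB.
- by apply/measurable_EFinP; exact: measurable_kernel.
- by move=> y; rewrite lee_fin kernel_ge0.
Qed.

Lemma measurable_rV_sub : measurable_fun setT (fun p : E * E => p.1 - p.2).
Proof.
apply: measurable_fun_rV => i.
under eq_fun do rewrite !mxE.
apply: measurable_funB.
- exact: (measurableT_comp (@measurable_coord R N i) measurable_fst).
- exact: (measurableT_comp (@measurable_coord R N i) measurable_snd).
Qed.

Lemma kernel_section_L2 e x : L2 (fun y => kernel e (x - y)).
Proof.
rewrite kernel_sub; apply: (@L2_continuous_compact _ _ _ (closed_box (fun i => x 0 i - e) (fun i => x 0 i + e))).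
- exact: compact_closed_box.
- exact: (smooth_box_bump 1 _ _ [::]).1.
- by move=> y; exact: box_bump_eq0.
Qed.

(** Not normalized: [kernel_mass e] appears as a factor in all the estimates, and is
    divided out once. *)
Definition mollify e f : E -> R := fun x => ip (fun y => kernel e (x - y)) f.

Lemma mollifyE e f x : mollify e f x = ip (fun y => kernel e (x - y)) f.
Proof. by []. Qed.

Lemma mollifyB e f g : L2 f -> L2 g ->
  mollify e (f - g) = mollify e f - mollify e g.
Proof.
by move=> Lf Lg; apply/funext => x; rewrite /mollify ipBr//; exact: kernel_section_L2.
Qed.

(** Jensen's inequality for the probability measures of density
    [kernel e (x - y) / kernel_mass e] *)
Lemma mollify_sqr_le e f x : L2 f ->
  ((mollify e f x ^+ 2)%:E <= (kernel_mass e)%:E *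
     \int[m]_y (kernel e (x - y)%R * (f y * f y))%:E)%E.
Proof.
move=> Lf; pose s : E -> R := fun y => Num.sqrt (kernel e (x - y)).
have s2 y : s y * s y = kernel e (x - y).
  by rewrite -expr2 sqr_sqrtr// kernel_ge0.
have mk : measurable_fun setT (fun y => kernel e (x - y)).
  exact: L2_measurable (kernel_section_L2 e x).
have ms : measurable_fun setT s.
  apply: measurableT_comp mk; apply: continuous_measurable_fun; exact: sqrt_continuous.
have Ls : L2 s.
  have cK := @compact_closed_box R N (fun i => x 0 i - e) (fun i => x 0 i + e).
  apply: (@L2_bounded_compact _ _ Omega _ 1 s cK ms).
    move=> y; rewrite /s ger0_norm ?sqrtr_ge0// -sqrtr1 ler_wsqrtr//; exact: kernel_le1.
  move=> y yK; rewrite /s (_ : kernel e (x - y) = 0) ?sqrtr0//.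
  by have := congr1 (@^~ y) (kernel_sub e x) => /= ->; exact: box_bump_eq0.
have Lsf : L2 (s * f).
  apply: (@L2_dominated _ _ _ _ f _ Lf).
    apply: measurable_funM => //; exact: L2_measurable Lf.
  apply: aeW => y; rewrite normrM ler_piMl// /s ger0_norm ?sqrtr_ge0//.
  by rewrite -sqrtr1 ler_wsqrtr// kernel_le1.
(* Cauchy-Schwarz for [sqrt kernel] and [sqrt kernel * f] *)
have -> : mollify e f x = ip s (s * f).
  by apply: eq_Rintegral => y _; rewrite -[(s * f) y]/(s y * f y) mulrA s2.
have h := si_cauchy_schwarz (L2_semi_inner Omega) Ls Lsf.
rewrite -lee_fin in h; apply: (le_trans h); rewrite EFinM.
apply: lee_pmul; rewrite ?lee_fin ?ip_ge0//.
  rewrite -lee_fin -ip_EFin// -(integral_kernel e x).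
  under eq_integral do rewrite s2.
  apply: ge0_integral_m_le; first by apply/measurable_EFinP.
  by move=> y; rewrite lee_fin kernel_ge0.
rewrite -ip_EFin// le_eqVlt; apply/orP; left; apply/eqP.
apply: eq_integral => y _; congr EFin.
by rewrite -[(s * f) y]/(s y * f y) mulrACA s2.
Qed.

(** Integrate Jensen's inequality over x and exchange the integrals. *)
Lemma mollify_L2 e f : L2 f -> measurable_fun setT (mollify e f) ->
  L2 (mollify e f) /\
  ip (mollify e f) (mollify e f) <= kernel_mass e ^+ 2 * ip f f.
Proof.
move=> Lf mM; have mf := L2_measurable Lf.
have C0 : 0 <= kernel_mass e.
  by apply: Rintegral_ge0 => x _; exact: kernel_ge0.
have mO := measurable_domain Omega.
pose q : E -> \bar R := fun y => ((f \_ Om) y * (f \_ Om) y)%:E.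
have mfO : measurable_fun setT (f \_ Om).
  by apply/(measurable_restrictT _ mO); exact: measurable_funTS.
have mq : measurable_fun setT q by apply/measurable_EFinP; exact: measurable_funM.
have q0 y : (0 <= q y)%E by rewrite lee_fin -expr2 sqr_ge0.
have qE : (\int[leb]_y q y = (ip f f)%:E)%E.
  rewrite -ip_EFin// ge0_integral_m//.
  - by apply: eq_integral => y _; rewrite /q !patchE; case: ifPn => // _; rewrite mulr0.
  - by apply/measurable_EFinP; exact: measurable_funM.
  - by move=> y; rewrite lee_fin -expr2 sqr_ge0.
have mkp : measurable_fun setT (fun p : E * E => (kernel e (p.1 - p.2))%:E).
  apply/measurable_EFinP; apply: measurableT_comp measurable_rV_sub.
  exact: measurable_kernel.
pose F (p : E * E) := ((kernel e (p.1 - p.2)%R)%:E * q p.2)%E.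
have mF : measurable_fun setT F.
  apply: emeasurable_funM => //.
  exact: (measurableT_comp mq measurable_snd).
have F0 p : (0 <= F p)%E by rewrite mule_ge0// lee_fin kernel_ge0.
have mk x : measurable_fun setT (fun y => kernel e (x - y)).
  exact: L2_measurable (kernel_section_L2 e x).
have inner x : (\int[m]_y (kernel e (x - y)%R * (f y * f y))%:E = \int[leb]_y F (x, y))%E.
  rewrite ge0_integral_m//.
  - apply: eq_integral => y _; rewrite /F /q !patchE -EFinM; case: ifPn => // _.
    by rewrite !mulr0.
  - by apply/measurable_EFinP; apply: measurable_funM => //; exact: measurable_funM.
  - by move=> y; rewrite lee_fin mulr_ge0 ?kernel_ge0// -expr2 sqr_ge0.
have FF : (\int[leb]_x \int[leb]_y F (x, y) = (kernel_mass e)%:E * (ip f f)%:E)%E.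
  rewrite (@fubini_tonelli _ _ _ _ _ leb leb F mF F0).
  rewrite -qE -ge0_integralZl_EFin//.
  apply: eq_integral => y _; rewrite /F/=.
  rewrite ge0_integralZr//.
  - congr (_ * _)%E; rewrite -(integral_kernel e y); apply: eq_integral => x _.
    by rewrite -[in RHS]kernelC opprB.
  - apply/measurable_EFinP; under eq_fun do rewrite -kernelC opprB; exact: mk.
  - by move=> x _; rewrite lee_fin kernel_ge0.
have mFx : measurable_fun setT (fun x => \int[leb]_y F (x, y))%E.
  exact: measurable_fun_fubini_tonelli_F.
have main : (\int[m]_x (mollify e f x * mollify e f x)%:E <=
    (kernel_mass e ^+ 2 * ip f f)%:E)%E.
  apply: (@le_trans _ _ (\int[m]_x ((kernel_mass e)%:E * \int[leb]_y F (x, y)))%E).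
    apply: ge0_le_integral => //.
    - by move=> x _; rewrite lee_fin -expr2 sqr_ge0.
    - by apply/measurable_EFinP; exact: measurable_funM.
    - exact: emeasurable_funM.
    - by move=> x _; rewrite -expr2 -inner; exact: mollify_sqr_le.
  rewrite expr2 -mulrA EFinM ge0_integralZl_EFin//; last first.
    by move=> x _; apply: integral_ge0 => y _; exact: F0.
  have [->|C1] := eqVneq (kernel_mass e) 0; first by rewrite !mul0e.
  rewrite lee_pmul2l// ?lte_fin ?lt_neqAle 1?eq_sym ?C1//.
  rewrite EFinM -FF; apply: ge0_integral_m_le => // x.
  by apply: integral_ge0 => y _; exact: F0.
have LM : L2 (mollify e f).
  apply: L2P => //; apply/integrableP; split.
    by apply/measurable_EFinP; exact: measurable_funM.
  apply: le_lt_trans (ltry (kernel_mass e ^+ 2 * ip f f)); apply: le_trans main.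
  rewrite le_eqVlt; apply/orP; left; apply/eqP; apply: eq_integral => x _.
  by rewrite gee0_abs// lee_fin -expr2 sqr_ge0.
by split => //; rewrite -lee_fin -ip_EFin.
Qed.

End mollifier.

(** * Integrals of derivatives of functions with compact support *)

Section compact_support.
Context {R : realType} {N : nat}.
Local Notation E := 'rV[R]_N.
Local Notation leb := (lebesgue_rV R N).
Implicit Types (k F : E -> R) (K : set E) (x y z h : E).

Let cvg_add_pair x y : (fun p : E * E => p.1 + p.2) @ (nbhs x, nbhs y) --> x + y.
Proof. by apply: cvgD; [exact: cvg_fst|exact: cvg_snd]. Qed.

Let shift_continuous (c : E) : continuous (fun x : E => x + c).
Proof.
move=> x; have h : (fun p : E => p + c) @ (nbhs x) --> x + c.
  by apply: cvgD; [exact: cvg_id|exact: cvg_cst].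
exact: h.
Qed.

(** Compactness gives a bound that is uniform for x in K; if x is not in K but x + h
    is, exchange the two points. *)
Lemma compact_support_uniform k K : compact K -> continuous k ->
  (forall x, ~ K x -> k x = 0) -> forall e : R, 0 < e -> exists2 d, 0 < d &
  forall x h, (forall i, `|h 0 i| < d) -> `|k (x + h) - k x| < e.
Proof.
move=> cK ck kK e e0.
pose P (h x : E) := `|k (x + h) - k x| < e.
have : \forall h \near nbhs (0 : E), K `<=` P h.
  move/compact_near_coveringP : cK => /(_ E (nbhs (0 : E)) P); apply.
  move=> x Kx.
  have c2 := cvg_comp _ _ (@cvg_add_pair x 0) (ck (x + 0)).
  have c3 : (fun p : E * E => k p.1) @ (nbhs x, nbhs (0 : E)) --> k x.
    exact: (cvg_comp fst k cvg_fst (ck x)).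
  have c1 : (fun p : E * E => k (p.1 + p.2) - k p.1) @ (nbhs x, nbhs (0 : E)) -->
      k (x + 0) - k x by apply: cvgB; [exact: c2|exact: c3].
  rewrite addr0 subrr in c1.
  have FF : Filter (nbhs (nbhs x, nbhs (0 : E))) by exact: filter_prod_filter.
  have h := (@cvgr0_norm_lt _ _ _ _ _ _ c1 e e0).
  exact: h.
move=> /nbhs_ballP[d /= d0 hd]; exists d => // x h hh.
have bh (h' : E) : (forall i, `|h' 0 i| < d) -> K `<=` P h'.
  move=> hh'; apply: hd; split => // i j; rewrite (ord1 i) /ball/= mxE sub0r normrN.
  exact: hh'.
have [Kx|nKx] := pselect (K x); first exact: (bh _ hh x Kx).
have [Kxh|nKxh] := pselect (K (x + h)); last by rewrite !kK// subrr normr0.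
have := bh (- h) _ (x + h) Kxh; rewrite /P addrK distrC; apply.
by move=> i; rewrite mxE normrN.
Qed.

Lemma is_derive_on_line k (v : E) z (t : R) : derivable k (t *: v + z) v ->
  is_derive t 1 (fun s : R => k (s *: v + z)) ('D_v k (t *: v + z)).
Proof.
move=> dk; rewrite /derivable in dk.
set g1 := (fun h : R => h^-1 *: _) in dk *.
have E1 : (fun h : R => h^-1 *: ((fun s : R => k (s *: v + z)) (h *: 1 + t) - (fun s : R => k (s *: v + z)) t)) = g1.
  by apply/funext => h; rewrite /g1 /= [h *: 1]mulr1 scalerDl addrA.
by apply: DeriveDef; [rewrite /derivable E1|rewrite /derive E1].
Qed.

(** Mean value theorem on the line, and uniform continuity of the derivative. *)
Lemma difference_quotient k K (i : 'I_N) : smooth k -> compact K ->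
  (forall x, ~ K x -> k x = 0) -> (forall x, ~ K x -> partial i k x = 0) ->
  forall e : R, 0 < e -> exists2 d, 0 < d &
  forall (s : R) z, s != 0 -> `|s| < d ->
    `|s^-1 * (k (s *: delta_mx 0 i + z) - k z) - partial i k z| < e.
Proof.
move=> sk cK kK pkK e e0; pose v : E := delta_mx 0 i.
have ck := (sk [:: i]).1.
have [d d0 hd] := compact_support_uniform cK ck pkK e0.
exists d => // s z s0 sd.
pose phi (t : R) := k (t *: v + z).
have dphi (t : R) : is_derive t 1 phi (partial i k (t *: v + z)).
  by apply: is_derive_on_line; exact: (sk [::]).2.
have cphi : continuous phi.
  by move=> t; apply/differentiable_continuous/derivable1_diffP; exact: (@ex_derive _ _ _ _ _ _ _ (dphi t)).
have [c cs cE] : exists2 c, `|c| < d & phi s - phi 0 = partial i k (c *: v + z) * s.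
  have [s1|s1|s1] := ltgtP 0 s.
  - have [c] := @MVT_segment R phi (fun t => partial i k (t *: v + z)) 0 s (ltW s1)
      (fun t _ => dphi t) (continuous_subspaceT cphi).
    rewrite in_itv/= => /andP[c0 cs] ->; exists c; last by rewrite subr0.
    by rewrite ger0_norm//; apply: le_lt_trans cs _; rewrite -(gtr0_norm s1).
  - have [c] := @MVT_segment R phi (fun t => partial i k (t *: v + z)) s 0 (ltW s1)
      (fun t _ => dphi t) (continuous_subspaceT cphi).
    rewrite in_itv/= => /andP[sc c0] h; exists c.
      rewrite ler0_norm//; apply: le_lt_trans (_ : _ <= - s) _; first by rewrite lerN2.
      by rewrite -(ltr0_norm s1).
    by rewrite -opprB h sub0r mulrN opprK.
  - by rewrite -s1 eqxx in s0.
rewrite -/v; have -> : k z = phi 0 by rewrite /phi scale0r add0r.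
have -> : s^-1 * (k (s *: v + z) - phi 0) = partial i k (c *: v + z).
  by rewrite -/(phi s) cE mulrC mulfK.
rewrite [c *: v + z]addrC; apply: hd => j.
by rewrite !mxE eqxx/= normrM; case: (j == i); rewrite ?normr1 ?mulr1// normr0 mulr0.
Qed.

Lemma partial_compact_support k K i : compact K -> (forall x, ~ K x -> k x = 0) ->
  forall x, ~ K x -> partial i k x = 0.
Proof.
move=> cK kK x nKx.
have nb : nbhs x (~` K).
  by apply: open_nbhs_nbhs; split => //; apply: closed_openC; exact: compact_closed.
rewrite /partial (@near_eq_derive _ _ _ _ (cst 0)) ?derive_cst//.
by apply: filterS nb => y; exact: kK.
Qed.

(** the closed neighbourhood of size r for the sup norm *)
Definition fatten K (r : R) : set E :=
  [set y | exists2 x, K x & forall i, `|y 0 i - x 0 i| <= r].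

Lemma compact_fatten K r : compact K -> compact (fatten K r).
Proof.
move=> cK.
have -> : fatten K r = (fun p : E * E => p.1 + p.2) @`
    (K `*` closed_box (fun=> - r) (fun=> r)).
  apply/seteqP; split => [y [x Kx yx]|_ [[x h] /= [Kx hb] <-]].
    exists (x, y - x) => /=; last by rewrite addrCA subrr addr0.
    by split => // i; rewrite !mxE -ler_norml; exact: yx.
  exists x => // i; rewrite mxE addrAC subrr add0r ler_norml; exact: hb.
apply: continuous_compact; last first.
  by apply: compact_setX => //; exact: compact_closed_box.
by apply: continuous_subspaceT; exact: add_continuous.
Qed.

Lemma sub_fatten K r : 0 <= r -> K `<=` fatten K r.
Proof. by move=> r0 x Kx; exists x => // i; rewrite subrr normr0. Qed.

Lemma fatten_fatten K r s : fatten (fatten K r) s `<=` fatten K (r + s).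
Proof.
move=> z [y [x Kx yx] zy]; exists x => // i.
rewrite (_ : z 0 i - x 0 i = (y 0 i - x 0 i) + (z 0 i - y 0 i)); last by ring.
by apply: le_trans (ler_normD _ _) _; apply: lerD.
Qed.

Lemma fatten_sub_open K (U : set E) : compact K -> open U -> K `<=` U ->
  exists2 r, 0 < r & fatten K r `<=` U.
Proof.
move=> cK oU KU.
pose P (r : R) (x : E) := forall y, (forall i, `|y 0 i - x 0 i| <= r) -> U y.
have : \forall r \near (0 : R)^'+, K `<=` P r.
  move/compact_near_coveringP : cK => /(_ R (0 : R)^'+ P); apply.
  move=> x Kx.
  have /nbhs_ballP[e /= e0 eU] : nbhs x U by apply: open_nbhs_nbhs; split => //; exact: KU.
  have e20 : 0 < e / 2 by rewrite divr_gt0.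
  exists (ball x (e / 2), [set r : R | r < e / 2]).
    split; first exact: nbhsx_ballx.
    by apply: nbhs_right_lt.
  move=> [x' r] /= [[_ xx'] re] y yx'; apply: eU; split => // i j.
  have := xx' i j; rewrite (ord1 i) /ball/= => h1; have h2 := yx' j.
  rewrite (_ : x 0 j - y 0 j = (x 0 j - x' 0 j) - (y 0 j - x' 0 j)); last by ring.
  apply: le_lt_trans (ler_normB _ _) _.
  rewrite (splitr e); apply: ltr_leD => //; apply: le_trans h2 _; exact: ltW.
move=> near0.
have [r [r0 hr]] : exists r : R, 0 < r /\ K `<=` P r.
  near ((0 : R)^'+) => r; exists r; split => //; near: r; exact: near0.
by exists r => // y [x Kx yx]; exact: hr yx.
Unshelve. all: by end_near. Qed.

Lemma lebesgue_integrable_compact k K : compact K -> continuous k ->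
  (forall x, ~ K x -> k x = 0) -> leb.-integrable setT (EFin \o k).
Proof.
move=> cK ck kK; have mK := compact_rV_measurable cK.
have [c c0 kc] := bounded_compact_support cK ck kK.
have mk := continuous_rV_measurable ck.
apply/integrableP; split; first exact/measurable_EFinP.
apply: (@le_lt_trans _ _ (\int[leb]_x (c%:E * (\1_K x)%:E))%E).
  apply: ge0_le_integral => //.
  - by apply: measurableT_comp => //; exact/measurable_EFinP.
  - by apply/measurable_EFinP; apply: measurable_funM.
  - move=> x _; rewrite /= -EFinM lee_fin indicE.
    have [Kx|nKx] := pselect (K x); first by rewrite mem_set// mulr1.
    by rewrite memNset// kK// normr0 mulr0.
rewrite ge0_integralZl_EFin//; last by apply/measurable_EFinP.
by rewrite integral_indic// setIT lte_mul_pinfty//; exact: lebesgue_compact.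
Qed.

Lemma Rintegral_shift h k : leb.-integrable setT (EFin \o k) ->
  \int[leb]_x k (x + h) = \int[leb]_x k x.
Proof.
move=> /measurable_int mk; congr fine.
rewrite integralE [RHS]integralE; congr (_ - _)%E.
- transitivity (\int[leb]_x ((EFin \o k)^\+ (x + h)%R))%E.
    by apply: eq_integral => y _; rewrite !funeposE.
  by apply: ge0_integral_shift => //; exact: measurable_funepos.
- transitivity (\int[leb]_x ((EFin \o k)^\- (x + h)%R))%E.
    by apply: eq_integral => y _; rewrite !funenegE.
  by apply: ge0_integral_shift => //; exact: measurable_funeneg.
Qed.

(** The difference quotients have integral 0 by translation invariance, and they
    converge uniformly, inside a fixed compact set. *)
Lemma integral_partial_eq0 F K i : smooth F -> compact K ->
  (forall x, ~ K x -> F x = 0) -> \int[leb]_x partial i F x = 0.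
Proof.
move=> sF cK FK; pose v : E := delta_mx 0 i.
have pK := partial_compact_support i cK FK.
have cF := (sF [::]).1; have cpF := (sF [:: i]).1.
have c1 := compact_fatten (r := 1) cK.
have m1 := compact_rV_measurable c1.
have I1 : (\int[leb]_x (\1_(fatten K 1) x)%:E = leb (fatten K 1))%E.
  by rewrite integral_indic// setIT.
have I0 := lebesgue_integrable_compact cK cF FK.
have Ip := lebesgue_integrable_compact cK cpF pK.
pose V := fine (leb (fatten K 1)).
have VE : (leb (fatten K 1) = V%:E)%E.
  by rewrite /V fineK// ge0_fin_numE// lebesgue_compact.
have V0 : 0 <= V by rewrite fine_ge0.
suff bound (e : R) : 0 < e -> `|\int[leb]_x partial i F x| <= e * V.
  apply/eqP; rewrite -normr_le0; apply/ler_addgt0Pr => e e0; rewrite add0r.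
  have d0 : 0 < e / (V + 1) by rewrite divr_gt0// ltr_wpDl.
  apply: le_trans (bound _ d0) _; rewrite -mulrA ler_piMr ?(ltW e0)//.
  by rewrite mulrC ler_pdivrMr ?ltr_wpDl// mul1r lerDl.
move=> e0; have [d d0 hd] := difference_quotient sF cK FK pK e0.
(* increments at most 1 keep all supports inside [fatten K 1] *)
pose s := Num.min (d / 2) 1.
have s0 : 0 < s by rewrite lt_min ltr01 divr_gt0.
have sd : `|s| < d.
  by rewrite gtr0_norm// gt_min ltr_pdivrMr// ltr_pMr// ltr1n.
have s1 : s <= 1 by rewrite ge_min lexx orbT.
pose Fs x := F (x + s *: v).
have cFs : continuous Fs.
  move=> x; apply: (@continuous_comp _ _ _ (fun x => x + s *: v) F); last exact: cF.
  exact: shift_continuous.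
have FsK x : ~ fatten K 1 x -> Fs x = 0.
  move=> nx; apply: FK => Kx; apply: nx; exists (x + s *: v) => // j.
  rewrite !mxE opprD addrA subrr sub0r normrN normrM (gtr0_norm s0).
  by case: (j == i); rewrite ?andbT ?normr1 ?mulr1// normr0 mulr0.
have Is := lebesgue_integrable_compact c1 cFs FsK.
pose q x := s^-1 * (Fs x - F x).
have cq : continuous q.
  by move=> x; exact: (cvgM (cvg_cst _) (cvgB (cFs x) (cF x))).
have F1 x : ~ fatten K 1 x -> F x = 0.
  by move=> nx; apply: FK => Kx; apply: nx; exact: sub_fatten.
have p1 x : ~ fatten K 1 x -> partial i F x = 0.
  by move=> nx; apply: pK => Kx; apply: nx; exact: sub_fatten.
have qK x : ~ fatten K 1 x -> q x = 0.
  by move=> nx; rewrite /q FsK// F1// subrr mulr0.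
have Iq := lebesgue_integrable_compact c1 cq qK.
have q0 : \int[leb]_x q x = 0.
  have Id : leb.-integrable setT (EFin \o (fun x => Fs x - F x)).
    apply: (lebesgue_integrable_compact c1).
      by move=> x; exact: (cvgB (cFs x) (cF x)).
    by move=> x nx; rewrite FsK// F1// subrr.
  rewrite /q RintegralZl//.
  by rewrite RintegralB// Rintegral_shift// subrr mulr0.
have cr : continuous (fun x => q x - partial i F x).
  by move=> x; exact: (cvgB (cq x) (cpF x)).
have rK x : ~ fatten K 1 x -> q x - partial i F x = 0.
  by move=> nx; rewrite qK// p1// subrr.
have Ir := lebesgue_integrable_compact c1 cr rK.
have -> : `|\int[leb]_x partial i F x| = `|\int[leb]_x (q x - partial i F x)|.
  by rewrite RintegralB// q0 sub0r normrN.
have Ieb : leb.-integrable setT (EFin \o (fun x => e * \1_(fatten K 1) x)).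
  apply/integrableP; split; first by apply/measurable_EFinP; apply: measurable_funM.
  under eq_integral do rewrite gee0_abs ?lee_fin ?mulr_ge0// ?ltW//= EFinM.
  rewrite ge0_integralZl_EFin ?ltW//; last by apply/measurable_EFinP.
  by rewrite I1 VE -EFinM ltry.
apply: le_trans (le_normr_Rintegral measurableT Ir) _.
have -> : e * V = \int[leb]_x (e * \1_(fatten K 1) x).
  rewrite RintegralZl//; last first.
    apply/integrableP; split; first by apply/measurable_EFinP.
    under eq_integral do rewrite gee0_abs ?lee_fin//=.
    by rewrite I1 VE ltry.
  by congr (_ * _); rewrite /Rintegral I1.
apply: le_Rintegral => //; first exact: integrable_norm Ir.
move=> x _; rewrite indicE; have [xK|xK] := pselect (fatten K 1 x).
  rewrite mem_set// mulr1; apply: ltW.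
  by rewrite /q /Fs [x + _]addrC; apply: hd => //; rewrite gt_eqF.
by rewrite memNset// rK// normr0 mulr0.
Qed.

End compact_support.

(** * Smoothness of convolutions and density of test functions *)

Section convolution.
Context {R : realType} {N : nat} (Omega : domain R N).
Local Notation E := 'rV[R]_N.
Local Notation leb := (lebesgue_rV R N).
Local Notation m := (m Omega).
Local Notation L2 := (L2 Omega).
Local Notation ip := (ip Omega).
Local Notation test := (test_function Omega).
Local Notation Om := (Omega : set E).
Implicit Types (f g k phi psi : E -> R) (K : set E) (x y : E).

Lemma Rintegral_m f : leb.-integrable setT (EFin \o f) ->
  (forall x, ~ Om x -> f x = 0) -> \int[m]_x f x = \int[leb]_x f x.
Proof.
move=> If f0; have /measurable_int mf := If; congr fine.
have fOm : (EFin \o f) \_ Om = EFin \o f.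
  apply/funext => x; rewrite patchE; case: ifPn => // /negP xO.
  by rewrite /= f0// => /mem_set.
have fp : ((EFin \o f)^\+ \_ Om = (EFin \o f)^\+)%E by rewrite -funepos_restrict fOm.
have fn : ((EFin \o f)^\- \_ Om = (EFin \o f)^\-)%E by rewrite -funeneg_restrict fOm.
rewrite integralE [RHS]integralE; congr (_ - _)%E.
- rewrite -[in RHS]fp; apply: ge0_integral_m => //; exact: measurable_funepos.
- rewrite -[in RHS]fn; apply: ge0_integral_m => //; exact: measurable_funeneg.
Qed.

Lemma smoothM f g : smooth f -> smooth g -> smooth (f * g).
Proof.
by move=> sf sg; apply: smooth_fun_alg; apply: fun_algM; exact: fun_alg_gen.
Qed.

(** Integration by parts: the derivative of a product of test functions has integral
    0. *)
Lemma test_weak_grad psi : test psi -> weak_grad Omega psi (fun i => partial i psi).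
Proof.
move=> tpsi i; split=> [|phi tphi]; first exact: test_partial_L2.
have [spsi [K [cK KO psiK]]] := tpsi; have sphi := tphi.1.
have sM := smoothM spsi sphi.
have MK x : ~ K x -> (psi * phi) x = 0.
  by move=> nx; rewrite -[LHS]/(psi x * phi x) psiK// mul0r.
have pMK := partial_compact_support i cK MK.
have Lp := test_L2 tpsi; have Lf := test_L2 tphi.
have Lpp := test_partial_L2 i tpsi; have Lpf := test_partial_L2 i tphi.
have h := integral_partial_eq0 i sM cK MK.
rewrite -Rintegral_m in h; last 2 first.
- by apply: (lebesgue_integrable_compact cK) => //; exact: (sM [:: i]).1.
- by move=> x nx; apply: pMK => /KO.
apply/eqP; rewrite -subr_eq0 opprK -h; apply/eqP.
rewrite /Defs.ip -RintegralD//; try exact: L2_integrable_mul.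
apply: eq_Rintegral => x _; rewrite /partial deriveM; last 2 first.
- exact: (spsi [::]).2.
- exact: (sphi [::]).2.
by congr (_ + _); rewrite mulrC.
Qed.

Lemma test_H1 psi : test psi -> H1 Omega psi.
Proof. by move=> tp; split; [exact: test_L2|eexists; exact: test_weak_grad]. Qed.

(** An L^2 function minus its projection to the closure of the test functions is
    orthogonal to them, so the fundamental lemma applies to it. *)
Lemma test_dense g : L2 g -> forall e : R, 0 < e ->
  exists2 phi, test phi & ip (phi - g) (phi - g) < e.
Proof.
move=> Lg e e0.
have SI := L2_semi_inner Omega.
pose C : set (E -> R) := [set u | L2 u /\ forall e : R, 0 < e ->
  exists2 phi, test phi & ip (phi - u) (phi - u) < e].
have tC phi : test phi -> C phi.
  move=> tphi; split; first exact: test_L2.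
  by move=> e' e'0; exists phi => //; rewrite subrr ip0l.
have CL u : C u -> L2 u by move=> [].
have sq2 (a b : E -> R) : L2 a -> L2 b -> ip (a + b) (a + b) <= 2 * ip a a + 2 * ip b b.
  by move=> La Lb; exact: (si_sqrD SI).
have CD u v : C u -> C v -> C (u + v).
  move=> [Lu hu] [Lv hv]; split; first exact: L2D.
  move=> e' e'0; have e4 : 0 < e' / 4 by rewrite divr_gt0.
  have [p tp pu] := hu _ e4; have [q tq qv] := hv _ e4.
  exists (p + q); first exact: testD.
  rewrite opprD addrACA.
  apply: le_lt_trans (sq2 _ _ (L2B (test_L2 tp) Lu) (L2B (test_L2 tq) Lv)) _.
  by move: (ip _ _) (ip _ _) pu qv => a b *; lra.
have CZ a u : C u -> C (a *: u).
  move=> [Lu hu]; split; first exact: L2Z.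
  move=> e' e'0; have a0 : 0 < a ^+ 2 + 1 by rewrite ltr_wpDl// sqr_ge0.
  have [p tp pu] := hu _ (divr_gt0 e'0 a0); exists (a *: p); first exact: testZ.
  have LB := L2B (test_L2 tp) Lu.
  rewrite -scalerBr ipZl ?ipZr//; try exact: L2Z.
  rewrite mulrA -expr2; apply: le_lt_trans (_ : _ <= (a ^+ 2 + 1) * ip (p - u) (p - u)) _.
    by rewrite ler_wpM2r ?ip_ge0// lerDl.
  by rewrite mulrC -ltr_pdivlMr.
have CI : semi_inner C ip.
  have [h1 h2 h3 h4 h5 h6 h7] := SI.
  split; [exact: tC (test_0 Omega)|exact: CD|exact: CZ| | | |] => *.
  - by apply: h4; apply: CL.
  - by apply: h5; apply: CL.
  - by apply: h6; apply: CL.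
  - by apply: h7; apply: CL.
have Cc : qcomplete C ip.
  apply: (qclosed_complete (@L2_complete _ _ Omega) CL) => x Lx hx; split => // e' e'0.
  have e4 : 0 < e' / 4 by rewrite divr_gt0.
  have [y Cy yx] := hx _ e4; have [p tp py] := Cy.2 _ e4; exists p => //.
  rewrite (_ : p - x = (p - y) + (y - x)); last by rewrite addrA subrK.
  apply: le_lt_trans (sq2 _ _ (L2B (test_L2 tp) Cy.1) (L2B Cy.1 Lx)) _.
  by move: (ip _ _) (ip _ _) py yx => a b *; lra.
have lc u : C u -> ip g u ^+ 2 <= ip u u * ip g g.
  by move=> Cu; rewrite ipC; exact: (si_cauchy_schwarz SI (CL _ Cu) Lg).
have [p Cp hp] := si_riesz CI Cc (l := ip g) (c := ip g g)
  (fun u v Cu Cv => ipDr (CL _ Cu) (CL _ Cv) Lg) (fun a u Cu => ipZr a (CL _ Cu) Lg)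
  (ip_ge0 Omega g) lc.
have gp : {ae m, forall x, (g - p) x = 0}.
  apply: fundamental_lemma; first exact: L2B (CL _ Cp).
  move=> phi tphi; rewrite (ipBl Lg (CL _ Cp) (test_L2 tphi)) hp ?subrr//.
  exact: tC.
have [phi tphi hphi] := Cp.2 _ e0; exists phi => //.
have Lphi := test_L2 tphi; have Lp := CL _ Cp.
have E1 : {ae m, forall x, (phi - g) x = (phi - p) x}.
  apply: filterS gp => x; rewrite -[(g - p) x]/(g x - p x) => /subr0_eq gpx.
  by rewrite -[LHS]/(phi x - g x) gpx.
by rewrite (ip_aeql _ _ _ E1) ?(ip_aeqr _ _ _ E1)//; exact: L2B.
Qed.

Lemma compact_reflect K x : compact K -> compact [set y | K (x - y)].
Proof.
move=> cK; rewrite (_ : [set y | _] = (fun z => x - z) @` K); last first.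
  apply/seteqP; split => [y Ky|_ [z Kz <-]]; first by exists (x - y) => //; rewrite subKr.
  by rewrite /= subKr.
apply: continuous_compact => //; apply: continuous_subspaceT => z.
exact: (cvgB (cvg_cst x) (@cvg_id _ (nbhs z))).
Qed.

Lemma reflect_continuous k x : continuous k -> continuous (fun y => k (x - y)).
Proof.
move=> ck y; have h : (fun y : E => x - y) @ y --> x - y.
  exact: (cvgB (cvg_cst x) (@cvg_id _ (nbhs y))).
exact: (cvg_comp _ _ h (ck (x - y))).
Qed.

Lemma reflect_derive k x y i : derivable k (x - y) (delta_mx 0 i) ->
  derivable (fun z => k (x - z)) y (delta_mx 0 i) /\
  partial i (fun z => k (x - z)) y = - partial i k (x - y).
Proof.
move=> dk; have h1 : is_derive (0 : R) 1 (fun s : R => k (s *: delta_mx 0 i + (x - y)))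
    (partial i k (x - y)).
  have := @is_derive_on_line _ _ k (delta_mx 0 i) (x - y) 0.
  by rewrite scale0r add0r; apply.
have h2 : is_derive (0 : R) 1 (fun s : R => k (x - (s *: delta_mx 0 i + y)))
    (- partial i k (x - y)).
  have h3 : is_derive (0 : R) 1 (-%R : R -> R) (-1).
    exact: is_deriveNid.
  have h1' : is_derive (- 0 : R) 1 (fun s : R => k (s *: delta_mx 0 i + (x - y)))
    (partial i k (x - y)) by rewrite oppr0.
  have := is_derive1_comp h1' (h3 : is_derive (0:R) 1 (fun s : R => - s) (-1)).
  rewrite mulrN1; congr is_derive; apply/funext => s /=.
  by rewrite scaleNr opprD addrCA.
split; last by rewrite /partial derive_line; exact: derive_val.
have [d2 _] := h2; move: d2; rewrite /derivable.
set g1 := (fun h : R => h^-1 *: _); set g2 := (fun h : R => h^-1 *: _).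
suff -> : g1 = g2 by [].
by apply/funext => h; rewrite /g1 /g2 /= addr0 [h *: 1]mulr1 scale0r add0r.
Qed.

Lemma smooth_reflect k x : smooth k -> smooth (fun y => k (x - y)).
Proof.
move=> sk; pose S : set (E -> R) := [set f | exists2 k, smooth k & exists a : R, f = fun y => a * k (x - y)].
apply: (@diff_stable_smooth _ _ S); last first.
  by exists k => //; exists 1; apply/funext => y; rewrite mul1r.
move=> _ {sk}[{}k sk [a ->]]; have [ck dk] := smooth_diff_stable sk; split.
  by move=> y; exact: (cvgM (cvg_cst a) (@reflect_continuous k x ck y)).
move=> i; have rk y := @reflect_derive k x y i ((dk i).1 _).
have E1 : (fun y => a * k (x - y)) = a \*o (fun y => k (x - y)) by [].
split=> [y|].
  by rewrite E1 -[_ \*o _]/(cst a * _); apply: derivableM; [exact: derivable_cst|exact: (rk y).1].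
exists (partial i k); first exact: (dk i).2.
exists (- a); apply/funext => y; rewrite E1 {1}/partial deriveMl; last exact: (rk y).1.
by rewrite -/(partial i _ y) (rk y).2 mulrN mulNr.
Qed.

Definition conv k g : E -> R := fun x => ip (fun y => k (x - y)) g.

Definition smooth_compact : set (E -> R) := [set k | smooth k /\
  exists2 K, compact K & forall x, ~ K x -> k x = 0].

Lemma smooth_compact_partial k i : smooth_compact k -> smooth_compact (partial i k).
Proof.
move=> [sk [K cK kK]]; split; first exact: ((smooth_diff_stable sk).2 i).2.
by exists K => //; exact: partial_compact_support.
Qed.

Lemma conv_section_L2 k x : smooth_compact k -> L2 (fun y => k (x - y)).
Proof.
move=> [sk [K cK kK]]; have cK' := @compact_reflect K x cK.
apply: (@L2_continuous_compact _ _ Omega _ (fun y => k (x - y)) cK').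
  by apply: reflect_continuous; exact: (sk [::]).1.
by move=> y; exact: kK.
Qed.

Section smooth_conv.
Variables (g : E -> R) (K : set E).
Hypotheses (Lg : L2 g) (cK : compact K) (gK : {ae m, forall x, ~ K x -> g x = 0}).

Let L1K : L2 (\1_K : E -> R).
Proof.
apply: (@L2_bounded_compact _ _ Omega _ 1 _ cK).
- by apply: measurable_indic; exact: compact_rV_measurable.
- by move=> x; rewrite indicE; case: (_ \in _); rewrite ?normr1// normr0.
- by move=> x nKx; rewrite indicE memNset.
Qed.

Let c : R := ip \1_K (fun x => `|g x|).

Let c_ge0 : 0 <= c.
Proof.
apply: ip_nneg => //.
- exact: L2_norm.
- by apply: aeW => x; rewrite indicE; case: (_ \in _).
- exact: aeW.
Qed.

Let ip_bound (a : E -> R) (e : R) : L2 a -> (forall x, `|a x| <= e) -> `|ip a g| <= e * c.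
Proof.
move=> La ae.
apply: le_trans (le_normr_Rintegral measurableT (L2_integrable_mul La Lg)) _.
rewrite /c /Defs.ip -RintegralZl//; last by apply: L2_integrable_mul => //; exact: L2_norm.
have I1 : m.-integrable setT (EFin \o (fun x => e * (\1_K x * `|g x|))).
  have := L2_integrable_mul (L2Z e L1K) (L2_norm Lg).
  by apply: eq_integrable => // x _ /=; rewrite mulrA.
have I2 : m.-integrable setT (EFin \o (fun x => `|a x * g x|)).
  have := L2_integrable_mul (L2_norm La) (L2_norm Lg).
  by apply: eq_integrable => // x _ /=; rewrite normrM.
have pos x : 0 <= e * (\1_K x * `|g x|).
  by rewrite mulr_ge0 ?(le_trans _ (ae x))// mulr_ge0// indicE.
apply: fine_le; try exact: integrable_fin_num.
rewrite [leRHS](_ : _ = \int[m]_x `|(e * (\1_K x * `|g x|))%:E|)%E; last first.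
  by apply: eq_integral => x _; rewrite gee0_abs// lee_fin pos.
rewrite [leLHS](_ : _ = \int[m]_x `|(a x * g x)%:E|)%E//.
apply: ae_ge0_le_integral => //.
- by apply: measurableT_comp => //; exact: measurable_int (L2_integrable_mul La Lg).
- by apply: measurableT_comp => //; exact: measurable_int I1.
apply: filterS gK => x gKx _; rewrite lee_fin normrM [leRHS]normrM (ger0_norm (le_trans (normr_ge0 _) (ae x))).
rewrite indicE; have [Kx|nKx] := pselect (K x).
  by rewrite mem_set// mul1r normr_id ler_wpM2r.
by rewrite gKx// !(normr0, mulr0).
Qed.

Let conv_continuous k : smooth_compact k -> continuous (conv k g).
Proof.
move=> sk; have [sk1 [Kk cKk kK]] := sk.
move=> x; have FF : Filter (nbhs x) by exact: nbhs_filter.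
apply/(@cvgrPdist_lt _ _ _ _ FF) => e e0.
have e1 : 0 < e / (c + 1) by rewrite divr_gt0// ltr_wpDl.
have [d d0 hd] := compact_support_uniform cKk (sk1 [::]).1 kK e1.
have : \forall z \near x, forall i, `|(x - z) 0 i| < d.
  have : nbhs x (ball x d) by exact: nbhsx_ballx.
  by apply: filterS => z [_ xz] i; rewrite !mxE; exact: xz.
apply: filterS => z xz; rewrite /conv -ipBl; try exact: conv_section_L2; last exact: Lg.
apply: le_lt_trans (@ip_bound _ (e / (c + 1)) _ _) _.
- by apply: L2B; exact: conv_section_L2.
- move=> y; apply: ltW; rewrite -[(_ - _) y]/(k (x - y) - k (z - y)).
  rewrite (_ : x - y = (z - y) + (x - z)); last by rewrite [RHS]addrC addrA subrK.
  exact: hd.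
- rewrite mulrAC ltr_pdivrMr ?ltr_wpDl// ltr_pM2l//.
  by rewrite ltrDl.
Qed.

Let conv_derive k i x : smooth_compact k ->
  (fun h : R => h^-1 *: (conv k g (h *: delta_mx 0 i + x) - conv k g x)) @ 0^' -->
  conv (partial i k) g x.
Proof.
move=> sk; have [sk1 [Kk cKk kK]] := sk; have skp := smooth_compact_partial i sk.
have LS y := conv_section_L2 y sk; have LP y := conv_section_L2 y skp.
apply/cvgrPdist_lt => e e0.
have e1 : 0 < e / (c + 1) by rewrite divr_gt0// ltr_wpDl.
have [d d0 hd] := difference_quotient sk1 cKk kK (partial_compact_support i cKk kK) e1.
have h0 : \forall h \near (0 : R)^', h != 0 by exact: nbhs_dnbhs_neq.
have hd0 : \forall h \near (0 : R)^', `|h| < d.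
  by apply: cvg_within; have := @nbhsx_ballx R R 0 d d0; apply: filterS => h; rewrite /ball/= sub0r normrN.
apply: filterS2 h0 hd0 => h hn hh.
have -> : conv (partial i k) g x - h^-1 *: (conv k g (h *: delta_mx 0 i + x) - conv k g x) =
   ip ((fun y => partial i k (x - y)) - h^-1 *: ((fun y => k (h *: delta_mx 0 i + x - y)) - (fun y => k (x - y)))) g.
  by rewrite ipBl ?ipZl ?ipBl//; [exact: L2B|apply: L2Z; exact: L2B].
apply: le_lt_trans (@ip_bound _ (e / (c + 1)) _ _) _.
- by apply: L2B => //; apply: L2Z; exact: L2B.
- move=> y; apply: ltW; rewrite distrC.
  have := hd h (x - y) hn hh; rewrite addrA; apply: le_lt_trans; exact: lexx.
- by rewrite mulrAC ltr_pdivrMr ?ltr_wpDl// ltr_pM2l// ltrDl.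
Qed.

Lemma conv_partial k i x : smooth_compact k ->
  derivable (conv k g) x (delta_mx 0 i) /\ partial i (conv k g) x = conv (partial i k) g x.
Proof.
move=> sk; have h := @conv_derive k i x sk; split; last exact: (cvg_lim _ h).
by apply/cvg_ex; eexists; exact: h.
Qed.

(** Differentiation falls on the kernel. The function g has compact support, hence
    is integrable, so uniform estimates on the kernel suffice. *)
Lemma smooth_conv k : smooth_compact k -> smooth (conv k g).
Proof.
move=> sk; pose S := [set f | exists2 k, smooth_compact k & f = conv k g].
apply: (@diff_stable_smooth _ _ S); last by exists k.
move=> _ {sk}[{}k sk ->]; split; first exact: conv_continuous.
move=> i; split=> [x|]; first exact: (conv_partial i x sk).1.
exists (partial i k); first exact: smooth_compact_partial.
by apply/funext => x; exact: (conv_partial i x sk).2.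
Qed.

End smooth_conv.

End convolution.

(** * Sobolev functions with compact support in the domain *)

Section mollification.
Context {R : realType} {N : nat} (Omega : domain R N).
Local Notation E := 'rV[R]_N.
Local Notation leb := (lebesgue_rV R N).
Local Notation m := (m Omega).
Local Notation L2 := (L2 Omega).
Local Notation ip := (ip Omega).
Local Notation mollify := (mollify Omega).
Local Notation dform := (dform Omega).
Local Notation H1 := (H1 Omega).
Local Notation grad := (grad Omega).
Local Notation test := (test_function Omega).
Local Notation Om := (Omega : set E).
Implicit Types (f g k phi psi : E -> R) (K : set E) (x y : E).

Lemma ip_le_norm f g : L2 f -> L2 g -> {ae m, forall x, `|f x| <= `|g x|} ->
  ip f f <= ip g g.
Proof.
move=> Lf Lg fg; rewrite -lee_fin -!ip_EFin//.
have sqE (a : R) : (a * a)%:E = (`|a| ^+ 2)%:E by rewrite real_normK ?num_real// expr2.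
apply: ae_ge0_le_integral => //.
- by move=> x _; rewrite sqE lee_fin sqr_ge0.
- exact: measurable_int (L2_integrable_sqr Lf).
- by move=> x _; rewrite sqE lee_fin sqr_ge0.
- exact: measurable_int (L2_integrable_sqr Lg).
by apply: filterS fg => x fgx _; rewrite (sqE (f x)) (sqE (g x)) lee_fin lerXn2r// nnegrE.
Qed.

Lemma L2_indic_compact K : compact K -> L2 (\1_K : E -> R).
Proof.
move=> cK; apply: (@L2_bounded_compact _ _ Omega _ 1 _ cK).
- by apply: measurable_indic; exact: compact_rV_measurable.
- by move=> x; rewrite indicE; case: (_ \in _); rewrite ?normr1// normr0.
- by move=> x nKx; rewrite indicE memNset.
Qed.

Lemma smooth_compact_kernel (s : R) : smooth_compact (kernel s : E -> R).
Proof.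
split; first exact: smooth_kernel.
exists (closed_box (fun=> - s) (fun=> s)); first exact: compact_closed_box.
by move=> x; exact: box_bump_eq0.
Qed.

Section mollify_compact.
Variables (g : E -> R) (K : set E).
Hypotheses (Lg : L2 g) (cK : compact K) (gK : {ae m, forall x, ~ K x -> g x = 0}).

Lemma smooth_mollify (s : R) : smooth (mollify s g).
Proof. exact: (smooth_conv Lg cK gK (smooth_compact_kernel s)). Qed.

Lemma mollify_eq0 (s : R) x : ~ fatten K s x -> mollify s g x = 0.
Proof.
move=> nx; have LK := L2_indic_compact cK.
have gE : {ae m, forall x, g x = (g \_ K) x}.
  apply: filterS gK => y gy; rewrite patchE; case: ifPn => // /negP yK.
  by rewrite gy// => Ky; apply: yK; exact: mem_set.
have LgK : L2 (g \_ K) by apply: L2_patch => //; exact: compact_rV_measurable.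
rewrite mollifyE (ip_aeqr Lg LgK (kernel_section_L2 Omega s x) gE).
rewrite /Defs.ip (_ : (fun y => _) = cst 0); first by rewrite /Rintegral integral0.
apply/funext => y /=; rewrite patchE; case: ifPn => [/set_mem Ky|]; last by rewrite mulr0.
rewrite kernel_eq0 ?mul0r// => xy; apply: nx; exists y => // i.
by have := xy i; rewrite !mxE.
Qed.

Lemma test_mollify (s : R) : fatten K s `<=` Om -> test (mollify s g).
Proof.
move=> sO; split; first exact: smooth_mollify.
exists (fatten K s); split => //; first exact: compact_fatten.
by move=> x; exact: mollify_eq0.
Qed.

(** Near K the translated kernel is a test function, so the definition of the weak
    gradient applies. *)
Lemma partial_mollify (s : R) i x : H1 g -> 0 <= s -> fatten K (s + s) `<=` Om ->
  fatten K s x -> partial i (mollify s g) x = mollify s (grad g i) x.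
Proof.
move=> Hg s0 sO Kx; have [_ hg] := weak_grad_grad Hg i.
pose phi y := kernel s (x - y).
have sp : smooth phi by exact: smooth_reflect (smooth_kernel s).
have tphi : test phi.
  split => //; exists (closed_box (fun j => x 0 j - s) (fun j => x 0 j + s)).
  split; first exact: compact_closed_box.
    move=> y yb; apply: sO; apply: fatten_fatten; exists x => // j.
    rewrite ler_norml; have /andP[] := yb j; move: (x 0 j) (y 0 j) => a b *.
    by apply/andP; split; lra.
  by move=> y; rewrite /phi; have /= -> := congr1 (@^~ y) (kernel_sub s x); exact: box_bump_eq0.
have [_ ->] := conv_partial Lg cK gK i x (smooth_compact_kernel s).
have E1 : partial i phi = - (fun y => partial i (kernel s) (x - y)).
  apply/funext => y; have [_ ->//] := @reflect_derive _ _ (kernel s) x y i ((smooth_kernel s [::]).2 i _).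
have Ls : L2 (fun y => partial i (kernel s) (x - y)).
  exact: conv_section_L2 (smooth_compact_partial i (smooth_compact_kernel s)).
have := hg phi tphi; rewrite E1 ipNr// => /oppr_inj h.
by rewrite /conv ipC h ipC.
Qed.

(** The weak gradient of g is only used within 2 s of K, where the mollifier of
    [grad g] can be computed with test functions of Omega. *)
Lemma partial_mollify_le (s : R) i : H1 g -> 0 <= s -> fatten K (s + s) `<=` Om ->
  ip (partial i (mollify s g)) (partial i (mollify s g)) <=
  @kernel_mass R N s ^+ 2 * ip (grad g i) (grad g i).
Proof.
move=> Hg s0 sO; have c2 := compact_fatten (r := s + s) cK.
have c1 := compact_fatten (r := s) cK.
have m2 := compact_rV_measurable c2.
have LG := grad_L2 i Hg; pose h : E -> R := (grad g i) \_ (fatten K (s + s)).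
have Lh : L2 h by exact: L2_patch.
have h0 : {ae m, forall x, ~ fatten K (s + s) x -> h x = 0}.
  by apply: aeW => x nx; rewrite /h patchE memNset.
have mh := continuous_rV_measurable (smooth_conv Lh c2 h0 (smooth_compact_kernel s) [::]).1.
have [Lmh mhle] := mollify_L2 Lh mh.
have s12 : fatten K s `<=` Om.
  by move=> x [y Ky xy]; apply: sO; exists y => // j; apply: le_trans (xy j) _; rewrite lerDl.
have tm := test_mollify s12.
have Ldm := test_partial_L2 i tm.
apply: (@le_trans _ _ (ip (mollify s h) (mollify s h))).
  apply: ip_le_norm => //; apply: aeW => x.
  have [Kx|nKx] := pselect (fatten K s x); last first.
    rewrite (partial_compact_support i c1 _ nKx) ?normr0//.
    by move=> y; exact: mollify_eq0.
  rewrite partial_mollify// le_eqVlt; apply/orP; left; apply/eqP; congr `|_|.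
  apply: eq_Rintegral => y _; rewrite /h patchE; case: ifPn => // yK.
  rewrite kernel_eq0 ?mul0r// => xy; case/negP: yK; apply/mem_set.
  apply: fatten_fatten; exists x => // j; have := xy j; rewrite !mxE distrC; exact: id.
apply: le_trans mhle _; rewrite ler_wpM2l ?sqr_ge0//.
apply: ip_le_norm => //; apply: aeW => x; rewrite /h patchE.
by case: ifP; rewrite ?normr0.
Qed.

End mollify_compact.

(** Averaging over a box of size s < d. *)
Lemma mollify_test_close phi (s d e : R) x : test phi -> 0 < s < d ->
  (forall x (h : E), (forall i, `|h 0 i| < d) -> `|phi (x + h) - phi x| < e) ->
  `|mollify s phi x - @kernel_mass R N s * phi x| <= e * @kernel_mass R N s.
Proof.
move=> tphi /andP[s0 sd] hd; have [sphi [K [cK KO phiK]]] := tphi.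
have ck : continuous (fun y => kernel s (x - y)).
  by apply: reflect_continuous; exact: (smooth_kernel s [::]).1.
have cp := (sphi [::]).1.
have c0 := @compact_closed_box R N (fun j => x 0 j - s) (fun j => x 0 j + s).
have k0 y : ~ closed_box (fun j => x 0 j - s) (fun j => x 0 j + s) y -> kernel s (x - y) = 0.
  by have /= -> := congr1 (@^~ y) (kernel_sub s x); exact: box_bump_eq0.
have I1 : leb.-integrable setT (EFin \o (fun y => kernel s (x - y) * phi y)).
  apply: (lebesgue_integrable_compact c0).
    by move=> y; exact: (cvgM (ck y) (cp y)).
  by move=> y /k0 ->; rewrite mul0r.
have I2 : leb.-integrable setT (EFin \o (fun y => kernel s (x - y))).
  exact: (lebesgue_integrable_compact c0).
have I3 (a : R) : leb.-integrable setT (EFin \o (fun y => kernel s (x - y) * a)).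
  apply: (lebesgue_integrable_compact c0).
    by move=> y; exact: (cvgM (ck y) (cvg_cst a)).
  by move=> y /k0 ->; rewrite mul0r.
have massE : @kernel_mass R N s = \int[leb]_y kernel s (x - y).
  by rewrite /Rintegral integral_kernel.
have mE (a : R) : @kernel_mass R N s * a = \int[leb]_y (kernel s (x - y) * a).
  by rewrite massE -RintegralZr.
have -> : mollify s phi x = \int[leb]_y (kernel s (x - y) * phi y).
  rewrite mollifyE /Defs.ip Rintegral_m// => y yO; rewrite phiK ?mulr0//.
  by move=> /KO.
rewrite (mE (phi x)) -RintegralB// [leRHS]mulrC mE.
have I4 : leb.-integrable setT (EFin \o (fun y => kernel s (x - y) * phi y - kernel s (x - y) * phi x)).
  by have := integrableB measurableT I1 (I3 (phi x)); apply: eq_integrable.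
apply: le_trans (le_normr_Rintegral measurableT I4) _.
apply: le_Rintegral => //; first exact: integrable_norm I4.
move=> y _; rewrite -mulrBr normrM ger0_norm ?kernel_ge0//.
have [yb|/k0 ->] := pselect (closed_box (fun j => x 0 j - s) (fun j => x 0 j + s) y); last by rewrite !mul0r.
rewrite ler_wpM2l ?kernel_ge0// ltW//.
have := hd x (y - x); rewrite addrCA subrr addr0; apply => j.
apply: le_lt_trans sd; rewrite !mxE ler_norml; have /andP[] := yb j.
by move: (x 0 j) (y 0 j) => a b *; apply/andP; split; lra.
Qed.

Lemma mollify_test_cvg phi (e : R) : test phi -> 0 < e -> exists2 d : R, 0 < d &
  forall s, 0 < s < d ->
  ip ((@kernel_mass R N s)^-1 *: mollify s phi - phi)
     ((@kernel_mass R N s)^-1 *: mollify s phi - phi) < e.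
Proof.
move=> tphi e0; have [sphi [K [cK KO phiK]]] := tphi.
have c1 := compact_fatten (r := 1) cK.
pose F : E -> R := \1_(fatten K 1); have LF : L2 F by exact: L2_indic_compact.
pose V := ip F F; have V0 : 0 <= V by exact: ip_ge0.
pose c := Num.min 1 (e / (V + 1)).
have c0 : 0 < c by rewrite lt_min ltr01 divr_gt0// ltr_wpDl.
have cV : c ^+ 2 * V < e.
  apply: le_lt_trans (_ : c * V < e).
    have c1' : c <= 1 by rewrite /c ge_min lexx.
    by rewrite ler_wpM2r// expr2 ler_piMl// ltW.
  apply: le_lt_trans (_ : e / (V + 1) * V < e).
    by rewrite ler_wpM2r// /c ge_min lexx orbT.
  by rewrite mulrAC ltr_pdivrMr ?ltr_wpDl// ltr_pM2l// ltrDl.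
have [d d0 hd] := compact_support_uniform cK (sphi [::]).1 phiK c0.
exists (Num.min d 1); first by rewrite lt_min d0 ltr01.
move=> s /andP[s0]; rewrite lt_min => /andP[sd s1].
have M0 := @kernel_mass_gt0 R N s s0.
have phiKae : {ae m, forall x, ~ K x -> phi x = 0} by exact: aeW.
have Lphi := test_L2 tphi.
have Lm : L2 (mollify s phi).
  apply: (mollify_L2 Lphi _).1; apply: continuous_rV_measurable.
  exact: (smooth_mollify Lphi cK phiKae s [::]).1.
apply: le_lt_trans cV; rewrite /V expr2 -mulrA -ipZr// -ipZl//; last exact: L2Z.
apply: ip_le_norm; [by apply: L2B => //; exact: L2Z|exact: L2Z|].
apply: aeW => x; rewrite -[((_ *: _) - _) x]/((@kernel_mass R N s)^-1 * mollify s phi x - phi x).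
rewrite -[(c *: F) x]/(c * F x) /F indicE.
have [Fx|nFx] := pselect (fatten K 1 x).
  rewrite mem_set// mulr1 (gtr0_norm c0).
  rewrite -(@ler_pM2l _ (@kernel_mass R N s))// -{1}(gtr0_norm M0) -normrM mulrBr mulrA.
  rewrite divff ?gt_eqF// mul1r [leRHS]mulrC; apply: (mollify_test_close (d := d)) => //.
  by rewrite s0.
rewrite memNset// mulr0 normr0 phiK; last by move=> Kx; apply: nFx; exact: sub_fatten.
rewrite (mollify_eq0 Lphi cK phiKae) ?mulr0 ?subrr ?normr0//.
move=> [y Ky xy]; apply: nFx; exists y => // j; apply: le_trans (xy j) _; exact: ltW.
Qed.

(** The mollified functions are test functions, their energy is at most that of g,
    and they converge to g in L^2; bounded energy then suffices, without convergence
    of gradients. *)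
Theorem H10_of_compact_support g K : H1 g -> compact K -> K `<=` Om ->
  {ae m, forall x, ~ K x -> g x = 0} -> H10 Omega g.
Proof.
move=> Hg cK KO gK; have Lg := H1_L2 Hg.
have [r r0 rO] := fatten_sub_open cK (@domain_open _ _ Omega) KO.
pose M := \sum_(i < N) ip (grad g i) (grad g i).
apply: (H1_closure_of_bounded (test_0 Omega) (@testD _ _ Omega) (@testZ _ _ Omega) (M := M) Lg _).1.
move=> e e0; have e8 : 0 < e / 16 by rewrite divr_gt0.
have [phi tphi phig] := test_dense Lg e8.
have [d d0 hd] := mollify_test_cvg tphi e8.
pose s := Num.min (d / 2) (r / 2).
have s0 : 0 < s by rewrite lt_min !divr_gt0.
have sd : 0 < s < d.
  by rewrite s0 gt_min ltr_pdivrMr// ltr_pMr// ltr1n.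
have sr : s + s <= r.
  have : s <= r / 2 by rewrite ge_min lexx orbT.
  by move=> h; rewrite (splitr r) lerD.
have sO : fatten K (s + s) `<=` Om.
  by move=> x [y Ky xy]; apply: rO; exists y => // j; apply: le_trans (xy j) _.
have s1O : fatten K s `<=` Om.
  by move=> x [y Ky xy]; apply: sO; exists y => // j; apply: le_trans (xy j) _; rewrite lerDl ltW.
have C0 := @kernel_mass_gt0 R N s s0; set C := @kernel_mass R N s in C0 *.
have tm := test_mollify Lg cK gK s1O.
exists (C^-1 *: mollify s g).
  by apply: sub_H1_closure; [exact: test_H1 (testZ _ tm)|exact: testZ].
have Hm := test_H1 tm; have Lm := H1_L2 Hm.
split.
  rewrite (dformE (H1Z C^-1 Hm) (H1Z C^-1 Hm) (weak_gradZ C^-1 Lm (test_weak_grad tm)) (weak_gradZ C^-1 Lm (test_weak_grad tm))).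
  apply: ler_sum => i _; have Lp := test_partial_L2 i tm.
  rewrite ipZl ?ipZr//; last exact: L2Z.
  rewrite mulrA -expr2 -(@ler_pM2l _ (C ^+ 2)) ?exprn_gt0// mulrA -exprMn divff ?gt_eqF//.
  by rewrite expr1n mul1r; exact: (partial_mollify_le Lg cK gK i Hg (ltW s0) sO).
have Lphi := test_L2 tphi.
have [_ [K' [cK' K'O phiK]]] := tphi.
have phiKae : {ae m, forall x, ~ K' x -> phi x = 0} by exact: aeW.
have Lmp : L2 (mollify s phi).
  apply: (mollify_L2 Lphi _).1; apply: continuous_rV_measurable.
  exact: (smooth_mollify Lphi cK' phiKae s [::]).1.
have Lgp := L2B Lg Lphi.
have [Lmgp hgp] : L2 (mollify s (g - phi)) /\ ip (mollify s (g - phi)) (mollify s (g - phi)) <= C ^+ 2 * ip (g - phi) (g - phi).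
  by apply: mollify_L2 => //; rewrite mollifyB//; apply: L2_measurable (L2B Lm Lmp).
have SI := L2_semi_inner Omega.
(* three errors: mollifying g - phi, mollifying the test function phi, and phi - g *)
rewrite (_ : C^-1 *: mollify s g - g = (C^-1 *: mollify s (g - phi) + (C^-1 *: mollify s phi - phi)) + (phi - g)); last first.
  by rewrite mollifyB// scalerBr subrKA subrKA.
have L1 : L2 (C^-1 *: mollify s (g - phi)) by exact: L2Z.
have L3 : L2 (C^-1 *: mollify s phi - phi) by apply: L2B => //; exact: L2Z.
apply: le_lt_trans (si_sqrD SI (L2D L1 L3) (L2B Lphi Lg)) _.
have h2 := si_sqrD SI L1 L3.
have h3 : ip (C^-1 *: mollify s (g - phi)) (C^-1 *: mollify s (g - phi)) <= ip (phi - g) (phi - g).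
  rewrite ipZl ?ipZr//.
  rewrite -(opprB g phi) ipNl ?ipNr ?opprK//; last by apply: L2N.
  rewrite mulrA -expr2 -(@ler_pM2l _ (C ^+ 2)) ?exprn_gt0// mulrA -exprMn divff ?gt_eqF//.
  by rewrite expr1n mul1r.
have := hd s sd; rewrite -/C; move: h2 h3 phig.
move: (ip (_ + _) _) (ip (phi - g) _) (ip (_ *: _) _) (ip (_ *: _ - _) _) => a b p q *; lra.
Qed.

End mollification.

(** * Resolvents and positive parts *)

Section pospart.
Context {R : realType} {N : nat} (Omega : domain R N).
Local Notation E := 'rV[R]_N.
Local Notation m := (m Omega).
Local Notation L2 := (L2 Omega).
Local Notation ip := (ip Omega).
Implicit Types (u v w f g : E -> R).

Definition pospart w : E -> R := fun x => Num.max (w x) 0.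

Lemma pospart_ge0 w x : 0 <= pospart w x.
Proof. by rewrite /pospart le_max lexx orbT. Qed.

Lemma ae_pospart_ge0 w : {ae m, forall x, 0 <= pospart w x}.
Proof. by apply: aeW => x; exact: pospart_ge0. Qed.

Lemma L2_pospart w : L2 w -> L2 (pospart w).
Proof. by move=> Lw; apply: L2_max => //; exact: L2_0. Qed.

Lemma pospart_sub w : w = pospart w - pospart (- w).
Proof.
apply/funext => x; rewrite -[RHS]/(Num.max (w x) 0 - Num.max (- w x) 0).
by have [h|h] := leP 0 (w x); have [h'|h'] := leP 0 (- w x); lra.
Qed.

Lemma pospart_disjoint w x : pospart w x * pospart (- w) x = 0.
Proof.
rewrite -[LHS]/(Num.max (w x) 0 * Num.max (- w x) 0).
have [h|h] := leP 0 (w x); have [h'|h'] := leP 0 (- w x); rewrite ?mulr0 ?mul0r//.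
by rewrite (_ : w x = 0) ?mul0r//; lra.
Qed.

Lemma ip_pospart_disjoint w : ip (pospart w) (pospart (- w)) = 0.
Proof.
rewrite /Defs.ip (_ : (fun x => _) = cst 0).
  by rewrite /Rintegral integral0.
by apply/funext => x; exact: pospart_disjoint.
Qed.

Lemma ip_pospart_self w : L2 w -> ip w (pospart w) = ip (pospart w) (pospart w).
Proof.
move=> Lw; rewrite {1}(pospart_sub w) ipBl; last 3 first.
- exact: L2_pospart.
- by apply: L2_pospart; exact: L2N.
- exact: L2_pospart.
by rewrite [ip (pospart (- w)) _]ipC ip_pospart_disjoint subr0.
Qed.

Lemma pospart_lip (a b : R) : `|Num.max a 0 - Num.max b 0| <= `|a - b|.
Proof.
have [a0|a0] := leP 0 a; have [b0|b0] := leP 0 b.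
- by [].
- by rewrite subr0 !ger0_norm//; lra.
- by rewrite sub0r normrN ger0_norm// ler0_norm; lra.
- by rewrite subrr normr0.
Qed.

Lemma ip_pospart_lip u v : L2 u -> L2 v ->
  ip (pospart u - pospart v) (pospart u - pospart v) <= ip (u - v) (u - v).
Proof.
move=> Lu Lv; apply: ip_le_norm; first by apply: L2B; exact: L2_pospart.
  exact: L2B.
by apply: aeW => x; exact: pospart_lip.
Qed.

Lemma ae_le0_of_pospart w : L2 w -> ip (pospart w) (pospart w) <= 0 ->
  {ae m, forall x, w x <= 0}.
Proof.
move=> Lw w0; have /ip_eq0 : L2 (pospart w) by exact: L2_pospart.
have -> : ip (pospart w) (pospart w) = 0 by apply/eqP; rewrite eq_le w0 ip_ge0.
move=> /(_ erefl); apply: filterS => x h.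
by rewrite -h /pospart le_max lexx.
Qed.

End pospart.

Lemma dformbE {R : realType} {N : nat} (Omega : domain R N) (b : R) u v :
  dformb Omega b u v = dform Omega u v + b * ip Omega u v.
Proof. by []. Qed.

(* Otherwise unification unfolds the forms down to integrals. *)
Local Opaque Defs.dform Defs.ip Defs.H1_closure Defs.L2.

Section resolvent.
Context {R : realType} {N : nat} (Omega : domain R N).
Local Notation E := 'rV[R]_N.
Local Notation m := (m Omega).
Local Notation L2 := (L2 Omega).
Local Notation ip := (ip Omega).
Local Notation H1 := (H1 Omega).
Local Notation dform := (dform Omega).
Local Notation dformb := (dformb Omega).
Local Notation test := (test_function Omega).
Implicit Types (u v w f g : E -> R).

Variable C : set (E -> R).
Hypotheses (C0 : C 0) (CD : forall u v, C u -> C v -> C (u + v))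
  (CZ : forall (a : R) u, C u -> C (a *: u)) (testC : test `<=` C).
Local Notation D := (H1_closure Omega C).

(** A relation instead of a function, because the solution is determined only up to
    null sets. *)
Definition resolvent (b : R) f u := D u /\ forall v, D v -> dformb b u v = ip f v.

Let SI (b : R) (b0 : 0 <= b) : semi_inner D (dformb b).
Proof. exact: (@H1_closure_semi_inner _ _ Omega C C0 CD CZ). Qed.
Let SI0 : semi_inner D dform.
Proof.
have [h1 h2 h3 h4 h5 h6 h7] := SI (lexx 0).
have e0 u v : dformb 0 u v = dform u v by rewrite dformbE mul0r addr0.
split; [exact: h1|exact: h2|exact: h3| | | |].
- by move=> x y Dx Dy; rewrite -!e0; exact: h4.
- by move=> x y z Dx Dy Dz; rewrite -!e0; exact: h5.
- by move=> a x z Dx Dz; rewrite -!e0; exact: h6.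
- by move=> x Dx; rewrite -!e0; exact: h7.
Qed.
Let DL2 u : D u -> L2 u. Proof. exact: H1_closure_L2. Qed.
Let SL := L2_semi_inner Omega.

Lemma H1_closure_test phi : test phi -> D phi.
Proof. by move=> tphi; apply: sub_H1_closure; [exact: test_H1|exact: testC]. Qed.

Lemma resolvent_exists (b : R) f : 0 < b -> L2 f -> exists u, resolvent b f u.
Proof.
move=> b0 Lf; have [||||u Du hu] := @si_riesz _ _ _ _ (SI (ltW b0)) (ip f) (b^-1 * ip f f)
  (@H1_closure_complete _ _ Omega C b b0).
- by move=> u v Du Dv; apply: ipDr => //; exact: DL2.
- by move=> a u Du; apply: ipZr => //; exact: DL2.
- by rewrite mulr_ge0 ?ip_ge0// invr_ge0 ltW.
- move=> u Du; have Lu := DL2 Du.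
  apply: le_trans (si_cauchy_schwarz SL Lf Lu) _.
  rewrite mulrC mulrA ler_wpM2r ?ip_ge0// ler_pdivlMr// mulrC dformbE lerDr.
  exact: dform_ge0.
by exists u.
Qed.

Lemma resolvent_form_operator (b : R) f u : L2 f -> resolvent b f u ->
  form_operator Omega D u (f - b *: u).
Proof.
move=> Lf [Du hu]; have Lu := DL2 Du; split => //; first by apply: L2B => //; exact: L2Z.
move=> v Dv; have Lv := DL2 Dv; have := hu v Dv; rewrite dformbE ipBl ?ipZl//; last exact: L2Z.
by move=> <-; rewrite addrK.
Qed.

Lemma resolvent_contraction (b : R) f u : 0 < b -> L2 f -> resolvent b (b *: f) u ->
  ip u u <= ip f f.
Proof.
move=> b0 Lf [Du hu]; have Lu := DL2 Du.
have h : ip u u <= ip f u.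
  have := hu u Du; rewrite dformbE ipZl// => h1; have := dform_ge0 Omega u => h2.
  by rewrite -(ler_pM2l b0) -h1 lerDr.
have := ip_ge0 Omega (f - u); rewrite (siBB SL)//.
by move: h; move: (ip u u) (ip f u) (ip f f) => p q r *; lra.
Qed.

Lemma resolventD (b : R) f g u v : L2 f -> L2 g -> resolvent b f u -> resolvent b g v ->
  resolvent b (f + g) (u + v).
Proof.
move=> Lf Lg [Du hu] [Dv hv]; split; first exact: (siD SI0).
move=> z Dz; rewrite ipDl//; last exact: DL2.
rewrite -(hu _ Dz) -(hv _ Dz) !dformbE (siDl SI0 Du Dv Dz) (ipDl (DL2 Du) (DL2 Dv) (DL2 Dz)).
by rewrite mulrDr addrACA.
Qed.

Lemma resolventZ (b a : R) f u : L2 f -> resolvent b f u ->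
  resolvent b (a *: f) (a *: u).
Proof.
move=> Lf [Du hu]; split; first exact: (siZ SI0).
move=> z Dz; rewrite ipZl//; last exact: DL2.
rewrite -(hu _ Dz) !dformbE (siZl SI0 _ Du Dz) (ipZl _ (DL2 Du) (DL2 Dz)).
by rewrite mulrDr mulrCA.
Qed.

(** Yosida approximation: [b * ip (w - u) w] is the energy of w for the approximating
    form, where [u] is [b] times the resolvent of [w]. *)
Lemma yosida_form (b : R) w u : L2 w -> resolvent b (b *: w) u ->
  dform u u + b * ip (w - u) (w - u) = b * ip (w - u) w.
Proof.
move=> Lw [Du hu]; have Lu := DL2 Du; have Lwu := L2B Lw Lu.
have := hu u Du; rewrite dformbE ipZl// => h.
rewrite [ip (w - u) (w - u)]ipBr// [ip (w - u) u]ipBl//.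
have -> : dform u u = b * ip w u - b * ip u u by rewrite -h addrK.
by move: (ip (w - u) w) (ip w u) (ip u u) => p q r; ring.
Qed.

(** The form is nonnegative at [u - v]. *)
Lemma yosida_form_le (b : R) v u : 0 < b -> D v -> resolvent b (b *: v) u ->
  b * ip (v - u) v <= dform v v.
Proof.
move=> b0 Dv [Du hu]; have Lu := DL2 Du; have Lv := DL2 Dv; have Lvu := L2B Lv Lu.
have h1 := hu v Dv; rewrite dformbE ipZl// in h1.
have h2 := yosida_form Lv (conj Du hu).
have h3 := si_ge0 SI0 (siB SI0 Du Dv); rewrite (siBB SI0)// in h3.
have h4 : b * ip (v - u) v = dform u v by rewrite ipBl// mulrBr -h1 addrK.
have h5 : 0 <= b * ip (v - u) (v - u) by rewrite mulr_ge0 ?ip_ge0// ltW.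
move: h2 h3 h4 h5; move: (b * ip (v - u) v) (b * _) (dform u v) (dform u u) (dform v v) => p q r s t *; lra.
Qed.

Lemma resolvent_close (b : R) v u : 0 < b -> D v -> resolvent b (b *: v) u ->
  b * ip (v - u) (v - u) <= dform v v.
Proof.
move=> b0 Dv ru; have := yosida_form_le b0 Dv ru; rewrite -(yosida_form (DL2 Dv) ru).
have := dform_ge0 Omega u; move: (dform _ _) (dform _ _) (b * _) => p q r *; lra.
Qed.

(** Clear for test functions by [resolvent_close]; they are dense and the resolvents
    are contractions. *)
Lemma resolvent_cvg f (e : R) : L2 f -> 0 < e -> exists2 b0 : R, 0 < b0 &
  forall b u, b0 < b -> resolvent b (b *: f) u -> ip (u - f) (u - f) < e.
Proof.
move=> Lf e0; have e8 : 0 < e / 16 by rewrite divr_gt0.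
have [v tv vf] := test_dense Lf e8.
have Dv := H1_closure_test tv; have Lv := DL2 Dv.
have d1 : 0 < dform v v + 1 by rewrite ltr_wpDl// dform_ge0.
exists ((dform v v + 1) / (e / 16)); first by rewrite divr_gt0.
move=> b u bb ru; have b0 : 0 < b by apply: lt_trans bb; rewrite divr_gt0.
have [w rw] := resolvent_exists b0 (L2Z b Lv).
have Lu := DL2 ru.1; have Lw := DL2 rw.1; have Lfv := L2B Lf Lv.
have Lbf := L2Z b Lf; have Lbv := L2Z b Lv.
have r1 : resolvent b (b *: (f - v)) (u - w).
  rewrite scalerBr -[- w]scaleN1r -[- (b *: v)]scaleN1r; apply: resolventD => //.
    exact: L2Z.
  exact: resolventZ.
have h1 := resolvent_contraction b0 Lfv r1.
have h2 := resolvent_close b0 Dv rw.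
have h3 : ip (v - w) (v - w) < e / 16.
  rewrite -(ltr_pM2l b0); apply: le_lt_trans h2 _.
  apply: lt_le_trans (_ : dform v v + 1 <= _); first by rewrite ltrDl.
  by rewrite -ler_pdivrMr// ltW.
rewrite (_ : u - f = (u - w) + ((w - v) + (v - f))); last by rewrite !addrA !subrK.
have L1 := L2B Lu Lw; have L2' := L2B Lw Lv; have L3 := L2B Lv Lf.
apply: le_lt_trans (si_sqrD SL L1 (L2D L2' L3)) _.
have := si_sqrD SL L2' L3.
move: h1 h3 vf; rewrite (si_subC SL Lf Lv) (si_subC SL Lv Lw).
move: (ip (u - w) (u - w)) (ip (w - v) (w - v)) (ip (v - f) (v - f)) (ip (_ + _) (_ + _)) => p q r s *; lra.
Qed.

Section lattice.
(** Positivity of the resolvents stands in for the Markov property of the form: it is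
    what makes the form domain a lattice. *)
Hypothesis resolvent_ge0 : forall (b : R) f u, 0 < b -> L2 f ->
  {ae m, forall x, 0 <= f x} -> resolvent b f u -> {ae m, forall x, 0 <= u x}.

(** The approximating forms decrease under [pospart]: their off-diagonal part is the
    positive resolvent. *)
Lemma dform_pospart v : D v -> D (pospart v) /\ dform (pospart v) (pospart v) <= dform v v.
Proof.
move=> Dv; have Lv := DL2 Dv; pose p := pospart v; pose q := pospart (- v).
have Lp : L2 p by exact: L2_pospart.
have Lq : L2 q by apply: L2_pospart; exact: L2N.
have vpq : v = p - q by exact: pospart_sub.
have key (b : R) u : 0 < b -> resolvent b (b *: p) u ->
    dform u u + b * ip (p - u) (p - u) <= dform v v.
  move=> b0 ru; have Lu := DL2 ru.1.
  have [w rw] := resolvent_exists b0 (L2Z b Lq); have Lw := DL2 rw.1.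
  have Lbp := L2Z b Lp; have Lbq := L2Z b Lq.
  have rv : resolvent b (b *: v) (u - w).
    rewrite vpq scalerBr -[- w]scaleN1r -[- (b *: q)]scaleN1r; apply: resolventD => //.
      exact: L2Z.
    exact: resolventZ.
  have h1 := yosida_form_le b0 Dv rv.
  have h2 := yosida_form Lp ru.
  have h3 := yosida_form Lq rw.
  have u0 : {ae m, forall x, 0 <= u x}.
    apply: (resolvent_ge0 b0 Lbp _ ru); apply: aeW => x.
    by rewrite -[(b *: p) x]/(b * p x) mulr_ge0 ?pospart_ge0// ltW.
  have w0 : {ae m, forall x, 0 <= w x}.
    apply: (resolvent_ge0 b0 Lbq _ rw); apply: aeW => x.
    by rewrite -[(b *: q) x]/(b * q x) mulr_ge0 ?pospart_ge0// ltW.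
  have uq : 0 <= b * ip u q by rewrite mulr_ge0 ?(ltW b0)// ip_nneg//; exact: ae_pospart_ge0.
  have wp : 0 <= b * ip w p by rewrite mulr_ge0 ?(ltW b0)// ip_nneg//; exact: ae_pospart_ge0.
  have ww : 0 <= b * ip (q - w) (q - w) by rewrite mulr_ge0 ?ip_ge0// ltW.
  have dw := dform_ge0 Omega w.
  have pq0 : ip p q = 0 by exact: ip_pospart_disjoint.
  (* the cross terms [ip u q] and [ip w p] are nonnegative because the resolvents
     of the nonnegative functions p and q are *)
  have E1 : ip (v - (u - w)) v = ip (p - u) p + ip (q - w) q + ip u q + ip w p.
    have Lpu := L2B Lp Lu; have Lqw := L2B Lq Lw.
    rewrite {1 2}vpq (_ : p - q - (u - w) = (p - u) - (q - w)); last first.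
      apply/funext => x; rewrite -[LHS]/(p x - q x - (u x - w x)).
      by rewrite -[RHS]/(p x - u x - (q x - w x)); ring.
    rewrite ipBl ?ipBr//; try exact: L2B.
    rewrite (ipBl Lp Lu Lq) (ipBl Lq Lw Lp) pq0 [ip q p]ipC pq0; ring.
  rewrite E1 !mulrDr -h2 -h3 -!addrA in h1; apply: le_trans h1; rewrite lerD2l lerDl.
  by rewrite !addr_ge0.
apply: (H1_closure_of_bounded C0 CD CZ Lp) => e e0.
have d1 : 0 < dform v v + 1 by rewrite ltr_wpDl// dform_ge0.
pose b := (dform v v + 1) / e; have b0 : 0 < b by rewrite divr_gt0.
have [u ru] := resolvent_exists b0 (L2Z b Lp); have Lu := DL2 ru.1.
have h := key _ _ b0 ru; exists u; first exact: ru.1.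
have i0 := ip_ge0 Omega (p - u); have d0 := dform_ge0 Omega u.
split; first by apply: le_trans h; rewrite lerDl mulr_ge0// ltW.
rewrite (si_subC SL Lu Lp) -(ltr_pM2l b0) /b divfK ?gt_eqF//.
apply: (@le_lt_trans _ _ (dform v v)); last by rewrite ltrDl.
by apply: le_trans h; rewrite lerDr.
Qed.

Lemma H1_closure_pospart v : D v -> D (pospart v).
Proof. by move=> /dform_pospart[]. Qed.

(** For s > 0, [pospart (p - s *: q) = p] for the positive part p and the negative
    part q; compare the energies, divide by s and let s tend to 0. *)
Lemma dform_disjoint_le0 v : D v -> dform (pospart v) (pospart (- v)) <= 0.
Proof.
move=> Dv; have DN : D (- v) by exact: (siN SI0).
pose p := pospart v; pose q := pospart (- v).
have Dp : D p by exact: H1_closure_pospart.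
have Dq : D q by exact: H1_closure_pospart.
have key (s : R) : 0 < s -> 2 * dform p q <= s * dform q q.
  move=> s0; have Ds : D (p - s *: q) by apply: (siB SI0) => //; exact: (siZ SI0).
  have := (dform_pospart Ds).2.
  have -> : pospart (p - s *: q) = p.
    apply/funext => x; rewrite -[LHS]/(Num.max (p x - s * q x) 0).
    have := pospart_disjoint v x; rewrite -/p -/q => /eqP; rewrite mulf_eq0 => /orP[]/eqP h.
      by rewrite h max_r// sub0r oppr_le0 mulr_ge0 ?pospart_ge0// ltW.
    by rewrite h mulr0 subr0 max_l// pospart_ge0.
  rewrite (siBB SI0 Dp (siZ SI0 s Dq)) (siZr SI0 s Dq Dp) (siZZ SI0 s Dq) => h.
  rewrite -(ler_pM2l s0); move: h; rewrite expr2 -mulrA.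
  move: (dform p p) (dform p q) (dform q q) => a b c h.
  have -> : s * (2 * b) = 2 * (s * b) by ring.
  by move: (s * b) (s * (s * c)) h => ? ? *; lra.
rewrite leNgt; apply/negP => pq.
have q0 := dform_ge0 Omega q.
have d1 : 0 < dform q q + 1 by rewrite ltr_wpDl.
have := key (dform p q / (dform q q + 1)) (divr_gt0 pq d1).
rewrite leNgt => /negP; apply.
rewrite mulrAC ltr_pdivrMr//.
move: (dform p q) (dform q q) pq q0 => a b a0 b0; nra.
Qed.

Lemma dform_pospart_le v : D v ->
  dform (pospart v) (pospart v) <= dform v (pospart v).
Proof.
move=> Dv; have Dp := H1_closure_pospart Dv.
have Dq := H1_closure_pospart (siN SI0 Dv).
have -> : dform v (pospart v) = dform (pospart v - pospart (- v)) (pospart v).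
  by rewrite -pospart_sub.
rewrite (siBl SI0 Dp Dq Dp) (siC SI0 Dq Dp); have := dform_disjoint_le0 Dv.
by move: (dform (pospart v) (pospart v)) (dform (pospart v) (pospart (- v))) => a b *; lra.
Qed.

Lemma H1_closure_norm v : D v -> D (fun x => `|v x|) /\
  dform (fun x => `|v x|) (fun x => `|v x|) <= dform v v.
Proof.
move=> Dv; have Dp := H1_closure_pospart Dv.
have Dq := H1_closure_pospart (siN SI0 Dv).
have -> : (fun x => `|v x|) = pospart v + pospart (- v).
  apply/funext => x; rewrite -[RHS]/(Num.max (v x) 0 + Num.max (- v x) 0).
  have [h|h] := leP 0 (v x); have [h'|h'] := leP 0 (- v x).
  - by rewrite ger0_norm//; lra.
  - by rewrite ger0_norm// addr0.
  - by rewrite ltr0_norm// add0r.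
  - lra.
split; first exact: (siD SI0).
have -> : dform v v = dform (pospart v - pospart (- v)) (pospart v - pospart (- v)).
  by rewrite -pospart_sub.
rewrite (siDD SI0 Dp Dq) (siBB SI0 Dp Dq); have := dform_disjoint_le0 Dv.
move: (dform (pospart v) (pospart v)) (dform (pospart v) (pospart (- v))).
by move: (dform (pospart (- v)) (pospart (- v))) => a b c *; lra.
Qed.

End lattice.

End resolvent.

(** * From semigroups to resolvents; the domains of the two forms *)

Section l2_limits.
Context {R : realType} {N : nat} (Omega : domain R N).
Local Notation E := 'rV[R]_N.
Local Notation m := (m Omega).
Local Notation L2 := (L2 Omega).
Local Notation ip := (ip Omega).
Implicit Types (u v w f g : E -> R).

Lemma ip_le0_closed g n : L2 g -> L2 n ->
  (forall e : R, 0 < e -> exists q, [/\ L2 q, ip (q - g) (q - g) < e & ip q n <= 0]) ->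
  ip g n <= 0.
Proof.
move=> Lg Ln H; rewrite leNgt; apply/negP => c0.
have SL := L2_semi_inner Omega.
have n1 : 0 < ip n n + 1 by rewrite ltr_wpDl// ip_ge0.
have [q [Lq qg qn]] := H _ (divr_gt0 (exprn_gt0 2 c0) n1).
have := si_cauchy_schwarz SL (L2B Lq Lg) Ln.
rewrite ltr_pdivlMr// in qg; rewrite (ipBl Lq Lg Ln).
have := ip_ge0 Omega n; have := ip_ge0 Omega (q - g); move: qg qn c0.
move: (ip (q - g) (q - g)) (ip n n) (ip q n) (ip g n) => a b x c *; nra.
Qed.

Lemma L2norm_cvg0 (F : R -> E -> R) : (forall t, 0 < t -> L2 (F t)) ->
  L2norm Omega (F t) @[t --> 0^'+] --> 0%E -> forall e : R, 0 < e ->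
  exists2 d : R, 0 < d & forall t, 0 < t < d -> ip (F t) (F t) < e.
Proof.
move=> LF F0 e e0; have se : 0 < Num.sqrt e by rewrite sqrtr_gt0.
have : \forall t \near 0^'+, (L2norm Omega (F t) < (Num.sqrt e)%:E)%E.
  have o : nbhs (0%E : \bar R) [set y | (y < (Num.sqrt e)%:E)%E].
    by apply: open_nbhs_nbhs; split; [exact: open_ereal_lt_ereal|rewrite /= lte_fin].
  exact: (F0 _ o).
move=> /nbhs_ballP[d /= d0 hd]; exists d => // t /andP[t0 td].
have := hd t; rewrite /ball/= sub0r normrN gtr0_norm// => /(_ td t0).
by rewrite L2norm_ip ?lte_fin ?ltr_sqrt//; exact: LF.
Qed.

Lemma L2norm_le_ip f g : L2 f -> L2 g -> (L2norm Omega f <= L2norm Omega g)%E ->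
  ip f f <= ip g g.
Proof.
by move=> Lf Lg; rewrite !L2norm_ip// lee_fin ler_sqrt// ip_ge0.
Qed.

End l2_limits.

Section semigroup.
Context {R : realType} {N : nat} (Omega : domain R N).
Local Notation E := 'rV[R]_N.
Local Notation m := (m Omega).
Local Notation L2 := (L2 Omega).
Local Notation ip := (ip Omega).
Local Notation dform := (dform Omega).
Local Notation test := (test_function Omega).
Implicit Types (u v w f g : E -> R).
Variables (C : set (E -> R)).
Local Notation D := (H1_closure Omega C).
Variables (T : R -> (E -> R) -> E -> R).
Hypothesis hT : semigroup_of Omega D T.
Let SL := L2_semi_inner Omega.

Lemma semigroup_ip_contraction t f : 0 <= t -> L2 f -> ip (T t f) (T t f) <= ip f f.
Proof.
move=> t0 Lf; apply: L2norm_le_ip => //; first exact: (semigroup_L2 hT).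
exact: (semigroup_contraction hT).
Qed.

Lemma semigroup_ae t f g : 0 <= t -> L2 f -> L2 g -> {ae m, forall x, f x = g x} ->
  {ae m, forall x, T t f x = T t g x}.
Proof.
move=> t0 Lf Lg fg; have LB := L2B Lf Lg.
have B0 : ip (f - g) (f - g) = 0.
  by apply: ip_ae0 => //; apply: filterS fg => x h; rewrite -[LHS]/(f x - g x) h subrr.
have TB0 : {ae m, forall x, T t (f - g) x = 0}.
  apply: ip_eq0; first exact: (semigroup_L2 hT).
  by apply/eqP; rewrite eq_le ip_ge0 andbT -B0 semigroup_ip_contraction.
have := @semigroup_linear _ _ _ _ _ hT t (-1) g f t0 Lg Lf.
have -> : (fun y => -1 * g y + f y) = f - g.
  by apply/funext => y; rewrite mulN1r addrC.
by apply: filterS2 TB0 => x -> h; move: h; move: (T t g x) (T t f x) => a b *; lra.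
Qed.

Lemma semigroup_sub t f g : 0 <= t -> L2 f -> L2 g ->
  {ae m, forall x, T t (f - g) x = T t f x - T t g x}.
Proof.
move=> t0 Lf Lg; have := @semigroup_linear _ _ _ _ _ hT t (-1) g f t0 Lg Lf.
have -> : (fun y => -1 * g y + f y) = f - g.
  by apply/funext => y; rewrite mulN1r addrC.
by apply: filterS => x ->; rewrite mulN1r addrC.
Qed.

Lemma generator_close u f (e : R) : form_operator Omega D u f -> 0 < e ->
  exists2 d : R, 0 < d & forall t, 0 < t < d ->
  ip (t^-1 *: (u - T t u) - f) (t^-1 *: (u - T t u) - f) < e.
Proof.
move=> uf; have Lu := H1_closure_L2 (let: And3 h _ _ := uf in h).
have Lf : L2 f by case: uf.
move=> e0; have h := (semigroup_generator hT Lu Lf).2 uf.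
apply: (@L2norm_cvg0 _ _ _ (fun t => t^-1 *: (u - T t u) - f) _ h) => // t t0.
apply: L2B => //; apply: L2Z; apply: L2B => //; apply: (semigroup_L2 hT) => //; exact: ltW.
Qed.

Section positive.
Hypothesis T_ge0 : forall t f, 0 <= t -> L2 f -> {ae m, forall x, 0 <= f x} ->
  {ae m, forall x, 0 <= T t f x}.

(** If [u] is the resolvent of [f], then [f - b *: u] is the limit of
    [t^-1 *: (u - T t u)], whose product with the negative part of [u] is at most 0. *)
Lemma resolvent_ge0_of_semigroup (b : R) f u : 0 < b -> L2 f ->
  {ae m, forall x, 0 <= f x} -> resolvent Omega C b f u -> {ae m, forall x, 0 <= u x}.
Proof.
move=> b0 Lf f0 ru; have Lu := H1_closure_L2 ru.1.
have uf := resolvent_form_operator Lf ru.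
pose p := pospart u; pose n := pospart (- u).
have Lp : L2 p by exact: L2_pospart.
have Ln : L2 n by apply: L2_pospart; exact: L2N.
have Lg : L2 (f - b *: u) by case: uf.
have key : ip (f - b *: u) n <= 0.
  apply: ip_le0_closed => // e e0; have [d d0 hd] := generator_close uf e0.
  pose t := d / 2; have t0 : 0 < t by rewrite divr_gt0.
  have td : 0 < t < d by rewrite t0 ltr_pdivrMr// ltr_pMr// ltr1n.
  have LT g : L2 g -> L2 (T t g) by move=> *; apply: (semigroup_L2 hT) => //; exact: ltW.
  exists (t^-1 *: (u - T t u)); split.
  - by apply: L2Z; apply: L2B => //; exact: LT.
  - exact: hd.
  have LuT := L2B Lu (LT _ Lu).
  rewrite (ipZl _ LuT Ln) pmulr_rle0 ?invr_gt0//.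
  have E1 : {ae m, forall x, (u - T t u) x = ((p - n) - (T t p - T t n)) x}.
    have := semigroup_sub (ltW t0) Lp Ln; rewrite -(pospart_sub u).
    by apply: filterS => x; rewrite -[(u - _) x]/(u x - T t u x) => ->.
  rewrite (ip_aeql LuT (L2B (L2B Lp Ln) (L2B (LT _ Lp) (LT _ Ln))) Ln E1).
  rewrite (ipBl (L2B Lp Ln) (L2B (LT _ Lp) (LT _ Ln)) Ln) (ipBl Lp Ln Ln).
  rewrite (ipBl (LT _ Lp) (LT _ Ln) Ln) ip_pospart_disjoint.
  have h1 : 0 <= ip (T t p) n.
    apply: ip_nneg (LT _ Lp) Ln _ (ae_pospart_ge0 _ _).
    by apply: T_ge0 => //; [exact: ltW|exact: ae_pospart_ge0].
  have h2 := si_ge0 SL (L2B (LT _ Ln) Ln); rewrite (siBB SL (LT _ Ln) Ln) in h2.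
  have h3 := semigroup_ip_contraction (ltW t0) Ln.
  move: h1 h2 h3; move: (ip (T t p) n) (ip (T t n) (T t n)) (ip (T t n) n) (ip n n) => a c x y *; lra.
rewrite (ipBl Lf (L2Z b Lu) Ln) (ipZl _ Lu Ln) in key.
have fn : 0 <= ip f n by apply: ip_nneg => //; exact: ae_pospart_ge0.
have un : ip u n = - ip n n.
  have := ip_pospart_self (L2N Lu); rewrite -/n => <-.
  by rewrite (ipNl Lu Ln) opprK.
have := ae_le0_of_pospart (L2N Lu); rewrite -/n => h.
have : {ae m, forall x, (- u) x <= 0}.
  apply: h; rewrite -(pmulr_rle0 _ b0).
  move: key fn; rewrite un mulrN; move: (b * _) (ip f n) => *; lra.
by apply: filterS => x; rewrite oppr_le0.
Qed.

End positive.
End semigroup.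

Section dirichlet_neumann.
Context {R : realType} {N : nat} (Omega : domain R N).
Local Notation E := 'rV[R]_N.
Local Notation m := (m Omega).
Local Notation L2 := (L2 Omega).
Local Notation ip := (ip Omega).
Local Notation dform := (dform Omega).
Local Notation dformb := (dformb Omega).
Local Notation test := (test_function Omega).
Local Notation Cc := (Cc_closure Omega).
Local Notation H := (H10 Omega).
Local Notation F := (tildeH1 Omega).
Implicit Types (u v w f g : E -> R).

Lemma Cc_closure0 : Cc 0.
Proof.
split; first exact: (continuous_subspaceT (@cst_continuous E R 0)).
by exists set0; split => //; exact: compact0.
Qed.

Lemma Cc_closureD u v : Cc u -> Cc v -> Cc (u + v).
Proof.
move=> [cu [K [cK KO uK]]] [cv [K' [cK' KO' vK']]]; split.
  by move=> x; exact: (cvgD (cu x) (cv x)).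
exists (K `|` K'); split; first exact: compactU.
  by move=> x [/KO|/KO'].
move=> x Ox /not_orP[nK nK'].
by rewrite -[LHS]/(u x + v x) uK// vK'// addr0.
Qed.

Lemma Cc_closureZ (a : R) u : Cc u -> Cc (a *: u).
Proof.
move=> [cu [K [cK KO uK]]]; split.
  by move=> x; exact: (cvgM (cvg_cst a) (cu x)).
by exists K; split => // x Ox nK; rewrite -[LHS]/(a * u x) uK// mulr0.
Qed.

Lemma test_Cc : test `<=` Cc.
Proof.
move=> phi [sphi [K [cK KO phiK]]]; split.
  by apply: continuous_subspaceT; exact: (sphi [::]).1.
exists K; split => //; first by move=> x Kx; apply: subset_closure; exact: KO.
by move=> x _; exact: phiK.
Qed.

Lemma H10_tildeH1 : H `<=` F.
Proof.
move=> u [Hu hu]; split => // e /hu[v [Hv tv uv]]; exists v; split => //.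
exact: test_Cc.
Qed.

Lemma tildeH1_semi_inner (b : R) : 0 <= b -> semi_inner F (dformb b).
Proof. exact: (@H1_closure_semi_inner _ _ Omega Cc Cc_closure0 Cc_closureD Cc_closureZ). Qed.

Lemma H10_semi_inner (b : R) : 0 <= b -> semi_inner H (dformb b).
Proof. exact: (@H1_closure_semi_inner _ _ Omega test (test_0 Omega) (@testD _ _ Omega) (@testZ _ _ Omega)). Qed.

(** The positivity of the Neumann resolvents will come from the process, whose transition
    probabilities are the Neumann semigroup. *)
Hypothesis FR : forall (b : R) f u, 0 < b -> L2 f ->
  {ae m, forall x, 0 <= f x} -> resolvent Omega Cc b f u -> {ae m, forall x, 0 <= u x}.

Let SI0 : semi_inner (H1 Omega) dform := dform_semi_inner Omega.
Let FH u : F u -> H1 Omega u. Proof. exact: H1_closure_H1. Qed.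
Let FL u : F u -> L2 u. Proof. exact: H1_closure_L2. Qed.
Let HL u : H u -> L2 u. Proof. exact: H1_closure_L2. Qed.

Let FB u v : F u -> F v -> F (u - v). Proof. exact: (siB (tildeH1_semi_inner ler01)). Qed.

Lemma tildeH1_pospart v : F v -> F (pospart v).
Proof. exact: (H1_closure_pospart Cc_closure0 Cc_closureD Cc_closureZ FR). Qed.

Lemma tildeH1_dform_pospart v : F v -> dform (pospart v) (pospart v) <= dform v v.
Proof. by move=> /(dform_pospart Cc_closure0 Cc_closureD Cc_closureZ FR)[]. Qed.

Lemma tildeH1_dform_pospart_le v : F v -> dform (pospart v) (pospart v) <= dform v (pospart v).
Proof. exact: (dform_pospart_le Cc_closure0 Cc_closureD Cc_closureZ FR). Qed.

(** The energy of [pospart z] is at most [dformb b z (pospart z)], hence it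
    vanishes. *)
Lemma tildeH1_le0 (b : R) z : 0 < b -> F z -> dformb b z (pospart z) <= 0 ->
  {ae m, forall x, z x <= 0}.
Proof.
move=> b0 Fz zz; have Lz := FL Fz; apply: ae_le0_of_pospart => //.
rewrite dformbE (ip_pospart_self Lz) in zz; rewrite -(pmulr_rle0 _ b0).
have := tildeH1_dform_pospart_le Fz; have := dform_ge0 Omega (pospart z); move: zz.
by move: (b * _) (dform _ _) (dform _ _) => p q r *; lra.
Qed.

(** H10 is an order ideal. The approximants [pospart (psi - v)], psi a test
    function, have bounded energy and vanish outside the support of psi. *)
Lemma H10_pospart_sub u v : H u -> F v -> {ae m, forall x, 0 <= v x} -> H (pospart (u - v)).
Proof.
move=> Hu Fv v0; have Lu := HL Hu; have Lv := FL Fv; have Fu := H10_tildeH1 Hu.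
pose M := 2 * dform (u - v) (u - v) + 2.
apply: (H1_closure_of_bounded (test_0 Omega) (@testD _ _ Omega) (@testZ _ _ Omega) (M := M) (L2_pospart (L2B Lu Lv)) _).1.
move=> e e0; have e1 : 0 < Num.min e 1 by rewrite lt_min e0 ltr01.
have [Hu1 hu] := Hu; have [psi [Hpsi tpsi psiu]] := hu _ e1.
have Hpu := siB SI0 Hpsi Hu1.
have Lpsi := test_L2 tpsi.
have : dform (psi - u) (psi - u) + ip (psi - u) (psi - u) < Num.min e 1 by exact: psiu.
rewrite lt_min => /andP[le le1].
have d0 := dform_ge0 Omega (psi - u); have i0 := ip_ge0 Omega (psi - u).
have Fpsi : F psi by apply: H10_tildeH1; exact: sub_H1_closure.
have Fpv := FB Fpsi Fv; have Fw := tildeH1_pospart Fpv.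
exists (pospart (psi - v)).
  have [_ [K [cK KO psiK]]] := tpsi.
  apply: (H10_of_compact_support (FH Fw) cK KO); apply: filterS v0 => x vx nKx.
  rewrite -[LHS]/(Num.max (psi x - v x) 0) psiK// sub0r.
  by have [h|h] := leP 0 (- v x); lra.
split.
  apply: le_trans (tildeH1_dform_pospart Fpv) _.
  rewrite (_ : psi - v = (psi - u) + (u - v)); last by rewrite subrKA.
  apply: le_trans (si_sqrD SI0 Hpu (FH (FB Fu Fv))) _; rewrite /M.
  by move: le1 i0 d0; move: (dform _ _) (ip _ _) (dform _ _) => a b c *; lra.
have Luv := L2B Lu Lv.
apply: le_lt_trans (ip_pospart_lip (L2B Lpsi Lv) Luv) _.
rewrite (_ : psi - v - (u - v) = psi - u); last by rewrite opprB addrA subrK.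
by move: le d0; move: (dform _ _) (ip _ _) => a b *; lra.
Qed.

Lemma H10_pospart u : H u -> H (pospart u).
Proof.
move=> Hu; rewrite -(subr0 u); apply: H10_pospart_sub => //.
  by have [] := tildeH1_semi_inner ler01.
exact: aeW.
Qed.

(** Test the equation of the resolvent with the negative part of u. *)
Lemma dirichlet_resolvent_ge0 (b : R) f u : 0 < b -> L2 f ->
  {ae m, forall x, 0 <= f x} -> resolvent Omega test b f u -> {ae m, forall x, 0 <= u x}.
Proof.
move=> b0 Lf f0 [Hu hu]; have HN := siN (H10_semi_inner ler01) Hu.
have HP := H10_pospart HN; have Lp := HL HP.
have : {ae m, forall x, (- u) x <= 0}.
  apply: (tildeH1_le0 b0 (H10_tildeH1 HN)).
  rewrite (siNl (H10_semi_inner (ltW b0)) Hu HP) (hu _ HP) oppr_le0.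
  by apply: ip_nneg => //; exact: ae_pospart_ge0.
by apply: filterS => x; rewrite oppr_le0.
Qed.

(** Test the difference of the two equations with [pospart (u - v)], which lies in
    both form domains. *)
Lemma dirichlet_resolvent_le (b : R) f u v : 0 < b -> L2 f ->
  {ae m, forall x, 0 <= f x} -> resolvent Omega test b f u -> resolvent Omega Cc b f v ->
  {ae m, forall x, u x <= v x}.
Proof.
move=> b0 Lf f0 [Hu hu] rv; have v0 := FR b0 Lf f0 rv.
have [Fv hv] := rv; have Fu := H10_tildeH1 Hu.
have HP := H10_pospart_sub Hu Fv v0.
have : {ae m, forall x, (u - v) x <= 0}.
  apply: (tildeH1_le0 b0 (FB Fu Fv)).
  rewrite (siBl (tildeH1_semi_inner (ltW b0)) Fu Fv (H10_tildeH1 HP)).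
  by rewrite (hu _ HP) (hv _ (H10_tildeH1 HP)) subrr.
by apply: filterS => x; rewrite -[(u - v) x]/(u x - v x) subr_le0.
Qed.

End dirichlet_neumann.

(** * Dissipative curves in L^2 *)

(** The set of times up to which [phi] stays below the line of slope [e] is closed
    from the left and can be prolonged to the right. *)
Lemma right_dini_le {R : realType} (phi : R -> R) :
  (forall t e, 0 <= t -> 0 < e ->
    exists2 d, 0 < d & forall h, 0 < h < d -> phi (t + h) <= phi t + e * h) ->
  (forall t e, 0 < t -> 0 < e ->
    exists2 d, 0 < d & forall s, 0 <= s -> t - d < s <= t -> phi t <= phi s + e) ->
  forall t, 0 <= t -> phi t <= phi 0.
Proof.
move=> hr hl a a0.
suff key e : 0 < e -> phi a <= phi 0 + e * a.
  apply/ler_addgt0Pr => e e0; have a1 : 0 < a + 1 by rewrite ltr_wpDl.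
  apply: le_trans (key _ (divr_gt0 e0 a1)) _.
  by rewrite lerD2l mulrAC ler_pdivrMr// ler_pM2l// lerDl.
move=> e0; pose S := [set s | 0 <= s <= a /\ forall r, 0 <= r <= s -> phi r <= phi 0 + e * r].
have S0 : S 0.
  split=> [|r]; first by rewrite lexx a0.
  by move=> /andP[r0 r1]; have -> : r = 0 by [apply/eqP; rewrite eq_le r0 r1]; rewrite mulr0 addr0.
have hS : has_sup S.
  by split; [exists 0|exists a => s [/andP[]]].
pose c := sup S.
have c0 : 0 <= c by apply: ub_le_sup => //; case: hS.
have ca : c <= a by apply: ge_sup; [exists 0|move=> s [/andP[]]].
have Slt r : 0 <= r -> r < c -> phi r <= phi 0 + e * r.
  move=> r0 rc; have d0 : 0 < c - r by rewrite subr_gt0.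
  have [s [_ Ss] rs] := sup_adherent d0 hS.
  by apply: Ss; rewrite r0 ltW//; move: rs; rewrite -/c subKr.
have Sc : S c.
  split=> [|r /andP[r0]]; first by rewrite c0 ca.
  rewrite le_eqVlt => /orP[/eqP ->|]; last exact: Slt.
  move: c0; rewrite le_eqVlt => /orP[/eqP <-|c0]; first by rewrite mulr0 addr0.
  apply/ler_addgt0Pr => n n0; have [d d0 hd] := hl _ _ c0 n0.
  pose s := Num.max 0 (c - d / 2).
  have s0 : 0 <= s by rewrite le_max lexx.
  have sc : s < c by rewrite gt_max c0 ltrBlDr ltrDl divr_gt0.
  have ds : c - d < s <= c.
    rewrite (ltW sc) andbT lt_max; apply/orP; right.
    by rewrite ltrD2l ltrN2 ltr_pdivrMr// ltr_pMr// ltr1n.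
  apply: le_trans (hd s s0 ds) _; rewrite lerD2r; apply: le_trans (Slt s s0 sc) _.
  by rewrite lerD2l ler_pM2l// ltW.
have [_ hc] := Sc.
have [ca'|] := ltP c a; last first.
  by move=> ac; have -> : a = c by [apply/eqP; rewrite eq_le ac ca]; apply: hc; rewrite c0 lexx.
have [d d0 hd] := hr c e c0 e0.
pose h := Num.min (d / 2) (a - c).
have h0 : 0 < h by rewrite lt_min divr_gt0// subr_gt0.
have hlt : h < d by rewrite gt_min ltr_pdivrMr// ltr_pMr// ltr1n.
have : S (c + h).
  split=> [|r /andP[r0 rch]].
    apply/andP; split; first by rewrite addr_ge0// ltW.
    by rewrite -lerBrDl /h ge_min lexx orbT.
  have [rc|cr] := leP r c; first by apply: hc; rewrite r0.
  have -> : r = c + (r - c) by rewrite addrC subrK.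
  apply: le_trans (hd (r - c) _) _.
    by rewrite subr_gt0 cr/=; apply: le_lt_trans hlt; rewrite lerBlDl.
  rewrite (mulrDr e c) addrA lerD2r; apply: hc; by rewrite c0 lexx.
by move=> /(ub_le_sup hS.2); rewrite -/c gerDl leNgt h0.
Qed.

Section dissipative.
Context {R : realType} {N : nat} (Omega : domain R N).
Local Notation E := 'rV[R]_N.
Local Notation m := (m Omega).
Local Notation L2 := (L2 Omega).
Local Notation ip := (ip Omega).
Implicit Types (u v f g : E -> R) (w : R -> E -> R).
Let SL := L2_semi_inner Omega.

(** Right derivatives and left continuity in L^2 are what contraction semigroups
    have at hand, and they suffice for a monotonicity argument. *)
Definition rderiv w (t : R) g := forall e : R, 0 < e -> exists2 d : R, 0 < d &
  forall h : R, 0 < h < d ->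
  ip (h^-1 *: (w (t + h) - w t) - g) (h^-1 *: (w (t + h) - w t) - g) < e.

Definition lcont w (t : R) := forall e : R, 0 < e -> exists2 d : R, 0 < d &
  forall s : R, 0 <= s -> t - d < s <= t -> ip (w s - w t) (w s - w t) < e.

Lemma ip_pospartD v c : L2 v -> L2 c ->
  ip (pospart (v + c)) (pospart (v + c)) <=
  ip (pospart v) (pospart v) + 2 * ip c (pospart v) + ip c c.
Proof.
move=> Lv Lc; have Lp := L2_pospart Lv.
rewrite [ip c _]ipC -(siDD SL Lp Lc).
apply: ip_le_norm; [by apply: L2_pospart; exact: L2D|exact: L2D|].
apply: aeW => x.
rewrite -[pospart (v + c) x]/(Num.max (v x + c x) 0) -[(pospart v + c) x]/(Num.max (v x) 0 + c x).
rewrite (@ger0_norm _ (Num.max (v x + c x) 0)) ?le_max ?lexx ?orbT//.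
have := ler_norm (Num.max (v x) 0 + c x).
have := normr_ge0 (Num.max (v x) 0 + c x).
have [h|h] := leP 0 (v x); have [h'|h'] := leP 0 (v x + c x); move: (`|_|) => z *; lra.
Qed.

(** The squared norm of [pospart (w t)] has right derivative at most [2 * ip (w' t)
    (pospart (w t))]. All comparisons of semigroups below are instances. *)
Lemma pospart_dissipative w (w' : R -> E -> R) :
  (forall t, 0 <= t -> L2 (w t)) -> (forall t, 0 <= t -> L2 (w' t)) ->
  (forall t, 0 <= t -> rderiv w t (w' t)) -> (forall t, 0 < t -> lcont w t) ->
  (forall t, 0 <= t -> ip (w' t) (pospart (w t)) <= 0) ->
  forall t, 0 <= t ->
    ip (pospart (w t)) (pospart (w t)) <= ip (pospart (w 0)) (pospart (w 0)).
Proof.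
move=> Lw Lw' wd wc ww; apply: (@right_dini_le R (fun t => ip (pospart (w t)) (pospart (w t)))).
  move=> t e t0 e0; have Lt := Lw t t0; have Lt' := Lw' t t0.
  pose P := ip (pospart (w t)) (pospart (w t)); pose Q := ip (w' t) (w' t).
  have P0 : 0 <= P by exact: ip_ge0.
  have Q0 : 0 <= Q by exact: ip_ge0.
  have P1 : 0 < P + 1 by rewrite ltr_wpDl.
  (* with this weight in Young's inequality each error term is at most e / 4 *)
  pose A := 4 * (P + 1) / e; have A0 : 0 < A by rewrite divr_gt0// mulr_gt0.
  have e1 : 0 < Num.min 1 (e / (4 * A)) by rewrite lt_min ltr01 divr_gt0// mulr_gt0.
  have [d d0 hd] := wd t t0 _ e1.
  have d2 : 0 < e / (4 * (2 * Q + 2)) by rewrite divr_gt0// mulr_gt0// ltr_wpDl// mulr_ge0.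
  exists (Num.min d (e / (4 * (2 * Q + 2)))); first by rewrite lt_min d0 d2.
  move=> h /andP[h0]; rewrite lt_min => /andP[hlt hlt2].
  have Lh : L2 (w (t + h)) by apply: Lw; rewrite addr_ge0// ltW.
  pose v := h^-1 *: (w (t + h) - w t).
  have Lv : L2 v by apply: L2Z; exact: L2B.
  have -> : w (t + h) = w t + h *: v.
    by rewrite /v scalerA divff ?gt_eqF// scale1r [RHS]addrC subrK.
  apply: le_trans (ip_pospartD Lt (L2Z h Lv)) _.
  have Lp := L2_pospart Lt.
  have := hd h; rewrite h0 hlt => /(_ isT); rewrite -/v lt_min => /andP[v1 v2].
  have Ld := L2B Lv Lt'.
  rewrite (ipZl h Lv Lp) (siZZ SL h Lv) -/P.
  have vv : ip v v <= 2 + 2 * Q.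
    have := si_sqrD SL Ld Lt'; rewrite subrK -/Q.
    by move: v1; move: (ip v v) (ip (v - w' t) (v - w' t)) => a b *; lra.
  have vp : 2 * ip v (pospart (w t)) <= e / 2.
    have E1 : ip v (pospart (w t)) = ip (v - w' t) (pospart (w t)) + ip (w' t) (pospart (w t)).
      by rewrite (ipBl Lv Lt' Lp) subrK.
    have y := young_of_sqr_le (ip_ge0 Omega (v - w' t)) P0 A0 (si_cauchy_schwarz SL Ld Lp).
    have h1 : A * ip (v - w' t) (v - w' t) <= e / 4.
      rewrite -ler_pdivlMl//; apply: (le_trans (ltW v2)).
      by rewrite le_eqVlt; apply/orP; left; apply/eqP; field; rewrite gt_eqF.
    have h2 : P / A <= e / 4.
      rewrite ler_pdivrMr// /A.
      have -> : e / 4 * (4 * (P + 1) / e) = P + 1 by field; rewrite gt_eqF.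
      by rewrite lerDl.
    have := ww t t0; move: y h1 h2; rewrite E1.
    move: (P / A) (A * _) (ip (v - w' t) (pospart (w t))) (ip (w' t) (pospart (w t))) => a b x y *; lra.
  have hv : h * ip v v <= e / 4.
    apply: (@le_trans _ _ (h * (2 + 2 * Q))); first by rewrite ler_pM2l.
    apply: (@le_trans _ _ (e / (4 * (2 * Q + 2)) * (2 + 2 * Q))).
      by rewrite ler_wpM2r ?addr_ge0 ?mulr_ge0// ltW.
    rewrite le_eqVlt; apply/orP; left; apply/eqP; field.
    by rewrite gt_eqF// ltr_wpDl// mulr_ge0.
  rewrite -addrA lerD2l expr2.
  have -> : 2 * (h * ip v (pospart (w t))) + h * h * ip v v =
     h * (2 * ip v (pospart (w t)) + h * ip v v) by ring.
  rewrite mulrC ler_pM2r//; move: vp hv; move: (2 * _) (h * _) => a b *; lra.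
move=> t e t0 e0; have Lt := Lw t (ltW t0).
pose P := ip (pospart (w t)) (pospart (w t)).
have P0 : 0 <= P by exact: ip_ge0.
have P1 : 0 < P + 1 by rewrite ltr_wpDl.
pose A := 2 * (P + 1) / e; have A0 : 0 < A by rewrite divr_gt0// mulr_gt0.
have e1 : 0 < e / (2 * A) by rewrite divr_gt0// mulr_gt0.
have [d d0 hd] := wc t t0 _ e1; exists d => // s s0 st.
have Ls := Lw s s0; have Lp := L2_pospart Lt; have Lq := L2_pospart Ls.
pose c := pospart (w t) - pospart (w s); have Lc : L2 c by exact: L2B.
have cc : ip c c <= e / (2 * A).
  apply: le_trans (ip_pospart_lip Lt Ls) _.
  by rewrite (si_subC SL Lt Ls); apply: ltW; exact: hd.
have -> : pospart (w s) = pospart (w t) - c by rewrite /c subKr.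
rewrite (siBB SL Lp Lc) -/P.
have y := young_of_sqr_le (ip_ge0 Omega c) P0 A0 (si_cauchy_schwarz SL Lc Lp).
have h1 : A * ip c c <= e / 2.
  rewrite -ler_pdivlMl//; apply: (le_trans cc).
  by rewrite le_eqVlt; apply/orP; left; apply/eqP; field; rewrite gt_eqF.
have h2 : P / A <= e / 2.
  rewrite ler_pdivrMr// /A.
  have -> : e / 2 * (2 * (P + 1) / e) = P + 1 by field; rewrite gt_eqF.
  by rewrite lerDl.
have := ip_ge0 Omega c; move: y h1 h2; rewrite (ipC Omega (pospart (w t)) c).
move: (P / A) (A * ip c c) (ip c (pospart (w t))) (ip c c) => a b x z *; lra.
Qed.

Lemma rderivB w1 w2 t g1 g2 : 0 <= t -> (forall s, 0 <= s -> L2 (w1 s)) ->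
  (forall s, 0 <= s -> L2 (w2 s)) -> L2 g1 -> L2 g2 ->
  rderiv w1 t g1 -> rderiv w2 t g2 -> rderiv (fun s => w1 s - w2 s) t (g1 - g2).
Proof.
move=> t0 L1 L2' Lg1 Lg2 h1 h2 e e0; have e4 : 0 < e / 4 by rewrite divr_gt0.
have [d1 d10 hd1] := h1 _ e4; have [d2 d20 hd2] := h2 _ e4.
exists (Num.min d1 d2); first by rewrite lt_min d10.
move=> h /andP[h0]; rewrite lt_min => /andP[hl1 hl2].
have th : 0 <= t + h by rewrite addr_ge0// ltW.
pose a := h^-1 *: (w1 (t + h) - w1 t) - g1; pose b := h^-1 *: (w2 (t + h) - w2 t) - g2.
have La : L2 a by apply: L2B => //; apply: L2Z; apply: L2B; exact: L1.
have Lb : L2 b by apply: L2B => //; apply: L2Z; apply: L2B; exact: L2'.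
have -> : h^-1 *: (w1 (t + h) - w2 (t + h) - (w1 t - w2 t)) - (g1 - g2) = a - b.
  apply/funext => x; rewrite -[LHS]/(h^-1 * (w1 (t + h) x - w2 (t + h) x - (w1 t x - w2 t x)) - (g1 x - g2 x)).
  rewrite -[RHS]/(h^-1 * (w1 (t + h) x - w1 t x) - g1 x - (h^-1 * (w2 (t + h) x - w2 t x) - g2 x)).
  ring.
apply: le_lt_trans (si_sqrB SL La Lb) _.
have : ip a a < e / 4 by apply: hd1; rewrite h0.
have : ip b b < e / 4 by apply: hd2; rewrite h0.
by move: (ip a a) (ip b b) => x y *; lra.
Qed.

Lemma lcontB w1 w2 t : 0 <= t -> (forall s, 0 <= s -> L2 (w1 s)) ->
  (forall s, 0 <= s -> L2 (w2 s)) ->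
  lcont w1 t -> lcont w2 t -> lcont (fun s => w1 s - w2 s) t.
Proof.
move=> t0 L1 L2' h1 h2 e e0; have e4 : 0 < e / 4 by rewrite divr_gt0.
have [d1 d10 hd1] := h1 _ e4; have [d2 d20 hd2] := h2 _ e4.
exists (Num.min d1 d2); first by rewrite lt_min d10.
move=> s s0 /andP[sd st].
have hs1 : t - d1 < s <= t.
  by rewrite st andbT; apply: le_lt_trans sd; rewrite lerD2l lerN2 ge_min lexx.
have hs2 : t - d2 < s <= t.
  by rewrite st andbT; apply: le_lt_trans sd; rewrite lerD2l lerN2 ge_min lexx orbT.
have La := L2B (L1 s s0) (L1 t t0); have Lb := L2B (L2' s s0) (L2' t t0).
have -> : w1 s - w2 s - (w1 t - w2 t) = (w1 s - w1 t) - (w2 s - w2 t).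
  by rewrite !opprB addrACA [RHS]addrACA [- w2 s + _]addrC.
apply: le_lt_trans (si_sqrB SL La Lb) _.
have := hd1 s s0 hs1; have := hd2 s s0 hs2.
by move: (ip (w1 s - _) _) (ip (w2 s - _) _) => x y *; lra.
Qed.

Lemma rderiv_cst g t : rderiv (fun=> g) t 0.
Proof.
by move=> e e0; exists 1 => // h _; rewrite subrr scaler0 subr0 ip0l.
Qed.

Lemma lcont_cst g t : lcont (fun=> g) t.
Proof. by move=> e e0; exists 1 => // s _ _; rewrite subrr ip0l. Qed.

Lemma rderiv_expR (l t : R) u : L2 u ->
  rderiv (fun s => expR (l * s) *: u) t ((l * expR (l * t)) *: u).
Proof.
move=> Lu e e0; have U1 : 0 < ip u u + 1 by rewrite ltr_wpDl// ip_ge0.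
have d1 : is_derive t 1 (fun s => expR (l * s)) (l * expR (l * t)).
  have h1 : is_derive t 1 (fun s : R => l * s) (l * 1) by exact: is_deriveZ.
  have := is_derive1_comp (is_derive_expR (l * t)) h1.
  by rewrite mulr1 mulrC.
have [d1' d1v] := d1.
have c := d1'; move/cvg_ex : c => [k kc].
have kE : k = l * expR (l * t) by rewrite -d1v /derive; apply/esym/cvg_lim.
rewrite kE in kc.
have e1 : 0 < Num.sqrt (e / (ip u u + 1)) by rewrite sqrtr_gt0 divr_gt0.
move/cvgrPdist_lt : kc => /(_ _ e1) /nbhs_ballP[d /= d0 hd].
exists d => // h /andP[h0 hlt].
have := hd h; rewrite /ball/= sub0r normrN gtr0_norm// => /(_ hlt); rewrite gt_eqF// => /(_ isT).
rewrite [h *: 1]mulr1 [h + t]addrC => hh.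
have -> : h^-1 *: (expR (l * (t + h)) *: u - expR (l * t) *: u) - (l * expR (l * t)) *: u =
  (h^-1 * (expR (l * (t + h)) - expR (l * t)) - l * expR (l * t)) *: u.
  by rewrite -scalerBl scalerA -scalerBl.
rewrite (siZZ SL _ Lu).
set a := (X in X ^+ 2 * _).
have : a ^+ 2 < e / (ip u u + 1).
  rewrite -(sqr_sqrtr (ltW (divr_gt0 e0 U1))) -(real_normK (num_real a)).
  by rewrite ltr_pXn2r// ?nnegrE ?sqrtr_ge0// distrC.
rewrite ltr_pdivlMr// => h2; apply: le_lt_trans h2.
by rewrite ler_wpM2l ?sqr_ge0// lerDl.
Qed.

Lemma lcont_expR (l t : R) u : L2 u -> lcont (fun s => expR (l * s) *: u) t.
Proof.
move=> Lu e e0; have U1 : 0 < ip u u + 1 by rewrite ltr_wpDl// ip_ge0.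
have e1 : 0 < Num.sqrt (e / (ip u u + 1)) by rewrite sqrtr_gt0 divr_gt0.
have ce : {for t, continuous (fun s => expR (l * s))}.
  apply: (@continuous_comp _ _ _ (fun s => l * s) expR); last exact: continuous_expR.
  by apply: continuousM; [exact: cvg_cst|exact: cvg_id].
move/cvgrPdist_lt : ce => /(_ _ e1) /nbhs_ballP[d /= d0 hd].
exists d => // s s0 /andP[st1 st2].
have := hd s; rewrite /ball/= ger0_norm ?subr_ge0// ltrBlDl -ltrBlDr => /(_ st1) hh.
rewrite -scalerBl (siZZ SL _ Lu); set a := (X in X ^+ 2 * _).
have : a ^+ 2 < e / (ip u u + 1).
  rewrite -(sqr_sqrtr (ltW (divr_gt0 e0 U1))) -(real_normK (num_real a)).
  by rewrite ltr_pXn2r// ?nnegrE ?sqrtr_ge0// distrC.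
rewrite ltr_pdivlMr// => h2; apply: le_lt_trans h2.
by rewrite ler_wpM2l ?sqr_ge0// lerDl.
Qed.

Section orbit.
Variables (C : set (E -> R)).
Local Notation D := (H1_closure Omega C).
Variables (T : R -> (E -> R) -> E -> R).
Hypothesis hT : semigroup_of Omega D T.

(** T t commutes with the difference quotients [s^-1 *: (u - T s u)] and contracts
    their distance to the limit. *)
Lemma semigroup_form_operator t u f : 0 <= t -> form_operator Omega D u f ->
  form_operator Omega D (T t u) (T t f).
Proof.
move=> t0 uf; have Lu : L2 u by have [/H1_closure_L2] := uf.
have Lf : L2 f by have [] := uf.
have LT s g : 0 <= s -> L2 g -> L2 (T s g) by exact: (semigroup_L2 hT).
apply/(semigroup_generator hT (LT _ _ t0 Lu) (LT _ _ t0 Lf)).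
have h := (semigroup_generator hT Lu Lf).2 uf.
apply: (@squeeze_cvge _ _ _ _ (cst 0%E) _ (fun s => L2norm Omega (fun x => s^-1 * (u x - T s u x) - f x))); [|exact: cvg_cst|exact: h].
near=> s; have s0 : 0 < s by near: s; exact: nbhs_right_gt.
rewrite Lnorm_ge0/=.
have LuT := L2B Lu (LT _ _ (ltW s0) Lu).
have Lq : L2 (s^-1 *: (u - T s u) - f) by apply: L2B => //; exact: L2Z.
rewrite -[leRHS]/(L2norm Omega (s^-1 *: (u - T s u) - f)).
apply: le_trans (semigroup_contraction hT t0 Lq).
have LTu := LT _ _ t0 Lu; have LTf := LT _ _ t0 Lf.
have L1 : L2 (s^-1 *: (T t u - T s (T t u)) - T t f).
  by apply: L2B => //; apply: L2Z; apply: L2B => //; apply: LT => //; exact: ltW.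
have L2' := LT _ _ t0 Lq.
rewrite -[leLHS]/(L2norm Omega (s^-1 *: (T t u - T s (T t u)) - T t f)).
rewrite !L2norm_ip// lee_fin ler_wsqrtr// le_eqVlt; apply/orP; left; apply/eqP.
have st : {ae m, forall x, T t (T s u) x = T s (T t u) x}.
  have a1 := semigroup_D hT t0 (ltW s0) Lu; have a2 := semigroup_D hT (ltW s0) t0 Lu.
  by apply: filterS2 a1 a2 => x; rewrite addrC => <- <-.
have e1 := @semigroup_linear _ _ _ _ _ hT t s^-1 (u - T s u) (- f) t0 LuT (L2N Lf).
have e2 := semigroup_sub hT t0 Lu (LT _ _ (ltW s0) Lu).
have e3 := @semigroup_linear _ _ _ _ _ hT t (-1) f 0 t0 Lf (L2_0 Omega).
have e4 := @semigroup_linear _ _ _ _ _ hT t (-1) 0 0 t0 (L2_0 Omega) (L2_0 Omega).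
have E1 : {ae m, forall x, (s^-1 *: (T t u - T s (T t u)) - T t f) x = T t (s^-1 *: (u - T s u) - f) x}.
  have z1 : (fun y => -1 * f y + (0 : E -> R) y) = - f.
    by apply/funext => y; rewrite addr0 mulN1r.
  have z2 : (fun y => -1 * (0 : E -> R) y + (0 : E -> R) y) = 0.
    by apply/funext => y; rewrite addr0 mulr0.
  rewrite z1 in e3; rewrite z2 in e4.
  apply: filterS2 (filterI st e1) (filterI e2 (filterI e3 e4)) => x [x1 x2] [x3 [x4 x5]].
  rewrite -[LHS]/(s^-1 * (T t u x - T s (T t u) x) - T t f x) -x1.
  rewrite -[T t (_ - f) x]/(T t (fun y => s^-1 * (u - T s u) y + (- f) y) x) x2 x3 x4.
  have -> : T t 0 x = 0.
    by move: x5; move: (T t 0 x) => z; lra.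
  by rewrite addr0 mulN1r.
by rewrite (ip_aeql L1 L2' L1 E1) (ip_aeqr L1 L2' L2' E1).
Unshelve. all: by end_near. Qed.

Lemma rderiv_semigroup t u f : 0 <= t -> form_operator Omega D u f ->
  rderiv (fun s => T s u) t (- T t f).
Proof.
move=> t0 uf e e0; have Lu : L2 u by have [/H1_closure_L2] := uf.
have Lf : L2 f by have [] := uf.
have LT s g : 0 <= s -> L2 g -> L2 (T s g) by exact: (semigroup_L2 hT).
have [d d0 hd] := generator_close hT (semigroup_form_operator t0 uf) e0.
exists d => // h /andP[h0 hlt]; have := hd h; rewrite h0 hlt => /(_ isT).
set a := _ - T t f; set b := _ - - T t f => aa.
have th : 0 <= t + h by rewrite addr_ge0// ltW.
have La : L2 a.
  apply: L2B; [apply: L2Z; apply: L2B|exact: LT]; first exact: LT.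
  by apply: (LT _ _ (ltW h0)); exact: LT.
have Lb : L2 b by apply: L2B; [apply: L2Z; apply: L2B; exact: LT|apply: L2N; exact: LT].
have E1 : {ae m, forall x, b x = (- a) x}.
  have := semigroup_D hT (ltW h0) t0 Lu; apply: filterS => x.
  rewrite addrC => hx.
  rewrite -[LHS]/(h^-1 * (T (t + h) u x - T t u x) - - T t f x).
  rewrite -[RHS]/(- (h^-1 * (T t u x - T h (T t u) x) - T t f x)) hx; ring.
rewrite (ip_aeql Lb (L2N La) Lb E1) (ip_aeqr Lb (L2N La) (L2N La) E1).
by rewrite (ipNl La (L2N La)) (ipNr La La) opprK.
Qed.

(** [T t u - T s u = T s (T (t - s) u - u)] and T s is a contraction. *)
Lemma lcont_semigroup t u : 0 < t -> L2 u -> lcont (fun s => T s u) t.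
Proof.
move=> t0 Lu e e0.
have LT s g : 0 <= s -> L2 g -> L2 (T s g) by exact: (semigroup_L2 hT).
have [d d0 hd] := @L2norm_cvg0 _ _ Omega (fun t => T t u \- u)
  (fun t t0 => L2B (LT _ _ (ltW t0) Lu) Lu) (semigroup_continuous hT Lu) e e0.
exists d => // s s0 /andP[sd st].
have [->|ts] := eqVneq s t; first by rewrite subrr ip0l.
have h0 : 0 < t - s by rewrite subr_gt0 lt_neqAle ts.
have hlt : t - s < d by move: sd; rewrite ltrBlDr addrC -ltrBlDr.
have := hd (t - s); rewrite h0 hlt => /(_ isT) hh; apply: le_lt_trans hh.
rewrite -[T (t - s) u \- u]/(T (t - s) u - u).
have Lh := LT _ _ (ltW h0) Lu; have LB := L2B Lh Lu.
rewrite (si_subC SL (LT _ _ s0 Lu) (LT _ _ (ltW t0) Lu)).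
apply: le_trans (semigroup_ip_contraction hT s0 LB).
have L1 := L2B (LT _ _ (ltW t0) Lu) (LT _ _ s0 Lu); have L2' := LT _ _ s0 LB.
have E1 : {ae m, forall x, (T t u - T s u) x = T s (T (t - s) u - u) x}.
  have e1 := semigroup_D hT s0 (ltW h0) Lu; have e2 := semigroup_sub hT s0 Lh Lu.
  apply: filterS2 e1 e2 => x; rewrite addrC subrK => hx ->.
  by rewrite -[LHS]/(T t u x - T s u x) hx.
by rewrite (ip_aeql L1 L2' L1 E1) (ip_aeqr L1 L2' L2' E1).
Qed.

End orbit.
End dissipative.

(** * The Dirichlet semigroup *)

Section comparison.
Context {R : realType} {N : nat} (Omega : domain R N).
Local Notation E := 'rV[R]_N.
Local Notation m := (m Omega).
Local Notation L2 := (L2 Omega).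
Local Notation ip := (ip Omega).
Local Notation dform := (dform Omega).
Local Notation dformb := (dformb Omega).
Local Notation test := (test_function Omega).
Local Notation Cc := (Cc_closure Omega).
Local Notation H := (H10 Omega).
Local Notation F := (tildeH1 Omega).
Local Notation Om := (Omega : set E).
Implicit Types (u v w f g : E -> R) (K : set E).
Let SL := L2_semi_inner Omega.

Lemma ae_le0_closed f : L2 f ->
  (forall e : R, 0 < e -> exists q, [/\ L2 q, ip (q - f) (q - f) < e &
     {ae m, forall x, q x <= 0}]) ->
  {ae m, forall x, f x <= 0}.
Proof.
move=> Lf hf; have Lp := L2_pospart Lf.
apply: ae_le0_of_pospart => //; rewrite -(ip_pospart_self Lf).
apply: ip_le0_closed => // e /hf[q [Lq qf q0]]; exists q; split => //.
rewrite -[leLHS]opprK -(ipNl Lq Lp) oppr_le0.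
apply: ip_nneg (L2N Lq) Lp _ (ae_pospart_ge0 _ _).
by apply: filterS q0 => x; rewrite -[(- q) x]/(- q x) oppr_ge0.
Qed.

(** Nonnegative functions with arbitrarily small norms have infimum 0 almost
    everywhere, so no subsequence has to be extracted. *)
Lemma ae_le_of_small_errors (f : E -> R) (Phi : E -> \bar R) (d : nat -> E -> R) :
  (forall n, L2 (d n)) -> (forall e : R, 0 < e -> exists n, ip (d n) (d n) < e) ->
  (forall n, {ae m, forall x, ((f x)%:E <= Phi x + (d n x)%:E)%E}) ->
  {ae m, forall x, ((f x)%:E <= Phi x)%E}.
Proof.
move=> Ld de fd.
pose A (k : nat) := \bigcap_n [set x | k.+1%:R^-1 <= d n x].
have mA k : measurable (A k).
  apply: bigcapT_measurable => n.
  rewrite -[X in measurable X]setTI; apply: measurable_fun_le => //.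
  exact: L2_measurable (Ld n).
have A0 k : {ae m, forall x, ~ A k x}.
  pose c : R := k.+1%:R; have c0 : 0 < c by rewrite ltr0n.
  have dA n x : A k x -> `|\1_(A k) x| <= `|(c *: d n) x| :> R.
    move=> Ax; rewrite indicE mem_set// normr1; have := Ax n Logic.I => /= h.
    rewrite -[(c *: d n) x]/(c * d n x); apply: le_trans (ler_norm _).
    by rewrite -(@ler_pM2l _ c^-1) ?invr_gt0// mulr1 mulrA mulVf ?gt_eqF// mul1r.
  have dA' n x : `|(\1_(A k) : E -> R) x| <= `|(c *: d n) x|.
    have [Ax|nAx] := pselect (A k x); first exact: dA.
    by rewrite indicE memNset// normr0.
  have L1 : L2 (\1_(A k) : E -> R).
    apply: (L2_dominated _ (L2Z c (Ld 0%N))); first exact: measurable_indic.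
    by apply: aeW => x; exact: dA'.
  have i0 : ip (\1_(A k)) (\1_(A k)) = 0.
    apply/eqP; rewrite eq_le ip_ge0 andbT; apply/ler_addgt0Pr => e e0; rewrite add0r.
    have [n dn] := de _ (divr_gt0 e0 (exprn_gt0 2 c0)).
    apply: (@le_trans _ _ (ip (c *: d n) (c *: d n))).
      apply: ip_le_norm => //; first exact: L2Z.
      by apply: aeW => x; exact: dA'.
    by rewrite (siZZ SL c (Ld n)) mulrC -ler_pdivlMr ?exprn_gt0// ltW.
  apply: filterS (ip_eq0 L1 i0) => x; rewrite indicE => h Ax.
  by move: h; rewrite mem_set// => /eqP; rewrite oner_eq0.
apply: filterS2 (ae_foralln A0) (ae_foralln fd) => x hA hf.
apply/lee_addgt0Pr => e e0.
have [k _ /(_ k (leqnn k)) /= ke] := near_infty_natSinv_lt (PosNum e0).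
have /existsNP[n /not_implyP[_ /negP]] := hA k.
rewrite -ltNge => dn; apply: le_trans (hf n) _; rewrite leeD2l// lee_fin.
by apply/ltW; apply: lt_trans dn _.
Qed.

Hypothesis FR : forall (b : R) f u, 0 < b -> L2 f ->
  {ae m, forall x, 0 <= f x} -> resolvent Omega Cc b f u -> {ae m, forall x, 0 <= u x}.

Variables (TD TN : R -> (E -> R) -> E -> R).
Hypotheses (hTD : semigroup_of Omega H TD) (hTN : semigroup_of Omega F TN).

Let HL u : H u -> L2 u. Proof. exact: H1_closure_L2. Qed.
Let FL u : F u -> L2 u. Proof. exact: H1_closure_L2. Qed.
Let HF u : H u -> F u. Proof. exact: H10_tildeH1. Qed.
Let SH b (b0 : 0 <= b) : semi_inner H (dformb b). Proof. exact: H10_semi_inner. Qed.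
Let SF b (b0 : 0 <= b) : semi_inner F (dformb b). Proof. exact: tildeH1_semi_inner. Qed.
Let SI0 : semi_inner (H1 Omega) dform := dform_semi_inner Omega.
Let HH u : H u -> H1 Omega u. Proof. exact: H1_closure_H1. Qed.
Let FH u : F u -> H1 Omega u. Proof. exact: H1_closure_H1. Qed.
Let LD t f : 0 <= t -> L2 f -> L2 (TD t f). Proof. exact: (semigroup_L2 hTD). Qed.
Let LN t f : 0 <= t -> L2 f -> L2 (TN t f). Proof. exact: (semigroup_L2 hTN). Qed.

Let dissip v : F v -> 0 <= dform v (pospart v).
Proof.
by move=> Fv; apply: le_trans (tildeH1_dform_pospart_le FR Fv); exact: dform_ge0.
Qed.

Let res_H (b : R) f : 0 < b -> L2 f -> exists u, resolvent Omega test b f u.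
Proof. exact: (resolvent_exists (test_0 Omega) (@testD _ _ Omega) (@testZ _ _ Omega)). Qed.

Let res_F (b : R) f : 0 < b -> L2 f -> exists u, resolvent Omega Cc b f u.
Proof. exact: (resolvent_exists (Cc_closure0 Omega) (@Cc_closureD _ _ Omega) (@Cc_closureZ _ _ Omega)). Qed.

Let cvg_H f (e : R) : L2 f -> 0 < e -> exists2 b0 : R, 0 < b0 &
  forall b u, b0 < b -> resolvent Omega test b (b *: f) u -> ip (u - f) (u - f) < e.
Proof. exact: (resolvent_cvg (test_0 Omega) (@testD _ _ Omega) (@testZ _ _ Omega)). Qed.

Let cvg_F f (e : R) : L2 f -> 0 < e -> exists2 b0 : R, 0 < b0 &
  forall b u, b0 < b -> resolvent Omega Cc b (b *: f) u -> ip (u - f) (u - f) < e.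
Proof. exact: (resolvent_cvg (Cc_closure0 Omega) (@Cc_closureD _ _ Omega) (@Cc_closureZ _ _ Omega) (@test_Cc _ _ Omega)). Qed.

Let scaled_ge0 (b : R) f : 0 < b -> {ae m, forall x, 0 <= f x} ->
  {ae m, forall x, 0 <= (b *: f) x}.
Proof.
by move=> b0; apply: filterS => x fx; rewrite -[(b *: f) x]/(b * f x) mulr_ge0// ltW.
Qed.

(** [- TD s u] is dissipative, as its derivative is paired with an element of H10. *)
Let dirichlet_ge0_domain t u f : 0 <= t -> form_operator Omega H u f ->
  {ae m, forall x, 0 <= u x} -> {ae m, forall x, 0 <= TD t u x}.
Proof.
move=> t0 uf u0; have Lu : L2 u by case: uf => /HL.
have Lf : L2 f by case: uf.
pose w s := (0 : E -> R) - TD s u.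
have := @pospart_dissipative _ _ Omega w (fun s => 0 - - TD s f) _ _ _ _ _ t t0.
have -> : ip (pospart (w 0)) (pospart (w 0)) = 0.
  apply: ip_ae0; first by apply: L2_pospart; apply: L2B; [exact: L2_0|exact: LD].
  apply: filterS2 u0 (semigroup_0 hTD Lu) => x ux hx.
  rewrite -[LHS]/(Num.max (0 - TD 0 u x) 0) hx sub0r.
  by have [h|h] := leP 0 (- u x); lra.
move=> h; have Lw : L2 (w t) by apply: L2B; [exact: L2_0|exact: LD].
have : {ae m, forall x, w t x <= 0}.
  apply: (ae_le0_of_pospart Lw); apply: h.
  - by move=> s s0; apply: L2B; [exact: L2_0|exact: LD].
  - by move=> s s0; apply: L2B; [exact: L2_0|apply: L2N; exact: LD].
  - move=> s s0; apply: rderivB => //.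
    + by move=> *; exact: L2_0.
    + by move=> *; exact: LD.
    + exact: L2_0.
    + by apply: L2N; exact: LD.
    + exact: rderiv_cst.
    + exact: (rderiv_semigroup hTD).
  - move=> s s0; apply: lcontB => //.
    + exact: ltW.
    + by move=> *; exact: L2_0.
    + by move=> *; exact: LD.
    + exact: lcont_cst.
    + exact: (lcont_semigroup hTD).
  - move=> s s0; rewrite /w !sub0r opprK.
    have [Hz Lz hz] := semigroup_form_operator hTD s0 uf.
    have HNz := siN (SH ler01) Hz; have HP := H10_pospart FR HNz.
    rewrite -(hz _ HP); have := dissip (HF HNz).
    by rewrite (siNl SI0 (HH Hz) (HH HP)) oppr_ge0.
by apply: filterS => x; rewrite /w -[(0 - _) x]/(0 - TD t u x) sub0r oppr_le0.
Qed.

(** By approximation by resolvents, for which the preceding lemma holds. *)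
Lemma dirichlet_semigroup_ge0 t f : 0 <= t -> L2 f -> {ae m, forall x, 0 <= f x} ->
  {ae m, forall x, 0 <= TD t f x}.
Proof.
move=> t0 Lf f0.
have : {ae m, forall x, (- TD t f) x <= 0}.
  apply: ae_le0_closed; first by apply: L2N; exact: LD.
  move=> e e0; have [b0 b00 hb] := cvg_H Lf e0.
  pose b := b0 + 1; have bb : 0 < b by rewrite ltr_wpDr.
  have [u ru] := res_H bb (L2Z b Lf); have Lu := HL ru.1.
  have u0 := dirichlet_resolvent_ge0 FR bb (L2Z b Lf) (scaled_ge0 bb f0) ru.
  have ufb := resolvent_form_operator (L2Z b Lf) ru.
  exists (- TD t u); split; first by apply: L2N; exact: LD.
    have LB := L2B Lu Lf; apply: le_lt_trans (hb b u _ ru); last by rewrite ltrDl.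
    apply: le_trans (semigroup_ip_contraction hTD t0 LB).
    apply: ip_le_norm; [apply: L2B; apply: L2N; exact: LD|exact: LD|].
    apply: filterS (semigroup_sub hTD t0 Lu Lf) => x ->.
    by rewrite -[(- TD t u - - TD t f) x]/(- TD t u x - - TD t f x) -opprD normrN.
  apply: filterS (dirichlet_ge0_domain t0 ufb u0) => x.
  by rewrite -[(- TD t u) x]/(- TD t u x) oppr_le0.
by apply: filterS => x; rewrite -[(- TD t f) x]/(- TD t f x) oppr_le0.
Qed.

Lemma dirichlet_semigroup_mono t f g : 0 <= t -> L2 f -> L2 g ->
  {ae m, forall x, f x <= g x} -> {ae m, forall x, TD t f x <= TD t g x}.
Proof.
move=> t0 Lf Lg fg; have := semigroup_sub hTD t0 Lg Lf.
have : {ae m, forall x, 0 <= TD t (g - f) x}.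
  apply: dirichlet_semigroup_ge0 => //; first exact: L2B.
  by apply: filterS fg => x; rewrite -[(g - f) x]/(g x - f x) subr_ge0.
by apply: filterS2 => x h1 h2; rewrite -subr_ge0 -h2.
Qed.

(** [TD s u - TN s v] is dissipative: both equations can be tested with its positive
    part, which lies in H10 because [TN s v] is nonnegative. *)
Let dirichlet_le_neumann_domain t u v f g : 0 <= t -> form_operator Omega H u f ->
  form_operator Omega F v g -> (forall s, 0 <= s -> {ae m, forall x, 0 <= TN s v x}) ->
  {ae m, forall x, u x <= v x} -> {ae m, forall x, TD t u x <= TN t v x}.
Proof.
move=> t0 uf vg v0 uv; have Lu : L2 u by case: uf => /HL.
have Lv : L2 v by case: vg => /FL.
have Lf : L2 f by case: uf.
have Lg : L2 g by case: vg.
pose w s := TD s u - TN s v.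
have := @pospart_dissipative _ _ Omega w (fun s => - TD s f - - TN s g) _ _ _ _ _ t t0.
have Lw s : 0 <= s -> L2 (w s) by move=> s0; apply: L2B; [exact: LD|exact: LN].
have -> : ip (pospart (w 0)) (pospart (w 0)) = 0.
  apply: ip_ae0; first by apply: L2_pospart; exact: Lw.
  apply: filterS2 uv (filterI (semigroup_0 hTD Lu) (semigroup_0 hTN Lv)) => x ux [hx hx'].
  rewrite -[LHS]/(Num.max (TD 0 u x - TN 0 v x) 0) hx hx'.
  by have [h|h] := leP 0 (u x - v x); lra.
move=> h.
have : {ae m, forall x, w t x <= 0}.
  apply: (ae_le0_of_pospart (Lw t t0)); apply: h.
  - exact: Lw.
  - by move=> s s0; apply: L2B; apply: L2N; [exact: LD|exact: LN].
  - move=> s s0; apply: rderivB => //.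
    + by move=> *; exact: LD.
    + by move=> *; exact: LN.
    + by apply: L2N; exact: LD.
    + by apply: L2N; exact: LN.
    + exact: (rderiv_semigroup hTD).
    + exact: (rderiv_semigroup hTN).
  - move=> s s0; apply: lcontB => //.
    + exact: ltW.
    + by move=> *; exact: LD.
    + by move=> *; exact: LN.
    + exact: (lcont_semigroup hTD).
    + exact: (lcont_semigroup hTN).
  - move=> s s0.
    have [Hz Lz hz] := semigroup_form_operator hTD s0 uf.
    have [Fy Ly hy] := semigroup_form_operator hTN s0 vg.
    have HP := H10_pospart_sub FR Hz Fy (v0 s s0).
    have Lp := HL HP; rewrite -/(w s) in HP Lp *.
    rewrite (ipBl (L2N Lz) (L2N Ly) Lp) (ipNl Lz Lp) (ipNl Ly Lp).
    rewrite -(hz _ HP) -(hy _ (HF HP)) opprK.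
    have Fw : F (w s) by apply: (siB (SF ler01)) => //; exact: HF.
    have := dissip Fw; rewrite {1}/w (siBl SI0 (HH Hz) (FH Fy) (HH HP)).
    by move: (dform _ _) (dform _ _) => a b *; lra.
by apply: filterS => x; rewrite /w -[(_ - _) x]/(TD t u x - TN t v x) subr_le0.
Qed.

Lemma dirichlet_le_neumann t f : 0 <= t -> L2 f -> {ae m, forall x, 0 <= f x} ->
  (forall s g, 0 <= s -> L2 g -> {ae m, forall x, 0 <= g x} ->
    {ae m, forall x, 0 <= TN s g x}) ->
  {ae m, forall x, TD t f x <= TN t f x}.
Proof.
move=> t0 Lf f0 TN0.
have : {ae m, forall x, (TD t f - TN t f) x <= 0}.
  apply: ae_le0_closed; first by apply: L2B; [exact: LD|exact: LN].
  move=> e e0; have e8 : 0 < e / 8 by rewrite divr_gt0.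
  have [b1 b10 hb1] := cvg_H Lf e8; have [b2 b20 hb2] := cvg_F Lf e8.
  pose b := b1 + b2 + 1; have bb : 0 < b by rewrite !addr_gt0.
  have [u ru] := res_H bb (L2Z b Lf); have Lu := HL ru.1.
  have [v rv] := res_F bb (L2Z b Lf); have Lv := FL rv.1.
  have v0 := FR bb (L2Z b Lf) (scaled_ge0 bb f0) rv.
  have uv := dirichlet_resolvent_le FR bb (L2Z b Lf) (scaled_ge0 bb f0) ru rv.
  have ufb := resolvent_form_operator (L2Z b Lf) ru.
  have vfb := resolvent_form_operator (L2Z b Lf) rv.
  exists (TD t u - TN t v); split.
  - by apply: L2B; [exact: LD|exact: LN].
  - have L1 := L2B Lu Lf; have L2' := L2B Lv Lf.
    have E1 : {ae m, forall x, (TD t u - TN t v - (TD t f - TN t f)) x = (TD t (u - f) - TN t (v - f)) x}.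
      apply: filterS2 (semigroup_sub hTD t0 Lu Lf) (semigroup_sub hTN t0 Lv Lf) => x x1 x2.
      rewrite -[RHS]/(TD t (u - f) x - TN t (v - f) x) x1 x2.
      by rewrite -[LHS]/(TD t u x - TN t v x - (TD t f x - TN t f x)); ring.
    have La : L2 (TD t u - TN t v - (TD t f - TN t f)).
      by apply: L2B; apply: L2B; [exact: LD|exact: LN|exact: LD|exact: LN].
    have Lb : L2 (TD t (u - f) - TN t (v - f)) by apply: L2B; [exact: LD|exact: LN].
    rewrite (ip_aeql La Lb La E1) (ip_aeqr La Lb Lb E1).
    apply: le_lt_trans (si_sqrB SL (LD t0 L1) (LN t0 L2')) _.
    have := semigroup_ip_contraction hTD t0 L1; have := semigroup_ip_contraction hTN t0 L2'.
    have := hb1 b u _ ru; have := hb2 b v _ rv.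
    have -> : b1 < b by rewrite /b -addrA ltrDl addr_gt0.
    have -> : b2 < b by rewrite /b addrAC ltrDr addr_gt0.
    move=> /(_ isT) + /(_ isT).
    move: (ip (TD t (u - f)) (TD t (u - f))) (ip (TN t (v - f)) (TN t (v - f))).
    by move: (ip (u - f) (u - f)) (ip (v - f) (v - f)) => x y z r *; lra.
  have := dirichlet_le_neumann_domain t0 ufb vfb (fun s s0 => TN0 s v s0 Lv v0) uv.
  by apply: filterS => x; rewrite -[(_ - _) x]/(TD t u x - TN t v x) subr_le0.
by apply: filterS => x; rewrite -[(_ - _) x]/(TD t f x - TN t f x) subr_le0.
Qed.

(** [TD s u - expR (l * s) *: u] is dissipative. *)
Let excessive_domain (l t : R) u g : 0 <= l -> 0 <= t -> form_operator Omega H u g ->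
  {ae m, forall x, 0 <= (g + l *: u) x} ->
  {ae m, forall x, TD t u x <= expR (l * t) * u x}.
Proof.
move=> l0 t0 ug gu; have [Hu Lg hu] := ug; have Lu := HL Hu.
pose w s := TD s u - expR (l * s) *: u.
have Lw s : 0 <= s -> L2 (w s) by move=> s0; apply: L2B; [exact: LD|exact: L2Z].
have := @pospart_dissipative _ _ Omega w (fun s => - TD s g - (l * expR (l * s)) *: u) _ _ _ _ _ t t0.
have -> : ip (pospart (w 0)) (pospart (w 0)) = 0.
  apply: ip_ae0; first by apply: L2_pospart; exact: Lw.
  apply: filterS (semigroup_0 hTD Lu) => x hx.
  rewrite -[LHS]/(Num.max (TD 0 u x - expR (l * 0) * u x) 0) hx mulr0 expR0 mul1r subrr.
  by have [] := leP (0 : R) 0.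
move=> h.
have : {ae m, forall x, w t x <= 0}.
  apply: (ae_le0_of_pospart (Lw t t0)); apply: h.
  - exact: Lw.
  - by move=> s s0; apply: L2B; [apply: L2N; exact: LD|exact: L2Z].
  - move=> s s0; apply: rderivB => //.
    + by move=> *; exact: LD.
    + by move=> *; exact: L2Z.
    + by apply: L2N; exact: LD.
    + exact: L2Z.
    + exact: (rderiv_semigroup hTD).
    + exact: rderiv_expR.
  - move=> s s0; apply: lcontB => //.
    + exact: ltW.
    + by move=> *; exact: LD.
    + by move=> *; exact: L2Z.
    + exact: (lcont_semigroup hTD).
    + exact: lcont_expR.
  - move=> s s0.
    have [Hz Lz hz] := semigroup_form_operator hTD s0 ug.
    have Hw : H (w s) by apply: (siB (SH ler01)) => //; exact: (siZ (SH ler01)).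
    have HP := H10_pospart FR Hw; have Lp := HL HP.
    rewrite (ipBl (L2N Lz) (L2Z _ Lu) Lp) (ipNl Lz Lp) (ipZl _ Lu Lp) -(hz _ HP).
    have h1 := dissip (HF Hw).
    have HU := siZ (SH ler01) (expR (l * s)) Hu.
    have h2 : dform (w s) (pospart (w s)) =
       dform (TD s u) (pospart (w s)) - expR (l * s) * ip g (pospart (w s)).
      rewrite -(hu _ HP) -(siZl SI0 _ (HH Hu) (HH HP)).
      by rewrite -(siBl SI0 (HH Hz) (HH HU) (HH HP)).
    have h3 : 0 <= expR (l * s) * ip (g + l *: u) (pospart (w s)).
      rewrite mulr_ge0 ?expR_ge0//; apply: ip_nneg => //.
      + by apply: L2D => //; exact: L2Z.
      + exact: ae_pospart_ge0.
    rewrite (ipDl Lg (L2Z l Lu) Lp) (ipZl _ Lu Lp) in h3.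
    rewrite h2 in h1; move: h1 h3; rewrite mulrDr.
    have -> : l * expR (l * s) * ip u (pospart (w s)) = expR (l * s) * (l * ip u (pospart (w s))) by ring.
    move: (dform (TD s u) (pospart (w s))) (expR (l * s) * ip g (pospart (w s))).
    by move: (expR (l * s) * (l * ip u (pospart (w s)))) => a b c {h2}; lra.
by apply: filterS => x; rewrite /w -[(_ - _) x]/(TD t u x - expR (l * t) * u x) subr_le0.
Qed.

(** A function of H10 that is superharmonic for [dformb l] is excessive. It may fail
    to be in the domain of the operator, but its resolvents y are, and there the
    superharmonicity says [(c - l) *: y <= c *: w]. *)
Lemma dirichlet_excessive (l t : R) w : 0 <= l -> 0 <= t -> H w ->
  (forall v, H v -> {ae m, forall x, 0 <= v x} -> 0 <= dformb l w v) ->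
  {ae m, forall x, TD t w x <= expR (l * t) * w x}.
Proof.
move=> l0 t0 Hw hw; have Lw := HL Hw.
have : {ae m, forall x, (TD t w - expR (l * t) *: w) x <= 0}.
  apply: ae_le0_closed; first by apply: L2B; [exact: LD|exact: L2Z].
  move=> e e0; pose M := 2 + 2 * expR (l * t) ^+ 2.
  have M0 : 0 < M by rewrite ltr_wpDr// mulr_ge0// sqr_ge0.
  have [b0 b00 hb] := cvg_H Lw (divr_gt0 e0 M0).
  pose c := b0 + l + 1; have c0 : 0 < c by rewrite addr_gt0// ltr_wpDr.
  have lc : 0 < c - l by rewrite /c addrAC addrK addr_gt0.
  have [y ry] := res_H c0 (L2Z c Lw); have [Hy hy] := ry; have Ly := HL Hy.
  have yop := resolvent_form_operator (L2Z c Lw) ry.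
  pose z := (c - l) *: y - c *: w.
  have Hz : H z by apply: (siB (SH ler01)); exact: (siZ (SH ler01)).
  have HP := H10_pospart FR Hz.
  have z0 : {ae m, forall x, z x <= 0}.
    apply: (tildeH1_le0 FR c0 (HF Hz)).
    have S := SH (ltW c0).
    rewrite /z (siBl S (siZ S _ Hy) (siZ S _ Hw) HP) (siZl S _ Hy HP) (siZl S _ Hw HP).
    rewrite -/z (hy _ HP) (ipZl _ Lw (HL HP)).
    have := hw _ HP (ae_pospart_ge0 _ _); rewrite !dformbE => h.
    have -> : (c - l) * (c * ip w (pospart z)) - c * (dform w (pospart z) + c * ip w (pospart z)) =
       - (c * (dform w (pospart z) + l * ip w (pospart z))) by ring.
    by rewrite oppr_le0 mulr_ge0// ltW.
  have key : {ae m, forall x, TD t y x <= expR (l * t) * y x}.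
    apply: (excessive_domain l0 t0 yop); apply: filterS z0 => x.
    rewrite -[z x]/((c - l) * y x - c * w x).
    rewrite -[(_ + _) x]/(c * w x - c * y x + l * y x) => h.
    have -> : c * w x - c * y x + l * y x = - ((c - l) * y x - c * w x) by ring.
    by rewrite oppr_ge0.
  exists (TD t y - expR (l * t) *: y); split.
  - by apply: L2B; [exact: LD|exact: L2Z].
  - have LB := L2B Ly Lw.
    have E1 : {ae m, forall x, (TD t y - expR (l * t) *: y - (TD t w - expR (l * t) *: w)) x =
       (TD t (y - w) - expR (l * t) *: (y - w)) x}.
      apply: filterS (semigroup_sub hTD t0 Ly Lw) => x x1.
      rewrite -[RHS]/(TD t (y - w) x - expR (l * t) * (y x - w x)) x1.
      by rewrite -[LHS]/(TD t y x - expR (l * t) * y x - (TD t w x - expR (l * t) * w x)); ring.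
    have La : L2 (TD t y - expR (l * t) *: y - (TD t w - expR (l * t) *: w)).
      by apply: L2B; apply: L2B; [exact: LD|exact: L2Z|exact: LD|exact: L2Z].
    have Lb : L2 (TD t (y - w) - expR (l * t) *: (y - w)) by apply: L2B; [exact: LD|exact: L2Z].
    rewrite (ip_aeql La Lb La E1) (ip_aeqr La Lb Lb E1).
    apply: le_lt_trans (si_sqrB SL (LD t0 LB) (L2Z _ LB)) _.
    rewrite (siZZ SL _ LB); have := hb c y _ ry.
    have -> : b0 < c by rewrite /c -addrA ltrDl ltr_wpDl.
    move=> /(_ isT); rewrite ltr_pdivlMr// /M => h1.
    have := semigroup_ip_contraction hTD t0 LB; move: h1.
    move: (ip (TD t (y - w)) (TD t (y - w))) (ip (y - w) (y - w)) (expR (l * t) ^+ 2) => p q r *; nra.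
  by apply: filterS key => x; rewrite -[(_ - _) x]/(TD t y x - expR (l * t) * y x) subr_le0.
by apply: filterS => x; rewrite -[(_ - _) x]/(TD t w x - expR (l * t) * w x) subr_le0.
Qed.

Let le_of_young (a b c : R) : 0 <= b - a -> 0 <= a - 2 * b + c -> a <= c.
Proof. by move=> *; lra. Qed.

(** Elements of H10 are small near the boundary, in the sense that outside of some
    compact set they lie below an excessive function of small norm. This
    function has least energy among those above u outside of the support K of a test
    function psi close to u, and it is small because [|u - psi|] is a competitor. *)
Lemma dirichlet_obstacle (l : R) u (e : R) : 0 < l -> 0 < e -> H u ->
  exists K w, [/\ compact K, K `<=` Om, H w /\ ip w w < e,
    {ae m, forall x, ~ K x -> u x <= w x} & {ae m, forall x, 0 <= w x} /\
    forall t, 0 <= t -> {ae m, forall x, TD t w x <= expR (l * t) * w x}].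
Proof.
move=> l0 e0 Hu; have Lu := HL Hu; have S := SH (ltW l0).
have le0 : 0 < l * e by rewrite mulr_gt0.
pose M := 1 + l; have M0 : 0 < M by rewrite addr_gt0.
have [Hu1 hu] := Hu; have [psi [Hpsi tpsi psiu]] := hu _ (divr_gt0 le0 M0).
have [_ [K [cK KO psiK]]] := tpsi; exists K.
have Hp : H psi by apply: sub_H1_closure.
have HB := siB S Hu Hp.
have [Hn dn] : H (fun x => `|(u - psi) x|) /\ dform (fun x => `|(u - psi) x|) (fun x => `|(u - psi) x|) <= dform (u - psi) (u - psi).
  split.
    have -> : (fun x => `|(u - psi) x|) = pospart (u - psi) + pospart (- (u - psi)).
      apply/funext => x; rewrite -[RHS]/(Num.max ((u - psi) x) 0 + Num.max (- (u - psi) x) 0).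
      by have [h|h] := leP 0 ((u - psi) x); have [h'|h'] := leP 0 (- (u - psi) x);
        rewrite ?(ger0_norm h) ?(ltr0_norm h); lra.
    by apply: (siD S); apply: (H10_pospart FR) => //; exact: (siN S).
  exact: (H1_closure_norm (Cc_closure0 Omega) (@Cc_closureD _ _ Omega) (@Cc_closureZ _ _ Omega) FR (HF HB)).2.
pose z := fun x => `|(u - psi) x|.
pose C : set (E -> R) := [set v | H v /\ {ae m, forall x, ~ K x -> u x <= v x}].
have Cz : C z.
  split => //; apply: aeW => x nK; rewrite /z -[(u - psi) x]/(u x - psi x) psiK// subr0.
  exact: ler_norm.
have mK := compact_rV_measurable cK; have mKC := measurableC mK.
have [|||||||||w Cw hw] := @si_minimizer _ _ H (dformb l) S C (fun=> 0) 0.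
- exact: (@H1_closure_complete _ _ Omega test l l0).
- by move=> v [].
- by exists z.
- move=> s x y s0 s1 [Hx hx] [Hy hy]; split.
    by apply: (siD S) => //; apply: (siZ S); exact: (siB S).
  apply: filterS2 hx hy => p xp yp nK.
  rewrite -[(x + _) p]/(x p + s * (y p - x p)); rewrite -subr_ge0.
  have -> : x p + s * (y p - x p) - u p = (1 - s) * (x p - u p) + s * (y p - u p) by ring.
  by rewrite addr_ge0// mulr_ge0// subr_ge0//; [exact: xp|exact: yp].
- move=> x Hx hx; split => //.
  have Lx := HL Hx; have Lux := L2B Lu Lx.
  have : {ae m, forall p, ((u - x) \_ (~` K)) p <= 0}.
    apply: ae_le0_closed; first exact: L2_patch.
    move=> e' e'0; have [y [Hy uy] yx] := hx _ (mulr_gt0 l0 e'0).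
    have Ly := HL Hy; exists ((u - y) \_ (~` K)); split.
    + by apply: L2_patch => //; exact: L2B.
    + apply: (@le_lt_trans _ _ (ip (y - x) (y - x))).
        apply: ip_le_norm; [by apply: L2B; apply: L2_patch => //; exact: L2B|exact: L2B|].
        apply: aeW => p; rewrite -[(_ - _) p]/(((u - y) \_ (~` K)) p - ((u - x) \_ (~` K)) p) !patchE.
        case: ifP => _; last by rewrite subrr normr0.
        rewrite -[(u - y) p]/(u p - y p) -[(u - x) p]/(u p - x p) -[(y - x) p]/(y p - x p).
        rewrite (_ : u p - y p - (u p - x p) = - (y p - x p)); last by ring.
        by rewrite normrN.
      rewrite -(ltr_pM2l l0); apply: le_lt_trans yx; rewrite dformbE lerDr.
      exact: dform_ge0.
    + apply: filterS uy => p up; rewrite patchE; case: ifPn => // /set_mem nK.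
      by rewrite -[(u - y) p]/(u p - y p) subr_le0; exact: up.
  apply: filterS => p; rewrite patchE => h nK; move: h; rewrite mem_set//.
  by rewrite -[(u - x) p]/(u p - x p) subr_le0.
- by move=> *; rewrite addr0.
- by move=> *; rewrite mulr0.
- by [].
- by move=> x _; rewrite mulr0 expr0n.
have [Hw uw] := Cw; have Lw := HL Hw.
(* adding a nonnegative function to w keeps it above the obstacle *)
have exc v : H v -> {ae m, forall x, 0 <= v x} -> 0 <= dformb l w v.
  move=> Hv v0; have := hw (w + v).
  rewrite addrAC subrr add0r; apply; split; first exact: (siD S).
  by apply: filterS2 uw v0 => x h1 h2 nK; rewrite -[(w + v) x]/(w x + v x) ler_wpDr// h1.
exists w; split => //.
- split => //; have := hw _ Cz; rewrite (siBr S Hn Hw Hw) => h.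
  have h2 := si_ge0 S (siB S Hw Hn); rewrite (siBB S Hw Hn) in h2.
  have h3 : dformb l z z <= dformb l (u - psi) (u - psi).
    rewrite !dformbE; apply: lerD => //; rewrite ler_pM2l//.
    apply: ip_le_norm; [exact: HL Hn|exact: HL HB|].
    by apply: aeW => x; rewrite /z normr_id.
  have h4 : dformb l (u - psi) (u - psi) < l * e.
    have : dform (psi - u) (psi - u) + ip (psi - u) (psi - u) < l * e / M by exact: psiu.
    rewrite (si_subC SI0 (HH Hp) Hu1) (si_subC SL (HL Hp) Lu) ltr_pdivlMr// dformbE /M.
    have := dform_ge0 Omega (u - psi); have := ip_ge0 Omega (u - psi).
    move=> i0 d0 hh; apply: le_lt_trans hh; rewrite -subr_ge0.
    have -> : (dform (u - psi) (u - psi) + ip (u - psi) (u - psi)) * (1 + l) -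
       (dform (u - psi) (u - psi) + l * ip (u - psi) (u - psi)) =
       ip (u - psi) (u - psi) + l * dform (u - psi) (u - psi) by ring.
    by rewrite addr_ge0// mulr_ge0// ltW.
  have h5 : l * ip w w <= dformb l w w by rewrite dformbE lerDr dform_ge0.
  rewrite -(ltr_pM2l l0); apply: (le_lt_trans h5); apply: le_lt_trans h4.
  apply: le_trans h3; rewrite -/z in h h2.
  exact: le_of_young h h2.
- split; last by move=> t t0; apply: dirichlet_excessive => //; exact: ltW.
  have HN := siN S Hw; have HP := H10_pospart FR HN.
  have : {ae m, forall x, (- w) x <= 0}.
    apply: (tildeH1_le0 FR l0 (HF HN)); rewrite (siNl S Hw HP) oppr_le0.
    by apply: exc => //; exact: ae_pospart_ge0.
  by apply: filterS => x; rewrite oppr_le0.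
Qed.

(** the product [(1_K TD h) ^ n 1_K] applied to g *)
Fixpoint killed (K : set E) (h : R) g (n : nat) : E -> R :=
  if n is n'.+1 then (TD h (killed K h g n')) \_ K else g \_ K.

Lemma killed_L2 K h g n : measurable K -> 0 <= h -> L2 g -> L2 (killed K h g n).
Proof.
move=> mK h0 Lg; elim: n => [|n ih] /=; first exact: L2_patch.
by apply: L2_patch => //; exact: LD.
Qed.

(** By induction on n. In K nothing is lost in the last step; off K the whole of [TD
    (n h) g] is at most a multiple of u, and u is below w there. *)
Lemma dirichlet_leak K (l h : R) u w g n : measurable K -> 0 <= l -> 0 <= h ->
  L2 u -> L2 w -> L2 g -> {ae m, forall x, 0 <= g x <= u x} ->
  (forall t, 0 <= t -> {ae m, forall x, TD t u x <= expR (l * t) * u x}) ->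
  {ae m, forall x, 0 <= w x} ->
  (forall t, 0 <= t -> {ae m, forall x, TD t w x <= expR (l * t) * w x}) ->
  {ae m, forall x, ~ K x -> u x <= w x} ->
  {ae m, forall x, TD (n%:R * h) g x <= killed K h g n x + expR (l * (n%:R * h)) * w x}.
Proof.
move=> mK l0 h0 Lu Lw Lg gu Tu w0 Tw uw.
elim: n => [|n ih].
  rewrite mul0r mulr0 expR0.
  apply: filterS2 (filterI (semigroup_0 hTD Lg) gu) (filterI uw w0) => x [-> /andP[g0 gux]] [ux wx].
  rewrite mul1r /= patchE; case: ifPn => [_|/negP xK]; first by rewrite lerDl.
  rewrite add0r (le_trans gux)// ux// => Kx; apply: xK; exact: mem_set.
have nh : 0 <= n%:R * h by rewrite mulr_ge0.
have nh1 : 0 <= n.+1%:R * h by rewrite mulr_ge0.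
have LS := killed_L2 n mK h0 Lg.
have e1 : {ae m, forall x, TD (n.+1%:R * h) g x = TD h (TD (n%:R * h) g) x}.
  rewrite -natr1 mulrDl mul1r addrC; exact: (semigroup_D hTD).
have Lr : L2 (fun x => expR (l * (n%:R * h)) * w x + killed K h g n x).
  exact: (L2D (L2Z (expR (l * (n%:R * h))) Lw) LS).
have e2 : {ae m, forall x, TD h (TD (n%:R * h) g) x <=
    TD h (fun x => expR (l * (n%:R * h)) * w x + killed K h g n x) x}.
  apply: dirichlet_semigroup_mono => //; first exact: LD.
  by apply: filterS ih => x; rewrite addrC.
have e3 := @semigroup_linear _ _ _ _ _ hTD h (expR (l * (n%:R * h))) w (killed K h g n) h0 Lw LS.
have e4 := Tw h h0.
have e5 : {ae m, forall x, TD (n.+1%:R * h) g x <= TD (n.+1%:R * h) u x}.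
  by apply: dirichlet_semigroup_mono => //; apply: filterS gu => x /andP[].
have e6 := Tu _ nh1.
have eE : expR (l * (n.+1%:R * h)) = expR (l * (n%:R * h)) * expR (l * h).
  by rewrite -expRD -mulrDr -natr1 mulrDl mul1r.
apply: filterS2 (filterI e1 (filterI e2 (filterI e3 e4))) (filterI (filterI e5 e6) uw) => x [x1 [x2 [x3 x4]]] [[x5 x6] x7].
rewrite /= patchE; case: ifPn => [_|/negP xK].
  rewrite x1; apply: (le_trans x2); rewrite x3 addrC lerD2l eE -mulrA.
  by rewrite ler_wpM2l ?expR_ge0.
rewrite add0r; apply: (le_trans x5); apply: (le_trans x6).
rewrite ler_wpM2l ?expR_ge0//; apply: x7 => Kx; apply: xK; exact: mem_set.
Qed.

(** u is b times the b-resolvent of f for large b, and g is the minimum of f and u;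
    being a resolvent of a nonnegative function, u is excessive. *)
Lemma dirichlet_dominated_approx f (e : R) : L2 f -> {ae m, forall x, 0 <= f x} -> 0 < e ->
  exists u g l, [/\ 0 < l, H u,
    forall t, 0 <= t -> {ae m, forall x, TD t u x <= expR (l * t) * u x},
    L2 g /\ {ae m, forall x, 0 <= g x <= u x} &
    {ae m, forall x, g x <= f x} /\ ip (f - g) (f - g) < e].
Proof.
move=> Lf f0 e0; have [b0 b00 hb] := cvg_H Lf e0.
pose b := b0 + 1; have bb : 0 < b by rewrite ltr_wpDr.
have [u ru] := res_H bb (L2Z b Lf); have [Hu hu] := ru; have Lu := HL Hu.
have u0 := dirichlet_resolvent_ge0 FR bb (L2Z b Lf) (scaled_ge0 bb f0) ru.
have Lg : L2 (fun x => Num.min (f x) (u x)) by exact: L2_min.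
exists u, (fun x => Num.min (f x) (u x)), b; split => //.
- move=> t t0; apply: dirichlet_excessive => //; first exact: ltW.
  move=> v Hv v0; rewrite (hu _ Hv); apply: ip_nneg => //; [exact: L2Z|exact: HL|exact: scaled_ge0].
- split => //; apply: filterS2 f0 u0 => x fx ux.
  by rewrite le_min fx ux ge_min lexx orbT.
- split; first by apply: aeW => x; rewrite ge_min lexx.
  apply: le_lt_trans (hb b u _ ru); last by rewrite ltrDl.
  apply: ip_le_norm; [exact: L2B|exact: L2B|]; apply: aeW => x.
  rewrite -[(f - _) x]/(f x - Num.min (f x) (u x)) -[(u - f) x]/(u x - f x).
  have [h|h] := leP (f x) (u x); first by rewrite subrr normr0.
  by rewrite distrC.
Qed.

End comparison.

(** * Integrals of functions that need not be measurable *)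

Section lower_integral.
Import HBNNSimple.
Context d (T : measurableType d) (R : realType) (mu : {measure set T -> \bar R}).
Local Open Scope ereal_scope.
Implicit Types f g : T -> \bar R.

(** Integrals of nonnegative functions, measurable or not, are suprema over the
    simple functions below them, and changing a simple function on a null set does
    not change its integral. *)
Lemma ge0_ae_le_lower_integral f g : (forall x, 0 <= f x) -> (forall x, 0 <= g x) ->
  {ae mu, forall x, f x <= g x} -> \int[mu]_x f x <= \int[mu]_x g x.
Proof.
move=> f0 g0 [N [mN N0 fgN]].
rewrite (ge0_integralTE _ f0) (ge0_integralTE _ g0).
apply: ge_ereal_sup => _ [h /= hf <-].
have mNC : measurable (~` N) by exact: measurableC.
apply: ereal_sup_ge; exists (sintegral mu (proj_nnsfun h mNC)).
  exists (proj_nnsfun h mNC) => //= x.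
  rewrite /= mindicE; have [Nx|nNx] := pselect (N x).
    by rewrite memNset//= ?mulr0//; exact: g0.
  rewrite mem_set//= mulr1; apply: le_trans (hf x) _.
  by apply: contrapT => nfg; apply: nNx; apply: fgN.
rewrite -!integralT_nnsfun le_eqVlt; apply/orP; left; apply/eqP.
apply: ge0_ae_eq_integral => //.
- by apply/measurable_EFinP; exact: measurable_funP.
- by apply/measurable_EFinP; exact: measurable_funP.
- by move=> x _; rewrite lee_fin.
- by move=> x _; rewrite lee_fin.
exists N; split => // x /= h1; apply: contrapT => nNx; apply: h1 => _.
by rewrite /= mindicE mem_set//= mulr1.
Qed.

Lemma ae_eq_lower_integral f g : {ae mu, forall x, f x = g x} ->
  \int[mu]_x f x = \int[mu]_x g x.
Proof.
move=> fg; rewrite integralE [RHS]integralE.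
have fp : {ae mu, forall x, f^\+ x = g^\+ x} by apply: filterS fg => x; rewrite !funeposE => ->.
have fn : {ae mu, forall x, f^\- x = g^\- x} by apply: filterS fg => x; rewrite !funenegE => ->.
congr (_ - _); apply/eqP; rewrite eq_le; apply/andP; split; apply: ge0_ae_le_lower_integral => //.
- by apply: filterS fp => x ->.
- by apply: filterS fp => x ->.
- by apply: filterS fn => x ->.
- by apply: filterS fn => x ->.
Qed.

Lemma ge0_integral_eq0_ae f : measurable_fun setT f -> (forall x, 0 <= f x) ->
  \int[mu]_x f x = 0 -> {ae mu, forall x, f x = 0}.
Proof.
move=> mf f0 if0; have : \int[mu]_x `|f x| = 0.
  by rewrite -[RHS]if0; apply: eq_integral => x _; rewrite gee0_abs.
by move/(ae_eq_integral_abs mu measurableT mf); apply: filterS => x; apply.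
Qed.

End lower_integral.

Section induction.
Import HBNNSimple.
Context d (T : measurableType d) (R : realType).
Local Open Scope ereal_scope.

(** Nonnegative measurable functions are increasing limits of simple functions. *)
Lemma ge0_measurable_induction (P : (T -> \bar R) -> Prop) :
  (forall A, measurable A -> P (fun x => (\1_A x)%:E)) ->
  (forall f g, measurable_fun setT f -> (forall x, 0 <= f x) -> P f ->
     measurable_fun setT g -> (forall x, 0 <= g x) -> P g -> P (fun x => f x + g x)) ->
  (forall (c : R) f, (0 <= c)%R -> measurable_fun setT f -> (forall x, 0 <= f x) ->
     P f -> P (fun x => c%:E * f x)) ->
  (forall f_ : nat -> T -> \bar R, (forall n, measurable_fun setT (f_ n)) ->
     (forall n x, 0 <= f_ n x) -> (forall n, P (f_ n)) ->
     (forall x, nondecreasing_seq (f_ ^~ x)) -> P (fun x => limn (f_ ^~ x))) ->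
  forall f, measurable_fun setT f -> (forall x, 0 <= f x) -> P f.
Proof.
move=> P1 PD PZ Plim f mf f0.
pose Q f := [/\ measurable_fun setT f, forall x, 0 <= f x & P f].
have Q1 (c : R) A : (0 <= c)%R -> measurable A -> Q (fun x => c%:E * (\1_A x)%:E).
  move=> c0 mA; have m1 : measurable_fun setT (fun x => (\1_A x)%:E : \bar R).
    by apply/measurable_EFinP; exact: measurable_indic.
  split.
  - exact: measurable_funeM.
  - by move=> x; rewrite mule_ge0 ?lee_fin.
  - by apply: PZ => // ; exact: P1.
have Qsum (n : nat) (c : 'I_n -> R) (A : 'I_n -> set T) : (forall i, (0 <= c i)%R) ->
    (forall i, measurable (A i)) ->
    Q (fun x => \sum_(i < n) (c i)%:E * (\1_(A i) x)%:E).
  elim: n => [|n ih] in c A *.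
    move=> _ _; have [m0 h0 p0] := Q1 0%R set0 (lexx _) measurable0.
    rewrite (_ : (fun x => _) = (fun x => 0%:E * (\1_set0 x)%:E)) //.
    by apply/funext => x; rewrite big_ord0 mul0e.
  move=> c0 mA.
  have [m1 h1 p1] := ih (fun i => c (widen_ord (leqnSn n) i)) (fun i => A (widen_ord (leqnSn n) i)) (fun i => c0 _) (fun i => mA _).
  have [m2 h2 p2] := Q1 _ _ (c0 ord_max) (mA ord_max).
  under eq_fun do rewrite big_ord_recr/=.
  split; [exact: emeasurable_funD|by move=> x; rewrite adde_ge0|exact: PD].
have Qs (h : {nnsfun T >-> R}) : Q (fun x => (h x)%:E).
  pose s : seq R := finmap.enum_fset (fset_set (range h)).
  rewrite (_ : (fun x => _) = (fun x => \sum_(i < size s)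
     (nth 0%R s i)%:E * (\1_(h @^-1` [set nth 0%R s i]) x)%:E)).
    apply: Qsum => i; last exact: measurable_sfunP.
    have e1 := in_fset_set (fimfunP h) (nth 0%R s i).
    by have /set_mem[x _ <-] := etrans (esym e1) (mem_nth 0%R (ltn_ord i)).
  by apply/funext => x; rewrite fimfunEord -sumEFin; apply: eq_bigr => i _; rewrite EFinM.
pose g := nnsfun_approx measurableT mf.
have -> : f = (fun x => limn ((fun n x => (g n x)%:E) ^~ x)).
  apply/funext => x; apply/esym/cvg_lim => //.
  exact: (cvg_nnsfun_approx measurableT mf (fun x _ => f0 x)).
apply: Plim.
- by move=> n; have [] := Qs (g n).
- by move=> n; have [] := Qs (g n).
- by move=> n; have [] := Qs (g n).
- move=> x a b ab; rewrite lee_fin.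
  by have /lefP := nd_nnsfun_approx measurableT mf ab; apply.
Qed.

End induction.

(** * The Markov property *)

Section markov.
Context {R : realType} {N : nat} (Omega : domain R N).
Context d (W : measurableType d) (X : process R N W).
Local Notation E := 'rV[R]_N.
Local Notation clO := (closure (Omega : set E)).
Local Open Scope ereal_scope.
Implicit Types (s t : R) (w : W) (A B : set E) (L G : set W) (Y : W -> \bar R).
Hypothesis hX : hunt_process Omega X.

Lemma natural_mono (I J : set R) : I `<=` J -> natural X I `<=` natural X J.
Proof.
move=> IJ; apply: sub_sigma_algebra2 => _ [t [B [It mB ->]]].
by exists t, B; split => //; exact: IJ.
Qed.

Lemma natural_measurable (I : set R) : I `<=` [set t | (0 <= t)%R] ->
  natural X I `<=` measurable.
Proof.
move=> I0 L; rewrite (hunt_sample hX); apply: natural_mono => t /I0.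
by rewrite /= in_itv/= andbT.
Qed.

Lemma natural_sigma_algebra (I : set R) : sigma_algebra setT (natural X I).
Proof. exact: smallest_sigma_algebra. Qed.

Lemma natural_traj (I : set R) t B : I t -> measurable B ->
  natural X I (traj X t @^-1` (Some @` B)).
Proof. by move=> It mB; apply: sub_sigma_algebra; exists t, B. Qed.

Lemma natural_setI (I : set R) L G : natural X I L -> natural X I G ->
  natural X I (L `&` G).
Proof. exact: (@measurableI _ (g_sigma_algebraType _) L G). Qed.

Lemma natural_set0 (I : set R) : natural X I set0.
Proof. exact: (@measurable0 _ (g_sigma_algebraType _)). Qed.

Lemma natural_setT (I : set R) : natural X I setT.
Proof. exact: (@measurableT _ (g_sigma_algebraType _)). Qed.

Lemma measurable_traj t B : (0 <= t)%R -> measurable B ->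
  measurable (traj X t @^-1` (Some @` B)).
Proof.
move=> t0 mB; apply: (@natural_measurable [set t]); first by move=> _ ->.
exact: natural_traj.
Qed.

Lemma traj_NoneE t : traj X t @^-1` [set None] = ~` (traj X t @^-1` (Some @` setT)).
Proof.
apply/seteqP; split => w /=; first by move=> -> [].
by case: (traj X t w) => // x; case; exists x.
Qed.

Lemma measurable_oapp t (f : E -> \bar R) (c : \bar R) : (0 <= t)%R ->
  measurable_fun setT f -> measurable_fun setT (fun w => oapp f c (traj X t w)).
Proof.
move=> t0 mf _ B mB; rewrite setTI.
have mfB : measurable (f @^-1` B) by rewrite -[X in measurable X]setTI; exact: mf.
rewrite (_ : _ @^-1` _ = traj X t @^-1` (Some @` (f @^-1` B)) `|`
    (traj X t @^-1` [set None] `&` (if `[< B c >] then setT else set0))).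
  apply: measurableU; first exact: measurable_traj.
  apply: measurableI; last by case: ifP.
  by rewrite traj_NoneE; apply: measurableC; exact: measurable_traj.
apply/seteqP; split => w /=.
  case: (traj X t w) => [x|] /= h; first by left; exists x.
  by right; split => //; case: ifPn => // /asboolP.
case=> [[x Bx <-]//|[->]] /=.
by case: ifPn => // /asboolP.
Qed.

Definition expect Y (o : option E) : \bar R := \int[law X o]_w Y w.

Lemma expectE Y o : expect Y o = \int[law X o]_w Y w. Proof. by []. Qed.

Lemma expect_ge0 Y o : (forall w, 0 <= Y w) -> 0 <= expect Y o.
Proof. by move=> Y0; apply: integral_ge0. Qed.

Lemma measurable_closure_domain : measurable clO.
Proof. by apply: closed_rV_measurable; exact: closed_closure. Qed.

Lemma measurable_expect Y : measurable_fun setT Y -> (forall w, 0 <= Y w) ->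
  measurable_fun clO (fun x => expect Y (Some x)).
Proof.
have mcl := measurable_closure_domain.
move: Y; apply: ge0_measurable_induction.
- move=> L mL; rewrite (_ : (fun x => _) = (fun x => law X (Some x) L)).
    exact: (hunt_law hX mL).
  by apply/funext => x; rewrite /expect integral_indic// setIT.
- move=> f g mf f0 If mg g0 Ig.
  rewrite (_ : (fun x => _) = (fun x => expect f (Some x) + expect g (Some x))).
    exact: emeasurable_funD.
  by apply/funext => x; rewrite /expect ge0_integralD.
- move=> c f c0 mf f0 If.
  rewrite (_ : (fun x => _) = (fun x => c%:E * expect f (Some x))).
    exact: measurable_funeM.
  by apply/funext => x; rewrite /expect ge0_integralZl_EFin.
- move=> f mf f0 If ndf.
  apply: (@emeasurable_fun_cvg _ _ _ _ (fun n x => expect (f n) (Some x))) => // x _.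
  by apply: cvg_monotone_convergence => // w _; exact: ndf.
Qed.

Lemma expect_traj_oapp Y s : (0 <= s)%R ->
  (fun w => expect Y (traj X s w)) =
  (fun w => oapp ((fun x => expect Y (Some x)) \_ clO) (expect Y None) (traj X s w)).
Proof.
move=> s0; apply/funext => w; have := hunt_state hX w s0.
by case: (traj X s w) => //= x clx; rewrite patchE mem_set.
Qed.

Lemma measurable_expect_traj Y s : (0 <= s)%R -> measurable_fun setT Y ->
  (forall w, 0 <= Y w) -> measurable_fun setT (fun w => expect Y (traj X s w)).
Proof.
move=> s0 mY Y0; rewrite expect_traj_oapp//; apply: measurable_oapp => //.
by apply/(measurable_restrictT _ measurable_closure_domain); exact: measurable_expect.
Qed.

Lemma completed_sub (S : set (set W)) : S `<=` completed Omega X S.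
Proof.
move=> L SL nu; exists L, set0; split => //.
- rewrite /law_from measure0 adde0 integral0_eq// => x _; exact: measure0.
- by rewrite !setDv setU0.
Qed.

(** The simple Markov property is the strong one at a constant time. *)
Lemma stopping_time_cst s : (0 <= s)%R -> stopping_time Omega X (fun=> s%:E).
Proof.
move=> s0; split=> [w|t t0]; first by rewrite lee_fin.
apply: completed_sub; have sa := natural_sigma_algebra `[0%R, t]%classic.
have [st|st] := leP s t.
  have -> : [set w : W | s%:E <= t%:E] = setT.
    by apply/predeqP => w /=; split => // _; rewrite lee_fin.
  exact: natural_setT.
have -> : [set w : W | s%:E <= t%:E] = set0.
  by apply/predeqP => w /=; split => //; rewrite lee_fin leNgt st.
exact: natural_set0.
Qed.

Lemma filt_at_cst s L : (0 <= s)%R -> natural X `[0%R, s]%classic L ->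
  filt_at Omega X (fun=> s%:E) L.
Proof.
move=> s0 nL; split.
  apply: completed_sub; apply: natural_mono nL => t.
  by rewrite /= !in_itv/= => /andP[->].
move=> t t0; apply: completed_sub; have [st|st] := leP s t.
  rewrite (_ : _ `&` _ = L); last first.
    by apply/seteqP; split => [w []//|w Lw]; split => //=; rewrite lee_fin.
  apply: natural_mono nL => r; rewrite /= !in_itv/= => /andP[-> rs].
  exact: le_trans rs st.
rewrite (_ : _ `&` _ = set0); first exact: sigma_algebra0.
by apply/seteqP; split => // w /= [_]; rewrite lee_fin leNgt st.
Qed.

Lemma oapp_indic t B w : oapp (fun x => (\1_B x)%:E) 0 (traj X t w) =
  (\1_(traj X t @^-1` (Some @` B)) w)%:E :> \bar R.
Proof.
rewrite [in RHS]indicE; case E1 : (traj X t w) => [x|] /=; last first.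
  by rewrite memNset//= E1 => -[].
rewrite indicE; have [Bx|nBx] := pselect (B x).
  by rewrite !mem_set//= E1; exists x.
by rewrite !memNset//= E1 => -[y By [yx]]; apply: nBx; rewrite -yx.
Qed.

Lemma markov_one_time s t L x (F : E -> \bar R) : (0 <= s)%R -> (0 <= t)%R ->
  natural X `[0%R, s]%classic L -> state Omega x ->
  measurable_fun setT F -> (forall y, 0 <= F y) ->
  \int[law X x]_w ((\1_L w)%:E * oapp F 0 (traj X (s + t)%R w)) =
  \int[law X x]_w ((\1_L w)%:E * expect (fun w' => oapp F 0 (traj X t w')) (traj X s w)).
Proof.
move=> s0 t0 nL sx; have st0 : (0 <= s + t)%R by rewrite addr_ge0.
have mL : measurable L.
  by apply: natural_measurable nL => r; rewrite /= in_itv/= => /andP[].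
have m1 : measurable_fun setT (fun w => (\1_L w)%:E : \bar R).
  by apply/measurable_EFinP; exact: measurable_indic.
have i0 w : 0 <= (\1_L w)%:E :> \bar R by rewrite lee_fin.
have o0 F' r : (forall y, 0 <= F' y) -> forall w : W, 0 <= oapp F' 0 (traj X r w).
  by move=> F0 w; case: (traj X r w) => //=.
have me F' : measurable_fun setT F' -> (forall y, 0 <= F' y) ->
    measurable_fun setT (fun w => expect (fun w' => oapp F' 0 (traj X t w')) (traj X s w)).
  move=> mF F0; apply: measurable_expect_traj => //; last exact: o0.
  exact: measurable_oapp.
move: F; apply: ge0_measurable_induction.
- move=> B mB.
  have := hunt_strong_markov hX (stopping_time_cst s0) (filt_at_cst s0 nL) t0 mB sx.
  move=> h; transitivity (\int[law X x]_w (\1_(L `&` [set w' | (Some @` B) (traj_at X (s%:E + t%:E) w')]) w)%:E).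
    by apply: eq_integral => w _; rewrite oapp_indic indicI EFinM.
  rewrite h; apply: eq_integral => w _; congr (_ * _).
  rewrite /expect; under eq_integral do rewrite oapp_indic.
  by rewrite integral_indic ?setIT//; exact: measurable_traj.
- move=> f g mf f0 If mg g0 Ig.
  have E1 r w : oapp (fun y => f y + g y) 0 (traj X r w) = oapp f 0 (traj X r w) + oapp g 0 (traj X r w).
    by case: (traj X r w) => //=; rewrite adde0.
  transitivity (\int[law X x]_w ((\1_L w)%:E * oapp f 0 (traj X (s + t)%R w) + (\1_L w)%:E * oapp g 0 (traj X (s + t)%R w))).
    by apply: eq_integral => w _; rewrite E1 ge0_muleDr// o0.
  rewrite (ge0_integralD _ measurableT); last 4 first.
  + by move=> w _; rewrite mule_ge0// o0.
  + by apply: emeasurable_funM => //; exact: measurable_oapp.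
  + by move=> w _; rewrite mule_ge0// o0.
  + by apply: emeasurable_funM => //; exact: measurable_oapp.
  rewrite If Ig -(ge0_integralD _ measurableT); last 4 first.
  + by move=> w _; rewrite mule_ge0// expect_ge0//; exact: o0.
  + by apply: emeasurable_funM => //; exact: me.
  + by move=> w _; rewrite mule_ge0// expect_ge0//; exact: o0.
  + by apply: emeasurable_funM => //; exact: me.
  + apply: eq_integral => w _; rewrite -ge0_muleDr; last 2 first.
    * by apply: expect_ge0; exact: o0.
    * by apply: expect_ge0; exact: o0.
    congr (_ * _); rewrite /expect; under [RHS]eq_integral do rewrite E1.
    by rewrite ge0_integralD// => *; try exact: o0; exact: measurable_oapp.
- move=> c f c0 mf f0 If.
  have E1 r w : oapp (fun y => c%:E * f y) 0 (traj X r w) = c%:E * oapp f 0 (traj X r w).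
    by case: (traj X r w) => //=; rewrite mule0.
  transitivity (\int[law X x]_w (c%:E * ((\1_L w)%:E * oapp f 0 (traj X (s + t)%R w)))).
    by apply: eq_integral => w _; rewrite E1 muleCA.
  rewrite (ge0_integralZl_EFin _ measurableT); last 3 first.
  + by move=> w _; rewrite mule_ge0// o0.
  + by apply: emeasurable_funM => //; exact: measurable_oapp.
  + by [].
  rewrite If -ge0_integralZl_EFin//.
  + apply: eq_integral => w _; rewrite muleCA; congr (_ * _).
    rewrite /expect; under [RHS]eq_integral do rewrite E1.
    by rewrite ge0_integralZl_EFin// => *; try exact: o0; exact: measurable_oapp.
  + by move=> w _; rewrite mule_ge0// expect_ge0//; exact: o0.
  + by apply: emeasurable_funM => //; exact: me.
- move=> f mf f0 If ndf.
  have ndo r w : nondecreasing_seq (fun n => oapp (f n) 0 (traj X r w)).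
    by move=> a b ab; case: (traj X r w) => //= y; exact: ndf.
  have E1 r w : oapp (fun y => limn (f ^~ y)) 0 (traj X r w) = limn (fun n => oapp (f n) 0 (traj X r w)).
    by case: (traj X r w) => //=; rewrite lim_cst.
  have co r w : cvgn (fun n => oapp (f n) 0 (traj X r w)).
    exact: ereal_nondecreasing_is_cvgn.
  transitivity (limn (fun n => \int[law X x]_w ((\1_L w)%:E * oapp (f n) 0 (traj X (s + t)%R w)))).
    rewrite -monotone_convergence//.
    + by apply: eq_integral => w _; rewrite E1 limeMl.
    + by move=> n; apply: emeasurable_funM => //; exact: measurable_oapp.
    + by move=> n w _; rewrite mule_ge0// o0.
    + by move=> w _ a b ab; rewrite lee_wpmul2l//; exact: ndo.
  transitivity (limn (fun n => \int[law X x]_w ((\1_L w)%:E * expect (fun w' => oapp (f n) 0 (traj X t w')) (traj X s w)))).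
    by congr (limn _); apply/funext => n; exact: If.
  have nde o : nondecreasing_seq (fun n => expect (fun w' => oapp (f n) 0 (traj X t w')) o).
    move=> a b ab; apply: ge0_le_integral => //.
    + by move=> w _; exact: o0.
    + exact: measurable_oapp.
    + exact: measurable_oapp.
    + by move=> w _; exact: ndo.
  rewrite -monotone_convergence//.
  + apply: eq_integral => w _; rewrite limeMl//; last exact: ereal_nondecreasing_is_cvgn.
    congr (_ * _); rewrite /expect.
    rewrite -monotone_convergence//.
    * by apply: eq_integral => w' _; rewrite E1.
    * by move=> n; exact: measurable_oapp.
    * by move=> n w' _; exact: o0.
  + by move=> n; apply: emeasurable_funM => //; exact: me.
  + by move=> n w _; rewrite mule_ge0// expect_ge0//; exact: o0.
  + by move=> w _ a b ab; rewrite lee_wpmul2l//; exact: nde.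
Qed.

(** Cylinders are described by the successive time increments because the Markov
    property is iterated from the first time on. *)
Fixpoint chain s (l : seq (R * set E)) : set W :=
  if l is p :: l' then (traj X (s + p.1)%R @^-1` (Some @` p.2)) `&` chain (s + p.1)%R l'
  else setT.

Definition good_chain (l : seq (R * set E)) :=
  forall p, p \in l -> (0 <= p.1)%R /\ measurable p.2.

Lemma good_chain_cons p l : good_chain (p :: l) ->
  [/\ (0 <= p.1)%R, measurable p.2 & good_chain l].
Proof.
move=> h; have [] := h p (mem_head _ _); split => // q ql; apply: h.
by rewrite inE ql orbT.
Qed.

Lemma measurable_chain s l : (0 <= s)%R -> good_chain l -> measurable (chain s l).
Proof.
elim: l s => [|p l ih] s s0 //= /good_chain_cons[p0 mp gl].
have sp : (0 <= s + p.1)%R by rewrite addr_ge0.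
by apply: measurableI; [exact: measurable_traj|exact: ih].
Qed.

Lemma chain_shift s r l w : (0 <= s)%R -> (0 <= r)%R -> good_chain l ->
  chain r l (timeshift X s w) = chain (s + r)%R l w.
Proof.
elim: l r => [|p l ih] r s0 r0 //= /good_chain_cons[p0 mp gl].
have rp : (0 <= r + p.1)%R by rewrite addr_ge0.
have -> : (s + r + p.1 = s + (r + p.1))%R by rewrite addrA.
by rewrite /setI/= ih// (hunt_shift hX)// [(r + p.1 + s)%R]addrC.
Qed.

(** Both sides unfold at the first time of the chain: [F y] is the probability of
    the rest of the chain from y on. *)
Lemma markov_chain l s L x : (0 <= s)%R -> good_chain l ->
  natural X `[0%R, s]%classic L -> state Omega x ->
  law X x (L `&` chain s l) = \int[law X x]_w ((\1_L w)%:E * law X (traj X s w) (chain 0%R l)).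
Proof.
elim: l s L x => [|p l ih] s L x s0 /= gl nL sx.
  have mL : measurable L.
    by apply: natural_measurable nL => r; rewrite /= in_itv/= => /andP[].
  rewrite setIT -(setIT L) -integral_indic// setIT.
  by apply: eq_integral => w _; rewrite probability_setT mule1.
have [p0 mp gl'] := good_chain_cons gl.
have sp : (0 <= s + p.1)%R by rewrite addr_ge0.
pose F := (fun y => (\1_p.2 y)%:E * law X (Some y) (chain 0%R l)) \_ clO.
have mch := measurable_chain (lexx 0%R) gl'.
have mF : measurable_fun setT F.
  apply/(measurable_restrictT _ measurable_closure_domain); apply: emeasurable_funM.
    by apply/measurable_EFinP; apply: measurable_funTS; exact: measurable_indic.
  exact: (hunt_law hX mch).
have F0 y : 0 <= F y.
  by rewrite /F patchE; case: ifP => // _; rewrite mule_ge0// lee_fin.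
have key r (L' : set W) o : (0 <= r)%R -> natural X `[0%R, r]%classic L' -> state Omega o ->
    law X o (L' `&` ((traj X (r + p.1)%R @^-1` (Some @` p.2)) `&` chain (r + p.1)%R l)) =
    \int[law X o]_w ((\1_L' w)%:E * oapp F 0 (traj X (r + p.1)%R w)).
  move=> r0 nL' so; have rp : (0 <= r + p.1)%R by rewrite addr_ge0.
  rewrite setIA ih//; last first.
    apply: natural_setI.
    - apply: natural_mono nL' => q; rewrite /= !in_itv/= => /andP[-> qr].
      by apply: le_trans qr _; rewrite lerDl.
    - by apply: natural_traj => //; rewrite /= in_itv/= rp lexx.
  apply: eq_integral => w _; rewrite indicI EFinM -muleA; congr (_ * _).
  rewrite -oapp_indic; have := hunt_state hX w rp.
  case: (traj X (r + p.1)%R w) => [y|] /= cly; last by rewrite mul0e.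
  by rewrite /F patchE mem_set.
rewrite key// markov_one_time//.
apply: eq_integral => w _; congr (_ * _).
have := key 0%R setT (traj X s w) (lexx _) _ (hunt_state hX w s0).
rewrite setTI => ->; last exact: natural_setT.
by apply: eq_integral => w' _; rewrite indicT mul1e add0r.
Qed.

End markov.

Lemma adde_cancell {R : realType} (a b c : \bar R) : a \is a fin_num ->
  (a + b = a + c)%E -> b = c.
Proof. by case: a b c => [a||] [b||] [c||] //= _ [] /addrI ->. Qed.

Section markov_functional.
Context {R : realType} {N : nat} (Omega : domain R N).
Context d (W : measurableType d) (X : process R N W).
Local Notation E := 'rV[R]_N.
Local Notation clO := (closure (Omega : set E)).
Local Notation expect := (expect X).
Local Notation chain := (chain X).
Local Notation event := (R * set E)%type.
Local Open Scope ereal_scope.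
Implicit Types (s t : R) (w : W) (A B : set E) (L G : set W) (Y : W -> \bar R).
Hypothesis hX : hunt_process Omega X.

Lemma measurable_timeshift s : (0 <= s)%R -> measurable_fun setT (timeshift X s).
Proof.
move=> s0; apply: (measurability _ (hunt_sample hX)) => _ [_ [t [B [t0 mB ->]]] <-].
rewrite setTI; rewrite /= in_itv/= andbT in t0.
rewrite (_ : _ @^-1` _ = traj X (t + s)%R @^-1` (Some @` B)).
  by apply: (measurable_traj hX) => //; exact: addr_ge0.
by apply/seteqP; split => w /=; rewrite (hunt_shift hX).
Qed.

Lemma measurable_timeshift_preimage s G : (0 <= s)%R -> measurable G ->
  measurable (timeshift X s @^-1` G).
Proof.
by move=> s0 mG; rewrite -[X in measurable X]setTI; exact: measurable_timeshift.
Qed.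

(** Absolute times, because sorting them shows that cylinders are closed under
    intersection. *)
Definition cylinder (l : seq event) : set W :=
  [set w | forall p, p \in l -> (Some @` p.2) (traj X p.1 w)].

Fixpoint absolute_times s (l : seq event) : seq event :=
  if l is p :: l' then ((s + p.1)%R, p.2) :: absolute_times (s + p.1)%R l' else [::].

Fixpoint increments s (l : seq event) : seq event :=
  if l is p :: l' then ((p.1 - s)%R, p.2) :: increments p.1 l' else [::].

Lemma cylinder_cons p l : cylinder (p :: l) =
  (traj X p.1 @^-1` (Some @` p.2)) `&` cylinder l.
Proof.
apply/seteqP; split => [w h|w [h1 h2] q]; last first.
  by rewrite inE => /predU1P[->//|]; exact: h2.
by split=> [|q ql]; apply: h; rewrite inE ?eqxx// ql orbT.
Qed.

Lemma chain_absolute s l : chain s l = cylinder (absolute_times s l).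
Proof.
elim: l s => [|p l ih] s /=; first by apply/seteqP; split.
by rewrite cylinder_cons/= ih.
Qed.

Lemma chain_increments s l : chain s (increments s l) = cylinder l.
Proof.
elim: l s => [|p l ih] s /=; first by apply/seteqP; split.
by rewrite cylinder_cons/= addrCA subrr addr0 ih.
Qed.

Lemma good_absolute s l p : (0 <= s)%R -> good_chain l -> p \in absolute_times s l ->
  (0 <= p.1)%R /\ measurable p.2.
Proof.
elim: l s => [|q l ih] s s0 //= /good_chain_cons[q0 mq gl].
have sq : (0 <= s + q.1)%R by rewrite addr_ge0.
by rewrite inE => /predU1P[->//|]; exact: ih.
Qed.

Lemma good_increments s l : path (fun a b : event => (a.1 <= b.1)%R) (s, set0) l ->
  (forall p, p \in l -> measurable p.2) -> good_chain (increments s l).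
Proof.
elim: l s => [|q l ih] s //= /andP[sq pl] ml p; rewrite inE => /predU1P[->/=|pl'].
  by rewrite subr_ge0; split => //; apply: ml; rewrite mem_head.
apply: (ih q.1) pl' => //; last by move=> r rl; apply: ml; rewrite inE rl orbT.
by case: l pl {ih ml}.
Qed.

Lemma cylinders_setI_closed :
  setI_closed [set G | exists2 l, good_chain l & G = chain 0%R l].
Proof.
move=> _ _ [l gl ->] [l' gl' ->].
pose r := sort (fun a b : event => (a.1 <= b.1)%R) (absolute_times 0%R l ++ absolute_times 0%R l').
have gr p : p \in r -> (0 <= p.1)%R /\ measurable p.2.
  by rewrite mem_sort mem_cat => /orP[]; exact: good_absolute.
exists (increments 0%R r).
  apply: good_increments; last by move=> p /gr[].
  have : sorted (fun a b : event => (a.1 <= b.1)%R) r.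
    by apply: sort_sorted => a b; exact: le_total.
  case: (r) gr => //= p q gr ->; rewrite andbT.
  by have [] := gr p (mem_head _ _).
rewrite chain_increments !chain_absolute; apply/seteqP; split.
  by move=> w [h1 h2] p; rewrite mem_sort mem_cat => /orP[]; [exact: h1|exact: h2].
by move=> w h; split => p pl; apply: h; rewrite mem_sort mem_cat pl ?orbT.
Qed.

(** Dynkin's lemma, from the cylinders to all events. *)
Lemma markov_set s L x G : (0 <= s)%R -> natural X `[0%R, s]%classic L ->
  state Omega x -> measurable G ->
  law X x (L `&` (timeshift X s @^-1` G)) =
  \int[law X x]_w ((\1_L w)%:E * law X (traj X s w) G).
Proof.
move=> s0 nL sx.
have mL : measurable L.
  by apply: (natural_measurable hX) nL => r; rewrite /= in_itv/= => /andP[].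
have mth G' : measurable G' -> measurable (L `&` (timeshift X s @^-1` G')).
  by move=> mG; apply: measurableI => //; exact: measurable_timeshift_preimage.
have m1 : measurable_fun setT (fun w => (\1_L w)%:E : \bar R).
  by apply/measurable_EFinP; exact: measurable_indic.
have i0 w : 0 <= (\1_L w)%:E :> \bar R by rewrite lee_fin.
have ml G' : measurable G' -> measurable_fun setT (fun w => (\1_L w)%:E * law X (traj X s w) G').
  move=> mG; apply: emeasurable_funM => //.
  rewrite (_ : (fun w => _) = (fun w => expect (fun w' => (\1_G' w')%:E) (traj X s w))).
    apply: (measurable_expect_traj hX) => //.
    by apply/measurable_EFinP; exact: measurable_indic.
  by apply/funext => w; rewrite !expectE integral_indic// setIT.
have l0 G' w : 0 <= (\1_L w)%:E * law X (traj X s w) G' by rewrite mule_ge0.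
pose Hs : set (set W) := [set G | measurable G /\
  law X x (L `&` (timeshift X s @^-1` G)) =
  \int[law X x]_w ((\1_L w)%:E * law X (traj X s w) G)].
have dH : dynkin Hs.
  split.
  - split => //; rewrite preimage_setT setIT -[L in LHS]setIT -integral_indic//.
    by apply: eq_integral => w _; rewrite probability_setT mule1.
  - move=> A [mA hA]; have mCA := measurableC mA; split => //.
    have e1 : law X x (L `&` (timeshift X s @^-1` A)) + law X x (L `&` (timeshift X s @^-1` (~` A))) = law X x L.
      rewrite -measureU//; try exact: mth.
        by rewrite -setIUr -preimage_setU setUv preimage_setT setIT.
      by apply/seteqP; split => // w [[_ Aw] [_ nAw]]; exact: nAw.
    have e2 : \int[law X x]_w ((\1_L w)%:E * law X (traj X s w) A) +
        \int[law X x]_w ((\1_L w)%:E * law X (traj X s w) (~` A)) = law X x L.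
      rewrite -ge0_integralD//; try exact: ml.
      rewrite -[L in RHS]setIT -integral_indic//; apply: eq_integral => w _.
      rewrite -ge0_muleDr// -measureU ?setICr// setUv.
      by rewrite [X in _ * X](probability_setT (law X (traj X s w))) mule1.
    move: e1; rewrite -e2 hA => e1.
    have fA : law X x (L `&` (timeshift X s @^-1` A)) \is a fin_num.
      by apply: fin_num_measure; exact: mth.
    by rewrite -hA in e1; exact: (adde_cancell fA e1).
  - move=> F tF HF; have mF n : measurable (F n) by have [] := HF n.
    split; first exact: bigcupT_measurable.
    rewrite preimage_bigcup setI_bigcupr measure_bigcup//; last 2 first.
    + by move=> n _; exact: mth.
    + apply/trivIsetP => /= i j _ _ ij; rewrite setIACA -preimage_setI.
      by move/trivIsetP : tF => /(_ _ _ Logic.I Logic.I ij) ->; rewrite preimage_set0 setI0.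
    transitivity (\int[law X x]_w (\sum_(n <oo) ((\1_L w)%:E * law X (traj X s w) (F n)))).
      rewrite integral_nneseries//; last by move=> n; exact: ml.
      congr (limn _); apply/funext => n; apply: eq_big => [i|i _].
        by rewrite in_setT.
      by have [_] := HF i.
    apply: eq_integral => w _; rewrite nneseriesZl//.
    rewrite measure_bigcup//; congr (_ * limn _); apply/funext => n.
    by apply: eq_bigl => i; rewrite in_setT.
have : <<s [set G | exists2 l, good_chain l & G = chain 0%R l] >> `<=` Hs.
  apply: dynkin_induction => //; first exact: cylinders_setI_closed.
  move=> _ [l gl ->]; split; first exact: (measurable_chain hX).
  rewrite -(markov_chain hX s0 gl nL sx); congr (law X x (L `&` _)).
  apply/predeqP => w; rewrite /preimage/= (chain_shift hX)// addr0; exact: iff_refl.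
move=> sub mG; have [] := sub G _ => //.
move: mG; rewrite (hunt_sample hX); apply: sub_sigma_algebra2 => _ [t [B [t0 mB ->]]].
rewrite /= in_itv/= andbT in t0.
exists [:: (t, B)]; first by move=> p; rewrite inE => /eqP ->.
by rewrite /= add0r setIT.
Qed.

Lemma markov_functional s L x Y : (0 <= s)%R -> natural X `[0%R, s]%classic L ->
  state Omega x -> measurable_fun setT Y -> (forall w, 0 <= Y w) ->
  \int[law X x]_w ((\1_L w)%:E * Y (timeshift X s w)) =
  \int[law X x]_w ((\1_L w)%:E * expect Y (traj X s w)).
Proof.
move=> s0 nL sx.
have mL : measurable L.
  by apply: (natural_measurable hX) nL => r; rewrite /= in_itv/= => /andP[].
have m1 : measurable_fun setT (fun w => (\1_L w)%:E : \bar R).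
  by apply/measurable_EFinP; exact: measurable_indic.
have i0 w : 0 <= (\1_L w)%:E :> \bar R by rewrite lee_fin.
have mY Y' : measurable_fun setT Y' -> measurable_fun setT (fun w => (\1_L w)%:E * Y' (timeshift X s w)).
  move=> mY; apply: emeasurable_funM => //.
  exact: (measurableT_comp mY (measurable_timeshift s0)).
have mE Y' : measurable_fun setT Y' -> (forall w, 0 <= Y' w) ->
    measurable_fun setT (fun w => (\1_L w)%:E * expect Y' (traj X s w)).
  by move=> mY' Y0; apply: emeasurable_funM => //; exact: (measurable_expect_traj hX).
have Y0 Y' : (forall w, 0 <= Y' w) -> forall w, 0 <= (\1_L w)%:E * Y' (timeshift X s w).
  by move=> Y0 w; rewrite mule_ge0.
have E0 Y' : (forall w, 0 <= Y' w) -> forall w, 0 <= (\1_L w)%:E * expect Y' (traj X s w).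
  by move=> Y0' w; rewrite mule_ge0// expect_ge0.
move: Y; apply: ge0_measurable_induction.
- move=> G mG; transitivity (law X x (L `&` (timeshift X s @^-1` G))).
    rewrite -[in RHS](setIT (L `&` _)) -integral_indic//; last first.
      by apply: measurableI => //; exact: measurable_timeshift_preimage.
    by apply: eq_integral => w _; rewrite indicI EFinM.
  rewrite markov_set//; apply: eq_integral => w _; congr (_ * _).
  by rewrite !expectE integral_indic// setIT.
- move=> f g mf f0 If mg g0 Ig.
  transitivity (\int[law X x]_w ((\1_L w)%:E * f (timeshift X s w) + (\1_L w)%:E * g (timeshift X s w))).
    by apply: eq_integral => w _; rewrite ge0_muleDr.
  rewrite (ge0_integralD _ measurableT (fun w _ => Y0 _ f0 w) (mY _ mf) (fun w _ => Y0 _ g0 w) (mY _ mg)).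
  rewrite If Ig -(ge0_integralD _ measurableT (fun w _ => E0 _ f0 w) (mE _ mf f0) (fun w _ => E0 _ g0 w) (mE _ mg g0)).
  apply: eq_integral => w _; rewrite -ge0_muleDr ?expect_ge0//; congr (_ * _).
  by rewrite !expectE (ge0_integralD _ measurableT (fun w _ => f0 w) mf (fun w _ => g0 w) mg).
- move=> c f c0 mf f0 If.
  transitivity (\int[law X x]_w (c%:E * ((\1_L w)%:E * f (timeshift X s w)))).
    by apply: eq_integral => w _; rewrite muleCA.
  rewrite (ge0_integralZl_EFin _ measurableT (fun w _ => Y0 _ f0 w) (mY _ mf) c0).
  rewrite If -(ge0_integralZl_EFin _ measurableT (fun w _ => E0 _ f0 w) (mE _ mf f0) c0).
  apply: eq_integral => w _; rewrite muleCA; congr (_ * _).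
  by rewrite !expectE (ge0_integralZl_EFin _ measurableT (fun w _ => f0 w) mf c0).
- move=> f mf f0 If ndf.
  have cf w : cvgn (f ^~ w) by exact: ereal_nondecreasing_is_cvgn.
  have nde o : nondecreasing_seq (fun n => expect (f n) o).
    move=> a b ab; apply: ge0_le_integral => //.
    by move=> w _; exact: ndf.
  transitivity (limn (fun n => \int[law X x]_w ((\1_L w)%:E * f n (timeshift X s w)))).
    rewrite -monotone_convergence//.
    + by apply: eq_integral => w _; rewrite limeMl.
    + by move=> n; exact: mY.
    + by move=> n w _; exact: Y0.
    + by move=> w _ a b ab; rewrite lee_wpmul2l//; exact: ndf.
  transitivity (limn (fun n => \int[law X x]_w ((\1_L w)%:E * expect (f n) (traj X s w)))).
    by congr (limn _); apply/funext => n; exact: If.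
  rewrite -monotone_convergence//.
  + apply: eq_integral => w _; rewrite limeMl//; last exact: ereal_nondecreasing_is_cvgn.
    by congr (_ * _); rewrite !expectE -monotone_convergence.
  + by move=> n; exact: mE.
  + by move=> n w _; exact: E0.
  + by move=> w _ a b ab; rewrite lee_wpmul2l//; exact: nde.
Qed.

End markov_functional.

(** * Sets of zero capacity *)

Section capacity.
Context {R : realType} {N : nat} (Omega : domain R N).
Local Notation E := 'rV[R]_N.
Local Notation m := (m Omega).
Local Notation ip := (ip Omega).

(** [u >= 1] on B bounds [m B] by the squared norm of u. *)
Lemma cap_open_measure_le (B : set E) (e : R) : measurable B ->
  (cap_open Omega B < e%:E)%E -> (m B <= e%:E)%E.
Proof.
move=> mB /ereal_inf_lt[_ [u [Fu u1] <-]]; rewrite lte_fin => ue.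
have Lu : L2 Omega u by exact: H1_closure_L2 Fu.
apply: (@le_trans _ _ (ip u u)%:E); last first.
  rewrite lee_fin; apply: le_trans (ltW ue).
  by rewrite -dformb1 dformbE mul1r lerDr dform_ge0.
rewrite -(setIT B) -integral_indic// -ip_EFin//; apply: ae_ge0_le_integral => //.
- by apply/measurable_EFinP; exact: measurable_indic.
- by move=> x _; rewrite lee_fin -expr2 sqr_ge0.
- exact: measurable_int (L2_integrable_sqr Lu).
apply: filterS u1 => x ux _; rewrite lee_fin indicE.
have [Bx|nBx] := pselect (B x); last by rewrite memNset// -expr2 sqr_ge0.
rewrite mem_set//; have h := ux Bx; apply: (le_trans h).
by rewrite ler_peMl// (le_trans ler01 h).
Qed.

Lemma cap_eq0_ae (A : set E) : cap Omega A = 0%E -> {ae m, forall x, ~ A x}.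
Proof.
move=> A0.
have BE (n : nat) : exists B, [/\ rel_open Omega B, A `<=` B & (m B <= (n.+1%:R^-1)%:E)%E].
  have n0 : (0 < n.+1%:R^-1 :> R) by rewrite invr_gt0.
  have : (cap Omega A < (n.+1%:R^-1)%:E)%E by rewrite A0 lte_fin.
  move=> /ereal_inf_lt[_ [B [oB AB] <-]] Bn; exists B; split => //.
  apply: cap_open_measure_le => //; case: oB => U oU ->.
  apply: measurableI; first exact: rV_open_measurable.
  by apply: closed_rV_measurable; exact: closed_closure.
pose B n := sval (cid (BE n)).
have BP n : [/\ rel_open Omega (B n), A `<=` B n & (m (B n) <= (n.+1%:R^-1)%:E)%E].
  exact: svalP (cid (BE n)).
have mB n : measurable (B n).
  have [[U oU ->] _ _] := BP n.
  apply: measurableI; first exact: rV_open_measurable.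
  by apply: closed_rV_measurable; exact: closed_closure.
exists (\bigcap_n B n); split.
- exact: bigcapT_measurable.
- apply/eqP; rewrite eq_le measure_ge0 andbT.
  apply/lee_addgt0Pr => e e0; rewrite add0e.
  have [k _ /(_ k (leqnn k)) /= ke] := near_infty_natSinv_lt (PosNum e0).
  apply: (@le_trans _ _ (m (B k))).
    by apply: le_measure; rewrite ?inE//; [exact: bigcapT_measurable|exact: bigcap_inf].
  by have [_ _ h] := BP k; apply: le_trans h _; rewrite lee_fin ltW.
by move=> x /contrapT Ax n _; have [_ h _] := BP n; exact: h.
Qed.

End capacity.

(** * The process and the two semigroups *)

Section bridge.
Context {R : realType} {N : nat} (Omega : domain R N).
Context d (W : measurableType d) (X : process R N W).
Local Notation E := 'rV[R]_N.
Local Notation m := (m Omega).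
Local Notation L2 := (L2 Omega).
Local Notation ip := (ip Omega).
Local Notation clO := (closure (Omega : set E)).
Local Notation Om := (Omega : set E).
Local Notation expect := (expect X).
Local Notation Cc := (Cc_closure Omega).
Variables (TN : R -> (E -> R) -> E -> R).
Hypotheses (hR : reflecting_brownian_motion Omega X)
  (hTN : semigroup_of Omega (tildeH1 Omega) TN).
Implicit Types (t : R) (f g : E -> R) (w : W) (K : set E).

Lemma rbm_hunt : hunt_process Omega X. Proof. by case: hR => -[]. Qed.

Lemma rbm_semigroup t f : 0 <= t -> L2 f ->
  {ae m, forall x, pt X t (EFin \o f) x = (TN t f x)%:E}.
Proof. by case: hR => _ _ h; exact: h. Qed.

Lemma ae_closure_domain : {ae m, forall x, clO x}.
Proof. by apply: filterS (ae_domain Omega) => x; exact: subset_closure. Qed.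

(** The transition probabilities do not charge an m-null set A: their density
    version [TN t (\1_A)] vanishes. This holds outside of an m-null set of starting
    points. *)
Lemma ae_traj (Q : E -> Prop) t : 0 <= t -> {ae m, forall x, Q x} ->
  {ae m, forall x, {ae law X (Some x), forall w, oapp Q True (traj X t w)}}.
Proof.
move=> t0 [A [mA A0 QA]].
have L1 : L2 (\1_A : E -> R).
  apply: (L2_ae _ (L2_0 Omega)); first exact: measurable_indic.
  exists A; split => // x /= h; apply: contrapT => nA; apply: h.
  by rewrite indicE memNset.
have T0 : {ae m, forall x, TN t (\1_A : E -> R) x = 0}.
  apply: ip_eq0; first exact: (semigroup_L2 hTN).
  apply/eqP; rewrite eq_le ip_ge0 andbT.
  apply: le_trans (semigroup_ip_contraction hTN t0 L1) _.
  rewrite le_eqVlt; apply/orP; left; apply/eqP; apply: ip_ae0 => //.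
  exists A; split => // x /= h; apply: contrapT => nA; apply: h.
  by rewrite indicE memNset.
apply: filterS2 T0 (rbm_semigroup t0 L1) => x -> hx.
have mo : measurable_fun setT (fun w => oapp (EFin \o (\1_A : E -> R)) 0%E (traj X t w)).
  apply: (measurable_oapp rbm_hunt) => //.
  by apply/measurable_EFinP; exact: measurable_indic.
have := ge0_integral_eq0_ae (mu := law X (Some x)) mo _ hx.
move=> h; have {}h := h (fun w => _); apply: filterS (h _).
  move=> w; case: (traj X t w) => //= y; rewrite indicE => -[] /eqP.
  rewrite pnatr_eq0 eqb0 => /negP yA; apply: contrapT => nQ; apply: yA.
  by apply/mem_set; apply: QA.
by move=> w; case: (traj X t w) => //= y; rewrite lee_fin.
Qed.

Lemma neumann_ge0 t f : 0 <= t -> L2 f -> {ae m, forall x, 0 <= f x} ->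
  {ae m, forall x, 0 <= TN t f x}.
Proof.
move=> t0 Lf f0; have Lp := L2_pospart Lf.
have fp : {ae m, forall x, f x = pospart f x}.
  by apply: filterS f0 => x h; rewrite /pospart; have [h'|h'] := leP 0 (f x); lra.
apply: filterS2 (semigroup_ae hTN t0 Lf Lp fp) (rbm_semigroup t0 Lp) => x -> hx.
rewrite -lee_fin -hx; apply: integral_ge0 => w _.
by case: (traj X t w) => //= y; rewrite lee_fin pospart_ge0.
Qed.

Lemma neumann_resolvent_ge0 (b : R) f u : 0 < b -> L2 f ->
  {ae m, forall x, 0 <= f x} -> resolvent Omega Cc b f u -> {ae m, forall x, 0 <= u x}.
Proof. exact: (resolvent_ge0_of_semigroup hTN neumann_ge0). Qed.

(** The functional [g (X_(n h))] on the event that the path is in K at the times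
    that are multiples of h up to n h, by recursion on the shifted path, in the form
    in which the Markov property is applied. *)
Fixpoint survive K (h : R) g (n : nat) (w : W) : \bar R :=
  if n is n'.+1 then
    ((\1_(traj X 0 @^-1` (Some @` K)) w)%:E * survive K h g n' (timeshift X h w))%E
  else oapp (EFin \o (g \_ K)) 0%E (traj X 0 w).

Definition in_K_at K (h : R) (n : nat) : set W :=
  [set w | forall j, (j <= n)%N -> (Some @` K) (traj X (j%:R * h) w)].

Lemma survive_ge0 K h g n w : (forall x, 0 <= g x) -> (0 <= survive K h g n w)%E.
Proof.
move=> g0; elim: n w => [|n ih] w /=; last by rewrite mule_ge0.
case: (traj X 0 w) => //= y; rewrite lee_fin patchE.
by case: ifP.
Qed.

Lemma measurable_survive K h g n : 0 <= h -> measurable K -> measurable_fun setT g ->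
  measurable_fun setT (survive K h g n).
Proof.
move=> h0 mK mg; elim: n => [|n ih] /=.
  apply: (measurable_oapp rbm_hunt) => //; apply/measurable_EFinP.
  by apply/(measurable_restrictT _ mK); exact: measurable_funTS.
apply: emeasurable_funM.
  by apply/measurable_EFinP; apply: measurable_indic; exact: (measurable_traj rbm_hunt).
exact: (measurableT_comp ih (measurable_timeshift rbm_hunt h0)).
Qed.

Lemma surviveE K h g n w : 0 <= h -> survive K h g n w =
  ((\1_(in_K_at K h n) w)%:E * oapp (EFin \o g) 0 (traj X (n%:R * h)%R w))%E.
Proof.
move=> h0; have nh0 k : 0 <= k%:R * h by rewrite mulr_ge0.
elim: n w => [|n ih] w /=.
  rewrite mul0r; have [Kw|nK] := pselect ((Some @` K) (traj X 0 w)).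
    rewrite indicE mem_set ?mul1e; last by move=> j /=; rewrite leqn0 => /eqP ->; rewrite mul0r.
    by case: Kw => x Kx <- /=; rewrite patchE mem_set.
  rewrite indicE memNset ?mul0e; last first.
    by move=> /(_ 0%N (leqnn _)); rewrite mul0r.
  case: (traj X 0 w) nK => //= x nK; rewrite patchE memNset// => Kx.
  by apply: nK; exists x.
have E1 j : traj X (j%:R * h) (timeshift X h w) = traj X (j.+1%:R * h) w.
  by rewrite (hunt_shift rbm_hunt)// -natr1 mulrDl mul1r.
rewrite ih E1; have [K0|nK0] := pselect ((Some @` K) (traj X 0 w)); last first.
  rewrite indicE memNset// mul0e indicE memNset ?mul0e//.
  by move=> /(_ 0%N (leq0n _)); rewrite mul0r.
have iffK : in_K_at K h n (timeshift X h w) <-> in_K_at K h n.+1 w.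
  split=> h1 j jn; last by rewrite E1; exact: h1.
  by case: j jn => [_|j jn]; [rewrite mul0r|rewrite -E1; exact: h1].
rewrite [in X in (X * _)%E]indicE mem_set// mul1e; congr (_ * _)%E.
have [k|k] := pselect (in_K_at K h n.+1 w).
  by rewrite !indicE !mem_set//; exact/iffK.
by rewrite !indicE !memNset// => /iffK.
Qed.

Lemma expect_survive K h g n x : 0 <= h -> measurable K -> measurable_fun setT g ->
  (forall y, 0 <= g y) -> clO x -> K x ->
  (expect (survive K h g n.+1) (Some x) = expect (fun w => expect (survive K h g n) (traj X h w)) (Some x))%E.
Proof.
move=> h0 mK mg g0 cx Kx.
have nL : natural X `[0, h]%classic (traj X 0 @^-1` (Some @` K)).
  by apply: natural_traj => //; rewrite /= in_itv/= lexx.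
have hm := @markov_functional _ _ Omega _ _ X rbm_hunt h _ (Some x) (survive K h g n) h0 nL cx
  (measurable_survive n h0 mK mg) (fun w => survive_ge0 K h n w g0).
apply: (etrans hm); apply: ae_eq_lower_integral.
have := @hunt_normal _ _ _ _ _ _ rbm_hunt (Some x) cx; apply: filterS => w w0.
by rewrite indicE mem_set ?mul1e//= w0; exists x.
Qed.

Variable (TD : R -> (E -> R) -> E -> R).
Hypothesis hTD : semigroup_of Omega (H10 Omega) TD.
Local Notation killed := (killed TD).

Lemma killed_ge0 K h g n : measurable K -> 0 <= h -> L2 g -> (forall x, 0 <= g x) ->
  {ae m, forall x, 0 <= killed K h g n x}.
Proof.
move=> mK h0 Lg g0; elim: n => [|n ih] /=.
  by apply: aeW => x; rewrite patchE; case: ifP.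
have := dirichlet_semigroup_ge0 neumann_resolvent_ge0 hTD h0 (killed_L2 hTD n mK h0 Lg) ih.
by apply: filterS => x hx; rewrite patchE; case: ifP.
Qed.

(** The Markov property and the domination of TD by TN, one step at a time; the null
    sets of each step are not charged by the transition probabilities. *)
Lemma killed_le_survive K h g n : measurable K -> 0 <= h -> L2 g -> (forall x, 0 <= g x) ->
  {ae m, forall x, ((killed K h g n x)%:E <= expect (survive K h g n) (Some x))%E}.
Proof.
move=> mK h0 Lg g0; have mg := L2_measurable Lg; elim: n => [|n ih].
  apply: filterS ae_closure_domain => x cx /=.
  have -> : expect (fun w => oapp (EFin \o (g \_ K)) 0%E (traj X 0 w)) (Some x) =
      expect (fun=> ((g \_ K) x)%:E) (Some x).
    apply: ae_eq_lower_integral.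
    have := @hunt_normal _ _ _ _ _ _ rbm_hunt (Some x) cx; apply: filterS => w w0.
    by rewrite w0.
  by rewrite !expectE integral_cst// [X in (_ * X)%E](probability_setT (law X (Some x))) mule1.
have LS := killed_L2 hTD n mK h0 Lg; have Lp := L2_pospart LS.
have S0 := killed_ge0 n mK h0 Lg g0.
have Sp : {ae m, forall x, killed K h g n x = pospart (killed K h g n) x}.
  by apply: filterS S0 => x hx; rewrite /pospart; have [h'|h'] := leP 0 (killed K h g n x); lra.
have e1 := dirichlet_le_neumann neumann_resolvent_ge0 hTD hTN h0 LS S0 neumann_ge0.
have e2 := semigroup_ae hTN h0 LS Lp Sp.
have e3 := rbm_semigroup h0 Lp.
have e40 : {ae m, forall x, ((killed K h g n x)%:E <= expect (survive K h g n) (Some x))%E /\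
    killed K h g n x = pospart (killed K h g n) x} by exact: filterI ih Sp.
have e4 := ae_traj h0 e40.
apply: filterS2 (filterI e1 (filterI e2 e3)) (filterI e4 ae_closure_domain) => x [x1 [x2 x3]] [x4 cx].
have s0 k w := survive_ge0 K h k w g0.
rewrite [killed _ _ _ _ _]/= patchE; case: ifPn => [/set_mem Kx|_]; last first.
  by apply: expect_ge0 => w; exact: s0.
rewrite expect_survive//; apply: (@le_trans _ _ (TN h (killed K h g n) x)%:E).
  by rewrite lee_fin.
rewrite x2 -x3; apply: ge0_ae_le_lower_integral.
- by move=> w; case: (traj X h w) => //= y; rewrite lee_fin pospart_ge0.
- by move=> w; apply: expect_ge0 => w'; exact: s0.
apply: filterS x4 => w; case: (traj X h w) => [y|] /=.
  by move=> [y1 y2]; rewrite -y2.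
by move=> _; apply: expect_ge0 => w'; exact: s0.
Qed.

(** Countably many times keep the event measurable; by right continuity it is the
    event that the path is in K during [[0, t]]. *)
Definition stays K t : set W := \bigcap_i in_K_at K (t / 2 ^+ i) (2 ^ i)%N.

Lemma measurable_in_K_at K h n : 0 <= h -> measurable K -> measurable (in_K_at K h n).
Proof.
move=> h0 mK; rewrite (_ : in_K_at K h n =
    \bigcap_(j in [set j | (j <= n)%N]) (traj X (j%:R * h) @^-1` (Some @` K))); last first.
  by apply/seteqP; split => w.
apply: bigcap_measurable => [|j _]; first by exists 0%N.
by apply: (measurable_traj rbm_hunt) => //; rewrite mulr_ge0.
Qed.

Lemma natural_in_K_at K h n t : 0 <= h -> n%:R * h <= t -> measurable K ->
  natural X `[0, t]%classic (in_K_at K h n).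
Proof.
move=> h0 nt mK; rewrite (_ : in_K_at K h n =
    \bigcap_(j in [set j | (j <= n)%N]) (traj X (j%:R * h) @^-1` (Some @` K))); last first.
  by apply/seteqP; split => w.
apply: (@bigcap_measurable _ (g_sigma_algebraType _)) => [|j jn]; first by exists 0%N.
apply: natural_traj => //; rewrite /= in_itv/= mulr_ge0//=.
by apply: le_trans nt; rewrite ler_wpM2r// ler_nat.
Qed.

Lemma natural_stays K t : 0 <= t -> measurable K -> natural X `[0, t]%classic (stays K t).
Proof.
move=> t0 mK; apply: (@bigcapT_measurable _ (g_sigma_algebraType _)) => i.
apply: natural_in_K_at => //; first by rewrite divr_ge0.
by rewrite natrX mulrC divfK// expf_neq0.
Qed.

Lemma measurable_stays K t : 0 <= t -> measurable K -> measurable (stays K t).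
Proof.
move=> t0 mK; apply: bigcapT_measurable => i; apply: measurable_in_K_at => //.
by rewrite divr_ge0.
Qed.

Lemma open_setC_Some K : compact K -> open (~` (Some @` K) : set (one_point_compactification E)).
Proof.
move=> cK; rewrite openE => -[x|] /= nK.
  have nKx : ~ K x by move=> Kx; apply: nK; exists x.
  have : nbhs x (~` K) by apply: open_nbhs_nbhs; split => //; apply: closed_openC; exact: compact_closed.
  by apply: filterS => y nKy [z Kz [zy]]; apply: nKy; rewrite -zy.
exists K; first by split => //; exact: compact_closed.
by move=> [y|] [[z nKz [<-]]|//]; move=> [z' Kz' [zz]]; apply: nKz; rewrite -zz.
Qed.

(** Dyadic times just after s bring the path close to its position at s, and K is
    closed. *)
Lemma staysP K t w s : compact K -> 0 <= t -> stays K t w -> 0 <= s <= t ->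
  (Some @` K) (traj X s w).
Proof.
move=> cK t0 Kw /andP[s0]; rewrite le_eqVlt => /predU1P[->|st].
  by have := Kw 0%N Logic.I 1%N (leqnn _); rewrite expr0 divr1 mul1r.
have {}t0 : 0 < t by exact: le_lt_trans st.
apply: contrapT => nKs.
have := @hunt_right _ _ _ _ _ _ rbm_hunt s w s0 (~` (Some @` K)).
have nb : nbhs (traj X s w) (~` (Some @` K)).
  by apply: open_nbhs_nbhs; split => //; exact: open_setC_Some.
move=> /(_ nb) /nbhs_ballP[e /= e0 he].
pose k := Num.truncn (t / e); have kE : t / e < k.+1%:R.
  by apply: truncnS_gt.
pose i := k.+1; pose h := t / 2 ^+ i.
have p0 : 0 < (2 : R) ^+ i by rewrite exprn_gt0.
have h0 : 0 < h by rewrite divr_gt0.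
have he' : h < e.
  rewrite /h ltr_pdivrMr// mulrC -ltr_pdivrMr//; apply: lt_le_trans kE _.
  by rewrite -natrX ler_nat; apply: ltnW; exact: ltn_expl.
pose j := (Num.truncn (s / h)).+1.
have js : s < j%:R * h by rewrite -ltr_pdivrMr//; exact: truncnS_gt.
have js' : j%:R * h <= s + h.
  rewrite /j -natr1 mulrDl mul1r lerD2r -ler_pdivlMr// truncn_le.
  by rewrite divr_ge0// ltW.
have jn : (j <= 2 ^ i)%N.
  rewrite /j -(ltr_nat R) natrX; apply: (@le_lt_trans _ _ (s / h)).
    by rewrite truncn_le divr_ge0// ltW.
  by rewrite ltr_pdivrMr// /h mulrC divfK ?gt_eqF.
have := he (j%:R * h); rewrite /ball/= ltr_distlC.
have -> : s - e < j%:R * h by apply: lt_trans js; rewrite ltrBlDr ltrDl.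
have -> : j%:R * h < s + e by apply: le_lt_trans js' _; rewrite ltrD2l.
by move=> /(_ isT js); apply; exact: (Kw i Logic.I j jn).
Qed.

Lemma in_K_at_decr K t i : in_K_at K (t / 2 ^+ i.+1) (2 ^ i.+1) `<=` in_K_at K (t / 2 ^+ i) (2 ^ i).
Proof.
move=> w Kw j ji; have := Kw (2 * j)%N; rewrite expnS leq_mul2l ji => /(_ isT).
suff -> : (2 * j)%:R * (t / 2 ^+ i.+1) = j%:R * (t / 2 ^+ i) by [].
rewrite natrM exprS; field; exact: expf_neq0.
Qed.

End bridge.

(** * Stieltjes measures *)

Section stieltjes_measure.
Context {R : realType}.

(** The Stieltjes measure of F is the image of the Lebesgue measure on the interval
    from 0 to the supremum of F under the generalized inverse of F. *)
Lemma stieltjes_measure_exists (z : \bar R) (F : R -> R)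
    (D := [set t : R | 0 <= t /\ (t%:E < z)%E]) :
  F 0 = 0 -> {in D &, nondecreasing F} ->
  (forall t e, D t -> 0 < e -> exists2 r, 0 < r &
     forall s, D s -> t < s < t + r -> F s < F t + e) ->
  exists nu : {measure set (measurableTypeR R) -> \bar R},
    nu (~` D) = 0%E /\ forall t, D t -> nu `[0, t]%classic = (F t)%:E.
Proof.
move=> F0 Fnd Frc.
have nd s t : D s -> D t -> s <= t -> F s <= F t.
  by move=> Ds Dt; apply: Fnd; apply/mem_set.
pose S y := [set s | D s /\ y <= F s].
pose Y := [set y : R | 0 < y /\ S y !=set0].
(* the value -1 sends the y that are not reached by F outside of D *)
pose g y := if `[< Y y >] then inf (S y) else -1.
have lbS y : has_lbound (S y) by exists 0 => s [[]].
have infS y : Y y -> S y (inf (S y)).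
  move=> [y0 Sy0]; have [s [[s0 sz] ys]] := Sy0.
  have i0 : 0 <= inf (S y) by apply: lb_le_inf => // r [[]].
  have Di : D (inf (S y)).
    split=> //; apply: le_lt_trans (sz); rewrite lee_fin; apply: ge_inf; first exact: lbS.
    by split.
  split; first exact: Di.
  apply/ler_addgt0Pr => e e0; have [r r0 hr] := Frc _ _ Di e0.
  have [s' [Ds' ys'] s'r] := inf_adherent r0 (conj Sy0 (lbS y)).
  have is' : inf (S y) <= s' by apply: ge_inf.
  move: is'; rewrite le_eqVlt => /predU1P[->|is'].
    by apply: le_trans ys' _; rewrite lerDl ltW.
  by apply: le_trans ys' _; apply/ltW; apply: hr => //; rewrite is' s'r.
have gP y t : Y y -> D t -> (g y <= t) = (y <= F t).
  move=> Yy Dt; rewrite /g asboolT//; have [Di yi] := infS _ Yy.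
  apply/idP/idP => h; first by apply: le_trans yi _; exact: nd.
  by apply: ge_inf.
have gD y : Y y -> D (g y) by move=> Yy; rewrite /g asboolT//; have [] := infS _ Yy.
have mY : measurable (Y : set (measurableTypeR R)).
  apply: is_interval_measurable => x y [x0 _] [_ [s [Ds ys]]] r /andP[xr ry].
  by split; [exact: lt_le_trans xr|exists s; split => //; exact: le_trans ys].
have mg : measurable_fun (setT : set (measurableTypeR R)) (g : measurableTypeR R -> measurableTypeR R).
  apply: (measurability _ (measurable_realfun.RGenOInfty.measurableE R)).
  move=> _ [_ [x ->] <-]; rewrite setTI.
  have [x1|x1] := ltP x (-1).
    rewrite (_ : _ @^-1` _ = setT)//; apply/seteqP; split => // y _ /=.
    rewrite in_itv/= andbT /g; case: ifPn => [/asboolP Yy|//].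
    have [[i0 _] _] := infS _ Yy; apply: lt_trans x1 _; apply: lt_le_trans i0.
    by rewrite ltrN10.
  have [x0|x0] := ltP x 0.
    rewrite (_ : _ @^-1` _ = Y)//; apply/seteqP; split => y /=; rewrite in_itv/= andbT.
      by rewrite /g; case: ifPn => [/asboolP//|_]; rewrite ltNge x1.
    by move=> Yy; rewrite /g asboolT//; have [[i0 _] _] := infS _ Yy; exact: lt_le_trans i0.
  have [xz|zx] := ltP x%:E z.
    rewrite (_ : _ @^-1` _ = Y `&` `]F x, +oo[%classic).
      by apply: measurableI => //; exact: measurable_itv.
    apply/seteqP; split => y /=; rewrite !in_itv/= !andbT.
      move=> xg; have Yy : Y y.
        apply: contrapT => nY; move: xg; rewrite /g asboolF// ltNge.
        by rewrite (le_trans _ x0)// lerN10.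
      by split => //; rewrite ltNge -gP// -ltNge.
    by move=> [Yy]; rewrite ltNge -(gP _ x)// -ltNge.
  rewrite (_ : _ @^-1` _ = set0)//; apply/seteqP; split => // y /=.
  rewrite in_itv/= andbT => xg; have [Yy|nY] := pselect (Y y).
    have [_ gz] := gD _ Yy; rewrite -lte_fin in xg.
    by have := le_lt_trans zx (lt_trans xg gz); rewrite ltxx.
  by move: xg; rewrite /g asboolF// ltNge (le_trans _ x0)// lerN10.
pose gm : {mfun measurableTypeR R >-> measurableTypeR R} :=
  HB.pack g (isMeasurableFun.Build _ _ _ _ (g : measurableTypeR R -> measurableTypeR R) mg).
have nuE A : pushforward (mrestr (@lebesgue_measure R) mY) gm A =
    lebesgue_measure (g @^-1` A `&` Y) by [].
unshelve (exists (pushforward (mrestr (@lebesgue_measure R) mY) gm)); first exact: mg.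
split.
  apply: etrans (nuE (~` D)) _; rewrite (_ : _ `&` _ = set0) ?measure0//.
  by apply/seteqP; split => // y [/= ngD Yy]; apply: ngD; exact: gD.
move=> t Dt; have [t0 tz] := Dt; apply: etrans (nuE _) _.
have D0 : D 0 by split => //; apply: le_lt_trans tz; rewrite lee_fin.
rewrite (_ : _ `&` _ = `]0, F t]%classic).
  rewrite lebesgue_measure_itv/= lte_fin sube0.
  case: ltP => // Ft0; congr EFin; apply/eqP; rewrite eq_le Ft0 andbT.
  by rewrite -F0; exact: nd.
apply/seteqP; split => y /=; rewrite !in_itv/=.
  by move=> [/andP[_ gt] Yy]; rewrite -gP// gt andbT; case: Yy.
move=> /andP[y0 yF]; have Yy : Y y by split => //; exists t.
by split => //; rewrite gP// yF andbT; have [] := gD _ Yy.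
Qed.

End stieltjes_measure.

(** * A finite measure equivalent to m *)

Section weighted.
Context {R : realType} {N : nat} (Omega : domain R N).
Local Notation E := 'rV[R]_N.
Local Notation m := (m Omega).

Let B (k : nat) : set E := closed_box (fun=> - k%:R) (fun=> k%:R).

Let mB k : measurable (B k).
Proof. by apply: closed_rV_measurable; exact: closed_closed_box. Qed.

Let c_ge0 (k : nat) : 0 <= (1 / (2 ^ k.+1)%:R) / (1 + fine (m (B k))).
Proof. by rewrite divr_ge0// addr_ge0// fine_ge0. Qed.

(** A finite measure with the same null sets as m: the completion of the filtration only
    involves finite initial distributions. *)
Definition weighted_m : set E -> \bar R :=
  mseries (fun k => mscale (NngNum (c_ge0 k)) (mrestr m (mB k))) 0.

HB.instance Definition _ := Measure.on weighted_m.

Let weighted_fin : fin_num_fun weighted_m.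
Proof.
move=> A mA; rewrite ge0_fin_numE//; apply: (@le_lt_trans _ _ (1%:E)); last exact: ltry.
rewrite /weighted_m /mseries.
have := @epsilon_trick0 R 1 xpredT ler01.
apply: le_trans; apply: lee_nneseries => [k _ _|k _].
  by rewrite measure_ge0.
rewrite /mscale/= /mrestr.
have mBk : (m (B k) = (fine (m (B k)))%:E)%E.
  rewrite fineK// ge0_fin_numE//; apply: m_compact; exact: compact_closed_box.
have b0 : 0 <= fine (m (B k)) by rewrite fine_ge0.
apply: (@le_trans _ _ ((1 / (2 ^ k.+1)%:R / (1 + fine (m (B k))))%:E * m (B k))%E).
  rewrite lee_pmul2l ?lte_fin ?divr_gt0 ?ltr0n ?expn_gt0//.
    by apply: le_measure; rewrite ?inE//; exact: measurableI.
  by rewrite ltr_pwDl.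
move: (fine _) mBk b0 => b -> b0; rewrite -EFinM lee_fin.
rewrite -[leLHS]mulrA; apply: ler_piMr; first by rewrite divr_ge0.
by rewrite mulrC ler_pdivrMr ?mul1r ?lerDr// ltr_pwDl.
Qed.

HB.instance Definition _ := Measure_isFinite.Build _ _ _ weighted_m weighted_fin.

Lemma weighted_m_eq0 A : measurable A -> weighted_m A = 0%E -> m A = 0%E.
Proof.
move=> mA A0.
have AB k : m (A `&` B k) = 0%E.
  apply/eqP; rewrite eq_le measure_ge0 andbT.
  have b0 : 0 <= fine (m (B k)) by rewrite fine_ge0.
  have c0 : 0 < 1 / (2 ^ k.+1)%:R / (1 + fine (m (B k))).
    by rewrite divr_gt0 ?ltr_pwDl// divr_gt0// ltr0n expn_gt0.
  rewrite -(@lee_pmul2l _ ((1 / (2 ^ k.+1)%:R / (1 + fine (m (B k))))%:E))// mule0 -A0.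
  have := @nneseries_lim_ge R (fun k => mscale (NngNum (c_ge0 k)) (mrestr m (mB k)) A) xpredT 0 k.+1.
  move=> /(_ (fun _ _ _ => measure_ge0 _ _)); apply: le_trans.
  rewrite big_mkord big_ord_recr/= /mscale /mrestr/= leeDr// sume_ge0// => i _.
  by rewrite mule_ge0// lee_fin.
have AU : A `<=` \bigcup_k (A `&` B k).
  move=> x Ax; have [k xk] : exists k, B k x.
    pose k := \max_(i < N) (Num.truncn (`|x 0 i|%R : R)).+1; exists k => i.
    rewrite -ler_norml; apply: le_trans (ltW (truncnS_gt _)) _.
    by rewrite ler_nat /k (bigD1 i)//= leq_maxl.
  by exists k.
apply/eqP; rewrite eq_le measure_ge0 andbT.
have mAB k : measurable (A `&` B k) by exact: measurableI.
apply: (le_trans (@measure_sigma_subadditive _ _ _ m _ _ mAB mA AU)).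
by rewrite eseries0.
Qed.

End weighted.

(** * The constant 1 is excessive *)

Section excessive_one.
Context {R : realType} {N : nat} (Omega : domain R N).
Context d (W : measurableType d) (X : process R N W).
Local Notation E := 'rV[R]_N.
Local Open Scope ereal_scope.
Hypothesis hX : hunt_process Omega X.

(** The cemetery is the point at infinity, so right continuity keeps the path alive
    for a while. *)
Lemma alive_nbhs t w : (0 <= t)%R -> traj X t w != None ->
  exists2 e : R, (0 < e)%R & forall s, (t < s < t + e)%R -> traj X s w != None.
Proof.
move=> t0; case E1 : (traj X t w) => [x|//] _.
have := @hunt_right _ _ _ _ _ _ hX t w t0 (Some @` setT).
have nb : nbhs (traj X t w) (Some @` [set: E]).
  by rewrite E1; apply: one_point_compactification_some_nbhs; exact: filterT.
move=> /(_ nb) /nbhs_ballP[e /= e0 he]; exists e => // s /andP[ts ste].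
have := he s; rewrite /ball/= ltr_distlC ste (lt_trans _ ts) ?ltrBlDr ?ltrDl// => /(_ isT ts).
by case=> y _ <-.
Qed.

Lemma lifetime_gt t w : (0 <= t)%R -> traj X t w != None -> t%:E < lifetime X w.
Proof.
move=> t0 Xt; have [e e0 he] := alive_nbhs t0 Xt.
apply: (@lt_le_trans _ _ (t + e)%:E); first by rewrite lte_fin ltrDl.
apply: le_ereal_inf_tmp => _ [s [s0 sN] <-]; rewrite lee_fin leNgt; apply/negP => ste.
have [st|ts] := leP s t.
  have := @hunt_cemetery _ _ _ _ _ _ hX s t w; rewrite s0 st => /(_ isT sN) h.
  by rewrite h in Xt.
by have := he s; rewrite ts ste sN => /(_ isT).
Qed.

Lemma pt_one_le1 t x : (0 <= t)%R -> pt X t (fun=> 1) x <= 1.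
Proof.
move=> t0; rewrite -[leRHS](probability_setT (law X (Some x))) -(setIT setT) -integral_indic//.
apply: ge0_le_integral => //.
- by move=> w _; case: (traj X t w).
- exact: (measurable_oapp hX).
- by apply/measurable_EFinP; exact: measurable_indic.
- by move=> w _; rewrite indicE mem_set//=; case: (traj X t w) => [y|] /=; rewrite lee_fin ?ler01.
Qed.

(** The events that the path is alive at time 1 / (n + 1) increase to a set of full
    probability. *)
Lemma pt_one_cvg x : closure (Omega : set E) x ->
  pt X t (fun=> 1) x @[t --> (0%R : R)^'+] --> (1 : \bar R).
Proof.
move=> cx.
pose A (n : nat) : set W := traj X n.+1%:R^-1 @^-1` (Some @` setT).
have i0 (n : nat) : (0 <= n.+1%:R^-1 :> R)%R by rewrite invr_ge0.
have mA n : measurable (A n) by apply: (measurable_traj hX).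
have ndA : nondecreasing_seq A.
  move=> i j ij; apply/subsetPset => w [y _ yE].
  rewrite /A /=; case E1 : (traj X j.+1%:R^-1 w) => [z|]; first by exists z.
  have := @hunt_cemetery _ _ _ _ _ _ hX j.+1%:R^-1 i.+1%:R^-1 w.
  by rewrite i0 lef_pV2 ?posrE// ler_nat ltnS ij E1 -yE => /(_ isT erefl).
have A1 : law X (Some x) (\bigcup_n A n) = 1.
  rewrite -(probability_setT (law X (Some x))).
  have mU : measurable (\bigcup_n A n) by exact: bigcupT_measurable.
  rewrite -[in LHS](setIT (\bigcup_n A n)) -[in RHS](setIT setT) -!integral_indic//.
  apply: ae_eq_lower_integral.
  have := @hunt_normal _ _ _ _ _ _ hX (Some x) cx; apply: filterS => w w0.
  rewrite !indicE [in RHS]mem_set// mem_set//.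
  have w0' : traj X 0 w != None by rewrite w0.
  have [e e0 he] := alive_nbhs (lexx _) w0'.
  have [k _ /(_ k (leqnn k)) /= ke] := near_infty_natSinv_lt (PosNum e0).
  exists k => //; have := he k.+1%:R^-1%R; rewrite add0r invr_gt0 ltr0n ke => /(_ isT).
  by rewrite /A /=; case: (traj X k.+1%:R^-1 w) => // y _; exists y.
have cvA : law X (Some x) \o A @ \oo --> (1 : \bar R).
  by rewrite -[X in _ --> X]A1; apply: nondecreasing_cvg_mu => //; exact: bigcupT_measurable.
have ptA n : pt X n.+1%:R^-1 (fun=> 1) x = law X (Some x) (A n).
  rewrite -[A n]setIT -integral_indic//; apply: eq_integral => w _.
  by rewrite -(oapp_indic _ _ setT); case: (traj X _ w) => //= y; rewrite indicT.
have mono s t : (0 <= s <= t)%R -> pt X t (fun=> 1) x <= pt X s (fun=> 1) x.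
  move=> st; have /andP[s0 st'] := st; apply: ge0_le_integral => //.
  - by move=> w _; case: (traj X t w).
  - by apply: (measurable_oapp hX) => //; exact: le_trans st'.
  - exact: (measurable_oapp hX).
  - move=> w _; have := @hunt_cemetery _ _ _ _ _ _ hX s t w st.
    by case: (traj X s w) => [y _|/(_ erefl) ->]; last rewrite /= lexx; case: (traj X t w) => [z|] /=; rewrite ?lexx ?lee_fin ?ler01.
have fin t : (0 <= t)%R -> pt X t (fun=> 1) x \is a fin_num.
  move=> t0; rewrite ge0_fin_numE; last first.
    by apply: integral_ge0 => w _; case: (traj X t w).
  by apply: le_lt_trans (pt_one_le1 x t0) _; exact: ltry.
apply/fine_cvgP; split.
  near=> t; apply: fin; near: t; exact: nbhs_right_ge.
apply/cvgrPdist_lt => e e0.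
move/fine_cvgP : cvA => [_] /cvgrPdist_lt /(_ e e0) [n _ /(_ n (leqnn n))] /= hn.
near=> t; have t0 : (0 < t)%R by near: t; exact: nbhs_right_gt.
have tn : (t < n.+1%:R^-1)%R by near: t; apply: nbhs_right_lt; rewrite invr_gt0.
apply: le_lt_trans hn; rewrite -ptA.
have h1 : (fine (pt X t (fun=> 1%E) x) <= 1)%R.
  rewrite -lee_fin fineK; first exact: (pt_one_le1 x (ltW t0)).
  exact: fin (ltW t0).
have h2 : (fine (pt X n.+1%:R^-1%R (fun=> 1%E) x) <= fine (pt X t (fun=> 1%E) x))%R.
  by apply: fine_le; [exact: fin (i0 n)|exact: fin (ltW t0)|apply: mono; rewrite !ltW].
rewrite !ger0_norm ?subr_ge0//; last exact: le_trans h2 h1.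
by rewrite lerD2l lerN2.
Unshelve. all: by end_near. Qed.

Lemma excessive_one : excessive Omega X 0 (fun=> 1).
Proof.
split=> //.
- move=> nu; exists (fun=> 1), (fun=> 1); split => //; first by move=> x _; rewrite lexx.
  exact: aeW.
- move=> t x t0 _; rewrite oppr0 mul0r expR0 mul1e; apply: pt_one_le1; exact: ltW.
- move=> x cx; under eq_fun do rewrite oppr0 mul0r expR0 mul1e.
  exact: pt_one_cvg.
Qed.

End excessive_one.

(** * Measurable versions *)

Lemma exists_rat_between {R : realType} (x : R) (y : \bar R) : (x%:E < y)%E ->
  exists q : rat, x < ratr q /\ ((ratr q)%:E < y)%E.
Proof.
case: y => [y||//] xy.
  by have [q] := rat_in_itvoo xy; rewrite in_itv/= => /andP[xq qy]; exists q.
have [q] := @rat_in_itvoo R x (x + 1) (ltr_pwDr ltr01 (lexx x)).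
by rewrite in_itv/= => /andP[xq _]; exists q; rewrite ltry.
Qed.

Section completed_version.
Context {R : realType} {N : nat} (Omega : domain R N).
Context d (W : measurableType d) (X : process R N W).
Local Notation E := 'rV[R]_N.
Local Notation m := (m Omega).
Local Notation clO := (closure (Omega : set E)).
Local Open Scope ereal_scope.
Hypothesis hX : hunt_process Omega X.
Implicit Types (G : set W) (Y Z : W -> \bar R).

Definition ae_null G := measurable G /\
  (law X None G = 0 /\ {ae m, forall x, law X (Some x) G = 0}).

Lemma completed_ae_null (S : set (set W)) L : completed Omega X S L ->
  exists L0 G, [/\ S L0, ae_null G & (L `\` L0) `|` (L0 `\` L) `<=` G].
Proof.
move=> /(_ (weighted_m Omega)) [L0 [G [SL mG nG LG]]]; exists L0, G; split => //.
have mP := hunt_law hX mG.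
have i0 : 0 <= \int[weighted_m Omega]_(x in clO) law X (Some x) G by apply: integral_ge0.
move: nG; rewrite /law_from => /eqP; rewrite padde_eq0// => /andP[/eqP I0 /eqP n0].
split => //; split => //.
have : \int[weighted_m Omega]_(x in clO) `|law X (Some x) G| = 0.
  by rewrite -[RHS]I0; apply: eq_integral => x _; rewrite gee0_abs.
move/(ae_eq_integral_abs (weighted_m Omega) (measurable_closure_domain Omega) mP).
move=> [A [mA A0 hA]].
have mA0 : {ae m, forall x, ~ A x}.
  by exists A; split => //; [exact: weighted_m_eq0|move=> x /contrapT].
apply: filterS2 mA0 (ae_closure_domain Omega) => x nAx cx.
by apply: contrapT => h; apply: nAx; apply: hA => /= h'; apply: h; exact: h'.
Qed.

Lemma ae_null_bigcup (G : (set W)^nat) : (forall k, ae_null (G k)) ->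
  ae_null (\bigcup_k G k).
Proof.
move=> hG; have mG k : measurable (G k) by have [] := hG k.
have mU : measurable (\bigcup_k G k) by exact: bigcupT_measurable.
have null o : (forall k, law X o (G k) = 0) -> law X o (\bigcup_k G k) = 0.
  move=> h; apply/eqP; rewrite eq_le measure_ge0 andbT.
  apply: (le_trans (@measure_sigma_subadditive _ _ _ (law X o) _ _ mG mU (@subset_refl _ _))).
  by rewrite eseries0// => k _ _; exact: h.
split => //; split; first by apply: null => k; have [_ []] := hG k.
have : {ae m, forall x, forall k, law X (Some x) (G k) = 0}.
  by apply: ae_foralln => k; have [_ []] := hG k.
by apply: filterS => x; exact: null.
Qed.

(** A nonnegative function measurable for a completed sigma-algebra is the supremum
    of the rationals below it, and each of the countably many events involved can be
    replaced by a measurable one. *)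
Lemma completed_version (S : set (set W)) Y : S `<=` measurable ->
  (forall B : set (\bar R), measurable B -> completed Omega X S (Y @^-1` B)) ->
  exists Z G, [/\ measurable_fun setT Z, forall w, 0 <= Z w, ae_null G &
    forall w, ~ G w -> 0 <= Y w -> Z w = Y w].
Proof.
move=> Sm mY.
pose r (k : nat) : R := if (unpickle k : option rat) is Some q then Num.max 0%R (ratr q) else 0%R.
have r0 k : (0 <= r k)%R by rewrite /r; case: unpickle => // q; rewrite le_max lexx.
have ex k : exists p : set W * set W, [/\ S p.1, ae_null p.2 &
    ((Y @^-1` [set y | (r k)%:E < y]) `\` p.1) `|` (p.1 `\` (Y @^-1` [set y | (r k)%:E < y])) `<=` p.2].
  have mB : measurable [set y : \bar R | (r k)%:E < y].
    rewrite (_ : [set y | _] = `](r k)%:E, +oo[%classic); first exact: emeasurable_itv.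
    by apply/seteqP; split => y /=; rewrite in_itv/= andbT.
  by have [L0 [G hG]] := completed_ae_null (mY _ mB); exists (L0, G).
pose L0 k := (sval (cid (ex k))).1; pose G k := (sval (cid (ex k))).2.
have LG k : [/\ S (L0 k), ae_null (G k) & ((Y @^-1` [set y | (r k)%:E < y]) `\` L0 k) `|` (L0 k `\` (Y @^-1` [set y | (r k)%:E < y])) `<=` G k].
  exact: (svalP (cid (ex k))).
pose z k w : \bar R := (r k)%:E * (\1_(L0 k) w)%:E.
have z0 k w : 0 <= z k w by rewrite /z mule_ge0// lee_fin.
pose Z w := esups (z ^~ w) 0%N.
have zZ k w : z k w <= Z w by apply: ereal_sup_ubound; exists k.
exists Z, (\bigcup_k G k); split.
- apply: measurable_fun_esups => k; apply: measurable_funeM.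
  apply/measurable_EFinP; apply: measurable_indic; apply: Sm.
  by have [] := LG k.
- by move=> w; apply: le_trans (zZ 0%N w).
- by apply: ae_null_bigcup => k; have [] := LG k.
move=> w nG Y0.
have iffL k : L0 k w <-> (r k)%:E < Y w.
  have [_ _ h] := LG k; split => h1; apply: contrapT => h2; apply: nG; exists k => //; apply: h.
    by right.
  by left.
apply/eqP; rewrite eq_le; apply/andP; split.
  apply: ge_ereal_sup => _ [k _ <-]; rewrite /z indicE.
  have [h|h] := pselect (L0 k w); last by rewrite memNset// mule0.
  by rewrite mem_set// mule1 ltW//; exact/iffL.
rewrite leNgt; apply/negP => ZY.
have Zf : Z w \is a fin_num.
  by rewrite ge0_fin_numE; [exact: lt_le_trans ZY (leey _)|exact: le_trans (zZ 0%N w)].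
move: ZY; rewrite -(fineK Zf) => /exists_rat_between[q [zq qY]].
have Z0 : (0 <= fine (Z w))%R by rewrite fine_ge0//; exact: le_trans (zZ 0%N w).
have rq : r (pickle q) = ratr q by rewrite /r pickleK max_r// (le_trans Z0)// ltW.
have := zZ (pickle q) w; rewrite /z rq indicE mem_set ?mule1; last by apply/iffL; rewrite rq.
by rewrite -(fineK Zf) lee_fin leNgt zq.
Qed.

End completed_version.

(** * Additive functionals with Revuz measure on the boundary *)

Section pcaf.
Context {R : realType} {N : nat} (Omega : domain R N).
Context d (W : measurableType d) (X : process R N W).
Local Notation E := 'rV[R]_N.
Local Notation m := (m Omega).
Local Notation clO := (closure (Omega : set E)).
Local Notation expect := (expect X).
Local Notation stays := (stays X).
Local Open Scope ereal_scope.
Variables (TN : R -> (E -> R) -> E -> R) (a : R -> W -> \bar R).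
Hypotheses (hR : reflecting_brownian_motion Omega X)
  (hTN : semigroup_of Omega (tildeH1 Omega) TN).
Implicit Types (t u : R) (w : W) (K : set E).

(** Kernels of the process are measurable only on the closure of Omega, which
    carries m. *)
Lemma closure_integralD (f g : E -> \bar R) :
  measurable_fun clO f -> measurable_fun clO g ->
  (forall x, 0 <= f x) -> (forall x, 0 <= g x) ->
  \int[m]_x (f x + g x) = \int[m]_x f x + \int[m]_x g x.
Proof.
move=> mf mg f0 g0; have mC := measurable_closure_domain Omega.
have hE (h : E -> \bar R) : \int[m]_x h x = \int[m]_x (h \_ clO) x.
  apply: ae_eq_lower_integral; apply: filterS (ae_closure_domain Omega) => x cx.
  by rewrite patchE mem_set.
have h0 (h : E -> \bar R) : (forall x, 0 <= h x) -> forall x, 0 <= (h \_ clO) x.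
  by move=> hh x; rewrite patchE; case: ifP.
rewrite hE [in RHS]hE [X in _ + X]hE -ge0_integralD//.
- by apply: eq_integral => x _; rewrite !patchE; case: ifP => //; rewrite adde0.
- by move=> x _; exact: h0.
- exact/(measurable_restrictT _ mC).
- by move=> x _; exact: h0.
- exact/(measurable_restrictT _ mC).
Qed.

Section defining.
Variables (L : set W) (A : set E).
Hypotheses (hL : additive_functional Omega X a L A)
  (a_ge0 : forall w t, L w -> (0 <= t)%R -> 0 <= a t w).

Lemma ae_defining : {ae m, forall x, {ae law X (Some x), forall w, L w}}.
Proof.
have [_ A0] := af_exceptional hL.
apply: filterS2 (cap_eq0_ae A0) (ae_closure_domain Omega) => x nA cx.
exact: (af_full hL).
Qed.

(** On the defining set the functional is nondecreasing, by additivity and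
    nonnegativity, and right continuous. *)
Lemma stieltjes_exists w : L w -> exists nu, stieltjes X a w nu.
Proof.
move=> Lw; pose D := [set t : R | (0 <= t)%R /\ t%:E < lifetime X w].
have fin t : D t -> a t w \is a fin_num by case=> t0 tz; exact: (af_finite hL).
have a0 : a 0%R w = 0 by exact: (af_0 hL).
have [||t e Dt e0|nu [nu0 nuE]] := @stieltjes_measure_exists R (lifetime X w) (fun t => fine (a t w)).
- by rewrite a0.
- move=> s t /set_mem Ds /set_mem Dt st; apply: fine_le; [exact: fin|exact: fin|].
  have [s0 _] := Ds; move: s0; rewrite le_eqVlt => /predU1P[s0|s0].
    by rewrite -s0 a0; apply: a_ge0 => //; case: Dt.
  have ts : (0 <= t - s)%R by rewrite subr_ge0.
  have := af_additive hL Lw ts (ltW s0); rewrite addrC subrK => ->.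
  by rewrite leeDl// a_ge0//; apply: (af_shift hL s0); exists w.
- have [t0 _] := Dt; have := af_right hL Lw t0; rewrite -[X in _ --> X](fineK (fin _ Dt)).
  move=> /fine_cvgP[_] /cvgrPdist_lt /(_ e e0) /nbhs_ballP[r /= r0 hr]; exists r => // s Ds /andP[ts str].
  have := hr s; rewrite /ball/= ltr_distlC str (lt_trans _ ts) ?ltrBlDr ?ltrDl// => /(_ isT ts).
  by rewrite ltr_distlC => /andP[].
- by exists nu; split => // t t0 tz; rewrite nuE//= fineK//; exact: fin.
Qed.

Lemma af_integral_ge0 t (f : E -> R) w : (forall x, 0 <= f x)%R -> 0 <= af_integral X a t f w.
Proof.
move=> f0; rewrite /af_integral; case: xgetP => // _ -> [nu _ ->].
by apply: integral_ge0 => s _; case: (traj X s w) => //= y; rewrite lee_fin.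
Qed.

(** On this event the integrand is 1 during the whole of [[0, t]]. *)
Lemma af_integral_stays K t w : compact K -> (0 <= t)%R -> L w -> stays K t w ->
  af_integral X a t (\1_K : E -> R) w = a t w.
Proof.
move=> cK t0 Lw Kw; rewrite /af_integral.
have [nu hnu] := stieltjes_exists Lw.
have := @xgetPex _ 0 [set I | exists2 nu, stieltjes X a w nu &
    I = \int[nu]_(s in `[0%R, t]%classic) (oapp (\1_K : E -> R) 0%R (traj X s w))%:E].
case=> [|nu' hnu' ->]; first by exists (\int[nu]_(s in `[0%R, t]%classic) (oapp (\1_K : E -> R) 0%R (traj X s w))%:E), nu.
have inK s : (0 <= s <= t)%R -> (Some @` K) (traj X s w) by exact: (staysP hR cK t0 Kw).
have tz : t%:E < lifetime X w.
  apply: (lifetime_gt (rbm_hunt hR) t0).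
  by have [|y _ <-] := inK t; rewrite ?t0 ?lexx.
case: hnu' => _ /(_ t t0 tz) <-.
transitivity (\int[nu']_(s in `[0%R, t]%classic) 1%:E); last first.
  by rewrite integral_cst ?mul1e//; exact: measurable_itv.
apply: eq_integral => s; rewrite inE/= in_itv/= => /inK[y Ky <-] /=.
by rewrite indicE mem_set.
Qed.

Section set.
Variable K : set E.
Hypotheses (cK : compact K) (KO : K `<=` (Omega : set E)).
Let mK : measurable K. Proof. by apply: closed_rV_measurable; exact: compact_closed. Qed.

(** a measurable version of the functional at time t, with a null set outside of
    which it is exact *)
Definition version t : (W -> \bar R) * set W :=
  xget (cst 0, set0) [set p | [/\ measurable_fun setT p.1, forall w, 0 <= p.1 w, ae_null Omega X p.2 &
    forall w, ~ p.2 w -> 0 <= a t w -> p.1 w = a t w]].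

Let a' t := (version t).1.
Let G t := (version t).2.

Lemma versionP t : (0 <= t)%R -> [/\ measurable_fun setT (a' t), forall w, 0 <= a' t w,
  ae_null Omega X (G t) & forall w, ~ G t w -> 0 <= a t w -> a' t w = a t w].
Proof.
move=> t0; apply: (xgetPex (cst 0, set0) (P := [set p | [/\ measurable_fun setT p.1, forall w, 0 <= p.1 w, ae_null Omega X p.2 &
    forall w, ~ p.2 w -> 0 <= a t w -> p.1 w = a t w]])).
have [|Z [G' hZ]] := completed_version (rbm_hunt hR) _ (af_adapted hL t0); last by exists (Z, G').
by apply: (natural_measurable (rbm_hunt hR)) => s; rewrite /= in_itv/= => /andP[].
Qed.

(** the amount by which the functional increases during [[0, t]] on paths that stay
    in K *)
Let c t w : \bar R := a' t w * (\1_(stays K t) w)%:E.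

Let c_ge0 t w : (0 <= t)%R -> 0 <= c t w.
Proof. by move=> /versionP[_ h _ _]; rewrite mule_ge0// lee_fin. Qed.

Let measurable_c t : (0 <= t)%R -> measurable_fun setT (c t).
Proof.
move=> t0; have [ma _ _ _] := versionP t0; apply: emeasurable_funM => //.
by apply/measurable_EFinP; apply: measurable_indic; exact: (measurable_stays hR).
Qed.

Let phi t : E -> \bar R := (fun x => expect (c t) (Some x)) \_ clO.

Let phi_ge0 t x : (0 <= t)%R -> 0 <= phi t x.
Proof.
by move=> t0; rewrite /phi patchE; case: ifP => // _; apply: expect_ge0 => w; exact: c_ge0.
Qed.

Let measurable_phi t : (0 <= t)%R -> measurable_fun setT (phi t).
Proof.
move=> t0; apply/(measurable_restrictT _ (measurable_closure_domain Omega)).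
by apply: (measurable_expect (rbm_hunt hR)); [exact: measurable_c|move=> w; exact: c_ge0].
Qed.

Let ae_version t : (0 <= t)%R -> {ae m, forall x, {ae law X (Some x), forall w, a' t w = a t w}}.
Proof.
move=> t0; have [_ _ [mG [_ G0]] hG] := versionP t0.
apply: filterS2 ae_defining G0 => x hx Gx.
have nG : {ae law X (Some x), forall w, ~ G t w}.
  by exists (G t); split => // w /contrapT.
by apply: filterS2 hx nG => w Lw nGw; apply: hG => //; exact: a_ge0.
Qed.

(** By the Markov property at time t, started from the law of [X_t], which does not
    charge null sets. *)
Let ae_version_shift t : (0 <= t)%R ->
  {ae m, forall x, {ae law X (Some x), forall w, ~ G t (timeshift X t w)}}.
Proof.
move=> t0; have hX := rbm_hunt hR; have [_ _ [mG [GN G0]] hG] := versionP t0.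
apply: filterS2 (ae_traj hR hTN t0 G0) (ae_closure_domain Omega) => x hx cx.
exists (timeshift X t @^-1` G t); split; last by move=> w /contrapT.
  exact: (measurable_timeshift_preimage hX).
have nT : natural X `[0%R, t]%classic setT by exact: natural_setT.
rewrite -[_ @^-1` _]setTI (@markov_set _ _ Omega _ _ X hX t setT (Some x) (G t) t0 nT cx mG).
rewrite -[RHS](integral0 (law X (Some x)) setT); apply: ae_eq_lower_integral.
apply: filterS hx => w; rewrite indicT mul1e; case: (traj X t w) => [y|] //=.
Qed.

Let e t : \bar R := \int[m]_x phi t x.

Let stays_shift t w : (0 <= t)%R -> stays K (t + t) w ->
  stays K t w /\ stays K t (timeshift X t w).
Proof.
move=> t0 Kw; have t2 : (0 <= t + t)%R by rewrite addr_ge0.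
have h i j : (j <= 2 ^ i)%N -> (0 <= j%:R * (t / 2 ^+ i) <= t)%R.
  move=> ji; have p0 : (0 < (2 : R) ^+ i)%R by rewrite exprn_gt0.
  apply/andP; split; first by rewrite mulr_ge0// divr_ge0// ltW.
  by rewrite mulrA ler_pdivrMr// mulrC ler_wpM2l// -natrX ler_nat.
split=> i _ j ji; have /andP[h1 h2] := h _ _ ji.
  by apply: (staysP hR cK t2 Kw); rewrite h1 (le_trans h2)// lerDl.
rewrite (hunt_shift (rbm_hunt hR))//; apply: (staysP hR cK t2 Kw).
by rewrite addr_ge0//= lerD2r.
Qed.

(** Additivity splits the increase at time t. The second half is, by the Markov
    property, the integral of the transition semigroup applied to [phi t], and by
    symmetry this is at most [e t]. *)
Let double t : (0 < t)%R -> e (t + t)%R <= 2%:R%:E * e t.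
Proof.
move=> t0; have hX := rbm_hunt hR; have t0' := ltW t0.
have t2 : (0 <= t + t)%R by rewrite addr_ge0.
have le x : {ae law X (Some x), forall w, L w} ->
    {ae law X (Some x), forall w, a' (t + t) w = a (t + t) w} ->
    {ae law X (Some x), forall w, a' t w = a t w} ->
    {ae law X (Some x), forall w, ~ G t (timeshift X t w)} ->
    {ae law X (Some x), forall w, c (t + t) w <= c t w + (\1_(stays K t) w)%:E * c t (timeshift X t w)}.
  move=> h1 h2 h3 h4; apply: filterS2 (filterI h1 h2) (filterI h3 h4) => w [Lw e2] [e1 nG].
  have [Kw|nK] := pselect (stays K (t + t) w); last first.
    rewrite {1}/c indicE memNset// mule0 adde_ge0//; first exact: c_ge0.
    by rewrite mule_ge0 ?lee_fin//; exact: c_ge0.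
  have [K1 K2] := stays_shift t0' Kw; rewrite /c !indicE !mem_set// !mule1 mul1e e2 e1.
  rewrite (af_additive hL Lw t0' t0'); have Lt : L (timeshift X t w) by apply: (af_shift hL t0); exists w.
  have [_ _ _ ->] := versionP t0'; [exact: lexx|exact: nG|exact: a_ge0].
have le2 : {ae m, forall x, phi (t + t)%R x <= phi t x + pt X t (phi t) x}.
  apply: filterS2 (filterI ae_defining (ae_version t2)) (filterI (filterI (ae_version t0') (ae_version_shift t0')) (ae_closure_domain Omega)).
  move=> x [h1 h2] [[h3 h4] cx]; have {h1 h2 h3 h4} h := le x h1 h2 h3 h4.
  rewrite /phi !patchE mem_set// -/(phi t).
  have m1 : measurable_fun setT (fun w => (\1_(stays K t) w)%:E : \bar R).
    by apply/measurable_EFinP; apply: measurable_indic; exact: (measurable_stays hR).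
  have mc := measurable_c t0'.
  have cs0 w : 0 <= (\1_(stays K t) w)%:E * c t (timeshift X t w).
    by rewrite mule_ge0 ?lee_fin//; exact: c_ge0.
  apply: (@le_trans _ _ (\int[law X (Some x)]_w (c t w + (\1_(stays K t) w)%:E * c t (timeshift X t w)))).
    apply: ge0_ae_le_lower_integral => // w; first exact: c_ge0.
    by rewrite adde_ge0//; exact: c_ge0.
  have mcs : measurable_fun setT (fun w => (\1_(stays K t) w)%:E * c t (timeshift X t w)).
    apply: emeasurable_funM => //; exact: (measurableT_comp mc (measurable_timeshift hX t0')).
  rewrite (ge0_integralD _ measurableT (fun w _ => c_ge0 w t0') mc (fun w _ => cs0 w) mcs).
  rewrite leeD2l// (@markov_functional _ _ Omega _ _ X hX t (stays K t) (Some x) (c t) t0' (natural_stays t0' mK) cx mc (fun w => c_ge0 w t0')).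
  apply: ge0_ae_le_lower_integral => [w|w|].
  - by rewrite mule_ge0 ?lee_fin// expect_ge0// => w'; exact: c_ge0.
  - by case: (traj X t w) => //= y; exact: phi_ge0.
  apply: aeW => w; rewrite indicE; have [Kw|nK] := pselect (stays K t w); last first.
    by rewrite memNset// mul0e; case: (traj X t w) => //= y; exact: phi_ge0.
  rewrite mem_set// mul1e; have := hunt_state hX w t0'.
  have := @staysP _ _ _ _ _ _ hR K t w t cK t0' Kw; rewrite t0' lexx => /(_ isT) [y _ <-] /= cy.
  by rewrite /phi patchE mem_set.
have mpt : measurable_fun clO (pt X t (phi t)).
  apply: (measurable_expect hX); first exact: (measurable_oapp hX _ t0' (measurable_phi t0')).
  by move=> w; case: (traj X t w) => //= y; exact: phi_ge0.
have pt0 x : 0 <= pt X t (phi t) x.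
  by apply: integral_ge0 => w _; case: (traj X t w) => //= y; exact: phi_ge0.
apply: (@le_trans _ _ (\int[m]_x (phi t x + pt X t (phi t) x))).
  apply: ge0_ae_le_lower_integral => // x; first exact: phi_ge0.
  by rewrite adde_ge0//; exact: phi_ge0.
rewrite closure_integralD//; last 2 first.
- by apply: measurable_funTS; exact: measurable_phi.
- by move=> x; exact: phi_ge0.
rewrite (_ : 2%:R%:E * e t = e t + e t); last by rewrite -[in RHS](mul1e (e t)) -ge0_muleDl ?lee_fin// -EFinD.
rewrite leeD2l//.
have [_ sym _] := hR; have := sym t (phi t) (fun=> 1) t0'.
have nb : nonneg_borel Omega (phi t).
  by split; [apply: measurable_funTS; exact: measurable_phi|move=> x _; exact: phi_ge0].
have nb1 : nonneg_borel Omega (fun=> 1) by split => // x _; rewrite lee_fin.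
move=> /(_ nb nb1); under eq_integral do rewrite mule1; move=> ->.
apply: ge0_ae_le_lower_integral.
- move=> x; rewrite mule_ge0 ?phi_ge0//; apply: integral_ge0 => w _.
  by case: (traj X t w) => //= y; rewrite lee_fin.
- by move=> x; exact: phi_ge0.
apply: aeW => x; rewrite -[leRHS]mule1; apply: lee_wpmul2l; first exact: phi_ge0.
exact: (pt_one_le1 hX).
Qed.

Variable mu : {measure set E -> \bar R}.
Hypothesis hmu : revuz_measure Omega X a mu.

(** The boundary does not meet K, so the right-hand side of the Revuz formula for
    h = 1 and the indicator of K is 0, and the formula says that e t is o(t). *)
Let small eps : (0 < eps)%R -> exists2 r : R, (0 < r)%R &
  forall t, (0 < t < r)%R -> e t <= (eps * t)%:E.
Proof.
move=> eps0; have hX := rbm_hunt hR.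
have := @hmu 0%R (fun=> 1) (\1_K : E -> R) (lexx _) (excessive_one hX).
have m1 : measurable_fun clO (\1_K : E -> R) by exact: measurable_indic.
have f1 x : clO x -> (0 <= (\1_K : E -> R) x)%R by move=> _; rewrite indicE.
move=> /(_ m1 f1).
rewrite (_ : \int[mu]_(x in bdry Omega) _ = 0); last first.
  rewrite integral0_eq// => x [_ nOx]; rewrite indicE memNset ?mule0// => Kx.
  by apply: nOx; apply: open_nbhs_nbhs; split; [exact: domain_open|exact: KO].
move=> cv; have nb : nbhs (0%:E : \bar R) [set y | y < eps%:E].
  by apply: open_nbhs_nbhs; split; [exact: open_ereal_lt_ereal|rewrite /= lte_fin].
have /nbhs_ballP[r /= r0 hr] := cv _ nb; exists r => // t /andP[t0 tr].
have := hr t; rewrite /ball/= sub0r normrN gtr0_norm// => /(_ tr t0) lt1.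
have le : e t <= \int[m]_x (1 * \int[law X (Some x)]_w af_integral X a t (\1_K : E -> R) w).
  apply: ge0_ae_le_lower_integral.
  - by move=> x; apply: phi_ge0; exact: ltW.
  - move=> x; rewrite mul1e; apply: integral_ge0 => w _.
    by apply: af_integral_ge0 => y; rewrite indicE.
  apply: filterS2 ae_defining (ae_version (ltW t0)) => x h1 h2.
  rewrite mul1e /phi patchE; case: ifPn => _; last first.
    by apply: integral_ge0 => w _; apply: af_integral_ge0 => y; rewrite indicE.
  apply: ge0_ae_le_lower_integral.
  - by move=> w; apply: c_ge0; exact: ltW.
  - by move=> w; apply: af_integral_ge0 => y; rewrite indicE.
  apply: filterS2 h1 h2 => w Lw aw; rewrite /c indicE.
  have [Kw|nK] := pselect (stays K t w); last first.
    by rewrite memNset// mule0; apply: af_integral_ge0 => y; rewrite indicE.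
  by rewrite mem_set// mule1 aw af_integral_stays// ltW.
apply: le_trans le _; apply: ltW; rewrite mulrC EFinM.
by move: lt1; rewrite lte_pdivrMl.
Qed.

Let dyadic n t : (0 < t)%R -> e t <= (2 ^+ n)%:E * e (t / 2 ^+ n)%R.
Proof.
elim: n t => [|n ih] t t0; first by rewrite expr0 divr1 mul1e.
have p0 : (0 < (2 : R) ^+ n)%R by rewrite exprn_gt0.
have p1 : (0 < (2 : R) ^+ n.+1)%R by rewrite exprn_gt0.
apply: (le_trans (ih t t0)); rewrite exprSr EFinM -muleA lee_pmul2l//.
have := double (divr_gt0 t0 p1).
suff -> : (t / 2 ^+ n.+1 + t / 2 ^+ n.+1 = t / 2 ^+ n)%R by rewrite exprSr.
by rewrite exprSr; field; rewrite gt_eqF.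
Qed.

Let e_eq0 t : (0 < t)%R -> e t = 0.
Proof.
move=> t0; apply/eqP; rewrite eq_le; apply/andP; split; last first.
  by apply: integral_ge0 => x _; apply: phi_ge0; exact: ltW.
apply/lee_addgt0Pr => eps eps0; rewrite add0e.
have [r r0 hr] := small (divr_gt0 eps0 t0).
pose n := Num.truncn (t / r).
have p0 : (0 < (2 : R) ^+ n.+1)%R by rewrite exprn_gt0.
have tn : (t / 2 ^+ n.+1 < r)%R.
  rewrite ltr_pdivrMr// mulrC -ltr_pdivrMr//; apply: lt_le_trans (truncnS_gt _) _.
  by rewrite -natrX ler_nat; apply: ltnW; exact: ltn_expl.
apply: (le_trans (dyadic n.+1 t0)).
have -> : eps%:E = (2 ^+ n.+1)%:E * (eps / t * (t / 2 ^+ n.+1))%:E.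
  by rewrite -EFinM; congr EFin; field; rewrite !gt_eqF.
by rewrite lee_pmul2l ?lte_fin//; apply: hr; rewrite tn divr_gt0.
Qed.

Lemma stays_vanish t : (0 <= t)%R ->
  {ae m, forall x, {ae law X (Some x), forall w, stays K t w -> a t w = 0}}.
Proof.
rewrite le_eqVlt => /predU1P[<-|t0].
  by apply: filterS ae_defining => x; apply: filterS => w Lw _; exact: (af_0 hL).
have h : {ae m, forall x, phi t x = 0}.
  by apply: ge0_integral_eq0_ae (e_eq0 t0); [exact: measurable_phi (ltW t0)|move=> x; apply: phi_ge0; exact: ltW].
apply: filterS2 (filterI h (ae_version (ltW t0))) (ae_closure_domain Omega) => x [px vx] cx.
move: px; rewrite /phi patchE mem_set// => px.
have := ge0_integral_eq0_ae (measurable_c (ltW t0)) (fun w => c_ge0 w (ltW t0)) px.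
apply: filterS2 vx => w aw cw Kw; move: cw.
by rewrite /c indicE mem_set// mule1 aw.
Qed.

End set.
End defining.

Variable mu : {measure set E -> \bar R}.

Lemma pcaf_ge0 t : pcaf Omega X a -> (0 <= t)%R ->
  {ae m, forall x, {ae law X (Some x), forall w, 0 <= a t w}}.
Proof.
move=> [L [A [hL a0 _]]] t0; apply: filterS (ae_defining hL) => x.
by apply: filterS => w Lw; exact: a0.
Qed.

(** A functional whose Revuz measure lives on the boundary does not increase while
    the path stays in a compact part of the domain: [e t] is o(t) and at most
    doubles with t, hence is 0. *)
Lemma pcaf_vanish K t : pcaf Omega X a -> revuz_measure Omega X a mu ->
  compact K -> K `<=` (Omega : set E) -> (0 <= t)%R ->
  {ae m, forall x, {ae law X (Some x), forall w, stays K t w -> a t w = 0}}.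
Proof.
by move=> [L [A [hL a0 _]]] hmu cK KO t0; exact: (stays_vanish hL a0 cK KO hmu).
Qed.

End pcaf.

(** * Comparison of the three semigroups *)

Section sandwich.
Context {R : realType} {N : nat} (Omega : domain R N).
Context d (W : measurableType d) (X : process R N W).
Local Notation E := 'rV[R]_N.
Local Notation m := (m Omega).
Local Notation L2 := (L2 Omega).
Local Notation ip := (ip Omega).
Local Notation clO := (closure (Omega : set E)).
Local Notation expect := (expect X).
Local Notation stays := (stays X).
Local Notation in_K_at := (in_K_at X).
Variables (a : R -> W -> \bar R) (mu : {measure set E -> \bar R}).
Variables (TD TN : R -> (E -> R) -> E -> R).
Hypotheses (hR : reflecting_brownian_motion Omega X)
  (hTD : semigroup_of Omega (H10 Omega) TD)
  (hTN : semigroup_of Omega (tildeH1 Omega) TN)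
  (ha : pcaf Omega X a) (hmu : revuz_measure Omega X a mu).
Variable t : R.
Hypothesis t0 : 0 <= t.
Implicit Types (f g u : E -> R) (K : set E).
Local Notation P := (Pmu X a t).

Let FR := neumann_resolvent_ge0 hR hTN.

Lemma ge0_eq_pospart f : {ae m, forall x, 0 <= f x} -> {ae m, forall x, f x = pospart f x}.
Proof.
by apply: filterS => x hx; rewrite /pospart; have [h'|h'] := leP 0 (f x); lra.
Qed.

Lemma Pmu_ae f g : {ae m, forall x, f x = g x} -> {ae m, forall x, P f x = P g x}.
Proof.
move=> fg; apply: filterS (ae_traj hR hTN t0 fg) => x hx.
apply: ae_eq_lower_integral; apply: filterS hx => w.
by case: (traj X t w) => //= y ->.
Qed.

Lemma Pmu_mono f g : (forall x, 0 <= f x) -> (forall x, 0 <= g x) ->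
  {ae m, forall x, f x <= g x} -> {ae m, forall x, (P f x <= P g x)%E}.
Proof.
move=> f0 g0 fg; apply: filterS (ae_traj hR hTN t0 fg) => x hx.
apply: ge0_ae_le_lower_integral.
- by move=> w; rewrite mule_ge0 ?expeR_ge0// lee_fin; case: (traj X t w).
- by move=> w; rewrite mule_ge0 ?expeR_ge0// lee_fin; case: (traj X t w).
apply: filterS hx => w h; apply: lee_wpmul2r; first exact: expeR_ge0.
by rewrite lee_fin; case: (traj X t w) h.
Qed.

(** The weight [expeR (- a t w)] is at most 1. *)
Lemma Pmu_le_neumann f : L2 f -> {ae m, forall x, 0 <= f x} ->
  {ae m, forall x, (P f x <= (TN t f x)%:E)%E}.
Proof.
move=> Lf f0; have fp := ge0_eq_pospart f0; have Lp := L2_pospart Lf.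
have h1 := Pmu_ae fp; have h2 := semigroup_ae hTN t0 Lf Lp fp.
have h3 := rbm_semigroup hR hTN t0 Lp; have h4 := pcaf_ge0 ha t0.
apply: filterS2 (filterI h1 h2) (filterI h3 h4) => x [-> ->] [<- hx].
apply: ge0_ae_le_lower_integral.
- by move=> w; rewrite mule_ge0 ?expeR_ge0// lee_fin; case: (traj X t w) => //= y; exact: pospart_ge0.
- by move=> w; case: (traj X t w) => //= y; rewrite lee_fin pospart_ge0.
apply: filterS hx => w aw.
rewrite (_ : oapp _ 0%E _ = (oapp (pospart f) 0 (traj X t w))%:E); last by case: (traj X t w).
rewrite -[leRHS]mule1; apply: lee_wpmul2l.
  by rewrite lee_fin; case: (traj X t w) => //= y; exact: pospart_ge0.
by rewrite -expeR0 lee_expeR leeNl oppe0.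
Qed.

Section dominated.
Variables (u g : E -> R) (l : R).
Hypotheses (l0 : 0 < l) (Hu : H10 Omega u)
  (exu : forall s, 0 <= s -> {ae m, forall x, TD s u x <= expR (l * s) * u x})
  (Lg : L2 g) (g0 : forall x, 0 <= g x) (gu : {ae m, forall x, g x <= u x}).

(** Let the mesh of the times at which the semigroup is killed tend to 0, along
    dyadic subdivisions, so that the events decrease to [stays K t]. *)
Lemma stays_lower_bound K w : compact K -> K `<=` (Omega : set E) -> L2 w ->
  {ae m, forall x, ~ K x -> u x <= w x} -> {ae m, forall x, 0 <= w x} ->
  (forall s, 0 <= s -> {ae m, forall x, TD s w x <= expR (l * s) * w x}) ->
  {ae m, forall x, ((TD t g x - expR (l * t) * w x)%:E <=
    expect (fun p => (\1_(stays K t) p)%:E * oapp (EFin \o g) 0 (traj X t p)) (Some x))%E}.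
Proof.
move=> cK KO Lw uw w0 exw; have hX := rbm_hunt hR.
have mK : measurable K by apply: closed_rV_measurable; exact: compact_closed.
pose h (i : nat) := t / 2 ^+ i; have h0 i : 0 <= h i by rewrite divr_ge0.
have nh (i : nat) : (2 ^ i)%N%:R * h i = t.
  by rewrite natrX /h mulrC divfK// expf_neq0.
have gu' : {ae m, forall x, 0 <= g x <= u x} by apply: filterS gu => x ->; rewrite g0.
have step : {ae m, forall x, forall i, ((TD t g x - expR (l * t) * w x)%:E <=
    expect (fun p => (\1_(in_K_at K (h i) (2 ^ i)) p)%:E * oapp (EFin \o g) 0 (traj X t p)) (Some x))%E}.
  apply: ae_foralln => i.
  have := dirichlet_leak FR hTD (2 ^ i) mK (ltW l0) (h0 i) (H1_closure_L2 Hu) Lw Lg gu' exu w0 exw uw.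
  rewrite nh => h1; have h2 := killed_le_survive hR hTN hTD (2 ^ i) mK (h0 i) Lg g0.
  apply: filterS2 h1 h2 => x x1 x2; apply: (@le_trans _ _ (killed TD K (h i) g (2 ^ i) x)%:E).
    by rewrite lee_fin lerBlDr.
  apply: (le_trans x2); rewrite le_eqVlt; apply/orP; left; apply/eqP.
  by apply: eq_integral => p _; rewrite (surviveE hR _ _ _ _ (h0 i)) nh.
have mo : measurable_fun setT (fun p => oapp (EFin \o g) 0%E (traj X t p)).
  by apply: (measurable_oapp hX) => //; apply/measurable_EFinP; exact: L2_measurable Lg.
have o0 p : (0 <= oapp (EFin \o g) 0 (traj X t p))%E.
  by case: (traj X t p) => //= y; rewrite lee_fin.
apply: filterS2 step (rbm_semigroup hR hTN t0 Lg) => x hx ptx.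
have ig : (law X (Some x)).-integrable setT (fun p => oapp (EFin \o g) 0%E (traj X t p)).
  apply/integrableP; split => //; under eq_integral do rewrite gee0_abs//.
  by move: ptx; rewrite /pt => ->; exact: ltry.
have m1 A : measurable A -> measurable_fun setT (fun p => (\1_A p)%:E * oapp (EFin \o g) 0 (traj X t p))%E.
  by move=> mA; apply: emeasurable_funM => //; apply/measurable_EFinP; exact: measurable_indic.
pose F i p := ((\1_(in_K_at K (h i) (2 ^ i)) p)%:E * oapp (EFin \o g) 0 (traj X t p))%E.
pose F' p := ((\1_(stays K t) p)%:E * oapp (EFin \o g) 0 (traj X t p))%E.
have mF i : measurable_fun setT (F i) by apply: m1; exact: (measurable_in_K_at hR).
have mF' : measurable_fun setT F' by apply: m1; exact: (measurable_stays hR).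
have FF' : {ae law X (Some x), forall p, setT p -> F ^~ p @ \oo --> F' p}.
  apply: aeW => p _; apply: cvg_near_cst.
  have dec i j : (i <= j)%N -> in_K_at K (h j) (2 ^ j) p -> in_K_at K (h i) (2 ^ i) p.
    by move=> ij; rewrite -(subnK ij); elim: (j - i)%N => // k ih /in_K_at_decr.
  have [Kp|nK] := pselect (stays K t p).
    by apply: nearW => i; rewrite /F /F' !indicE !mem_set//; exact: Kp.
  have [i ni] : exists i, ~ in_K_at K (h i) (2 ^ i) p.
    by apply: contrapT => /forallNP hi; apply: nK => i _; apply: contrapT; exact: hi.
  by exists i => // j /= ij; rewrite /F /F' !indicE !memNset// => /(dec i j ij).
have Fg : {ae law X (Some x), forall p i, setT p -> (`|F i p| <= oapp (EFin \o g) 0 (traj X t p))%E}.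
  apply: aeW => p i _; rewrite gee0_abs /F ?mule_ge0 ?lee_fin//.
  rewrite -[leRHS]mul1e; apply: lee_wpmul2r => //.
  by rewrite lee_fin indicE; case: (_ \in _).
have [_ _ cv] := dominated_convergence measurableT mF mF' FF' ig Fg.
by apply: (cvge_ge _ cv); apply: nearW => i; exact: hx.
Qed.

(** On paths that stay in K the weight is 1. The compact sets K are those of the
    obstacle lemma, with functions w of smaller and smaller norm as errors. *)
Lemma dirichlet_le_Pmu_dominated : {ae m, forall x, ((TD t g x)%:E <= P g x)%E}.
Proof.
pose c := expR (l * t); have c0 : 0 < c by exact: expR_gt0.
have ex (n : nat) : exists w, [/\ L2 w, ip w w < n.+1%:R^-1 / c ^+ 2 &
    {ae m, forall x, ((TD t g x)%:E <= P g x + (c * w x)%:E)%E}].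
  have e0 : 0 < n.+1%:R^-1 / c ^+ 2 by rewrite divr_gt0 ?invr_gt0// exprn_gt0.
  have [K [w [cK KO [Hw ww] uw [w0 exw]]]] := dirichlet_obstacle FR hTD l0 e0 Hu.
  have Lw : L2 w by exact: H1_closure_L2 Hw.
  exists w; split => //.
  apply: filterS2 (stays_lower_bound cK KO Lw uw w0 exw) (pcaf_vanish hR hTN ha hmu cK KO t0) => x h1 h2.
  suff : ((TD t g x - c * w x)%:E <= P g x)%E by rewrite EFinB leeBlDr.
  apply: (le_trans h1); apply: ge0_ae_le_lower_integral.
  - by move=> p; rewrite mule_ge0 ?lee_fin//; case: (traj X t p) => //= y; rewrite lee_fin.
  - by move=> p; rewrite mule_ge0 ?expeR_ge0// lee_fin; case: (traj X t p).
  apply: filterS h2 => p hp; rewrite indicE.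
  have [Kp|nK] := pselect (stays K t p); last first.
    by rewrite memNset// mul0e mule_ge0 ?expeR_ge0// lee_fin; case: (traj X t p).
  by rewrite mem_set// mul1e hp// oppe0 expeR0 mule1; case: (traj X t p).
pose w n := sval (cid (ex n)).
have hw n : [/\ L2 (w n), ip (w n) (w n) < n.+1%:R^-1 / c ^+ 2 &
    {ae m, forall x, ((TD t g x)%:E <= P g x + (c * w n x)%:E)%E}] by exact: svalP (cid (ex n)).
apply: (@ae_le_of_small_errors _ _ _ _ _ (fun n => c *: w n)).
- by move=> n; have [Lw _ _] := hw n; exact: L2Z.
- move=> e e0; have [k _ /(_ k (leqnn k)) /= ke] := near_infty_natSinv_lt (PosNum e0).
  exists k; have [Lw wk _] := hw k; rewrite (ipZl _ Lw (L2Z _ Lw)) (ipZr _ Lw Lw).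
  by apply: lt_trans ke; rewrite mulrA -expr2 mulrC -ltr_pdivlMr// exprn_gt0.
- by move=> n; have [_ _] := hw n.
Qed.

End dominated.

(** By approximation from below by functions dominated by excessive elements of H10. *)
Lemma dirichlet_le_Pmu f : L2 f -> {ae m, forall x, 0 <= f x} ->
  {ae m, forall x, ((TD t f x)%:E <= P f x)%E}.
Proof.
move=> Lf f0; have fp := ge0_eq_pospart f0.
have ex (n : nat) : exists g, [/\ L2 g, ip (f - g) (f - g) < n.+1%:R^-1 &
    {ae m, forall x, ((TD t f x)%:E <= P f x + (TD t (f - g) x)%:E)%E}].
  have e0 : 0 < n.+1%:R^-1 :> R by rewrite invr_gt0.
  have [u [g [l [l0 Hu exu [Lg gu] [gf fg]]]]] := dirichlet_dominated_approx FR hTD Lf f0 e0.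
  exists g; split => //; have Lp := L2_pospart Lg.
  have gp : {ae m, forall x, g x = pospart g x}.
    by apply: ge0_eq_pospart; apply: filterS gu => x /andP[].
  have gpu : {ae m, forall x, pospart g x <= u x}.
    by apply: filterS2 gp gu => x <- /andP[].
  have gpf : {ae m, forall x, pospart g x <= pospart f x}.
    by apply: filterS2 (filterI gp gf) fp => x [<- h] <-.
  have h1 := dirichlet_le_Pmu_dominated l0 Hu exu Lp (pospart_ge0 g) gpu.
  have h2 := Pmu_mono (pospart_ge0 g) (pospart_ge0 f) gpf.
  apply: filterS2 (filterI h1 (filterI h2 (Pmu_ae fp)))
    (filterI (semigroup_ae hTD t0 Lg Lp gp) (semigroup_sub hTD t0 Lf Lg)) => x [x1 [x2 x3]] [x4 x5].
  rewrite x3 (_ : TD t f x = TD t g x + TD t (f - g) x); last by rewrite x5 addrC subrK.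
  by rewrite EFinD leeD2r// x4; exact: le_trans x1 x2.
pose g n := sval (cid (ex n)).
have hg n : [/\ L2 (g n), ip (f - g n) (f - g n) < n.+1%:R^-1 &
    {ae m, forall x, ((TD t f x)%:E <= P f x + (TD t (f - g n) x)%:E)%E}] by exact: svalP (cid (ex n)).
apply: (@ae_le_of_small_errors _ _ _ _ _ (fun n => TD t (f - g n))).
- by move=> n; have [Lw _ _] := hg n; apply: (semigroup_L2 hTD) => //; exact: L2B.
- move=> e e0; have [k _ /(_ k (leqnn k)) /= ke] := near_infty_natSinv_lt (PosNum e0).
  exists k; have [Lw wk _] := hg k.
  apply: le_lt_trans (semigroup_ip_contraction hTD t0 (L2B Lf Lw)) _.
  exact: lt_trans wk ke.
- by move=> n; have [_ _] := hg n.
Qed.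

End sandwich.

Theorem theorem4p6 (R : realType) (N : nat) (hN : (0 < N)%N)
    (Omega : domain R N)
    (mu : {measure set 'rV[R]_N -> \bar R}) (hmu : smooth_measure Omega mu)
    (d : measure_display) (W : measurableType d) (X : process R N W)
    (hX : reflecting_brownian_motion Omega X)
    (Amu : R -> W -> \bar R) (hA : pcaf Omega X Amu)
    (hAmu : revuz_measure Omega X Amu mu)
    (TD TN : R -> ('rV[R]_N -> R) -> 'rV[R]_N -> R)
    (hTD : semigroup_of Omega (H10 Omega) TD)
    (hTN : semigroup_of Omega (tildeH1 Omega) TN)
    (t : R) (ht : 0 <= t) :
  [/\ op_le Omega (fun _ _ => 0%E) (fun f x => (TD t f x)%:E),
      op_le Omega (fun f x => (TD t f x)%:E) (Pmu X Amu t) &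
      op_le Omega (Pmu X Amu t) (fun f x => (TN t f x)%:E)].
Proof.
split=> f Lf f0.
- have := dirichlet_semigroup_ge0 (neumann_resolvent_ge0 hX hTN) hTD ht Lf f0.
  by apply: filterS => x; rewrite lee_fin.
- exact: (dirichlet_le_Pmu hX hTD hTN hA hAmu ht Lf f0).
- exact: (Pmu_le_neumann hX hTN hA ht Lf f0).
Qed.
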